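(* Let $\Psi:[1,+\infty)\to[1,+\infty)$ satisfy $\Psi(n)\to+\infty$ as $n\to+\infty$. Then, apart from $o(X)$ exceptions (as $X\to\infty$), every integer $n$ satisfying $$1\leqslant n\leqslant X,\qquad 4\nmid n,\qquad n\not\equiv 7\pmod 8$$ can be written as $n=x^2+y^2+z^2$ with $x,y,z\in\mathbb{Z}$ and $0<z<\sqrt{\log n}\,\Psi(n)$.
   Context: ''Apart from $o(X)$ exceptions'' means: the number of integers $n\in[1,X]$ with $4\nmid n$ and $n\not\equiv7\pmod 8$ that do not admit such a representation, divided by $X$, tends to $0$ as $X\to\infty$. Here $\log$ is the natural logarithm. *)

(* Defs.v *)
From HB Require Import structures.
From mathcomp Require Import all_boot all_order all_algebra.
From mathcomp Require Import all_classical all_reals all_analysis.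

Set Implicit Arguments.
Unset Strict Implicit.
Unset Printing Implicit Defensive.

Import Order.TTheory GRing.Theory Num.Theory.
Import numFieldNormedType.Exports.

Local Open Scope classical_set_scope.
Local Open Scope ring_scope.

Definition small_representable (R : realType) (Psi : R -> R) (n : nat) : Prop :=
  exists x y z : int,
    [/\ n%:Z = x ^+ 2 + y ^+ 2 + z ^+ 2,
        0 < z &
        (z%:~R : R) < Num.sqrt (ln (n%:R : R)) * Psi n%:R].

Definition admissible (n : nat) : bool :=
  ~~ (4 %| n)%N && (n != 7 %[mod 8])%N.

(* [Num.truncn X] is the integer part of [X >= 0], so the sum ranges over
   the integers of [1, X]. *)
Definition exception_count (R : realType) (Psi : R -> R) (X : R) : nat :=
  (\sum_(1 <= n < (Num.truncn X).+1 |
      admissible n && ~~ `[< small_representable Psi n >]) 1)%N.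

(* Main.v *)
Require Import Defs.
From HB Require Import structures.
From mathcomp Require Import all_boot all_order all_algebra.
From mathcomp Require Import all_classical all_reals all_analysis.
From mathcomp Require Import zify ring lra.

Set Implicit Arguments.
Unset Strict Implicit.
Unset Printing Implicit Defensive.

Import Order.TTheory GRing.Theory Num.Theory.
Import numFieldNormedType.Exports.

Local Open Scope classical_set_scope.
Local Open Scope ring_scope.

(* Let chi be the nonprincipal character mod 4, y = X^(1/2v) for a large constant v, Y a little
   below sqrt X, and P a large constant.  In a residue class modulo Q = 8 * prod_{2 < p <= P} p take
   z from a progression mod Q of length N ~ K sqrt(ln X) such that n - z^2 is prime to every odd
   p <= P and has odd part 1 mod 4.  Put
     s(n, z) = 1 if no prime p = 3 mod 4 with P < p <= y divides n - z^2, and 0 otherwise,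
     B(m) = sum of chi(l) over the divisors l <= Y of m all of whose prime factors exceed y.
   By Brun's sieve the sum over z of s(n, z) B(n - z^2) has mean M, a positive constant times
   N / sqrt(ln y), and small variance over n: z1 and z2 are correlated only through primes p > P
   dividing z1^2 - z2^2, which is harmless on average, and the diagonal z1 = z2 is negligible once K
   is large.  On the other hand, if m = n - z^2 survives the sieve but is not a sum of two squares,
   the sum of chi over all divisors of its y-rough part k vanishes, and pairing l with k / l gives
   B(m) = - (sum of chi(l) over the divisors l of k with Y < l < sqrt k).  Such middle divisors are
   rare, and their chi-sum is small on average: its second moment is bounded by sieving, the number
   of m having one by Hall-Tenenbaum bounds.  So an exceptional n either deviates from the mean M or
   has a large middle sum, and both happen for few n. *)

(** Write w for 1 / sqrt(ln y), the density of survivors up to constants. The squared mean has size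
    (N w)^2 and the diagonal N w times a constant depending on v, so N w must exceed a large
    constant: this is the origin of the length sqrt(ln n). The remainder y^(16 D + 25) of the sieve
    confines it to primes up to a small power of X; B stands in for the condition at the larger
    primes. The truncation Y < sqrt X is forced because the second moment needs n in prescribed
    classes modulo l1 l2 <= Y^2, together with the sieve, in an interval of length X. The price is
    the middle sum. Its second moment grows like a power of ln v, while survivors with a middle
    divisor form a proportion v^(-c); neither fact suffices alone, and a Cauchy-Schwarz type
    inequality combines them into a bound tending to 0 as v grows. Constants are fixed in the order
    eps, P, v, K, and y tends to infinity with X. K comes after v because the diagonal carries a
    factor (2 v + 1)^3, and P comes first because it fixes the modulus Q and makes the pair
    correlations average close to 1. *)

Lemma le_of_eq (R : realType) (a b : R) : a = b -> a <= b.
Proof. by move->. Qed.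

(** * Brun's sieve *)

Section Sieve.
Variable R : realType.
Implicit Types (l : seq R) (f : nat -> R).

(** The elementary symmetric polynomial of degree [i], by recursion on the list so that primes can
    join the sieve one at a time. *)
Fixpoint elsym (i : nat) (l : seq R) : R :=
  match i, l with
  | 0%N, _ => 1
  | _.+1, [::] => 0
  | i'.+1, x :: l' => elsym i l' + x * elsym i' l'
  end.

(** Inclusion-exclusion for the product of the [1 - x], cut off after order [r]. *)
Definition tesym (r : nat) (l : seq R) : R := \sum_(i < r.+1) (-1) ^+ i * elsym i l.

Lemma esym0 l : elsym 0 l = 1. Proof. by case: l. Qed.

Lemma esym_ge0 i l : all (>= 0) l -> 0 <= elsym i l.
Proof.
elim: l i => [|x l IH] [|i] //= /andP[x0 l0].
by rewrite addr_ge0 ?mulr_ge0 ?IH.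
Qed.

Lemma tesym_cons r x l : tesym r.+1 (x :: l) = tesym r.+1 l - x * tesym r l.
Proof.
rewrite /tesym big_ord_recl [in RHS]big_ord_recl !esym0 -addrA; congr (_ + _).
rewrite mulr_sumr -sumrB; apply: eq_bigr => i _.
by rewrite lift0 /= exprS; ring.
Qed.

(** Splitting off the head [x], the signed error at depth [r.+1] is that of the tail at the same
    depth plus [x] times that of the tail at depth [r]. The first omitted term [elsym] obeys the
    same recursion, so both bounds pass through the induction. *)
Lemma bonferroni r l : all (fun x => 0 <= x <= 1) l ->
  0 <= (-1) ^+ r * (tesym r l - \prod_(x <- l) (1 - x)) <= elsym r.+1 l.
Proof.
elim: l r => [|x l IH] r.
  rewrite big_nil /tesym big_ord_recl big1 ?addr0 /=; last by move=> i _; rewrite mulr0.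
  by rewrite mulr1 subrr mulr0 lexx.
move=> /= /andP[/andP[x0 x1] Hl].
have P01 : 0 <= \prod_(x <- l) (1 - x) <= 1.
  elim: l Hl {IH} => [|z l IH]; first by rewrite big_nil ler01 lexx.
  move=> /= /andP[/andP[z0 z1] /IH /andP[a b]]; rewrite big_cons mulr_ge0 ?subr_ge0//=.
  by rewrite mulr_ile1// ?subr_ge0// lerBlDr lerDl.
rewrite big_cons; case: r => [|r].
  have /andP[A B] := IH 0%N Hl.
  move: A B; rewrite /tesym !big_ord_recl !big_ord0 !esym0 !expr0 !mul1r !addr0 => A B.
  rewrite mulr1; move/andP: P01 => [p0 p1]; nra.
have /andP[A B] := IH r.+1 Hl; have /andP[C D] := IH r Hl.
rewrite tesym_cons.
have -> : (-1) ^+ r.+1 * (tesym r.+1 l - x * tesym r l - (1 - x) * \prod_(j <- l) (1 - j)) =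
  (-1) ^+ r.+1 * (tesym r.+1 l - \prod_(j <- l) (1 - j)) +
  x * ((-1) ^+ r * (tesym r l - \prod_(j <- l) (1 - j))) by rewrite exprS; ring.
apply/andP; split; first by apply: addr_ge0 => //; apply: mulr_ge0.
by apply: lerD => //; apply: ler_wpM2l.
Qed.

Lemma esym_le_pow i l : all (>= 0) l -> elsym i l <= (\sum_(x <- l) x) ^+ i.
Proof.
elim: l i => [|x l IH] [|i] //=; first by rewrite big_nil expr0n.
move=> /andP[x0 l0]; rewrite big_cons.
have S0 : 0 <= \sum_(j <- l) j by rewrite big_seq sumr_ge0 // => z zl; apply: (allP l0).
rewrite exprS mulrDl addrC lerD //.
  apply: ler_wpM2l => //; apply: (le_trans (IH i l0)).
  by apply: lerXn2r; rewrite ?nnegrE ?addr_ge0// lerDr.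
apply: (le_trans (IH i.+1 l0)); rewrite exprS; apply: ler_wpM2l => //.
by apply: lerXn2r; rewrite ?nnegrE ?addr_ge0// lerDr.
Qed.

(** Each monomial of [elsym i] occurs [i!] times in the expanded power of the sum. The induction
    uses the first two terms of the binomial expansion of [(x + S) ^+ k.+1]. The factorial is what
    makes deep truncation cheap. *)
Lemma esym_le_fact i l : all (>= 0) l ->
  elsym i l <= (\sum_(x <- l) x) ^+ i / i`!%:R.
Proof.
elim: l i => [|x l IH] [|i] //=; rewrite ?expr0 ?fact0 ?divr1//.
  by move=> _; rewrite big_nil expr0n /= mul0r.
move=> /andP[x0 l0]; rewrite big_cons.
have S0 : 0 <= \sum_(j <- l) j by rewrite big_seq sumr_ge0 // => z zl; apply: (allP l0).
set S := \sum_(j <- l) j in S0 *.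
have H : forall k, S ^+ k.+1 + k.+1%:R * x * S ^+ k <= (x + S) ^+ k.+1.
  elim=> [|k IHk]; first by rewrite !expr1 expr0; lra.
  rewrite [leRHS]exprS; apply: (le_trans _ (ler_wpM2l _ IHk)); last lra.
  have Sk : 0 <= S ^+ k by rewrite exprn_ge0.
  rewrite !exprS -(natr1 k.+1) .
  have: 0 <= k.+1%:R * (x ^+2) * S ^+ k by rewrite !mulr_ge0// exprn_ge0.
  lra.
apply: (@le_trans _ _ (S ^+ i.+1 / i.+1`!%:R + x * (S ^+ i / i`!%:R))).
  by apply: lerD; [exact: IH|apply: ler_wpM2l => //; exact: IH].
have F0 : (0 : R) < i.+1`!%:R by rewrite ltr0n fact_gt0.
rewrite ler_pdivlMr// mulrDl divfK ?gt_eqF//.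
apply: le_trans (H i); rewrite lerD2l factS natrM.
have F1 : (0 : R) < i`!%:R by rewrite ltr0n fact_gt0.
by apply: le_of_eq; field; rewrite gt_eqF.
Qed.

Lemma sum_esym_le r l : all (>= 0) l ->
  \sum_(i < r.+1) elsym i l <= (1 + \sum_(x <- l) x) ^+ r.
Proof.
move=> l0.
have S0 : 0 <= \sum_(j <- l) j by rewrite big_seq sumr_ge0 // => z zl; apply: (allP l0).
apply: (@le_trans _ _ (\sum_(i < r.+1) (\sum_(x <- l) x) ^+ i)).
  by apply: ler_sum => i _; exact: esym_le_pow.
set S := \sum_(x <- l) x in S0 *.
elim: r => [|r IH]; first by rewrite big_ord1 !expr0.
rewrite big_ord_recl expr0 exprS mulrDl mul1r; apply: lerD.
  by rewrite exprn_ege1// lerDl.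
under eq_bigr do rewrite lift0 exprS.
by rewrite -mulr_sumr ler_wpM2l.
Qed.

Variables (wt : nat -> R) (s : seq nat) (E : nat -> nat -> bool) (ps : seq nat).
Variables (A Rm : R) (g rho : nat -> R).
Hypotheses (wt0 : forall n, 0 <= wt n) (A0 : 0 <= A) (Rm0 : 0 <= Rm).
Hypothesis g01 : forall p, p \in ps -> 0 <= g p <= 1.
Hypothesis rho0 : forall p, p \in ps -> 0 <= rho p.

(* f has mean mu against every product of sieve events outside U.  Being stable under sums and under
   multiplication by a fresh event, this passes to the truncated symmetric functions. *)
Definition approx (U : seq nat) (phi : nat -> R) (mu kappa : R) :=
  forall d, uniq d -> {subset d <= ps} -> (forall p, p \in d -> p \notin U) ->
  `|\sum_(n <- s) wt n * (phi n * \prod_(p <- d) (E p n)%:R)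
    - A * (mu * \prod_(p <- d) g p)| <= Rm * (kappa * \prod_(p <- d) rho p).

Lemma approx_total U f m k : approx U f m k ->
  `|\sum_(n <- s) wt n * f n - A * m| <= Rm * k.
Proof.
move=> H; have := H [::] isT; rewrite !big_nil !mulr1.
rewrite (eq_bigr (fun n => wt n * f n)); last by move=> n _; rewrite big_nil mulr1.
by apply.
Qed.

Lemma approx_add U f1 f2 m1 m2 k1 k2 : approx U f1 m1 k1 -> approx U f2 m2 k2 ->
  approx U (fun n => f1 n + f2 n) (m1 + m2) (k1 + k2).
Proof.
move=> H1 H2 d ud sd dU; rewrite !mulrDl !mulrDr.
apply: le_trans (lerD (H1 d ud sd dU) (H2 d ud sd dU)).
apply: le_trans (ler_normD _ _); apply: le_of_eq; congr `|_|.
rewrite (eq_bigr (fun n => wt n * (f1 n * \prod_(p <- d) (E p n)%:R) +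
  wt n * (f2 n * \prod_(p <- d) (E p n)%:R))); last by move=> n _; ring.
by rewrite big_split /=; ring.
Qed.

Lemma approx_sign U f m k (i : nat) : approx U f m k ->
  approx U (fun n => (-1) ^+ i * f n) ((-1) ^+ i * m) k.
Proof.
move=> H d ud sd dU; apply: le_trans (H d ud sd dU).
rewrite -[leRHS](normrMsign i) mulrBr mulr_sumr; apply: le_of_eq; congr `|_ - _|.
  by apply: eq_bigr => n _; ring.
by ring.
Qed.

Lemma approx_ext U f f' m m' k k' : approx U f m k -> f =1 f' -> m = m' -> k = k' ->
  approx U f' m' k'.
Proof.
move=> H e <- <- d ud sd dU.
rewrite (eq_bigr (fun n => wt n * (f n * \prod_(p <- d) (E p n)%:R))); first exact: H.
by move=> n _; rewrite e.
Qed.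

Lemma approx_sub U U' f m k : {subset U <= U'} -> approx U f m k -> approx U' f m k.
Proof.
move=> sU H d ud sd dU; apply: H => // p pd.
by apply: contra (dU p pd); apply: sU.
Qed.

Lemma approx_event U f m k p : approx U f m k -> p \in ps -> p \notin U ->
  approx (p :: U) (fun n => f n * (E p n)%:R) (m * g p) (k * rho p).
Proof.
move=> H pps pU d ud sd dU; have := H (p :: d).
rewrite /= ud andbT !big_cons => H'.
rewrite -2!mulrA; rewrite (eq_bigr (fun n => wt n * (f n * ((E p n)%:R * \prod_(p <- d) (E p n)%:R)))); last by move=> n _; ring.
have : p \notin d by apply/negP => /dU; rewrite in_cons eqxx.
have e : \sum_(n <- s) wt n * (f n * \prod_(p <- p :: d) (E p n)%:R) =
  \sum_(n <- s) wt n * (f n * ((E p n)%:R * \prod_(p <- d) (E p n)%:R)).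
  by apply: eq_bigr => n _; rewrite big_cons.
move=> /H'; rewrite e; apply.
- by move=> q; rewrite in_cons => /orP[/eqP->//|/sd].
- by move=> q; rewrite in_cons => /orP[/eqP->//|/dU]; rewrite in_cons negb_or => /andP[].
Qed.

Lemma approx_esym q U f m k i : approx U f m k -> uniq q -> {subset q <= ps} ->
  (forall p, p \in q -> p \notin U) ->
  approx (q ++ U) (fun n => f n * elsym i [seq (E p n)%:R | p <- q])
    (m * elsym i (map g q)) (k * elsym i (map rho q)).
Proof.
move=> H; elim: q i => [|p q IH] i uq sq qU.
  case: i => [|i] /=.
    by apply: approx_ext H _ _ _ => [n||]; rewrite /= mulr1.
  move=> d _ _ _; rewrite !mulr0 mul0r !mulr0 mul0r mulr0 big1 ?subr0 ?normr0//.
  by move=> n _; rewrite mulr0 mul0r mulr0.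
move: uq => /= /andP[pq uq].
have sq' : {subset q <= ps} by move=> z zq; apply: sq; rewrite in_cons zq orbT.
have qU' z : z \in q -> z \notin U by move=> zq; apply: qU; rewrite in_cons zq orbT.
have H1 j := IH j uq sq' qU'.
have sU : {subset q ++ U <= p :: q ++ U} by move=> z zz; rewrite in_cons zz orbT.
case: i => [|i] /=.
  apply: (approx_sub sU).
  by apply: approx_ext (H1 0%N) _ _ _ => [n||]; rewrite /= !esym0.
have pU : p \notin q ++ U by rewrite mem_cat negb_or pq qU// in_cons eqxx.
have A1 := approx_event (H1 i) (sq p (mem_head _ _)) pU.
have A2 := approx_add (approx_sub sU (H1 i.+1)) A1.
by apply: approx_ext A2 _ _ _ => [n||]; ring.
Qed.

Definition sesym (r : nat) (l : seq R) : R := \sum_(i < r.+1) elsym i l.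

Lemma tesymS r l : tesym r.+1 l = tesym r l + (-1) ^+ r.+1 * elsym r.+1 l.
Proof. by rewrite /tesym big_ord_recr. Qed.

Lemma sesymS r l : sesym r.+1 l = sesym r l + elsym r.+1 l.
Proof. by rewrite /sesym big_ord_recr. Qed.

Lemma approx_tesym q U f m k r : approx U f m k -> uniq q -> {subset q <= ps} ->
  (forall p, p \in q -> p \notin U) ->
  approx (q ++ U) (fun n => f n * tesym r [seq (E p n)%:R | p <- q])
    (m * tesym r (map g q)) (k * sesym r (map rho q)).
Proof.
move=> H uq sq qU; elim: r => [|r IH].
  apply: approx_ext (approx_esym 0 H uq sq qU) _ _ _ => [n||];
  by rewrite /tesym /sesym big_ord1 ?expr0 ?mul1r.
have H1 := approx_add IH (approx_sign r.+1 (approx_esym r.+1 H uq sq qU)).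
by apply: approx_ext H1 _ _ _ => [n||]; rewrite ?tesymS ?sesymS; ring.
Qed.

(* A block is a set of primes with its own even truncation depth; usieve bounds the sieve product
   vsieve from above and usieve - esieve bounds it from below. *)
Fixpoint usieve (bl : seq (seq nat * nat)) (f : nat -> R) : R :=
  if bl is b :: bl' then usieve bl' f * tesym b.2 (map f b.1) else 1.

Fixpoint esieve (bl : seq (seq nat * nat)) (f : nat -> R) : R :=
  if bl is b :: bl' then usieve bl' f * elsym b.2.+1 (map f b.1) +
     esieve bl' f * tesym b.2 (map f b.1) else 0.

Fixpoint vsieve (bl : seq (seq nat * nat)) (f : nat -> R) : R :=
  if bl is b :: bl' then vsieve bl' f * \prod_(p <- b.1) (1 - f p) else 1.

Fixpoint sieve_urem (bl : seq (seq nat * nat)) (f : nat -> R) : R :=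
  if bl is b :: bl' then sieve_urem bl' f * sesym b.2 (map f b.1) else 1.

Fixpoint sieve_erem (bl : seq (seq nat * nat)) (f : nat -> R) : R :=
  if bl is b :: bl' then sieve_urem bl' f * elsym b.2.+1 (map f b.1) +
     sieve_erem bl' f * sesym b.2 (map f b.1) else 0.

Definition bprimes (bl : seq (seq nat * nat)) := flatten (map fst bl).

Lemma sieve_bounds bl f : (forall p, p \in bprimes bl -> 0 <= f p <= 1) ->
  all (fun b => ~~ odd b.2) bl ->
  [/\ 0 <= vsieve bl f, vsieve bl f <= usieve bl f,
      usieve bl f - esieve bl f <= vsieve bl f & 0 <= esieve bl f].
Proof.
elim: bl => [|b bl IH] /=; first by move=> _ _; rewrite subr0 lexx ler01.
move=> H /andP[ev evs].
have [|//|V0 VU UE E0] := IH.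
  by move=> p pb; apply: H; rewrite /bprimes /= mem_cat pb orbT.
have Hb : all (fun x => 0 <= x <= 1) (map f b.1).
  by apply/allP => _ /mapP[p pb ->]; apply: H; rewrite /bprimes /= mem_cat pb.
have Hb0 : all (>= 0) (map f b.1) by apply: sub_all Hb => x /andP[].
have := bonferroni b.2 Hb; rewrite -signr_odd (negbTE ev) expr0 mul1r big_map.
have := esym_ge0 b.2.+1 Hb0.
have : 0 <= \prod_(p <- b.1) (1 - f p).
  rewrite big_seq prodr_ge0// => p pb; rewrite subr_ge0.
  have /andP[_ ->//] : 0 <= f p <= 1 by apply: H; rewrite /bprimes /= mem_cat pb.
move: (tesym _ _) (elsym _ _) (\prod_(_ <- _) _) => T e P P0 e0 /andP[TP Te].
by split; nra.
Qed.

Lemma approx_sieve bl f m k U : approx U f m k ->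
  uniq (bprimes bl) -> {subset bprimes bl <= ps} ->
  (forall p, p \in bprimes bl -> p \notin U) ->
  approx (bprimes bl ++ U) (fun n => f n * usieve bl (fun p => (E p n)%:R))
    (m * usieve bl g) (k * sieve_urem bl rho) /\
  approx (bprimes bl ++ U) (fun n => f n * esieve bl (fun p => (E p n)%:R))
    (m * esieve bl g) (k * sieve_erem bl rho).
Proof.
move=> H; elim: bl => [|b bl IH].
  move=> _ _ _; split.
    by apply: approx_ext H _ _ _ => [n||] /=; rewrite mulr1.
  move=> d _ _ _ /=; rewrite !mulr0 mul0r !mulr0 mul0r mulr0 big1 ?subr0 ?normr0//.
  by move=> n _; rewrite mulr0 mul0r mulr0.
rewrite /bprimes /= cat_uniq -/(bprimes bl) => /and3P[ub /hasPn dj uq] sq qU.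
have [|z zb|IHu IHe] := IH uq.
- by move=> z zb; apply: sq; rewrite mem_cat zb orbT.
- by apply: qU; rewrite mem_cat zb orbT.
have sb : {subset b.1 <= ps} by move=> z zb; apply: sq; rewrite mem_cat zb.
have bU p : p \in b.1 -> p \notin bprimes bl ++ U.
  move=> pb; rewrite mem_cat negb_or qU ?mem_cat ?pb// andbT.
  by apply/negP => /dj /negP.
rewrite -catA; split.
  by apply: approx_ext (approx_tesym b.2 IHu ub sb bU) _ _ _ => [n||] /=; ring.
have := approx_add (approx_esym b.2.+1 IHu ub sb bU) (approx_tesym b.2 IHe ub sb bU).
by move=> H1; apply: approx_ext H1 _ _ _ => [n||] /=; ring.
Qed.

Lemma vsieveE bl f : vsieve bl f = \prod_(p <- bprimes bl) (1 - f p).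
Proof.
elim: bl => [|b bl IH]; first by rewrite big_nil.
by rewrite /bprimes /= big_cat /= -/(bprimes _) -IH mulrC.
Qed.

(** Pointwise the sieve product lies between [usieve - esieve] and [usieve], and [approx_sieve]
    controls the means of both. The main terms differ by [A * esieve], and the remainders of the two
    approximations add up. *)
Lemma brun_sieve bl : approx [::] (fun=> 1) 1 1 ->
  uniq (bprimes bl) -> {subset bprimes bl <= ps} -> all (fun b => ~~ odd b.2) bl ->
  `|\sum_(n <- s) wt n * \prod_(p <- bprimes bl) (1 - (E p n)%:R)
     - A * \prod_(p <- bprimes bl) (1 - g p)|
  <= A * esieve bl g + Rm * (sieve_urem bl rho + sieve_erem bl rho).
Proof.
move=> H ub sb ev.
have [//|Hu He] := approx_sieve H ub sb.
have := approx_total Hu; have := approx_total He; rewrite !mul1r.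
rewrite (eq_bigr (fun n => wt n * esieve bl (fun p => (E p n)%:R))); last first.
  by move=> n _; rewrite mul1r.
rewrite [X in _ -> `|X - _| <= _ -> _](eq_bigr (fun n => wt n * usieve bl (fun p => (E p n)%:R))); last first.
  by move=> n _; rewrite mul1r.
have E01 n p : 0 <= ((E p n)%:R : R) <= 1 by rewrite ler0n lern1 leq_b1.
have Bn n := @sieve_bounds bl (fun p => (E p n)%:R) (fun p _ => E01 n p) ev.
have [|V0 VU UE E0] := @sieve_bounds bl g _ ev; first by move=> p /sb /g01.
have Q1 : \sum_(n <- s) wt n * \prod_(p <- bprimes bl) (1 - (E p n)%:R) <=
   \sum_(n <- s) wt n * usieve bl (fun p => (E p n)%:R).
  apply: ler_sum => n _; apply: ler_wpM2l => //; rewrite -vsieveE.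
  by have [] := Bn n.
have Q2 : \sum_(n <- s) wt n * usieve bl (fun p => (E p n)%:R) -
   \sum_(n <- s) wt n * esieve bl (fun p => (E p n)%:R) <=
   \sum_(n <- s) wt n * \prod_(p <- bprimes bl) (1 - (E p n)%:R).
  rewrite -sumrB; apply: ler_sum => n _; rewrite -mulrBr; apply: ler_wpM2l => //; rewrite -vsieveE.
  by have [] := Bn n.
rewrite -vsieveE; move: Q1 Q2.
move: (\sum_(n <- s) wt n * usieve _ _) (\sum_(n <- s) wt n * esieve _ _)
  (\sum_(n <- s) wt n * \prod_(_ <- _) _) => SU SE SV Q1 Q2.
rewrite !ler_distl => /andP[a1 a2] /andP[a3 a4].
have K0 : 0 <= A * (usieve bl g - vsieve bl g) by rewrite mulr_ge0// subr_ge0.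
have K1 : A * (usieve bl g - esieve bl g) <= A * vsieve bl g by apply: ler_wpM2l.
have K2 : 0 <= Rm * sieve_erem bl rho by lra.
apply/andP; split; nra.
Qed.

(** In a block whose first omitted term is at most [h] times its sieve product, the truncated sum is
    at most [1 + h] times that product. The factor 2 arises because the omitted term enters twice:
    as a loss of its own, and as an overshoot multiplying the losses of the other blocks. *)
Lemma esieve_le bl f (h : seq nat * nat -> R) :
  (forall p, p \in bprimes bl -> 0 <= f p <= 1) -> all (fun b => ~~ odd b.2) bl ->
  (forall b, b \in bl -> 0 <= h b /\
     elsym b.2.+1 (map f b.1) <= h b * \prod_(p <- b.1) (1 - f p)) ->
  esieve bl f <= vsieve bl f * (\prod_(b <- bl) (1 + 2 * h b) - 1) /\
  usieve bl f <= vsieve bl f * \prod_(b <- bl) (1 + 2 * h b).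
Proof.
elim: bl => [|b bl IH] /=; first by rewrite big_nil subrr mulr0 mulr1 lexx.
move=> H /andP[ev evs] Hh.
have H' p : p \in bprimes bl -> 0 <= f p <= 1.
  by move=> pb; apply: H; rewrite /bprimes /= mem_cat pb orbT.
have [|e1 u1] := IH H' evs; first by move=> c cb; apply: Hh; rewrite in_cons cb orbT.
have [V0 VU UE E0] := sieve_bounds H' evs.
have [h0 hb] := Hh b (mem_head _ _).
have Hb : all (fun x => 0 <= x <= 1) (map f b.1).
  by apply/allP => _ /mapP[p pb ->]; apply: H; rewrite /bprimes /= mem_cat pb.
have Hb0 : all (>= 0) (map f b.1) by apply: sub_all Hb => x /andP[].
have := bonferroni b.2 Hb; rewrite -signr_odd (negbTE ev) expr0 mul1r big_map.
have e0 := esym_ge0 b.2.+1 Hb0.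
have : 0 <= \prod_(p <- b.1) (1 - f p).
  rewrite big_seq prodr_ge0// => p pb; rewrite subr_ge0.
  by have /andP[_ ->//] : 0 <= f p <= 1 by apply: H; rewrite /bprimes /= mem_cat pb.
have Q1 : 1 <= \prod_(c <- bl) (1 + 2 * h c).
  rewrite big_seq; apply: (big_ind (fun z => 1 <= z)) => //; first by move=> *; apply: mulr_ege1.
  by move=> c cb; have [|c0 _] := Hh c; [rewrite in_cons cb orbT | lra].
rewrite big_cons; move: e1 u1 VU e0 hb Q1.
set Q := \prod_(c <- bl) _; set P := \prod_(p <- b.1) _.
move: (tesym _ _) (elsym _ _) (usieve _ _) (esieve _ _) (vsieve _ _) V0 E0 UE => T e U X V V0 E0 UE.
move=> e1 u1 VU e0 hb Q1 P0 /andP[TP Te].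
have T0 : 0 <= T by lra.
have TP' : T <= (1 + h b) * P by lra.
have U0 : 0 <= U by lra.
have VP : 0 <= V * P by apply: mulr_ge0.
have VPh : 0 <= V * P * h b by apply: mulr_ge0.
have VPhQ : 0 <= V * P * h b * (Q - 1) by apply: mulr_ge0 => //; lra.
have B1 : U * e <= V * Q * (h b * P) by apply: ler_pM.
have B2 : X * T <= V * (Q - 1) * ((1 + h b) * P) by apply: ler_pM.
have B3 : U * T <= V * Q * ((1 + h b) * P) by apply: ler_pM.
by split; nra.
Qed.

(** In each summand of [sieve_erem] exactly one block plays the role of the omitted term, which
    costs the factor [size bl]. *)
Lemma remainder_le bl f (K : seq nat * nat -> R) :
  (forall p, p \in bprimes bl -> 0 <= f p) ->
  (forall b, b \in bl -> (1 + \sum_(p <- b.1) f p) ^+ b.2.+1 <= K b) ->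
  sieve_urem bl f + sieve_erem bl f <= (size bl).+1%:R * \prod_(b <- bl) K b.
Proof.
move=> f0 HK.
suff : [/\ 0 <= sieve_urem bl f, sieve_urem bl f <= \prod_(b <- bl) K b &
   sieve_erem bl f <= (size bl)%:R * \prod_(b <- bl) K b].
  by move=> [_ a b]; rewrite -natr1 mulrDl mul1r addrC lerD.
elim: bl f0 HK => [|b bl IH] f0 HK /=; first by rewrite big_nil mul0r ler01 lexx.
have [p pb|c cb|U0 U1 E1] := IH.
- by apply: f0; rewrite /bprimes /= mem_cat pb orbT.
- by apply: HK; rewrite in_cons cb orbT.
have b0 : all (>= 0) (map f b.1).
  by apply/allP => _ /mapP[p pb ->]; apply: f0; rewrite /bprimes /= mem_cat pb.
have S0 : 0 <= \sum_(p <- b.1) f p.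
  by rewrite -(big_map f xpredT id) big_seq sumr_ge0 // => z zl; apply: (allP b0).
have := HK b (mem_head _ _).
have := sum_esym_le b.2 b0; have := esym_le_pow b.2.+1 b0; rewrite !big_map -/(sesym _ _) => A1 A2 A3.
have s0 : 0 <= sesym b.2 (map f b.1) by apply: sumr_ge0 => i _; apply: esym_ge0.
have e0 := esym_ge0 b.2.+1 b0.
have s1 : sesym b.2 (map f b.1) <= K b.
  apply: le_trans A2 (le_trans _ A3); rewrite exprS ler_peMl ?exprn_ge0//; lra.
have e1 : elsym b.2.+1 (map f b.1) <= K b.
  apply: le_trans A1 (le_trans _ A3); apply: lerXn2r; rewrite ?nnegrE//; lra.
have K0 : 0 <= K b by lra.
rewrite big_cons; set Q := \prod_(c <- bl) _ in U1 E1 *.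
have Q0 : 0 <= Q by lra.
split; first by rewrite mulr_ge0.
  by rewrite [leRHS]mulrC ler_pM.
have B1 : sieve_urem bl f * elsym b.2.+1 (map f b.1) <= Q * K b by apply: ler_pM.
have B2 : sieve_erem bl f * sesym b.2 (map f b.1) <= (size bl)%:R * Q * K b.
  apply: (@le_trans _ _ ((size bl)%:R * Q * sesym b.2 (map f b.1))).
    by apply: ler_wpM2r.
  by apply: ler_wpM2l => //; rewrite mulr_ge0.
by rewrite -natr1; lra.
Qed.
End Sieve.

(** * Prime sums *)

Section Mertens.
Variable R : realType.

Lemma ln_lesub1 (x : R) : 0 < x -> ln x <= x - 1.
Proof.
move=> x0; have e : 1 + (x - 1) = x by ring.
by have := @le_ln1Dx R (x - 1); rewrite e; apply; lra.
Qed.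

Lemma ln_natM m n : (0 < m)%N -> (0 < n)%N -> ln (m * n)%:R = ln m%:R + ln n%:R :> R.
Proof. by move=> m0 n0; rewrite natrM lnM// posrE ltr0n. Qed.

Lemma ln_nat_ge0 n : 0 <= ln n%:R :> R.
Proof.
by case: n => [|n]; [rewrite ln0// | apply: ln_ge0; rewrite ler1n].
Qed.

Lemma ler_ln_nat m n : (0 < m)%N -> (m <= n)%N -> ln m%:R <= ln n%:R :> R.
Proof. by move=> m0 mn; rewrite ler_ln ?ler_nat// posrE ltr0n// (leq_trans m0). Qed.

Lemma ln_succ_le n : (0 < n)%N -> ln n.+1%:R - ln n%:R <= n%:R^-1 :> R.
Proof.
move=> n0; have n0' : (0 : R) < n%:R by rewrite ltr0n.
rewrite -ln_div ?posrE ?ltr0n//; apply: le_trans (ln_lesub1 _) _; first by rewrite divr_gt0 ?ltr0n.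
by rewrite -natr1 mulrDl divff ?gt_eqF// mul1r addrC addKr.
Qed.

Lemma ln_succ_ge n : (0 < n)%N -> n.+1%:R^-1 <= ln n.+1%:R - ln n%:R :> R.
Proof.
move=> n0; have n0' : (0 : R) < n%:R by rewrite ltr0n.
have n1' : (0 : R) < n.+1%:R by rewrite ltr0n.
suff : ln n%:R - ln n.+1%:R <= - (n.+1%:R^-1) :> R.
  by move: (n.+1%:R^-1) => z; lra.
rewrite -ln_div ?posrE ?ltr0n//; apply: le_trans (ln_lesub1 _) _; first by rewrite divr_gt0 ?ltr0n.
apply: le_of_eq; move: n1'; rewrite -(natr1 n) => n1'.
by field; lra.
Qed.

Lemma ln2_ge : 1 / 2 <= ln 2 :> R.
Proof. by have := @ln_succ_ge 1 isT; rewrite ln1 subr0; lra. Qed.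

Lemma ln2_le1 : ln 2 <= 1 :> R.
Proof. by have := @ln_lesub1 2; lra. Qed.

Lemma ln_gt0_nat n : (1 < n)%N -> 0 < ln n%:R :> R.
Proof. by move=> n1; apply: ln_gt0; rewrite ltr1n. Qed.

Lemma ln_nat_half n : (1 < n)%N -> 1 / 2 <= ln n%:R :> R.
Proof. by move=> n1; apply: le_trans ln2_ge _; apply: ler_ln_nat. Qed.

(* Only the prime divisors of N contribute, so any B > N gives ln N. *)
Lemma ln_logn_le B N : (0 < N)%N ->
  \sum_(1 <= p < B.+1 | prime p) (logn p N)%:R * ln p%:R <= ln N%:R :> R.
Proof.
elim/ltn_ind: N => N IH N0; case: (leqP N 1) => [N1|N1].
  have -> : N = 1%N by lia.
  by rewrite big1 ?ln1// => p _; rewrite logn1 mul0r.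
have pp := pdiv_prime N1; set p := pdiv N in pp.
have pN : (p %| N)%N by exact: pdiv_dvd.
have [M NE] : exists M, N = (M * p)%N by exists (N %/ p)%N; rewrite divnK.
have M0 : (0 < M)%N by rewrite NE in N0; case: (M) N0.
have p1 := prime_gt1 pp.
have MN : (M < N)%N by rewrite NE -{1}(muln1 M) ltn_pmul2l.
rewrite NE (ln_natM M0 (prime_gt0 pp)).
rewrite (eq_bigr (fun q => (logn q M)%:R * ln q%:R + (q == p)%:R * ln p%:R)); last first.
  move=> q pq; rewrite (lognM _ M0 (prime_gt0 pp)) (logn_prime _ pp) natrD mulrDl.
  by case: eqP => [->|]//; rewrite !mul0r.
rewrite big_split /= lerD//; first exact: IH.
case: (ltnP p B.+1) => pB.
  rewrite big_mkcond (bigD1_seq p) /= ?mem_index_iota ?iota_uniq ?prime_gt0//.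
  by rewrite pp eqxx mul1r big1 ?addr0// => q /negbTE->; rewrite mul0r if_same.
rewrite big_nat_cond big1 ?ln_nat_ge0// => q /andP[/andP[_ qB] _].
have -> : (q == p) = false by apply/eqP => qp; move: qB; rewrite qp ltnS leqNgt pB.
by rewrite mul0r.
Qed.

Lemma ln_logn B N : (0 < N)%N -> (N <= B)%N ->
  \sum_(1 <= p < B.+1 | prime p) (logn p N)%:R * ln p%:R = ln N%:R :> R.
Proof.
elim/ltn_ind: N => N IH N0 NB; case: (leqP N 1) => [N1|N1].
  have -> : N = 1%N by lia.
  by rewrite big1 ?ln1// => p _; rewrite logn1 mul0r.
have pp := pdiv_prime N1; set p := pdiv N in pp.
have pN : (p %| N)%N by exact: pdiv_dvd.
have [M NE] : exists M, N = (M * p)%N by exists (N %/ p)%N; rewrite divnK.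
have M0 : (0 < M)%N by rewrite NE in N0; case: (M) N0.
have p1 := prime_gt1 pp.
have MN : (M < N)%N by rewrite NE -{1}(muln1 M) ltn_pmul2l.
have pB : (p < B.+1)%N by rewrite ltnS (leq_trans (dvdn_leq N0 pN)).
rewrite NE (ln_natM M0 (prime_gt0 pp)).
rewrite (eq_bigr (fun q => (logn q M)%:R * ln q%:R + (q == p)%:R * ln p%:R)); last first.
  move=> q pq; rewrite (lognM _ M0 (prime_gt0 pp)) (logn_prime _ pp) natrD mulrDl.
  by case: eqP => [->|]//; rewrite !mul0r.
rewrite big_split /= IH//; last by rewrite (leq_trans (ltnW MN)).
congr (_ + _); rewrite big_mkcond (bigD1_seq p) /= ?mem_index_iota ?iota_uniq ?prime_gt0//.
by rewrite pp eqxx mul1r big1 ?addr0// => q /negbTE->; rewrite mul0r if_same.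
Qed.

Definition theta (n : nat) : R := \sum_(1 <= p < n.+1 | prime p) ln p%:R.

(** Every prime in (n, 2n] divides the central binomial coefficient, which is at most 2^(2n). *)
Lemma theta_double n : theta (n + n) <= theta n + (n + n)%:R.
Proof.
rewrite /theta (@big_cat_nat _ _ _ n.+1) //=; last by rewrite ltnS leq_addr.
rewrite lerD2l.
have C0 : (0 < 'C(n + n, n))%N by rewrite bin_gt0 leq_addr.
apply: (@le_trans _ _ (ln 'C(n + n, n)%:R)).
  apply: le_trans (ln_logn_le (n + n) C0).
  rewrite [leRHS](@big_cat_nat _ _ _ n.+1) //=; last by rewrite ltnS leq_addr.
  rewrite -[leLHS]add0r lerD//; first by apply: sumr_ge0 => p _; rewrite mulr_ge0 ?ln_nat_ge0.
  rewrite big_nat_cond [leRHS]big_nat_cond; apply: ler_sum => p /andP[/andP[np pn] pp].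
  rewrite -[leLHS]mul1r ler_wpM2r ?ln_nat_ge0// ler1n logn_gt0 mem_primes pp C0 /=.
  have : (p %| (n + n)`!)%N by rewrite dvdn_fact ?prime_gt0//= -ltnS.
  rewrite -(bin_fact (leq_addr n n)) addnK Euclid_dvdM// => /orP[//|].
  rewrite Euclid_dvdM// orbb => Hp; exfalso; move: Hp.
  have H : forall m, (p %| m`!)%N -> (p <= m)%N.
    elim=> [|m IHm]; first by rewrite fact0 dvdn1 => /eqP pe; rewrite pe in pp.
    rewrite factS Euclid_dvdM// => /orP[/dvdn_leq->//|/IHm]; exact: leqW.
  by move/H; lia.
have : (ln 'C(n + n, n)%:R <= ln (2 ^ (n + n))%:R :> R).
  apply: ler_ln_nat => //; have := expnDn 1 1 (n + n).
  rewrite addn1 => ->; rewrite (bigD1 (inord n : 'I_(n + n).+1)) //= inordK ?ltnS ?leq_addr//.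
  by rewrite !exp1n !muln1 leq_addr.
move=> /le_trans; apply; rewrite natrX lnXn ?ltr0n// -[leLHS]mulr_natr.
by rewrite -[leRHS]mul1r; apply: ler_wpM2r => //; exact: ln2_le1.
Qed.

Lemma theta_mono m n : (m <= n)%N -> theta m <= theta n.
Proof.
move=> mn; rewrite /theta [leRHS](@big_cat_nat _ _ _ m.+1) //= lerDl.
by apply: sumr_ge0 => p _; exact: ln_nat_ge0.
Qed.

Lemma theta_le n : theta n <= 4 * n%:R.
Proof.
have H k : theta (2 ^ k) <= 2 * (2 ^ k)%:R.
  elim: k => [|k IH]; first by rewrite /theta big_mkcond big_nat1 /=; lra.
  rewrite expnS mul2n -addnn; apply: le_trans (theta_double _) _.
  by rewrite natrD; lra.
case: n => [|n]; first by rewrite /theta big_geq// mulr0.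
have n0 : (0 < n.+1)%N by [].
have /andP[a b] := trunc_log_bounds (isT : (1 < 2)%N) n0.
apply: le_trans (theta_mono (ltnW b)) _; apply: le_trans (H _) _.
rewrite expnS natrM; suff : (2 ^ trunc_log 2 n.+1)%:R <= n.+1%:R :> R by lra.
by rewrite ler_nat.
Qed.

(** The induction runs on the sharper bound [2 - (ln n + 2) / n], modelled on the integral of ln x /
    x^2. *)
Lemma sum_ln_quad n : \sum_(2 <= m < n.+1) ln m%:R / (m%:R * (m%:R - 1)) <= 2 :> R.
Proof.
suff : (0 < n)%N -> \sum_(2 <= m < n.+1) ln m%:R / (m%:R * (m%:R - 1)) <= 2 - (ln n%:R + 2) / n%:R :> R.
  case: n => [|n] H; first by rewrite big_geq.
  apply: le_trans (H isT) _; rewrite gerBl divr_ge0// addr_ge0// ln_nat_ge0//.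
elim: n => // n IH _; case: n IH => [_|n IH]; first by rewrite big_geq// ln1; lra.
rewrite big_nat_recr //=; apply: le_trans (lerD (IH isT) (lexx _)) _.
have := @ln_succ_le n.+1 isT; rewrite -(natr1 n.+1); set x : R := n.+1%:R.
have x1 : 1 <= x by rewrite ler1n.
set a := ln (x + 1); set b := ln x => ab.
have x0 : 0 < x by lra.
rewrite addrK -subr_ge0.
have -> : 2 - (a + 2) / (x + 1) - (2 - (b + 2) / x + a / ((x + 1) * x)) =
  ((b + 2) * (x + 1) - (a + 2) * x - a) / (x * (x + 1)) by field; lra.
apply: divr_ge0; last by nra.
have := ler_wpM2r (ltW x0) ab; rewrite mulVf ?gt_eqF// => ab'.
have : x^-1 <= 1 by rewrite invf_le1.
nra.
Qed.

Lemma sum_prime_ln_quad n : \sum_(1 <= p < n.+1 | prime p) ln p%:R / (p%:R * (p%:R - 1)) <= 2 :> R.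
Proof.
apply: le_trans (sum_ln_quad n); rewrite big_mkcond /=.
case: n => [|n]; first by rewrite !big_geq.
rewrite big_ltn //= add0r; apply: ler_sum_nat => m /andP[m2 _]; case: ifP => // _.
apply: divr_ge0; rewrite ?ln_nat_ge0// mulr_ge0// subr_ge0 ler1n; lia.
Qed.

Lemma ln_fact_ge n : n%:R * ln n%:R - n%:R <= ln n`!%:R :> R.
Proof.
elim: n => [|n IH]; first by rewrite mul0r fact0 ln1 subrr.
rewrite factS ln_natM ?fact_gt0//; case: n IH => [|n] IH.
  by rewrite fact0 ln1; lra.
apply: le_trans (lerD (lexx _) IH).
have := @ln_succ_le n.+1 isT; have n0 : (0 : R) < n.+1%:R by rewrite ltr0n.
move=> /(ler_wpM2l (ltW n0)); rewrite mulfV ?gt_eqF// -(natr1 n.+1).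
lra.
Qed.

Lemma ln_fact_le n : ln n`!%:R <= n%:R * ln n%:R :> R.
Proof.
elim: n => [|n IH]; first by rewrite mul0r fact0 ln1.
rewrite factS ln_natM ?fact_gt0//.
have : n%:R * ln n%:R <= n%:R * ln n.+1%:R :> R.
  by case: (n) => [|k]; rewrite ?mul0r// ler_wpM2l// ler_ln_nat.
by rewrite -(natr1 n); lra.
Qed.

(** The exponent of p in n! is at least n / p - 1 and at most n / (p - 1). Summed against ln p, the
    -1 costs at most [theta n <= 4 n], and the excess n / (p (p - 1)) costs at most 2 n; comparison
    with Stirling-type bounds for ln n! finishes. *)
Lemma mertens1 n : (0 < n)%N ->
  `|\sum_(1 <= p < n.+1) (prime p)%:R * (ln p%:R / p%:R) - ln n%:R| <= 4 :> R.
Proof.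
move=> n0; have n0' : (0 : R) < n%:R by rewrite ltr0n.
have -> : \sum_(1 <= p < n.+1) (prime p)%:R * (ln p%:R / p%:R) =
   \sum_(1 <= p < n.+1 | prime p) ln p%:R / p%:R :> R.
  rewrite [RHS]big_mkcond; apply: eq_bigr => p _; case: (prime p); rewrite ?mul1r ?mul0r//.
set S := \sum_(_ <= _ < _ | _) _.
have F0 := fact_gt0 n.
have up : n%:R * S - theta n <= ln n`!%:R.
  apply: le_trans (ln_logn_le n F0); rewrite mulr_sumr -sumrB.
  rewrite big_nat_cond [leRHS]big_nat_cond; apply: ler_sum => p /andP[/andP[p0 pn] pp].
  rewrite logn_fact// (big_ltn (n0 : (1 < n.+1)%N)) expn1 natrD.
  have h : n%:R / p%:R - 1 <= (n %/ p)%:R :> R.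
    rewrite lerBlDr ler_pdivrMr ?ltr0n// natr1 -natrM ler_nat.
    by rewrite {1}(divn_eq n p) mulSn addnC leq_add2r ltnW// ltn_pmod.
  have := ler_wpM2r (ln_nat_ge0 p) h; set q := (\sum_(_ <= _ < _) _)%N.
  have : 0 <= q%:R * ln p%:R :> R by rewrite mulr_ge0 ?ln_nat_ge0.
  by rewrite mulrDl; lra.
have lo : ln n`!%:R <= n%:R * (S + 2).
  (* This branch is [n <= 2]. In the other one the sum over primes up to n! is split at n, which
     requires n < n!. *)
  case: (leqP n`! n) => nF.
    apply: le_trans (ler_ln_nat F0 nF) _; apply: le_trans (ln_lesub1 n0') _.
    have : 0 <= S by apply: sumr_ge0 => p _; rewrite divr_ge0// ln_nat_ge0.
    nra.
  have logB p : prime p -> (logn p n`!)%:R <= n%:R / (p%:R - 1) :> R.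
    move=> pp; rewrite logn_fact//; have p1 := prime_gt1 pp.
    have p1' : (1 : R) < p%:R by rewrite ltr1n.
    have H k : \sum_(1 <= i < k.+1) n%:R / p%:R ^+ i <= n%:R / (p%:R - 1) * (1 - (p%:R ^+ k)^-1) :> R.
      elim: k => [|k IH]; first by rewrite big_geq// expr0 invr1 subrr mulr0.
      rewrite big_nat_recr //=; apply: le_trans (lerD IH (lexx _)) _.
      apply: le_of_eq; rewrite exprS; field.
      by rewrite expf_neq0 ?subr_eq0 /= ?gt_eqF//; lra.
    have h1 : n%:R / (p%:R - 1) * (1 - (p%:R ^+ n)^-1) <= n%:R / (p%:R - 1) :> R.
      by rewrite -[leRHS]mulr1 ler_wpM2l ?divr_ge0 ?subr_ge0 ?(ltW p1')// ?gerBl ?invr_ge0 ?exprn_ge0.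
    rewrite natr_sum; apply: le_trans (le_trans (H n) h1).
    apply: ler_sum => i _; rewrite -natrX ler_pdivlMr ?ltr0n ?expn_gt0 ?prime_gt0//.
    by rewrite -natrM ler_nat leq_trunc_div.
  have -> : ln n`!%:R = \sum_(1 <= p < n.+1 | prime p) (logn p n`!)%:R * ln p%:R :> R.
    rewrite -(@ln_logn n`! n`!)// (@big_cat_nat _ _ _ n.+1) //=; last by rewrite ltnS ltnW.
    rewrite [X in _ + X]big_nat_cond [X in _ + X]big1 ?addr0// => p /andP[/andP[np _] pp].
    rewrite logn_fact// big_nat big1 ?mul0r// => k /andP[k1 _].
    apply: divn_small; apply: leq_trans np _; rewrite -{1}(expn1 p) leq_exp2l ?prime_gt1//.
  have := sum_prime_ln_quad n => /(ler_wpM2l (ltW n0')); rewrite mulrDr => /(lerD (lexx (n%:R * S))) h.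
  apply: (le_trans _ (le_trans h _)); last lra.
  rewrite -mulrDr -big_split /= mulr_sumr; apply: ler_sum => p pp.
  apply: le_trans (ler_wpM2r (ln_nat_ge0 p) (logB p pp)) _.
  have p1' : (1 : R) < p%:R by rewrite ltr1n prime_gt1.
  apply: le_of_eq; field; lra.
have := theta_le n; have := ln_fact_ge n; have := ln_fact_le n => h1 h2 h3.
rewrite ler_distl; apply/andP; split; rewrite -(ler_pM2l n0'); lra.
Qed.
End Mertens.
Section Mertens2.
Variable R : realType.

Lemma ln_sub_le (x y : R) : 0 < x -> 0 < y -> ln y - ln x <= (y - x) / x.
Proof.
move=> x0 y0; rewrite -ln_div ?posrE//; apply: le_trans (ln_lesub1 _) _; first exact: divr_gt0.
by rewrite mulrBl divff ?gt_eqF.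
Qed.

Lemma ln_sub_ge (x y : R) : 0 < x -> 0 < y -> (y - x) / y <= ln y - ln x.
Proof.
move=> x0 y0; have := ln_sub_le y0 x0 => h.
have -> : (y - x) / y = - ((x - y) / y) by rewrite -mulNr opprB.
lra.
Qed.

Lemma abel_lnln (a : nat -> R) (c C : R) : 0 <= C ->
  (forall n, (0 < n)%N -> `|\sum_(1 <= k < n.+1) a k - c * ln n%:R| <= C) ->
  forall y x, (1 < y)%N -> (y <= x)%N ->
  `|\sum_(y.+1 <= n < x.+1) a n / ln n%:R - c * (ln (ln x%:R) - ln (ln y%:R))|
   <= (3 * C + `|c|) / ln y%:R.
Proof.
move=> C0 HC y x y1 yx.
pose E n := \sum_(1 <= k < n.+1) a k - c * ln n%:R.
have y0 := ln_gt0_nat R y1.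
(* Partial summation with the boundary terms kept on the left, so that both sides are additive in
   [x] and induction applies. Bounding the two boundary terms afterwards accounts for 2 C of the 3
   C. *)
suff H : `|\sum_(y.+1 <= n < x.+1) a n / ln n%:R - c * (ln (ln x%:R) - ln (ln y%:R))
   - E x / ln x%:R + E y / ln y%:R| <= (C + `|c|) * (1 / ln y%:R - 1 / ln x%:R).
  have x0 : 0 < ln x%:R :> R := ln_gt0_nat R (leq_trans y1 yx).
  have lyx : ln y%:R <= ln x%:R :> R by apply: ler_ln_nat => //; lia.
  have iyx : (ln x%:R)^-1 <= (ln y%:R)^-1 :> R by rewrite lef_pV2 ?posrE.
  have ix0 : 0 < (ln x%:R)^-1 :> R by rewrite invr_gt0.
  have Ex : `|E x / ln x%:R| <= C / ln y%:R.
    rewrite normrM (ger0_norm (ltW ix0)); apply: ler_pM; rewrite ?normr_ge0 ?(ltW ix0)//; apply: HC; lia.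
  have Ey : `|E y / ln y%:R| <= C / ln y%:R.
    have iy0 : 0 <= (ln y%:R)^-1 :> R by rewrite invr_ge0 ltW.
    rewrite normrM (ger0_norm iy0); apply: ler_wpM2r => //.
    by apply: HC; lia.
  have H' : (C + `|c|) * (1 / ln y%:R - 1 / ln x%:R) <= (C + `|c|) / ln y%:R.
    by rewrite ler_wpM2l ?addr_ge0// !mul1r lerBlDr lerDl ltW.
  move: H H' Ex Ey; set S := \sum_(_ <= _ < _) _.
  move: (E x / _) (E y / _) (ln (ln x%:R) - _) => ex ey l.
  rewrite !mulrDl; set T := c * l; move=> H H' Ex Ey.
  move: (le_trans H H') Ex Ey; rewrite !ler_norml => /andP[h1 h2] /andP[h3 h4] /andP[h5 h6].
  by apply/andP; split; lra.
elim: x yx => [|x IH]; first by lia.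
rewrite leq_eqVlt => /orP[/eqP <-|]; first by rewrite big_geq// !subrr !mulr0 subr0 sub0r addNr normr0.
rewrite ltnS => yx; have {}IH := IH yx.
have x0 : 0 < ln x%:R :> R := ln_gt0_nat R (leq_trans y1 yx).
have x10 : 0 < ln x.+1%:R :> R by apply: ln_gt0_nat; lia.
have xp : (0 < x)%N by lia.
rewrite big_nat_recr //=; set S := \sum_(_ <= _ < _) _ in IH *.
pose d := ln x.+1%:R - ln x%:R : R.
have d0 : 0 <= d by rewrite subr_ge0 ler_ln_nat.
have d1 : d <= 1.
  apply: le_trans (ln_succ_le R xp) _; rewrite invf_le1 ?ler1n// ltr0n//.
pose b := 1 / ln x%:R - 1 / ln x.+1%:R : R.
have Ea : a x.+1 = c * d + E x.+1 - E x by rewrite /E big_nat_recr //= /d; ring.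
pose r := d / ln x.+1%:R - (ln (ln x.+1%:R) - ln (ln x%:R)) : R.
have db : d / ln x%:R - d / ln x.+1%:R = d * b by rewrite /b; ring.
have b0 : 0 <= b by rewrite subr_ge0 !mul1r lef_pV2 ?posrE// ler_ln_nat.
have r1 : `|r| <= b.
  have u1 := ln_sub_le x0 x10; have u2 := ln_sub_ge x0 x10; rewrite -/d in u1 u2.
  rewrite ler_norml /r; have : d * b <= b by rewrite ler_piMl.
  move=> h; apply/andP; split; lra.
have -> : S + a x.+1 / ln x.+1%:R - c * (ln (ln x.+1%:R) - ln (ln y%:R)) - E x.+1 / ln x.+1%:R + E y / ln y%:R =
  (S - c * (ln (ln x%:R) - ln (ln y%:R)) - E x / ln x%:R + E y / ln y%:R) + (c * r + E x * b).
  by rewrite Ea /r /b; field; rewrite !gt_eqF.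
apply: le_trans (ler_normD _ _) _.
have h1 : `|c * r + E x * b| <= (C + `|c|) * b.
  apply: le_trans (ler_normD _ _) _; rewrite !normrM (ger0_norm b0) addrC mulrDl lerD//.
    by rewrite ler_wpM2r// HC.
  by rewrite ler_wpM2l.
apply: le_trans (lerD IH h1) _; rewrite /b; apply: le_of_eq; ring.
Qed.

Lemma mertens2 : exists2 C : R, 0 <= C & forall y x, (1 < y)%N -> (y <= x)%N ->
  `|\sum_(y.+1 <= p < x.+1 | prime p) p%:R^-1 - (ln (ln x%:R) - ln (ln y%:R))| <= C / ln y%:R.
Proof.
exists (3 * 4 + `|1|) => [|y x y1 yx]; first by rewrite normr1; lra.
have := @abel_lnln (fun p => (prime p)%:R * (ln p%:R / p%:R)) 1 4 _ _ y x y1 yx.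
rewrite mul1r; have -> : \sum_(y.+1 <= n < x.+1) (prime n)%:R * (ln n%:R / n%:R) / ln n%:R =
   \sum_(y.+1 <= p < x.+1 | prime p) p%:R^-1 :> R.
  rewrite [RHS]big_mkcond; apply: eq_bigr => p _; case: ifP => [/prime_gt1 p1|_]; last by rewrite !mul0r.
  by rewrite mul1r mulrAC divff ?mul1r// gt_eqF// ln_gt0_nat.
by apply => // n n0; rewrite mul1r; exact: mertens1.
Qed.
End Mertens2.

(** * The nonprincipal character modulo 4 *)

Definition chi (n : nat) : int := if (n %% 4 == 1)%N then 1 else if (n %% 4 == 3)%N then -1 else 0.

Lemma chiM m n : chi (m * n) = chi m * chi n.
Proof.
rewrite /chi -modnMm.
have : (m %% 4 < 4)%N by rewrite ltn_pmod.
have : (n %% 4 < 4)%N by rewrite ltn_pmod.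
by move: (m %% 4)%N (n %% 4)%N => [|[|[|[|//]]]] [|[|[|[|//]]]].
Qed.

Lemma chi_sqr n : odd n -> chi n * chi n = 1.
Proof.
move=> on; rewrite /chi; have := ltn_pmod n (isT : (0 < 4)%N).
have : odd (n %% 4) by rewrite (odd_mod n (erefl : odd 4 = false)).
by move: (n %% 4)%N => [|[|[|[|//]]]].
Qed.

Section ChiSums.
Variable R : realType.
Notation chir n := ((chi n)%:~R : R).

Lemma chi_norm n : `|chir n| <= 1.
Proof.
rewrite /chi; case: ifP => _; first by rewrite normr1.
by case: ifP => _; rewrite ?rmorphN /= ?normrN ?normr1 ?normr0.
Qed.

Lemma sum_chi n : \sum_(1 <= k < n.+1) chir k = ((n %% 4 == 1)%N || (n %% 4 == 2)%N)%:R.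
Proof.
elim: n => [|n IH]; first by rewrite big_geq.
rewrite big_nat_recr //= IH /chi.
have E : (n.+1 %% 4 = (n %% 4).+1 %% 4)%N by rewrite -addn1 -[in RHS]addn1 modnDml.
rewrite E; have := ltn_pmod n (isT : (0 < 4)%N).
move: (n %% 4)%N => [|[|[|[|//]]]] _ /=; rewrite ?rmorphN ?rmorph1 ?rmorph0; lra.
Qed.

Lemma sum_chi_int m n : (m <= n)%N -> `|\sum_(m.+1 <= k < n.+1) chir k| <= 1.
Proof.
move=> mn; have E : \sum_(m.+1 <= k < n.+1) chir k =
   \sum_(1 <= k < n.+1) chir k - \sum_(1 <= k < m.+1) chir k.
  rewrite [X in _ = X - _](@big_cat_nat _ _ _ m.+1) //=.
  by rewrite addrAC subrr add0r.
by rewrite E !sum_chi; case: (_ || _); case: (_ || _) => /=; rewrite ler_norml; apply/andP; split; lra.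
Qed.

Lemma sum_abel (a b : nat -> R) m n : (m <= n)%N ->
  \sum_(m.+1 <= k < n.+1) a k * b k =
  (\sum_(m.+1 <= k < n.+1) a k) * b n.+1 +
  \sum_(m.+1 <= j < n.+1) (\sum_(m.+1 <= k < j.+1) a k) * (b j - b j.+1).
Proof.
move=> mn; elim: n mn => [|n IH].
  by rewrite leqn0 => /eqP->; rewrite !big_geq// mul0r addr0.
rewrite leq_eqVlt => /orP[/eqP <-|]; first by rewrite !big_geq// mul0r addr0.
rewrite ltnS => mn; rewrite [LHS]big_nat_recr //= IH// [in RHS]big_nat_recr //=.
rewrite [X in _ = _ + X]big_nat_recr //= [X in _ = _ + (_ + X * _)]big_nat_recr //=.
by ring.
Qed.

Lemma dirichlet_test (a b : nat -> R) (K : R) m n : (m <= n)%N ->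
  (forall j, (m <= j <= n)%N -> `|\sum_(m.+1 <= k < j.+1) a k| <= K) ->
  (forall j, (m < j)%N -> 0 <= b j.+1 <= b j) ->
  `|\sum_(m.+1 <= k < n.+1) a k * b k| <= K * b m.+1.
Proof.
move=> mn aK bd; rewrite sum_abel//.
apply: le_trans (ler_normD _ _) _.
have b0 j : (m < j)%N -> 0 <= b j by move=> mj; have /andP[p q] := bd j mj; lra.
have -> : b m.+1 = b n.+1 + \sum_(m.+1 <= j < n.+1) (b j - b j.+1).
  by rewrite (@telescope_sumr_eq _ _ _ (fun j => - b j)) //= => [|i _]; [ring|ring].
rewrite mulrDr lerD//.
  by rewrite normrM (ger0_norm (b0 _ _)) ?ltnS// ler_wpM2r ?b0 ?ltnS// aK// mn leqnn.
apply: le_trans (ler_norm_sum _ _ _) _; rewrite mulr_sumr.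
apply: ler_sum_nat => j /andP[mj jn].
have /andP[p q] := bd j mj.
by rewrite normrM [X in _ * X]ger0_norm ?subr_ge0// ler_wpM2r ?subr_ge0// aK// ltnW.
Qed.

Definition chisum (n : nat) : R := \sum_(1 <= k < n.+1) chir k / k%:R.

Lemma chisum_diff m n : (m <= n)%N -> `|chisum n - chisum m| <= m.+1%:R^-1.
Proof.
move=> mn; rewrite /chisum (@big_cat_nat _ _ _ m.+1) //= addrAC subrr add0r.
rewrite -[leRHS]mul1r; apply: (@dirichlet_test _ (fun k => k%:R^-1)) => // [j /andP[mj _]|j mj].
  exact: sum_chi_int.
have j0 : (0 : R) < j%:R by rewrite ltr0n; lia.
apply/andP; split; first by rewrite invr_ge0.
by rewrite lef_pV2 ?posrE ?ltr0n ?ler_nat//; lia.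
Qed.

(** [L] is L(1, chi). The intervals of radius 1 / (n + 1) around [chisum n] meet pairwise, so the
    supremum of their left ends lies in all of them. The left end at n = 3 is 1 - 1/3 - 1/4, which
    is above 1/4; the positivity of [L] is used for a division and for the positivity of the mean of
    B. *)
Lemma chisum_lim : exists2 L : R, 1 / 4 <= L &
  forall n, `|chisum n - L| <= n.+1%:R^-1.
Proof.
pose S := [set x | exists n, x = chisum n - n.+1%:R^-1].
have ub n : ubound S (chisum n + n.+1%:R^-1).
  move=> _ [m ->]; case: (leqP m n) => mn.
    have := chisum_diff mn; rewrite ler_norml => /andP[h1 h2].
    have : 0 <= n.+1%:R^-1 :> R by rewrite invr_ge0.
    by move: (n.+1%:R^-1) (m.+1%:R^-1) h1 h2 => *; lra.
  have := chisum_diff (ltnW mn); rewrite ler_norml => /andP[h1 h2].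
  have : 0 <= m.+1%:R^-1 :> R by rewrite invr_ge0.
  by move: (n.+1%:R^-1) (m.+1%:R^-1) h1 h2 => *; lra.
have S0 : nonempty S by exists (chisum 0 - 1%:R^-1), 0%N.
have lo n : chisum n - n.+1%:R^-1 <= sup S.
  by apply: ub_le_sup; [exists (chisum 0 + 1%:R^-1); exact: ub|exists n].
have hi n : sup S <= chisum n + n.+1%:R^-1 by apply: ge_sup.
exists (sup S); last by move=> n; rewrite ler_distl; have := lo n; have := hi n; move: (n.+1%:R^-1) => z h1 h2; apply/andP; split; lra.
apply: le_trans (lo 3%N); rewrite /chisum (big_ltn (isT : (1 < 4)%N)) (big_ltn (isT : (2 < 4)%N)) (big_ltn (isT : (3 < 4)%N)) big_geq // /chi /=.
by rewrite ?rmorphN ?rmorph1 ?rmorph0; lra.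
Qed.

Lemma lnq_decr n : (3 < n)%N -> ln n.+1%:R / n.+1%:R <= ln n%:R / n%:R :> R.
Proof.
move=> n3; have n0 : (0 < n)%N by lia.
have n0' : (0 : R) < n%:R by rewrite ltr0n.
have n1' : (0 : R) < n.+1%:R by rewrite ltr0n.
have l1 : 1 <= ln n%:R :> R.
  apply: (@le_trans _ _ (ln 4%:R)); last by apply: ler_ln_nat.
  have -> : (4%:R : R) = 2 * 2 by rewrite -natrM.
  by rewrite lnM ?posrE//; have := ln2_ge R; lra.
have := ln_succ_le R n0 => /(ler_wpM2l (ltW n0')); rewrite mulfV ?gt_eqF// => h.
rewrite ler_pdivrMr// mulrAC ler_pdivlMr//; move: h; rewrite -!(natr1 n); lra.
Qed.

Lemma chi_ln_sum n : `|\sum_(1 <= k < n.+1) chir k * (ln k%:R / k%:R)| <= 5.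
Proof.
have t k : (0 < k)%N -> `|chir k * (ln k%:R / k%:R)| <= 1.
  move=> k0; rewrite normrM; have h : 0 <= ln k%:R / k%:R :> R by rewrite divr_ge0// ln_nat_ge0.
  rewrite (ger0_norm h) -[leRHS]mulr1 ler_pM// ?chi_norm// ler_pdivrMr ?ltr0n// mul1r.
  by have := @ln_lesub1 R k%:R; rewrite ltr0n k0 => /(_ isT); lra.
have small m : (m <= 4)%N -> `|\sum_(1 <= k < m.+1) chir k * (ln k%:R / k%:R)| <= 4.
  move=> m4; apply: le_trans (ler_norm_sum _ _ _) _.
  apply: (@le_trans _ _ (\sum_(1 <= k < m.+1) 1)).
    by apply: ler_sum_nat => k /andP[k0 _]; exact: t.
  by rewrite sumr_const_nat subn1 /= ler_nat.
case: (leqP n 3) => n3; first by apply: le_trans (small n _) _; [lia|lra].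
rewrite (@big_cat_nat _ _ _ 4) //=; last by lia.
apply: le_trans (ler_normD _ _) _.
have h1 := small 3%N isT; have : `|\sum_(4 <= k < n.+1) chir k * (ln k%:R / k%:R)| <= 1; last by lra.
apply: (@le_trans _ _ (1 * (ln 4%:R / 4%:R))).
  apply: (@dirichlet_test _ (fun k => ln k%:R / k%:R)) => [|j /andP[mj _]|j mj]; first by lia.
    exact: sum_chi_int.
  by rewrite lnq_decr// divr_ge0// ln_nat_ge0.
rewrite mul1r ler_pdivrMr// mul1r; have := @ln_lesub1 R 4%:R; lra.
Qed.

(** In the bounded sum of chi(k) ln k / k, expand ln k over the prime powers dividing k. The factor
    attached to p^j is chi(p^j) / p^j times [chisum (n %/ p ^ j)], so the primes contribute [L]
    times the wanted sum up to an error controlled by [theta], and higher powers converge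
    absolutely. Dividing by [L] gives the bound, with 11 = 5 + 2 + 4 for the full sum, the higher
    powers and the replacement of [chisum] by [L]. *)
Lemma chi_prime_ln : exists2 C : R, 0 <= C & forall n,
  `|\sum_(1 <= p < n.+1) chir p * (prime p)%:R * (ln p%:R / p%:R)| <= C.
Proof.
have [L L0 HL] := chisum_lim; exists (11 / L) => [|n]; first by rewrite divr_ge0//; lra.
have Ln0 : 0 < L by lra.
rewrite ler_pdivlMr// mulrC -{1}(ger0_norm (ltW Ln0)) -normrM.
set T := \sum_(_ <= _ < _) _.
have chiX p k : chi (p ^ k) = chi p ^+ k.
  by elim: k => [|k IH]; rewrite ?expn0 ?expr0// expnS chiM IH exprS.
have inner p k : (0 < p)%N -> \sum_(1 <= m < n.+1) (p ^ k %| m)%:R * (chir m / m%:R) =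
    chir (p ^ k) / (p ^ k)%:R * chisum (n %/ p ^ k).
  move=> p0; set q := (p ^ k)%N; have q0 : (0 < q)%N by rewrite expn_gt0 p0.
  rewrite /chisum mulr_sumr.
  have H : forall N, \sum_(1 <= m < N.+1) (q %| m)%:R * (chir m / m%:R) =
     \sum_(1 <= j < (N %/ q).+1) (chir q / q%:R) * (chir j / j%:R).
    elim=> [|N IH]; first by rewrite div0n !big_geq.
    rewrite big_nat_recr //= IH divnS//; case: (boolP (q %| N.+1)%N) => [/dvdnP[j jE]|_]; last first.
      by rewrite mul0r addr0.
    have -> : (N %/ q = j.-1)%N.
      have := divnS N q0; rewrite jE dvdn_mull// mulnK//; lia.
    have j0 : (0 < j)%N by case: (j) jE.
    rewrite -[(true + j.-1)%N]/(j.-1.+1) (prednK j0) [RHS]big_nat_recr//= jE mul1r chiM rmorphM natrM.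
    by congr (_ + _); field; rewrite !pnatr_eq0 -!lt0n j0 q0.
  exact: H.
have E : \sum_(1 <= k < n.+1) chir k * (ln k%:R / k%:R) =
   \sum_(1 <= p < n.+1 | prime p) ln p%:R * \sum_(1 <= k < n.+1) chir (p ^ k) / (p ^ k)%:R * chisum (n %/ p ^ k).
  transitivity (\sum_(1 <= m < n.+1) \sum_(1 <= p < n.+1 | prime p) (ln p%:R * \sum_(1 <= k < n.+1) (p ^ k %| m)%:R * (chir m / m%:R))).
    rewrite big_nat [RHS]big_nat; apply: eq_bigr => m /andP[m0 mn].
    transitivity (chir m / m%:R * ln m%:R); first by ring.
    rewrite -(@ln_logn R n m)// mulr_sumr; apply: eq_bigr => p pp.
    suff e : (logn p m = \sum_(1 <= k < n.+1) (p ^ k %| m))%N.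
      by rewrite e -mulr_suml natr_sum; ring.
    rewrite (logn_count_dvd _ pp) [RHS](@big_cat_nat _ _ _ m) //=; last exact: leqW.
    rewrite [X in _ = (_ + X)%N]big_nat [X in _ = (_ + X)%N]big1 ?addn0// => k /andP[mk _].
    case: (boolP (p ^ k %| m)%N) => // /(dvdn_leq m0).
    by have := ltn_expl k (prime_gt1 pp); lia.
  rewrite exchange_big /=; apply: eq_bigr => p pp; rewrite -mulr_sumr; congr (_ * _).
  by rewrite exchange_big /=; apply: eq_bigr => k _; apply: inner; exact: prime_gt0.
have := chi_ln_sum n; rewrite E => H5.
have chin0 m : `|chisum m| <= 1.
  by have := chisum_diff (leq0n m); rewrite /chisum [X in _ - X]big_geq// subr0 invr1.
pose W p := \sum_(2 <= k < n.+1) chir (p ^ k) / (p ^ k)%:R * chisum (n %/ p ^ k).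
have HW p : prime p -> `|W p| <= 1 / (p%:R * (p%:R - 1)).
  move=> pp; have p1 : (1 : R) < p%:R by rewrite ltr1n prime_gt1.
  have G N : \sum_(2 <= k < N.+1) (p%:R ^+ k)^-1 <= 1 / (p%:R * (p%:R - 1)) :> R.
    suff : (0 < N)%N -> \sum_(2 <= k < N.+1) (p%:R ^+ k)^-1 <= 1 / (p%:R * (p%:R - 1)) - 1 / (p%:R ^+ N * (p%:R - 1)) :> R.
      case: N => [|N] h; first by rewrite big_geq// divr_ge0// mulr_ge0//; lra.
      apply: le_trans (h isT) _; rewrite gerBl divr_ge0// mulr_ge0 ?exprn_ge0//; lra.
    elim: N => // N IH _; case: N IH => [_|N IH]; first by rewrite big_geq// expr1 subrr.
    rewrite big_nat_recr //=; apply: le_trans (lerD (IH isT) (lexx _)) _.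
    apply: le_of_eq; rewrite !exprS; field.
    by rewrite expf_neq0 ?subr_eq0 /= ?gt_eqF//; lra.
  apply: le_trans (ler_norm_sum _ _ _) _; apply: le_trans (G n).
  apply: ler_sum => k _; rewrite !normrM normfV natrX [`|p%:R ^+ k|]ger0_norm ?exprn_ge0//.
  have u0 : 0 <= (p%:R ^+ k)^-1 :> R by rewrite invr_ge0 exprn_ge0.
  rewrite mulrAC -[leRHS]mul1r ler_wpM2r//.
  by rewrite mulr_ile1// chi_norm.
have Wsum : `|\sum_(1 <= p < n.+1 | prime p) ln p%:R * W p| <= 2.
  apply: le_trans (ler_norm_sum _ _ _) _; apply: le_trans (sum_prime_ln_quad R n).
  apply: ler_sum => p pp; rewrite normrM (ger0_norm (ln_nat_ge0 R p)).
  by apply: ler_wpM2l; rewrite ?ln_nat_ge0// -div1r HW.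
have Esum : `|\sum_(1 <= p < n.+1 | prime p) ln p%:R * (chir p / p%:R * (chisum (n %/ p) - L))| <= 4.
  case: (posnP n) => [->|n0]; first by rewrite big_geq// normr0.
  have n0' : (0 : R) < n%:R by rewrite ltr0n.
  apply: le_trans (ler_norm_sum _ _ _) _.
  apply: (@le_trans _ _ (\sum_(1 <= p < n.+1 | prime p) ln p%:R * n%:R^-1)).
    rewrite big_nat_cond [leRHS]big_nat_cond; apply: ler_sum => p /andP[/andP[p0 pn] pp].
    rewrite normrM (ger0_norm (ln_nat_ge0 R p)) ler_wpM2l ?ln_nat_ge0//.
    have p0' : (0 : R) < p%:R by rewrite ltr0n.
    rewrite !normrM normfV (ger0_norm (ltW p0')).
    apply: (@le_trans _ _ (1 / p%:R * (n %/ p).+1%:R^-1)).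
      by apply: ler_pM; rewrite ?mulr_ge0 ?invr_ge0 ?normr_ge0 ?(ltW p0')// ler_wpM2r ?invr_ge0 ?(ltW p0')// chi_norm.
    rewrite mul1r -invfM lef_pV2 ?posrE ?mulr_gt0 ?ltr0n// -natrM ler_nat mulnC ltnW//.
    exact: ltn_ceil.
  rewrite -mulr_suml ler_pdivrMr//; exact: theta_le.
have -> : L * T = \sum_(1 <= p < n.+1 | prime p) ln p%:R * \sum_(1 <= k < n.+1) chir (p ^ k) / (p ^ k)%:R * chisum (n %/ p ^ k)
   - \sum_(1 <= p < n.+1 | prime p) ln p%:R * W p
   - \sum_(1 <= p < n.+1 | prime p) ln p%:R * (chir p / p%:R * (chisum (n %/ p) - L)).
  rewrite -!sumrB /T mulr_sumr [RHS]big_mkcond; apply: eq_big_nat => p /andP[p0 pn].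
  case: ifP => pp; last by rewrite mulr0 mul0r mulr0.
  rewrite (big_ltn (leq_ltn_trans p0 pn)) expn1 -/(W p) mulr1; ring.
move: H5 Wsum Esum; rewrite !ler_norml => /andP[h1 h2] /andP[h3 h4] /andP[h5 h6].
apply/andP; split; lra.
Qed.

Lemma chi_mertens : exists2 C : R, 0 <= C & forall n,
  `|\sum_(1 <= p < n.+1 | prime p) chir p / p%:R| <= C.
Proof.
have [C C0 HC] := chi_prime_ln; exists (3 * C / ln 2) => [|n].
  by rewrite divr_ge0 ?mulr_ge0// (le_trans _ (ln2_ge R)).
case: (leqP n 1) => n1.
  rewrite big_nat_cond big1 ?normr0.
    by rewrite divr_ge0 ?mulr_ge0// (le_trans _ (ln2_ge R)).
  by move=> p /andP[/andP[p0 pn] /prime_gt1]; lia.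
rewrite (@big_cat_nat _ _ _ 3) //= [X in X + _]big_nat_cond big1 ?add0r; last first.
  move=> p /andP[/andP[p0 pn] /prime_gt1 p1]; have -> : p = 2%N by lia.
  by rewrite /chi mul0r.
have := @abel_lnln R (fun p => chir p * (prime p)%:R * (ln p%:R / p%:R)) 0 C C0 _ 2 n isT n1.
rewrite !mul0r subr0 normr0 addr0.
have -> : \sum_(3 <= k < n.+1) chir k * (prime k)%:R * (ln k%:R / k%:R) / ln k%:R =
  \sum_(3 <= k < n.+1 | prime k) chir k / k%:R.
  rewrite [RHS]big_mkcond; apply: eq_bigr => p _; case: ifP => [/prime_gt1 p1|_]; last by rewrite mulr0 !mul0r.
  by rewrite mulr1; field; rewrite (gt_eqF (ln_gt0_nat R p1)) pnatr_eq0 -lt0n (ltnW p1).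
by apply => m _; rewrite mul0r subr0.
Qed.
End ChiSums.

(** * The fundamental lemma of the sieve *)

Section Brun.
Variable R : realType.

Definition sprimes (pr : pred nat) (y : nat) :=
  [seq p <- iota 0 y.+1 | [&& prime p, (2 < p)%N & pr p]].

Lemma mem_sprimes pr y p :
  (p \in sprimes pr y) = [&& prime p, (2 < p)%N, (p <= y)%N & pr p].
Proof.
by rewrite mem_filter mem_iota add0n ltnS /=; case: (prime p); case: (2 < p)%N; case: (pr p); rewrite ?andbT ?andbF.
Qed.

(* On doubly exponential blocks the sum of 1 / p is bounded, so depths growing linearly away from
   the largest primes suffice. *)
Definition sblock pr y j := [seq p <- sprimes pr y | (2 ^ 2 ^ j < p <= 2 ^ 2 ^ j.+1)%N].

Definition sblocks pr y D t := [seq (sblock pr y j, (2 * (D + (t - j)))%N) | j <- iota 0 t.+1].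

Lemma sblocks_perm pr y D t : (y < 2 ^ 2 ^ t.+1)%N ->
  perm_eq (bprimes (sblocks pr y D t)) (sprimes pr y).
Proof.
move=> yt; rewrite /bprimes /sblocks -map_comp.
have H k : perm_eq (flatten (map (sblock pr y) (iota 0 k))) [seq p <- sprimes pr y | (p <= 2 ^ 2 ^ k)%N].
  elim: k => [|k IH].
    rewrite /= (@eq_in_filter _ _ pred0) ?filter_pred0//.
    by move=> p; rewrite mem_sprimes => /and4P[_ p2 _ _]; rewrite leqNgt p2.
  rewrite -addn1 iotaD map_cat flatten_cat /= cats0 add0n addn1.
  rewrite perm_sym -(permPl (permEl (perm_filterC (fun p => (p <= 2 ^ 2 ^ k)%N) _))).
  have sE : sblock pr y k = [seq p <- sprimes pr y | (2 ^ 2 ^ k < p <= 2 ^ 2 ^ k.+1)%N] by [].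
  rewrite sE; move: (sprimes pr y) IH => s IH.
  rewrite -!filter_predI; apply: perm_cat.
    rewrite perm_sym; apply: perm_trans IH _; rewrite (@eq_filter _ _ (fun p => (p <= 2 ^ 2 ^ k)%N)) // => p /=.
    case: leqP => //= h; apply: (leq_trans h); rewrite leq_exp2l// leq_exp2l//.
  rewrite (@eq_filter _ _ (fun p => (2 ^ 2 ^ k < p <= 2 ^ 2 ^ k.+1)%N)) // => p /=.
  by rewrite -ltnNge.
rewrite (_ : map _ _ = map (sblock pr y) (iota 0 t.+1)); last exact: eq_map.
apply: perm_trans (H t.+1) _; rewrite (@eq_in_filter _ _ predT) ?filter_predT// => p.
by rewrite mem_sprimes => /and4P[_ _ py _]; rewrite (leq_trans py)// ltnW.
Qed.

Lemma sprimes_uniq pr y : uniq (sprimes pr y).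
Proof. by rewrite filter_uniq// iota_uniq. Qed.

Lemma sub_le_sum (s1 s2 : seq nat) (F : nat -> R) : uniq s1 -> {subset s1 <= s2} ->
  (forall n, 0 <= F n) -> \sum_(n <- s1) F n <= \sum_(n <- s2) F n.
Proof.
move=> u1 s12 F0.
elim: s1 s2 u1 s12 => [|a s1 IH] s2; first by rewrite big_nil sumr_ge0.
move=> /= /andP[as1 u1] s12; rewrite big_cons.
have as2 : a \in s2 by apply: s12; rewrite mem_head.
rewrite [leRHS](perm_big _ (perm_to_rem as2)) big_cons lerD2l; apply: IH => // b bs1.
have : b \in s2 by apply: s12; rewrite in_cons bs1 orbT.
rewrite (perm_mem (perm_to_rem as2)) in_cons => /orP[/eqP ba|//].
by rewrite -ba bs1 in as1.
Qed.
(** A block reaches from a to a^2, and ln ln (a^2) - ln ln a = ln 2. *)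
Lemma sblock_inv : exists2 C : R, 0 <= C & forall pr y j, \sum_(p <- sblock pr y j) p%:R^-1 <= C.
Proof.
have [C C0 HC] := mertens2 R; exists (1 + 2 * C) => [|pr y j]; first lra.
set a := (2 ^ 2 ^ j)%N.
have a1 : (1 < a)%N by rewrite -[1%N](expn0 2) ltn_exp2l// expn_gt0.
have bE : (2 ^ 2 ^ j.+1 = a * a)%N by rewrite /a -expnD addnn -mul2n -expnS.
have la := ln_nat_half R a1.
have ab : (a <= a * a)%N by rewrite leq_pmulr// ltnW.
have a0 : (0 < a)%N by apply: ltnW.
apply: (@le_trans _ _ (\sum_(a.+1 <= p < (a * a).+1 | prime p) p%:R^-1)).
  rewrite -[leRHS]big_filter; apply: sub_le_sum => [|p|n]; last by rewrite invr_ge0.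
    by rewrite filter_uniq// sprimes_uniq.
  rewrite mem_filter mem_sprimes bE -/a => /andP[/andP[ap pa] /and4P[pp _ _ _]].
  by rewrite mem_filter pp mem_index_iota ltnS ap.
have := HC a (a * a)%N a1 ab; rewrite ler_distl => /andP[_ h]; apply: le_trans h _.
rewrite ln_natM// -ln_div ?posrE; [|lra|lra].
have -> : (ln a%:R + ln a%:R) / ln a%:R = 2 :> R by field; lra.
have h2 := ln2_le1 R; have : C / ln a%:R <= 2 * C; last lra.
by rewrite ler_pdivrMr; [nra|lra].
Qed.

(** The exponent of 2 in the product of all block remainders: block [j] has size at most
    [2 ^ 2 ^ (j + 2)], raised to its depth plus one. Dropping the lower order terms leaves
    [2 ^ t * (16 * D + 24)]. *)
Lemma sum_depth D t : (\sum_(j < t.+1) 2 ^ (j + 2) * (2 * (D + (t - j))).+1 + 8 * D + 8 * t + 20 =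
  2 ^ (t + 3) * (2 * D + 3))%N.
Proof.
elim: t => [|t IH]; first by rewrite big_ord1 /= subnn; lia.
rewrite big_ord_recl /= subn0 add0n.
rewrite (eq_bigr (fun j : 'I_t.+1 => 2 * (2 ^ (j + 2) * (2 * (D + (t - j))).+1)))%N; last first.
  by move=> j _; rewrite /bump /= add1n addSn expnS subSS mulnA.
rewrite -big_distrr /= addSn [in RHS]expnS -mulnA; move: IH.
by move: (2 ^ (t + 3) * _)%N (\sum_(_ < _) _)%N => P S <-; rewrite (_ : (2 ^ 2)%N = 4%N)//; lia.
Qed.

Lemma one_sub_ge_exp (x : R) : 0 <= x <= 2 / 3 -> expR (- (3 * x)) <= 1 - x.
Proof.
move=> /andP[x0 x1]; rewrite expRN.
have := expR_ge1Dx (3 * x); set e := expR _ => h.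
have e0 : 0 < e by exact: expR_gt0.
rewrite -(ler_pM2r e0) mulVf ?gt_eqF//; nra.
Qed.

Lemma pow_fact_le (x : R) n : 0 <= x -> x ^+ n / n`!%:R <= expR x.
Proof.
case: n => [|n] x0; last by apply: le_trans (expR_ge1Dxn n x0); rewrite lerDr.
by rewrite expr0 fact0 divr1; have := expR_ge1Dx x; lra.
Qed.

Lemma sblock_size pr y j (rho : nat -> R) : (forall p, p \in sprimes pr y -> rho p <= 2) ->
  1 + \sum_(p <- sblock pr y j) rho p <= (2 ^ 2 ^ (j + 2))%:R.
Proof.
move=> r2; set b := (2 ^ 2 ^ j.+1)%N.
have b2 : (4 <= b)%N.
  by rewrite /b -[4%N]/(2 ^ 2)%N leq_exp2l// -{1}[2%N]expn1 leq_exp2l.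
have -> : (2 ^ 2 ^ (j + 2) = b * b)%N by rewrite /b -expnD addnn -mul2n -expnS addn2.
apply: (@le_trans _ _ (1 + \sum_(p <- sblock pr y j) 2)).
  rewrite lerD2l big_seq [leRHS]big_seq; apply: ler_sum => p.
  by rewrite mem_filter => /andP[_ /r2].
apply: (@le_trans _ _ (1 + \sum_(p <- iota 1 b) 2)).
  rewrite lerD2l; apply: sub_le_sum => // [|p].
    by rewrite filter_uniq// sprimes_uniq.
  by rewrite mem_filter mem_iota mem_sprimes => /andP[/andP[_ pb] /and4P[/prime_gt0 p0 _ _ _]]; rewrite p0 add1n ltnS.
rewrite big_const_seq count_predT size_iota iter_addr_0 natrM -mulr_natr.
have : (4 : R) <= b%:R by rewrite ler_nat.
nra.
Qed.

(** Block [j] is truncated at depth [2 * (D + (t - j))]. Its first omitted term is at most K0 /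
    4^(depth + 1) times its sieve product, so the losses form a geometric series of size 16^(-D).
    The remainders multiply to y^(16 D + 24) because [2 ^ 2 ^ t <= y], and one more factor y covers
    the number of blocks. *)
Theorem fundamental_lemma : exists2 C : R, 0 <= C &
  forall (D y : nat) (pr : pred nat) (wt : nat -> R) (s : seq nat)
    (E : nat -> nat -> bool) (A Rm : R) (g rho : nat -> R),
  (forall n, 0 <= wt n) -> 0 <= A -> 0 <= Rm -> (1 < y)%N ->
  (forall p, p \in sprimes pr y -> 0 <= rho p <= 2 /\ g p = rho p / p%:R) ->
  approx wt s E (sprimes pr y) A Rm g rho [::] (fun=> 1) 1 1 ->
  `|\sum_(n <- s) wt n * \prod_(p <- sprimes pr y) (1 - (E p n)%:R)
     - A * \prod_(p <- sprimes pr y) (1 - g p)|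
  <= A * \prod_(p <- sprimes pr y) (1 - g p) * (C / 16 ^+ D) + Rm * y%:R ^+ (16 * D + 25).
Proof.
have [L L0 HL] := sblock_inv.
(* 14 = 8 + 6: [expR (8 * L)] bounds [(8 * L) ^+ r / r!] once 4^r has been extracted, and a block's
   sieve product is at least [expR (- (6 * L))]. *)
pose K0 : R := expR (14 * L).
have K0p : 0 < K0 by exact: expR_gt0.
exists (K0 * expR K0) => [|D y pr wt s E A Rm g rho wt0 A0 Rm0 y1 Hg Happ].
  by rewrite mulr_ge0// ?expR_ge0// ltW.
set ps := sprimes pr y in Hg Happ *.
set t := trunc_log 2 (trunc_log 2 y).
have y0 : (0 < y)%N by apply: ltnW.
have ly0 : (0 < trunc_log 2 y)%N by rewrite trunc_log_gt0.
have /andP[ly1 ly2] := trunc_log_bounds (isT : (1 < 2)%N) y0.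
have /andP[lt1 lt2] := trunc_log_bounds (isT : (1 < 2)%N) ly0.
have yt1 : (2 ^ 2 ^ t <= y)%N by apply: leq_trans ly1; rewrite leq_exp2l.
have yt2 : (y < 2 ^ 2 ^ t.+1)%N by apply: leq_trans ly2 _; rewrite leq_exp2l.
pose bl := sblocks pr y D t.
have bp : perm_eq (bprimes bl) ps by exact: sblocks_perm.
have ub : uniq (bprimes bl) by rewrite (perm_uniq bp) sprimes_uniq.
have sb : {subset bprimes bl <= ps} by move=> p; rewrite (perm_mem bp).
have ev : all (fun b => ~~ odd b.2) bl.
  by apply/allP => _ /mapP[j _ ->] /=; rewrite oddM.
have rho0 p : p \in ps -> 0 <= rho p by move=> /Hg[/andP[]].
have g23 p : p \in ps -> 0 <= g p <= 2 / 3.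
  move=> pps; have [/andP[r0 r2] ->] := Hg p pps.
  move: pps; rewrite mem_sprimes => /and4P[_ p2 _ _].
  have p3 : (3 : R) <= p%:R by rewrite ler_nat.
  by rewrite divr_ge0//= ler_pdivrMr; [nra|lra].
have g01 p : p \in ps -> 0 <= g p <= 1 by move=> /g23 /andP[-> h]; lra.
have := brun_sieve wt0 A0 g01 Happ ub sb ev.
rewrite (perm_big _ bp).
rewrite (eq_bigr (fun n => wt n * \prod_(p <- ps) (1 - (E p n)%:R))); last first.
  by move=> n _; rewrite (perm_big _ bp).
move=> /le_trans; apply.
have blsub j p : p \in sblock pr y j -> p \in ps by rewrite mem_filter => /andP[].
have bg p : p \in bprimes bl -> 0 <= g p <= 1 by move=> /sb /g01.
have HE : esieve bl g <= \prod_(p <- ps) (1 - g p) * (K0 * expR K0 / 16 ^+ D).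
  pose h (b : seq nat * nat) := K0 / 4 ^+ b.2.+1.
  have [|He _] := @esieve_le R bl g h bg ev.
    move=> _ /mapP[j _ ->] /=; rewrite /h /=; split; first by rewrite divr_ge0 ?exprn_ge0// ltW.
    set b := sblock pr y j; set r := (2 * _)%N.
    have Sg : \sum_(p <- b) g p <= 2 * L.
      apply: (@le_trans _ _ (\sum_(p <- b) 2 * p%:R^-1)); last first.
        by rewrite -mulr_sumr ler_wpM2l// HL.
      rewrite big_seq [leRHS]big_seq; apply: ler_sum => p /blsub pps.
      by have [/andP[r0 r2] ->] := Hg p pps; rewrite ler_wpM2r// invr_ge0.
    have gb0 : all (>= 0) (map g b).
      by apply/allP => _ /mapP[p /blsub /g01 /andP[g0 _] ->].
    have Sg0 : 0 <= \sum_(p <- b) g p.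
      by rewrite big_seq sumr_ge0// => p /blsub /g01 /andP[].
    have V1 : expR (- (6 * L)) <= \prod_(p <- b) (1 - g p).
      apply: (@le_trans _ _ (\prod_(p <- b) expR (- (3 * g p)))).
        rewrite -expR_sum ler_expR sumrN -mulr_sumr lerN2; lra.
      rewrite big_seq [leRHS]big_seq; apply: ler_prod => p /blsub /g23 gp.
      by rewrite expR_ge0 one_sub_ge_exp.
    apply: (le_trans (esym_le_fact _ gb0)); rewrite big_map.
    apply: (@le_trans _ _ (expR (8 * L) / 4 ^+ r.+1)).
      apply: (@le_trans _ _ ((2 * L) ^+ r.+1 / r.+1`!%:R)).
        by rewrite ler_wpM2r ?invr_ge0// lerXn2r ?nnegrE ?mulr_ge0.
      rewrite ler_pdivlMr ?exprn_gt0// mulrAC -exprMn mulrAC -mulrA.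
      have -> : 2 * (4 * L) = 8 * L by ring.
      by apply: pow_fact_le; rewrite mulr_ge0.
    rewrite mulrAC ler_wpM2r ?invr_ge0 ?exprn_ge0//.
    apply: (@le_trans _ _ (K0 * expR (- (6 * L)))); last by rewrite ler_wpM2l// ltW.
    by rewrite /K0 -expRD ler_expR; lra.
  move: He; rewrite vsieveE (perm_big _ bp) /= => He.
  apply: (le_trans He).
  have V0 : 0 <= \prod_(p <- ps) (1 - g p).
    by rewrite big_seq prodr_ge0// => p /g01 /andP[_]; rewrite subr_ge0.
  apply: ler_wpM2l => //.
  have S1 : \sum_(b <- bl) 2 * h b <= K0 / 16 ^+ D.
    rewrite big_map /h /= -mulr_sumr -mulr_sumr.
    have Hsum k : \sum_(j <- iota 0 k.+1) (4 ^+ (2 * (D + (k - j))).+1)^-1 <= 1 / (2 * 16 ^+ D) :> R.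
      rewrite -[iota 0 k.+1]/(index_iota 0 k.+1) big_mkord (reindex_inj rev_ord_inj) /=.
      rewrite (eq_bigr (fun i : 'I_k.+1 => (4 * 16 ^+ D)^-1 * (16 ^+ i)^-1)); last first.
        move=> i _; rewrite subSS subKn; last by rewrite -ltnS.
        by rewrite exprS exprM -[4 ^+ 2]/(4 * 4) -natrM exprD mulrA invfM.
      rewrite -mulr_sumr.
      have G m : \sum_(i < m.+1) (16 ^+ i)^-1 <= 16 / 15 - 1 / (15 * 16 ^+ m) :> R.
        elim: m => [|m IH]; first by rewrite big_ord1 expr0; lra.
        rewrite big_ord_recr /=; apply: le_trans (lerD IH (lexx _)) _.
        rewrite exprS; have : 0 < 16 ^+ m :> R by rewrite exprn_gt0.
        move: (16 ^+ m) => z z0; apply: le_of_eq; field; lra.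
      apply: (@le_trans _ _ ((4 * 16 ^+ D)^-1 * 2)).
        rewrite ler_wpM2l ?invr_ge0 ?mulr_ge0 ?exprn_ge0//; apply: le_trans (G k) _.
        have : 0 <= 1 / (15 * 16 ^+ k) :> R by rewrite divr_ge0 ?mulr_ge0 ?exprn_ge0.
        lra.
      have : 0 < 16 ^+ D :> R by rewrite exprn_gt0.
      move: (16 ^+ D) => z z0; apply: le_of_eq; field; lra.
    have := Hsum t => /(ler_wpM2l (ltW K0p)) /(ler_wpM2l (ler0n R 2)) h1; apply: (le_trans h1).
    have : 0 < 16 ^+ D :> R by rewrite exprn_gt0.
    move: (16 ^+ D) => z z0; apply: le_of_eq; field; lra.
  have P1 : \prod_(b <- bl) (1 + 2 * h b) <= expR (K0 / 16 ^+ D).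
    apply: (@le_trans _ _ (expR (\sum_(b <- bl) 2 * h b))); last by rewrite ler_expR.
    rewrite expR_sum; apply: ler_prod => b _; rewrite expR_ge1Dx andbT.
    by rewrite addr_ge0 ?mulr_ge0 ?invr_ge0 ?exprn_ge0// ltW.
  set x := K0 / 16 ^+ D in P1.
  have x0 : 0 <= x by rewrite divr_ge0 ?exprn_ge0// ltW.
  have xK : x <= K0 by rewrite ler_pdivrMr ?exprn_gt0// ler_peMr ?(ltW K0p)// exprn_ege1//; lra.
  have -> : K0 * expR K0 / 16 ^+ D = x * expR K0 by rewrite /x; ring.
  apply: (@le_trans _ _ (x * expR x)); last by rewrite ler_wpM2l// ler_expR.
  have := expR_ge1Dx (- x); rewrite expRN.
  have := expR_gt0 x; set e := expR x in P1 *; move=> e0 /(ler_wpM2r (ltW e0)).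
  by rewrite mulVf ?gt_eqF//; nra.
have HR : sieve_urem bl rho + sieve_erem bl rho <= y%:R ^+ (16 * D + 25).
  have b0 p : p \in bprimes bl -> 0 <= rho p by move=> /sb /rho0.
  apply: le_trans (@remainder_le R bl rho (fun b => (1 + \sum_(p <- b.1) rho p) ^+ b.2.+1) b0 _) _ => //.
  have -> : (16 * D + 25 = (16 * D + 24).+1)%N by rewrite -addnS.
  rewrite exprS; apply: ler_pM => //.
  - rewrite big_seq prodr_ge0// => b bb; rewrite exprn_ge0// addr_ge0// big_seq sumr_ge0//.
    by move/mapP: bb => [j _ ->] p /blsub /rho0.
  - rewrite ler_nat /bl size_map size_iota; apply: leq_trans yt1.
    apply: (@leq_trans (2 ^ t.+1)); first exact: ltn_expl.
    by rewrite leq_exp2l// ltn_expl.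
  apply: (@le_trans _ _ (\prod_(j <- iota 0 t.+1) ((2 ^ 2 ^ (j + 2))%:R ^+ (2 * (D + (t - j))).+1))).
    rewrite big_map /=; apply: ler_prod => j _; apply/andP; split.
      by rewrite exprn_ge0// addr_ge0// big_seq sumr_ge0// => p /blsub /rho0.
    apply: lerXn2r; rewrite ?nnegrE//.
      by rewrite addr_ge0// big_seq sumr_ge0// => p /blsub /rho0.
    by apply: sblock_size => p /Hg[/andP[]].
  rewrite -[iota 0 t.+1]/(index_iota 0 t.+1) big_mkord.
  rewrite (eq_bigr (fun j : 'I_t.+1 => (2 ^ (2 ^ (j + 2) * (2 * (D + (t - j))).+1))%:R)); last first.
    by move=> j _; rewrite -natrX -expnM.
  rewrite -natr_prod -expn_sum -natrX ler_nat.
  apply: (@leq_trans ((2 ^ 2 ^ t) ^ (16 * D + 24))); last by rewrite leq_exp2r// addn_gt0 orbT.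
  rewrite -expnM leq_exp2l//; have := sum_depth D t; rewrite expnD; set S := (\sum_(_ < _) _)%N.
  by move: (2 ^ t)%N => T; nia.
have V0 : 0 <= \prod_(p <- ps) (1 - g p).
  by rewrite big_seq prodr_ge0// => p /g01 /andP[_]; rewrite subr_ge0.
by rewrite -mulrA; apply: lerD; apply: ler_wpM2l.
Qed.
End Brun.

(** * Periodic events and the Chinese remainder theorem *)

Section Periodic.

Definition nper (q : nat) (F : nat -> bool) := forall n, F (n + q)%N = F n.

Definition cnt (F : nat -> bool) a N : nat := \sum_(a <= n < a + N) F n.

Lemma nper_mul q F k n : nper q F -> F (n + k * q)%N = F n.
Proof.
move=> H; elim: k => [|k IH]; first by rewrite mul0n addn0.
by rewrite mulSn addnCA addnC H.
Qed.

Lemma nper_mod q F n : nper q F -> F (n %% q)%N = F n.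
Proof. by move=> H; rewrite [in RHS](divn_eq n q) addnC nper_mul. Qed.

Lemma nper_dvd q q' F : nper q F -> (q %| q')%N -> nper q' F.
Proof. by move=> H /dvdnP[k ->] n; rewrite nper_mul. Qed.

Lemma nper_and q F G : nper q F -> nper q G -> nper q (fun n => F n && G n).
Proof. by move=> H1 H2 n; rewrite H1 H2. Qed.

Lemma cntD F a N M : cnt F a (N + M) = (cnt F a N + cnt F (a + N) M)%N.
Proof. by rewrite /cnt addnA (@big_cat_nat _ _ _ (a + N)) //= ?leq_addr// -addnA leq_add2l leq_addr. Qed.

Lemma cnt_period F q a : nper q F -> cnt F a q = cnt F 0 q.
Proof.
move=> H; elim: a => // a IH; rewrite -IH.
have h1 : cnt F a q.+1 = (cnt F a q + F (a + q))%N.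
  by rewrite -addn1 cntD /cnt addn1 big_nat1.
have h2 : cnt F a q.+1 = (F a + cnt F a.+1 q)%N.
  by rewrite /cnt addnS big_ltn ?ltnS ?leq_addr// addSn.
by move: h1; rewrite h2 H addnC => /addIn.
Qed.

Lemma cnt_mul F q a k : nper q F -> cnt F a (k * q) = (k * cnt F 0 q)%N.
Proof.
move=> H; elim: k a => [|k IH] a; first by rewrite !mul0n /cnt addn0 big_geq.
by rewrite !mulSn cntD IH cnt_period.
Qed.

Lemma cnt_mono F a N M : (N <= M)%N -> (cnt F a N <= cnt F a M)%N.
Proof. by move=> h; rewrite -(subnKC h) cntD leq_addr. Qed.

Lemma cnt_approx (R : realType) F q a N : (0 < q)%N -> nper q F ->
  `|(cnt F a N)%:R - N%:R * (cnt F 0 q)%:R / q%:R| <= (cnt F 0 q)%:R :> R.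
Proof.
move=> q0 H; set r := cnt F 0 q.
have lo : (N %/ q * r <= cnt F a N)%N by rewrite -(cnt_mul a _ H) cnt_mono// leq_trunc_div.
have hi : (cnt F a N <= (N %/ q).+1 * r)%N by rewrite -(cnt_mul a _ H) cnt_mono// ltnW// ltn_ceil.
have q0' : (0 : R) < q%:R by rewrite ltr0n.
have r0 : (0 : R) <= r%:R by [].
have l1 : (N %/ q)%:R * r%:R <= N%:R * r%:R / q%:R :> R.
  by rewrite ler_pdivlMr// mulrAC ler_wpM2r// -natrM ler_nat leq_trunc_div.
have l2 : N%:R * r%:R / q%:R <= (N %/ q).+1%:R * r%:R :> R.
  by rewrite ler_pdivrMr// [leRHS]mulrAC ler_wpM2r// -natrM ler_nat ltnW// ltn_ceil.
move: lo hi; rewrite -!(ler_nat R) !natrM.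
move: l1 l2; rewrite -(natr1 (N %/ q)) mulrDl mul1r => l1 l2 l3 l4.
by rewrite ler_norml; apply/andP; split; lra.
Qed.

Lemma sum_mul_split (f : nat -> nat) a b :
  (\sum_(0 <= n < a * b) f n = \sum_(0 <= j < b) \sum_(0 <= i < a) f (i + a * j))%N.
Proof.
elim: b => [|b IH]; first by rewrite muln0 !big_geq.
rewrite big_nat_recr //= -IH mulnS addnC (@big_cat_nat _ _ _ (a * b)) //= ?leq_addr//.
congr (_ + _)%N; rewrite -{1}[(a * b)%N]add0n big_addn addnC addnK.
by [].
Qed.

(** Write n = i + q1 j: [F] depends on i alone, and for fixed i the numbers i + q1 j run through all
    residues modulo q2. *)
Lemma cnt_crt q1 q2 F G : coprime q1 q2 -> (0 < q1)%N -> (0 < q2)%N -> nper q1 F -> nper q2 G ->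
  cnt (fun n => F n && G n) 0 (q1 * q2) = (cnt F 0 q1 * cnt G 0 q2)%N.
Proof.
move=> co q10 q20 HF HG; rewrite /cnt !add0n sum_mul_split.
rewrite exchange_big /= big_distrl /=; apply: eq_bigr => i _.
rewrite (eq_bigr (fun j => F i * G (i + q1 * j)))%N; last first.
  by move=> j _; rewrite mulnC nper_mul//; case: (F i) => //=; rewrite mul1n mulnC.
rewrite -big_distrr /=; congr (_ * _)%N.
rewrite !big_mkord.
pose h (j : 'I_q2) : 'I_q2 := Ordinal (ltn_pmod (i + q1 * j) q20).
have hinj : injective h.
  move=> j k /(congr1 val) /= /eqP; rewrite eqn_modDl.
  wlog jk : j k / (k <= j)%N.
    by move=> W; case: (leqP k j) => [/W//|/ltnW/W]; rewrite eq_sym => W' /W'.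
  rewrite eqn_mod_dvd ?leq_mul2l ?jk ?orbT// -mulnBr Gauss_dvdr 1?coprime_sym// => hd.
  apply/val_inj => /=; have := ltn_ord j; case: (posnP (j - k)) => [|p0]; first lia.
  by have := dvdn_leq p0 hd; lia.
rewrite [RHS](reindex_inj hinj) /=; apply: eq_bigr => j _.
by rewrite nper_mod.
Qed.

Lemma cnt_residue q c : (0 < q)%N -> cnt (fun n => n == c %[mod q]) 0 q = 1%N.
Proof.
move=> q0; rewrite /cnt add0n big_mkord (bigD1 (Ordinal (ltn_pmod c q0))) //= modn_mod eqxx.
rewrite big1 // => i ni; apply/eqP; rewrite eqb0; apply: contra ni => /eqP h.
by apply/eqP/val_inj; rewrite /= -h modn_small.
Qed.

Lemma nper_residue q c : nper q (fun n => n == c %[mod q]).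
Proof. by move=> n; rewrite modnDr. Qed.

(** Over a full period of the product modulus the events are independent, and an interval differs
    from whole periods by at most the count in one period. That count is a product over the primes
    involved, which gives the remainder the multiplicative shape demanded by [approx]. *)
Lemma approx_periodic (R : realType) q0 F0 ps (E : nat -> nat -> bool) a N :
  (0 < q0)%N -> nper q0 F0 -> (forall p, p \in ps -> prime p /\ coprime p q0) ->
  (forall p, p \in ps -> nper p (E p)) ->
  approx (fun n => (F0 n)%:R) (index_iota a (a + N)) E ps
    (N%:R * (cnt F0 0 q0)%:R / q0%:R) ((cnt F0 0 q0)%:R : R)
    (fun p => (cnt (E p) 0 p)%:R / p%:R) (fun p => (cnt (E p) 0 p)%:R) [::] (fun=> 1) 1 1.
Proof.
move=> q00 H0 Hp HE d ud sd _.
suff : exists q F, [/\ (0 < q)%N, nper q F, q = (q0 * \prod_(p <- d) p)%N,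
    cnt F 0 q = (cnt F0 0 q0 * \prod_(p <- d) cnt (E p) 0 p)%N &
    forall n, (F n)%:R = (F0 n)%:R * \prod_(p <- d) (E p n)%:R :> R].
  move=> [q [F [qq HF qE cE FE]]].
  rewrite (eq_bigr (fun n => (F n)%:R)); last by move=> n _; rewrite FE mul1r.
  rewrite -natr_sum -/(cnt F a N) !mul1r.
  have q0r : (q0%:R : R) != 0 by rewrite pnatr_eq0 -lt0n.
  have -> : N%:R * (cnt F0 0 q0)%:R / q0%:R * \prod_(p <- d) ((cnt (E p) 0 p)%:R / p%:R) =
     N%:R * (cnt F 0 q)%:R / q%:R :> R.
    rewrite big_split /= cE qE !natrM !natr_prod prodfV invfM.
    by rewrite -!mulrA; congr (_ * (_ * _)); rewrite mulrCA.
  have -> : (cnt F0 0 q0)%:R * \prod_(p <- d) (cnt (E p) 0 p)%:R = (cnt F 0 q)%:R :> R.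
    by rewrite cE natrM natr_prod.
  exact: cnt_approx.
elim: d ud sd => [|p d IH] ud sd.
  by exists q0, F0; split => //; rewrite ?big_nil ?muln1// => n; rewrite big_nil mulr1.
move: ud => /= /andP[pd ud].
have [|q [F [qq HF qE cE FE]]] := IH ud; first by move=> z zd; apply: sd; rewrite in_cons zd orbT.
have pps : p \in ps by apply: sd; rewrite mem_head.
have [pp pq0] := Hp p pps.
have cop : coprime p q.
  rewrite qE coprimeMr pq0 /= big_seq; apply: (big_ind (fun z => coprime p z)).
  - exact: coprimen1.
  - by move=> x y; rewrite coprimeMr => -> ->.
  - move=> z zd; have [|pz _] := Hp z; first by apply: sd; rewrite in_cons zd orbT.
    rewrite prime_coprime// dvdn_prime2//; apply: contra pd => /eqP->//.
exists (p * q)%N, (fun n => E p n && F n); split.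
- by rewrite muln_gt0 qq prime_gt0.
- apply: nper_and; first by apply: nper_dvd (HE p pps) _; rewrite dvdn_mulr.
  by apply: nper_dvd HF _; rewrite dvdn_mull.
- by rewrite big_cons qE mulnCA.
- by rewrite (cnt_crt cop (prime_gt0 pp) qq (HE p pps) HF) big_cons cE mulnCA.
- by move=> n; rewrite big_cons mulrCA -FE; case: (E p n); case: (F n); rewrite /= ?mulr1 ?mulr0 ?mul0r.
Qed.
End Periodic.

(** * Sums of nonnegative multiplicative functions *)

Section Multiplicative.
Variable R : realType.

Lemma sum_dvd (V : nmodType) (F : nat -> V) q N : (0 < q)%N ->
  \sum_(1 <= m < N.+1 | (q %| m)%N) F m = \sum_(1 <= j < (N %/ q).+1) F (q * j)%N.
Proof.
move=> q0; elim: N => [|N IH]; first by rewrite div0n !big_geq.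
rewrite big_mkcond big_nat_recr //= -big_mkcond IH divnS//.
case: (boolP (q %| N.+1)%N) => [/dvdnP[j jE]|_]; last by rewrite addr0.
have j0 : (0 < j)%N by case: (j) jE.
have -> : (N %/ q = j.-1)%N.
  by have := divnS N q0; rewrite jE dvdn_mull// mulnK//; lia.
by rewrite -[(true + j.-1)%N]/(j.-1.+1) (prednK j0) [RHS]big_nat_recr//= jE mulnC.
Qed.

Section CM.
Variable f : nat -> R.
Hypothesis f1 : f 1%N = 1.
Hypothesis fM : forall m n, (0 < m)%N -> (0 < n)%N -> f (m * n)%N = f m * f n.
Hypothesis f0 : forall m, 0 <= f m.

Lemma cm_pow p k : (0 < p)%N -> f (p ^ k)%N = f p ^+ k.
Proof.
move=> p0; elim: k => [|k IH]; first by rewrite expn0 f1 expr0.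
by rewrite expnS fM ?expn_gt0 ?p0// IH exprS.
Qed.

Definition smooth_sum (ps : seq nat) X := \sum_(1 <= m < X.+1 | all (mem ps) (primes m)) f m.

(** Separating the multiples of p gives S <= S' + f(p) S, where S' belongs to the smaller set of
    primes. Solving for S produces the Euler factor without any infinite series. *)
Lemma euler_bound ps X : uniq ps -> (forall p, p \in ps -> prime p /\ f p < 1) ->
  smooth_sum ps X <= \prod_(p <- ps) (1 - f p)^-1.
Proof.
elim: ps => [|p ps IH].
  move=> _ _; rewrite big_nil /smooth_sum.
  apply: (@le_trans _ _ (\sum_(1 <= m < X.+1) (m == 1%N)%:R)).
    rewrite big_mkcond; apply: ler_sum_nat => m /andP[m0 _].
    case: ifP => [|_]; last by rewrite ler0n.
    case: (leqP m 1) => m1; first by rewrite (_ : m = 1%N); [rewrite f1 eqxx lexx | lia].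
    have := pdiv_prime m1 => pp; move/allP/(_ (pdiv m)).
    by rewrite mem_primes pp m0 pdiv_dvd => /(_ isT).
  case: X => [|X]; first by rewrite big_geq// ler01.
  rewrite big_ltn// eqxx big_nat big1 ?addr0// => m /andP[m1 _].
  by rewrite gtn_eqF.
move=> /= /andP[pps ups] H; have [pp fp1] := H p (mem_head _ _).
have p0 := prime_gt0 pp.
have {}IH : smooth_sum ps X <= \prod_(q <- ps) (1 - f q)^-1.
  by apply: IH => // q qps; apply: H; rewrite in_cons qps orbT.
suff : smooth_sum (p :: ps) X <= smooth_sum ps X + f p * smooth_sum (p :: ps) X.
  move=> h; rewrite big_cons ler_pdivlMl ?subr_gt0//; apply: le_trans IH; lra.
rewrite {1}/smooth_sum (bigID (fun m => (p %| m)%N)) /= addrC; apply: lerD.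
  rewrite /smooth_sum big_mkcond [leRHS]big_mkcond; apply: ler_sum => m _.
  case: ifP => [/andP[/allP am pm]|_]; last by case: ifP.
  suff -> : all (mem ps) (primes m) by [].
  apply/allP => q qm; have := am q qm; rewrite !inE => /orP[/eqP qp|//].
  by move: qm pm; rewrite qp mem_primes => /and3P[_ _ ->].
rewrite (eq_bigl (fun m => (p %| m)%N && all (mem (p :: ps)) (primes m))); last by move=> m; rewrite andbC.
rewrite big_mkcondr (sum_dvd (fun m => if all (mem (p :: ps)) (primes m) then f m else 0))//.
apply: (@le_trans _ _ (\sum_(1 <= j < (X %/ p).+1) (if all (mem (p :: ps)) (primes j) then f p * f j else 0))).
  apply: ler_sum_nat => j /andP[j0 _]; rewrite fM//.
  case: ifP => [/allP aj|_]; last by case: ifP; rewrite ?mulr_ge0.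
  suff -> : all (mem (p :: ps)) (primes j) by [].
  by apply/allP => q qj; apply: aj; rewrite primesM// qj orbT.
rewrite -big_mkcond -mulr_sumr; apply: ler_wpM2l => //.
rewrite /smooth_sum [leRHS](@big_cat_nat _ _ _ (X %/ p).+1) //=; last by rewrite ltnS leq_div.
by rewrite lerDl sumr_ge0.
Qed.
End CM.

Lemma inv_one_sub_le (x : R) : 0 <= x <= 3 / 4 -> (1 - x)^-1 <= expR (x + 4 * x ^+ 2).
Proof.
move=> /andP[x0 x1]; apply: le_trans (expR_ge1Dx _).
rewrite -[leLHS]div1r ler_pdivrMr; last lra.
have : 0 <= x ^+ 2 * (3 - 4 * x) by rewrite mulr_ge0 ?sqr_ge0//; lra.
lra.
Qed.

Lemma sum_prime_inv_sq n : \sum_(1 <= p < n.+1 | prime p) (p%:R ^+ 2)^-1 <= 4 :> R.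
Proof.
have h := sum_prime_ln_quad R n.
apply: (@le_trans _ _ (\sum_(1 <= p < n.+1 | prime p) 2 * (ln p%:R / (p%:R * (p%:R - 1))))); last first.
  by rewrite -mulr_sumr; lra.
apply: ler_sum => p pp; have p1 : (1 : R) < p%:R by rewrite ltr1n prime_gt1.
have l2 := ln_nat_half R (prime_gt1 pp).
apply: (@le_trans _ _ (1 / (p%:R * (p%:R - 1)))).
  by rewrite mul1r expr2 lef_pV2 ?posrE; nra.
rewrite mulrA ler_wpM2r// ?invr_ge0 ?mulr_ge0//; lra.
Qed.

Section HT.
Variable f : nat -> R.
Hypothesis f1 : f 1%N = 1.
Hypothesis fM : forall m n, (0 < m)%N -> (0 < n)%N -> f (m * n)%N = f m * f n.
Hypothesis f0 : forall m, 0 <= f m.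
Hypothesis f3 : forall p, prime p -> f p <= 4 /\ f p <= 3 / 4 * p%:R.

Lemma log_sum_le X : \sum_(1 <= m < X.+1) f m / m%:R <=
  expR 256 * expR (\sum_(1 <= p < X.+1 | prime p) f p / p%:R).
Proof.
pose g m := f m / m%:R.
have g1 : g 1%N = 1 by rewrite /g f1 divr1.
have gM m n : (0 < m)%N -> (0 < n)%N -> g (m * n)%N = g m * g n.
  by move=> m0 n0; rewrite /g fM// natrM invfM; ring.
have g0 m : 0 <= g m by rewrite divr_ge0.
have g34 p : prime p -> 0 <= g p <= 3 / 4.
  move=> pp; rewrite g0 /g ler_pdivrMr ?ltr0n ?prime_gt0//.
  by have [] := f3 pp.
pose ps := [seq p <- index_iota 1 X.+1 | prime p].
have ups : uniq ps by rewrite filter_uniq// iota_uniq.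
have : smooth_sum g ps X <= \prod_(p <- ps) (1 - g p)^-1.
  apply: (euler_bound g1 gM g0 X ups) => p; rewrite mem_filter => /andP[pp _]; split => //.
  by have /andP[_ h] := g34 p pp; lra.
rewrite /smooth_sum => h; rewrite -[\sum_(1 <= m < _) _ / _]/(\sum_(1 <= m < X.+1) g m).
have -> : \sum_(1 <= m < X.+1) g m = \sum_(1 <= m < X.+1 | all (mem ps) (primes m)) g m.
  rewrite [RHS]big_mkcond; apply: eq_big_nat => m /andP[m0 mX].
  suff -> : all (mem ps) (primes m) by [].
  apply/allP => p; rewrite mem_primes => /and3P[pp _ pm].
  by rewrite inE mem_filter pp mem_index_iota prime_gt0//= (leq_ltn_trans (dvdn_leq m0 pm)).
apply: (le_trans h); rewrite big_filter -expRD.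
apply: (@le_trans _ _ (\prod_(1 <= p < X.+1 | prime p) expR (g p + 4 * g p ^+ 2))).
  apply: ler_prod => p pp; have /andP[a b] := g34 p pp.
  by rewrite invr_ge0 inv_one_sub_le ?a ?b// andbT; lra.
rewrite -expR_sum ler_expR big_split /= addrC lerD2r.
(* 256 = 4 * 16 * 4: the 4 of [inv_one_sub_le], the bound 16 on [f p ^+ 2], and the bound 4 on the
   sum of 1 / p^2. *)
have h2 := sum_prime_inv_sq X.
apply: (@le_trans _ _ (\sum_(1 <= p < X.+1 | prime p) 64 * (p%:R ^+ 2)^-1)); last first.
  by rewrite -mulr_sumr; lra.
apply: ler_sum => p pp; rewrite /g exprMn exprVn mulrA ler_wpM2r ?invr_ge0 ?exprn_ge0//.
have [a _] := f3 pp; have : f p ^+ 2 <= 4 ^+ 2 by rewrite lerXn2r ?nnegrE.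
lra.
Qed.

(** Split ln X = (ln X - ln m) + ln m. The first part is at most X / m. For the second, expand ln m
    over prime powers, write m as j times a prime power, and sum over the primes first: Chebyshev's
    bound gives O(X / j). The constant is 273 = 1 + 4 * 4 + 64 * 4. *)
Lemma hall_tenenbaum_log X : (0 < X)%N ->
  ln X%:R * \sum_(1 <= m < X.+1) f m <= 273 * X%:R * \sum_(1 <= m < X.+1) f m / m%:R.
Proof.
move=> X0; have X0' : (0 : R) < X%:R by rewrite ltr0n.
have S0 : 0 <= \sum_(1 <= m < X.+1) f m / m%:R by apply: sumr_ge0 => m _; rewrite divr_ge0.
have A : \sum_(1 <= m < X.+1) f m * (ln X%:R - ln m%:R) <= X%:R * \sum_(1 <= m < X.+1) f m / m%:R.
  rewrite mulr_sumr; apply: ler_sum_nat => m /andP[m0 mX].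
  have m0' : (0 : R) < m%:R by rewrite ltr0n.
  rewrite mulrCA ler_wpM2l// -ln_div ?posrE// ltW//.
  by have := @ln_sublinear R (X%:R / m%:R); apply; rewrite divr_gt0.
have B : \sum_(1 <= m < X.+1) f m * ln m%:R <= 272 * X%:R * \sum_(1 <= m < X.+1) f m / m%:R.
  have -> : \sum_(1 <= m < X.+1) f m * ln m%:R =
     \sum_(1 <= j < X.+1) f j * \sum_(1 <= p < X.+1 | prime p) ln p%:R * \sum_(1 <= k < X.+1) (j * p ^ k <= X)%:R * f p ^+ k.
    transitivity (\sum_(1 <= m < X.+1) \sum_(1 <= p < X.+1 | prime p) \sum_(1 <= k < X.+1) ln p%:R * ((p ^ k %| m)%:R * f m)).
      apply: eq_big_nat => m /andP[m0 mX].
      rewrite -(@ln_logn R X m)// mulr_sumr; apply: eq_bigr => p pp.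
      rewrite -mulr_sumr -mulr_suml -natr_sum.
      suff e : (logn p m = \sum_(1 <= k < X.+1) (p ^ k %| m))%N by rewrite e; ring.
      rewrite (logn_count_dvd _ pp) [RHS](@big_cat_nat _ _ _ m) //=; last exact: leqW.
      rewrite [X in _ = (_ + X)%N]big_nat [X in _ = (_ + X)%N]big1 ?addn0// => k /andP[mk _].
      case: (boolP (p ^ k %| m)%N) => // /(dvdn_leq m0).
      by have := ltn_expl k (prime_gt1 pp); lia.
    rewrite exchange_big /=.
    under [RHS]eq_bigr do rewrite mulr_sumr.
    rewrite [RHS]exchange_big /=; apply: eq_bigr => p pp.
    rewrite exchange_big /=.
    under [RHS]eq_bigr do rewrite mulr_sumr mulr_sumr.
    rewrite [RHS]exchange_big /=; apply: eq_bigr => k _.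
    rewrite -mulr_sumr; have q0 : (0 < p ^ k)%N by rewrite expn_gt0 prime_gt0.
    have -> : \sum_(1 <= m < X.+1) (p ^ k %| m)%:R * f m = \sum_(1 <= m < X.+1 | (p ^ k %| m)%N) f m.
      by rewrite [RHS]big_mkcond; apply: eq_bigr => m _; case: ifP; rewrite ?mul1r ?mul0r.
    rewrite sum_dvd//.
    have -> : \sum_(1 <= j < X.+1) f j * (ln p%:R * ((j * p ^ k <= X)%:R * f p ^+ k)) =
      \sum_(1 <= j < X.+1) (j <= X %/ p ^ k)%:R * (ln p%:R * (f j * f p ^+ k)).
      by apply: eq_bigr => j _; rewrite leq_divRL//; ring.
    rewrite [RHS](@big_cat_nat _ _ _ (X %/ p ^ k).+1) //=; last by rewrite ltnS leq_div.
    rewrite [X in _ = _ + X]big_nat [X in _ = _ + X]big1 ?addr0; last first.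
      by move=> j /andP[h _]; rewrite leqNgt h mul0r.
    rewrite mulr_sumr; apply: eq_big_nat => j /andP[j0 jX].
    by rewrite -ltnS jX mul1r fM// cm_pow ?prime_gt0//; ring.
  rewrite mulr_sumr; apply: ler_sum_nat => j /andP[j0 jX].
  have j0' : (0 : R) < j%:R by rewrite ltr0n.
  rewrite [leRHS]mulrCA ler_wpM2l//.
  (* The term k = 1 keeps its condition [j * p <= X], since it has to feed [theta]. The terms k >= 2
     are bounded by X / j times a geometric series of ratio at most 3/4; this is the reason for the
     hypothesis [f p <= 3 / 4 * p%:R]. *)
  have H1 p : prime p -> \sum_(1 <= k < X.+1) (j * p ^ k <= X)%:R * f p ^+ k <=
      4 * (j * p <= X)%:R + 64 * (X%:R / j%:R) / (p%:R * (p%:R - 1)).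
    move=> pp; have p1 : (1 : R) < p%:R by rewrite ltr1n prime_gt1.
    rewrite big_ltn// expn1 expr1; apply: lerD.
      by rewrite mulrC ler_wpM2r//; have [] := f3 pp.
    pose x := f p / p%:R.
    have x0 : 0 <= x by rewrite divr_ge0.
    have x34 : x <= 3 / 4 by rewrite ler_pdivrMr; [have [] := f3 pp | lra].
    have G N : \sum_(2 <= k < N.+1) x ^+ k <= 4 * x ^+ 2.
      suff : (0 < N)%N -> \sum_(2 <= k < N.+1) x ^+ k <= 4 * x ^+ 2 - 4 * x ^+ N.+1.
        case: N => [|N] h; first by rewrite big_geq// mulr_ge0 ?exprn_ge0.
        by apply: le_trans (h isT) _; rewrite gerBl mulr_ge0 ?exprn_ge0.
      elim: N => // N IH _; case: N IH => [_|N IH]; first by rewrite big_geq// subrr.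
      rewrite big_nat_recr //=; apply: le_trans (lerD (IH isT) (lexx _)) _.
      rewrite [x ^+ N.+3]exprS; have : 0 <= x ^+ N.+2 by exact: exprn_ge0.
      by move: (x ^+ N.+2) => z z0; nra.
    apply: (@le_trans _ _ (\sum_(2 <= k < X.+1) (X%:R / j%:R) * x ^+ k)).
      apply: ler_sum => k _; rewrite /x exprMn exprVn.
      case: leqP => h; last by rewrite mul0r mulr_ge0 ?divr_ge0 ?exprn_ge0// mulr_ge0 ?exprn_ge0 ?invr_ge0// exprn_ge0.
      rewrite mul1r mulrCA ler_peMr ?exprn_ge0// -mulrA -invfM -natrX -natrM.
      rewrite ler_pdivlMr; first by rewrite mul1r ler_nat.
      by rewrite ltr0n muln_gt0 j0 expn_gt0 prime_gt0.
    rewrite -mulr_sumr; apply: le_trans (ler_wpM2l _ (G X)) _; first by rewrite divr_ge0.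
    have -> : 64 * (X%:R / j%:R) / (p%:R * (p%:R - 1)) = X%:R / j%:R * (64 / (p%:R * (p%:R - 1))) :> R by ring.
    rewrite ler_wpM2l ?divr_ge0//.
    have xx : x ^+ 2 <= 16 / p%:R ^+ 2.
      rewrite /x exprMn exprVn ler_wpM2r ?invr_ge0 ?exprn_ge0//.
      by have [a _] := f3 pp; have := @lerXn2r R 2 (f p) 4; rewrite !nnegrE => /(_ (f0 p) (ler0n _ _) a); lra.
    apply: (@le_trans _ _ (64 / p%:R ^+ 2)); first lra.
    rewrite ler_wpM2l// lef_pV2 ?posrE ?exprn_gt0 ?mulr_gt0 ?subr_gt0//; [|lra|lra].
    by rewrite expr2 ler_wpM2l//; lra.
  apply: (@le_trans _ _ (\sum_(1 <= p < X.+1 | prime p) ln p%:R * (4 * (j * p <= X)%:R + 64 * (X%:R / j%:R) / (p%:R * (p%:R - 1))))).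
    by apply: ler_sum => p pp; rewrite ler_wpM2l ?ln_nat_ge0// H1.
  have XJ0 : 0 <= X%:R / j%:R :> R by rewrite divr_ge0.
  have -> : \sum_(1 <= p < X.+1 | prime p) ln p%:R * (4 * (j * p <= X)%:R + 64 * (X%:R / j%:R) / (p%:R * (p%:R - 1))) =
    4 * (\sum_(1 <= p < X.+1 | prime p) (j * p <= X)%:R * ln p%:R) +
    64 * (X%:R / j%:R) * \sum_(1 <= p < X.+1 | prime p) ln p%:R / (p%:R * (p%:R - 1)) :> R.
    by rewrite !mulr_sumr -big_split /=; apply: eq_bigr => p _; ring.
  have -> : 272 * X%:R / j%:R = 4 * (4 * (X%:R / j%:R)) + 64 * (X%:R / j%:R) * 4 :> R by ring.
  apply: lerD; last first.
    by rewrite ler_wpM2l ?mulr_ge0//; have := sum_prime_ln_quad R X; lra.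
  rewrite ler_wpM2l//.
  apply: (@le_trans _ _ (theta R (X %/ j))); last first.
    apply: le_trans (theta_le R _) _; rewrite ler_wpM2l// ler_pdivlMr// -natrM ler_nat.
    exact: leq_trunc_div.
  rewrite [leLHS](@big_cat_nat _ _ _ (X %/ j).+1) //=; last by rewrite ltnS leq_div.
  rewrite [X in _ + X]big_nat_cond [X in _ + X]big1 ?addr0; last first.
    by move=> p /andP[/andP[h _] _]; rewrite mulnC -leq_divRL// leqNgt h mul0r.
  rewrite /theta; apply: ler_sum => p _; rewrite -[leRHS]mul1r ler_wpM2r ?ln_nat_ge0//.
  by rewrite lern1 leq_b1.
have e : \sum_(1 <= m < X.+1) f m * (ln X%:R - ln m%:R) =
    ln X%:R * (\sum_(1 <= m < X.+1) f m) - \sum_(1 <= m < X.+1) f m * ln m%:R.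
  by rewrite mulr_sumr -sumrB; apply: eq_bigr => m _; ring.
rewrite e in A; lra.
Qed.

Lemma hall_tenenbaum X : (1 < X)%N -> \sum_(1 <= m < X.+1) f m <=
  273 * expR 256 * X%:R / ln X%:R * expR (\sum_(1 <= p < X.+1 | prime p) f p / p%:R).
Proof.
move=> X1; have l0 := ln_gt0_nat R X1.
have := hall_tenenbaum_log (ltnW X1); rewrite -ler_pdivlMl// => /le_trans; apply.
have := log_sum_le X; set S := \sum_(_ <= _ < _) _; set e := expR (\sum_(_ <= _ < _ | _) _) => h.
have c0 : 0 <= (ln X%:R)^-1 * (273 * X%:R) :> R.
  by apply: mulr_ge0; [rewrite invr_ge0 ltW|rewrite mulr_ge0 ?ler0n].
have := ler_wpM2l c0 h; rewrite !mulrA => /le_trans; apply.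
by apply: le_of_eq; ring.
Qed.
End HT.

Lemma abel_inv_sum (f : nat -> R) (K : R) Y Z : (0 < Y)%N -> (Y <= Z)%N -> (forall m, 0 <= f m) ->
  (forall t, (Y <= t <= Z)%N -> \sum_(1 <= m < t.+1) f m <= K * t%:R) ->
  \sum_(Y.+1 <= m < Z.+1) f m / m%:R <= K * (1 + ln Z%:R - ln Y%:R).
Proof.
move=> Y0 YZ f0 HK.
have Y0' : (0 : R) < Y%:R by rewrite ltr0n.
have K0 : 0 <= K.
  have := HK Y; rewrite leqnn YZ => /(_ isT) h; rewrite -(pmulr_lge0 _ Y0'); apply: le_trans h.
  exact: sumr_ge0.
have P t : (Y <= t <= Z)%N -> \sum_(Y.+1 <= m < t.+1) f m <= K * t%:R.
  move=> /andP[Yt tZ]; apply: le_trans (HK t _); last by rewrite Yt.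
  by rewrite [leRHS](@big_cat_nat _ _ _ Y.+1) //= lerDr sumr_ge0.
rewrite (sum_abel _ (fun m => m%:R^-1))//.
have h1 : (\sum_(Y.+1 <= m < Z.+1) f m) / Z.+1%:R <= K.
  rewrite ler_pdivrMr ?ltr0n//; apply: le_trans (P Z _) _; first by rewrite YZ leqnn.
  by rewrite ler_wpM2l// ler_nat.
have h2 : \sum_(Y.+1 <= j < Z.+1) (\sum_(Y.+1 <= k < j.+1) f k) * (j%:R^-1 - j.+1%:R^-1) <=
    K * (ln Z%:R - ln Y%:R).
  have T : \sum_(Y.+1 <= j < Z.+1) (ln j%:R - ln j.-1%:R) = ln Z%:R - ln Y%:R :> R.
    by rewrite big_add1 /= telescope_sumr.
  rewrite -T mulr_sumr; apply: ler_sum_nat => j /andP[Yj jZ].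
  have j0 : (0 < j)%N by lia.
  have j0' : (0 : R) < j%:R by rewrite ltr0n.
  have j1' : (0 : R) < j.+1%:R by rewrite ltr0n.
  have d0 : 0 <= j%:R^-1 - j.+1%:R^-1 :> R by rewrite subr_ge0 lef_pV2 ?posrE// ler_nat.
  apply: le_trans (ler_wpM2r d0 (P j _)) _; first by rewrite ltnW.
  rewrite -mulrA ler_wpM2l//.
  have jp : (0 < j.-1)%N by lia.
  have := ln_succ_ge R jp; rewrite prednK// => /(le_trans _); apply.
  have -> : j%:R * (j%:R^-1 - j.+1%:R^-1) = j.+1%:R^-1 :> R.
    by move: j1'; rewrite -(natr1 j) => j1'; field; rewrite !gt_eqF.
  by rewrite lef_pV2 ?posrE// ler_nat.
have -> : K * (1 + ln Z%:R - ln Y%:R) = K + K * (ln Z%:R - ln Y%:R) by ring.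
exact: lerD.
Qed.

Section Cmul.
Variable h : nat -> R.

(** The completely multiplicative extension of [h] from the primes. *)
Definition cmul (m : nat) : R := \prod_(1 <= p < m.+1 | prime p) h p ^+ logn p m.

Lemma cmul_widen B m : (0 < m)%N -> (m <= B)%N ->
  \prod_(1 <= p < B.+1 | prime p) h p ^+ logn p m = cmul m.
Proof.
move=> m0 mB; rewrite (@big_cat_nat _ _ _ m.+1) //= [X in _ * X]big_nat_cond [X in _ * X]big1 ?mulr1//.
move=> p /andP[/andP[mp _] pp]; rewrite lognE pp m0.
by case: (boolP (p %| m)%N) => // /(dvdn_leq m0); rewrite leqNgt mp.
Qed.

Lemma cmul1 : cmul 1 = 1.
Proof. by rewrite /cmul big_nat_cond big1// => p _; rewrite logn1. Qed.

Lemma cmulM m n : (0 < m)%N -> (0 < n)%N -> cmul (m * n) = cmul m * cmul n.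
Proof.
move=> m0 n0; rewrite -(@cmul_widen (m * n) m)//; last by rewrite leq_pmulr.
rewrite -(@cmul_widen (m * n) n)//; last by rewrite leq_pmull.
by rewrite /cmul -big_split /=; apply: eq_bigr => p pp; rewrite lognM// exprD.
Qed.

Lemma cmul_prime p : prime p -> cmul p = h p.
Proof.
move=> pp; have p0 := prime_gt0 pp.
rewrite /cmul big_mkcond (bigD1_seq p) /= ?mem_index_iota ?iota_uniq ?p0 ?ltnSn//.
rewrite pp logn_prime// eqxx expr1 big1 ?mulr1// => q /negbTE qp.
by rewrite logn_prime// qp expr0 if_same.
Qed.

Hypothesis h0 : forall p, 0 <= h p.
Lemma cmul_ge0 m : 0 <= cmul m.
Proof. by rewrite /cmul prodr_ge0// => p _; rewrite exprn_ge0. Qed.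
End Cmul.
End Multiplicative.

(** * Sums of two squares and rough character sums *)

Section TwoSquares.

Definition sum2sq (n : nat) := exists x y : int, n%:Z = x ^+ 2 + y ^+ 2.

Lemma sum2sqM m n : sum2sq m -> sum2sq n -> sum2sq (m * n).
Proof.
move=> [x [y e1]] [u [v e2]]; exists (x * u - y * v), (x * v + y * u).
by rewrite PoszM e1 e2; ring.
Qed.

Lemma sum2sq_sqr n : sum2sq (n * n).
Proof. by exists n%:Z, 0; rewrite PoszM; ring. Qed.

Lemma sum2sq1 : sum2sq 1. Proof. exact: (sum2sq_sqr 1). Qed.

Lemma sum2sqX n k : sum2sq n -> sum2sq (n ^ k).
Proof.
move=> h; elim: k => [|k IH]; first exact: sum2sq1.
by rewrite expnS; exact: sum2sqM.
Qed.

(** By Wilson, (p - 1)! = -1. Pairing i with p - i turns (p - 1)! into the square of h!, where h =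
    (p - 1) / 2 is even, so no sign appears. *)
Lemma sqrt_m1 p : prime p -> (p %% 4 = 1)%N -> exists x, (p %| x ^ 2 + 1)%N.
Proof.
move=> pp p4; pose h := (p %/ 4 * 2)%N.
have pE : p = (h + h).+1 by rewrite {1}(divn_eq p 4) p4 /h; lia.
have chp : p \in [pchar 'F_p] by rewrite pchar_Fp.
exists (h`!); rewrite (dvdn_pcharf chp) natrD natrX.
have := Wilson (prime_gt1 pp); rewrite pp => W.
have {W} : (p %| p.-1`!.+1)%N by [].
rewrite -[(p.-1`!).+1]addn1 (dvdn_pcharf chp) natrD.
suff -> : (p.-1`!)%:R = (h`!)%:R ^+ 2 :> 'F_p by [].
have -> : p.-1 = (h + h)%N by lia.
rewrite -(ffact_fact (leq_addr h h)) addnK natrM expr2; congr (_ * _).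
rewrite ffact_prod fact_prod big_add1 /= big_mkord !natr_prod.
transitivity (\prod_(i < h) (- (i.+1%:R : 'F_p))).
  apply: eq_bigr => i _; apply/eqP; rewrite -subr_eq0 opprK -natrD -(dvdn_pcharf chp).
  by have := ltn_ord i => ih; rewrite (_ : (h + h - i + i.+1 = p)%N)//; lia.
rewrite prodrN card_ord -signr_odd (_ : odd h = false) ?expr0 ?mul1r//.
by rewrite /h oddM andbF.
Qed.

Lemma sqr_diff_le (a b k : nat) : (a < k.+1)%N -> (b < k.+1)%N ->
  (a%:Z - b%:Z) ^+ 2 <= k%:Z * k%:Z.
Proof.
rewrite !ltnS -!lez_nat => ak bk.
have : 0 <= a%:Z by [].
have : 0 <= b%:Z by [].
move: a%:Z b%:Z k%:Z ak bk => x y z xz yz y0 x0.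
have : 0 <= (z - (x - y)) * (z + (x - y)) by apply: mulr_ge0; lra.
lra.
Qed.

(** Thue's argument: with k the integer part of sqrt p there are (k + 1)^2 > p pairs (a, b), so two
    of them agree in a + x b modulo p. Their difference (u, w) satisfies u^2 + w^2 = 0 modulo p and
    0 < u^2 + w^2 < 2 p. *)
Lemma prime_sum2sq p : prime p -> (p %% 4 = 1)%N -> sum2sq p.
Proof.
move=> pp p4; have [x px] := sqrt_m1 pp p4.
have p0 := prime_gt0 pp.
have [k /andP[k1 k2]] : exists k, (k * k < p < k.+1 * k.+1)%N.
  have : exists j, (p < j.+1 * j.+1)%N by exists p; nia.
  move=> /ex_minnP [k hk mk]; exists k; rewrite hk andbT.
  have kk : (k * k <= p)%N.
    rewrite leqNgt; apply/negP; case: k hk mk => // k _ mk /mk; lia.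
  rewrite ltn_neqAle kk andbT; apply/eqP => e.
  have kp : (k %| p)%N by rewrite -e dvdn_mulr.
  have [p1 /(_ k kp)] := primeP pp; case/orP => /eqP kE; move: e p1; rewrite kE; nia.
pose f (a : 'I_k.+1 * 'I_k.+1) : 'I_p := Ordinal (ltn_pmod (a.1 + x * a.2) p0).
have : ~~ injectiveb f.
  apply/negP => /injectiveP /leq_card; rewrite card_prod !card_ord; lia.
move=> /injectivePn [[a b] [[c d] ne /(congr1 val) /= /eqP e]].
pose u : int := a%:Z - c%:Z; pose w : int := b%:Z - d%:Z.
have d1 : (p%:Z %| u + x%:Z * w)%Z.
  have -> : u + x%:Z * w = (a + x * b)%N%:Z - (c + x * d)%N%:Z by rewrite !PoszD !PoszM /u /w; ring.
  by rewrite -eqz_mod_dvd; apply/eqP; rewrite !modz_nat; congr Posz; apply/eqP.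
have d2 : (p%:Z %| u ^+ 2 + w ^+ 2)%Z.
  have -> : u ^+ 2 + w ^+ 2 = (u + x%:Z * w) * (u - x%:Z * w) + (x ^ 2 + 1)%N%:Z * w ^+ 2.
    have -> : (x ^ 2 + 1)%N%:Z = x%:Z * x%:Z + 1 by rewrite PoszD -mulnn PoszM.
    by ring.
  by apply: rpredD; apply: dvdz_mulr => //; rewrite dvdzE.
have ub : u ^+ 2 + w ^+ 2 < 2 * p%:Z.
  have := sqr_diff_le (ltn_ord a) (ltn_ord c); have := sqr_diff_le (ltn_ord b) (ltn_ord d).
  rewrite -/u -/w -ltz_nat in k1 *; move: k1 (u ^+ 2) (w ^+ 2); rewrite PoszM.
  by move: (k%:Z * k%:Z) p%:Z => {d1 d2 e f ne px} K P h e1 e2 h1 h2; lra.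
have lb : 0 < u ^+ 2 + w ^+ 2.
  rewrite lt_def addr_ge0 ?sqr_ge0// andbT paddr_eq0 ?sqr_ge0// !sqrf_eq0 /u /w !subr_eq0.
  apply: contra ne => /andP[/eqP [h1] /eqP [h2]].
  by apply/eqP; congr pair; apply/val_inj.
exists u, w; case/dvdzP: d2 => t tE; rewrite tE in ub lb *.
have p0' : 0 < p%:Z by [].
suff -> : t = 1 by rewrite mul1r.
rewrite ltr_pM2r// in ub; rewrite pmulr_lgt0// in lb.
by move: ub lb; case: t {tE} => [[|[|t]]|t].
Qed.

Notation dchi n := (\sum_(1 <= l < n.+1 | (l %| n)%N) chi l).

(** Induction on [e]: the divisors of p^(e+1) k that are multiples of p^(e+1) correspond to the
    divisors of k, and the others are the divisors of p^e k. *)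
Lemma dchi_pow p e k : prime p -> (0 < k)%N -> coprime p k ->
  dchi (p ^ e * k)%N = (\sum_(i < e.+1) chi p ^+ i) * dchi k.
Proof.
move=> pp k0 co; have p0 := prime_gt0 pp.
have chiX i : chi (p ^ i) = chi p ^+ i.
  by elim: i => [|i IH]; rewrite ?expn0 ?expr0// expnS chiM IH exprS.
have pk : ~~ (p %| k)%N by rewrite -prime_coprime.
elim: e => [|e IH]; first by rewrite big_ord1 expr0 mul1r expn0 mul1n.
rewrite big_ord_recr /= mulrDl -IH.
set n := (p ^ e.+1 * k)%N; have n0 : (0 < n)%N by rewrite muln_gt0 expn_gt0 p0.
have q0 : (0 < p ^ e.+1)%N by rewrite expn_gt0 p0.
rewrite (bigID (fun l => (p ^ e.+1 %| l)%N)) /= addrC; congr (_ + _).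
  have le : (p ^ e * k <= n)%N by rewrite /n expnS -mulnA leq_pmull.
  rewrite (eq_bigl (fun l => (l %| p ^ e * k)%N)).
    rewrite [LHS](@big_cat_nat _ _ _ (p ^ e * k).+1) //= [X in _ + X]big_nat_cond.
    rewrite [X in _ + X]big1 ?addr0// => l /andP[/andP[h _] /dvdn_leq].
    by rewrite muln_gt0 expn_gt0 p0 k0 => /(_ isT); rewrite leqNgt h.
  move=> l; apply/andP/idP => [[ln nl]|ld].
    have l0 : (0 < l)%N by apply: dvdn_gt0 ln.
    have le1 : (logn p l <= e)%N.
      by rewrite -ltnS ltnNge; apply: contra nl; rewrite pfactor_dvdn.
    have [q qq lE] := pfactor_coprime pp l0.
    have qk : (q %| k)%N.
      have : (q %| p ^ e.+1 * k)%N by apply: dvdn_trans ln; rewrite lE dvdn_mulr.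
      by rewrite Gauss_dvdr// coprimeXr// coprime_sym.
    by rewrite lE mulnC dvdn_mul// dvdn_exp2l.
  split; first by apply: dvdn_trans ld _; rewrite /n expnS -mulnA dvdn_mull.
  apply/negP => h; have := dvdn_trans h ld; rewrite expnSr dvdn_pmul2l ?expn_gt0 ?p0//.
  exact/negP.
rewrite (eq_bigl (fun l => (p ^ e.+1 %| l)%N && (l %| n)%N)); last by move=> l; rewrite andbC.
rewrite big_mkcondr (sum_dvd (fun l => if (l %| n)%N then chi l else 0))//.
rewrite /n mulKn// mulr_sumr [RHS]big_mkcond; apply: eq_bigr => j _.
rewrite dvdn_pmul2l// chiM chiX.
by case: ifP.
Qed.

(** At a prime p = 3 mod 4 the local factor is 1 - 1 + 1 - ..., which vanishes for an odd exponent.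
    A nonzero divisor sum therefore makes every such prime power a square. *)
Lemma sum2sq_dchi k : odd k -> dchi k != 0 -> sum2sq k.
Proof.
elim/ltn_ind: k => k IH ok; case: (leqP k 1) => k1.
  have -> : k = 1%N by case: k k1 ok {IH} => [|[|]].
  by move=> _; exact: sum2sq1.
have pp := pdiv_prime k1; set p := pdiv k in pp.
have k0 : (0 < k)%N by apply: ltnW.
have [q co kE] := pfactor_coprime pp k0.
have e0 : (0 < logn p k)%N by rewrite logn_gt0 mem_primes pp k0 pdiv_dvd.
set e := logn p k in kE e0.
have q0 : (0 < q)%N by move: k0; rewrite kE; case: (q).
have op : odd p by apply: dvdn_odd (pdiv_dvd k) ok.
have oq : odd q by move: ok; rewrite kE oddM => /andP[].
rewrite {1 2}kE mulnC dchi_pow// mulf_eq0 negb_or => /andP[c1 c2].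
rewrite kE; apply: sum2sqM.
  apply: IH => //; rewrite [X in (_ < X)%N]kE -{1}(muln1 q) ltn_pmul2l//.
  by rewrite -(expn0 p) ltn_exp2l// prime_gt1.
have : (p %% 4 = 1 \/ p %% 4 = 3)%N.
  have := ltn_pmod p (isT : (0 < 4)%N); have : odd (p %% 4) by rewrite (odd_mod p (erefl : odd 4 = false)).
  by move: (p %% 4)%N => [|[|[|[|//]]]] //=; auto.
case=> p4; first by apply: sum2sqX; exact: prime_sum2sq.
move: c1; rewrite (_ : chi p = -1); last by rewrite /chi p4.
have S i : \sum_(j < i) (-1 : int) ^+ j = (odd i)%:R.
  elim: i => [|i IHi]; first by rewrite big_ord0.
  by rewrite big_ord_recr /= IHi -signr_odd; case: (odd i).
rewrite S /= ; case: (boolP (odd e)) => //= oe _.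
have -> : e = (e./2 + e./2)%N by rewrite addnn even_halfK.
by rewrite expnD; exact: sum2sq_sqr.
Qed.

Lemma sum2sq_1mod4 a : (0 < a)%N -> (forall p, prime p -> (p %| a)%N -> (p %% 4 != 3)%N) -> sum2sq a.
Proof.
elim/ltn_ind: a => a IH a0 H; case: (leqP a 1) => a1.
  have -> : a = 1%N by lia.
  exact: sum2sq1.
have pp := pdiv_prime a1; set p := pdiv a in pp.
have pa : (p %| a)%N := pdiv_dvd a.
rewrite -(divnK pa); apply: sum2sqM.
  apply: IH; rewrite ?divn_gt0 ?prime_gt0//.
  - by rewrite ltn_Pdiv// prime_gt1.
  - exact: dvdn_leq.
  - by move=> q pq qa; apply: H => //; apply: dvdn_trans qa _; apply: dvdn_div.
case: (even_prime pp) => [->|op]; first by exists 1, 1.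
apply: prime_sum2sq => //; have := H p pp pa.
have := ltn_pmod p (isT : (0 < 4)%N); have : odd (p %% 4) by rewrite (odd_mod p (erefl : odd 4 = false)).
by move: (p %% 4)%N => [|[|[|[|//]]]].
Qed.

Lemma chi_sign l : odd l -> chi l = 1 \/ chi l = -1.
Proof.
move=> ol; rewrite /chi; have := ltn_pmod l (isT : (0 < 4)%N).
have : odd (l %% 4) by rewrite (odd_mod l (erefl : odd 4 = false)).
by move: (l %% 4)%N => [|[|[|[|//]]]] //=; auto.
Qed.

(* The involution l |-> k / l preserves chi, so the divisors below sqrt k already sum to 0. *)
Lemma dchi_flip k Y : odd k -> chi k = 1 -> dchi k = 0 -> (Y * Y < k)%N ->
  \sum_(1 <= l < Y.+1 | (l %| k)%N) chi l =
  - \sum_(1 <= l < k.+1 | [&& (l %| k)%N, (Y < l)%N & (l * l < k)%N]) chi l.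
Proof.
move=> ok ck dk Yk; have k0 : (0 < k)%N by case: k ok {ck dk Yk}.
pose A := \sum_(1 <= l < k.+1 | (l %| k)%N && (l * l < k)%N) chi l.
pose S := \sum_(1 <= l < k.+1 | (l %| k)%N && (l * l == k)%N) chi l.
have inv : \sum_(1 <= l < k.+1 | (l %| k)%N && (k < l * l)%N) chi l = A.
  have pe : perm_eq [seq l <- index_iota 1 k.+1 | (l %| k)%N && (k < l * l)%N]
      [seq (k %/ l)%N | l <- [seq l <- index_iota 1 k.+1 | (l %| k)%N && (l * l < k)%N]].
    apply: uniq_perm; first by rewrite filter_uniq// iota_uniq.
      rewrite map_inj_in_uniq ?filter_uniq ?iota_uniq// => x y.
      rewrite !mem_filter => /andP[/andP[xk _] _] /andP[/andP[yk _] _] e.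
      have := divnK xk; rewrite e => e1; have := divnK yk => e2.
      by have := divn_gt0 k (dvdn_gt0 k0 yk); rewrite (dvdn_leq k0 yk); nia.
    move=> x; rewrite mem_filter mem_index_iota; apply/idP/mapP.
      move=> /andP[/andP[xk kx] /andP[x0 _]]; have e := divnK xk.
      exists (k %/ x)%N; last by rewrite divnA// mulKn.
      rewrite mem_filter mem_index_iota ltnS leq_div dvdn_div//= divn_gt0// (dvdn_leq k0 xk) !andbT.
      by move: e; set q := (k %/ x)%N; nia.
    move=> [l]; rewrite mem_filter mem_index_iota => /andP[/andP[lk ll] /andP[l0 _]] ->.
    have e := divnK lk; rewrite ltnS leq_div dvdn_div//= divn_gt0// (dvdn_leq k0 lk) !andbT.
    by move: e; set q := (k %/ l)%N; nia.
  rewrite -big_filter (perm_big _ pe) big_map big_filter; apply: eq_bigr => l /andP[lk _].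
  have ol : odd l := dvdn_odd lk ok.
  have := chi_sqr ol; have := chiM (k %/ l) l; rewrite divnK// ck.
  by case: (chi_sign ol) => ->; lia.
(* The total is [A + S + A], where [S] is the term of l = sqrt k, if there is one, and thus -1, 0 or
   1. As the total is 0, parity forces [S] and [A] to vanish. *)
have A0 : A = 0.
  have : dchi k = A + S + A.
    rewrite (bigID (fun l => (l * l < k)%N)) /= -addrA; congr (_ + _).
    rewrite (bigID (fun l => (l * l == k)%N)) /=; congr (_ + _).
      by apply: eq_bigl => l; case: (l %| k)%N => //=; case: eqP => [->|]; rewrite ?ltnn ?andbF.
    by rewrite -inv; apply: eq_bigl => l; case: (l %| k)%N => //=; case: ltngtP.
  rewrite dk; have : S = 0 \/ S = 1 \/ S = -1.
    have [r hr] : exists r, (r * r <= k < r.+1 * r.+1)%N.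
      have : exists j, (k < j.+1 * j.+1)%N by exists k; nia.
      move=> /ex_minnP [r hr mr]; exists r; rewrite hr andbT.
      by rewrite leqNgt; apply/negP; case: r hr mr => // r _ mr /mr; lia.
    case: (boolP (r * r == k)%N) => [/eqP rk|rk].
      have r0 : (0 < r)%N by case: (r) rk k0 => // <-.
      have -> : S = chi r.
        rewrite /S big_mkcond (bigD1_seq r) /= ?mem_index_iota ?iota_uniq ?r0 ?ltnS ?(leq_trans _ (proj1 (andP hr))) ?leq_pmulr//.
        rewrite -{1}rk dvdn_mulr// rk eqxx big1 ?addr0// => l lr.
        case: eqP => [ll|]; last by rewrite andbF.
        by exfalso; move/eqP: lr; apply; nia.
      have orr : odd r by move: ok; rewrite -rk oddM andbb.
      by case: (chi_sign orr) => ->; auto.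
    left; rewrite /S big1// => l /andP[_ /eqP ll]; exfalso; move/eqP: rk; apply.
    by rewrite -ll; have -> : r = l by nia.
  lia.
have Yk' : (Y <= k)%N by nia.
have S1 : A = \sum_(1 <= l < Y.+1 | (l %| k)%N) chi l +
    \sum_(1 <= l < k.+1 | [&& (l %| k)%N, (Y < l)%N & (l * l < k)%N]) chi l.
  rewrite /A (bigID (fun l => (l <= Y)%N)) /=; congr (_ + _).
    rewrite [LHS](@big_cat_nat _ _ _ Y.+1) //= [X in _ + X = _]big_nat_cond.
    rewrite [X in _ + X = _]big1 ?addr0; last by move=> l /andP[/andP[h _] /andP[_ h2]]; lia.
    rewrite big_nat_cond [RHS]big_nat_cond; apply: eq_bigl => l.
    case: (boolP (1 <= l < Y.+1)%N) => //= /andP[l1 lY]; have lY' : (l <= Y)%N by rewrite -ltnS.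
    rewrite lY' andbT.
    rewrite (_ : (l * l < k)%N) ?andbT//; apply: leq_ltn_trans Yk; exact: leq_mul.
  by apply: eq_bigl => l; rewrite -ltnNge -andbA; congr (_ && _); rewrite andbC.
by move: S1; rewrite A0 => /esym /eqP; rewrite addr_eq0 => /eqP.
Qed.
End TwoSquares.

(** * Prime products and character sums over rough integers *)

Section Consequences.
Variable R : realType.
Notation chir n := ((chi n)%:~R : R).

Lemma sum_prime_inv : exists2 C : R, 0 <= C & forall y, (1 < y)%N ->
  `|\sum_(1 <= p < y.+1 | prime p) p%:R^-1 - ln (ln y%:R)| <= C.
Proof.
have [C C0 HC] := mertens2 R; exists (1 / 2 + `|ln (ln 2)| + C / ln 2) => [|y y1].
  by rewrite !addr_ge0// divr_ge0// (le_trans _ (ln2_ge R)).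
have -> : \sum_(1 <= p < y.+1 | prime p) p%:R^-1 = 2^-1 + \sum_(3 <= p < y.+1 | prime p) p%:R^-1 :> R.
  rewrite (@big_cat_nat _ _ _ 3) //=; congr (_ + _).
  by rewrite big_mkcond (big_ltn (isT : (1 < 3)%N)) (big_ltn (isT : (2 < 3)%N)) big_geq//= add0r addr0.
have := HC 2%N y isT y1.
set S := \sum_(_ <= _ < _ | _) _; move: (ln (ln y%:R)) (ln (ln 2)) (C / ln 2) => a b c.
have := ler_norm b; have := ler_norm (- b); rewrite normrN => h1 h2.
by rewrite !ler_norml => /andP[h3 h4]; apply/andP; split; lra.
Qed.

Lemma sum_prime_between : exists2 C : R, 0 <= C & forall y x, (1 < y)%N -> (y <= x)%N ->
  \sum_(y.+1 <= p < x.+1 | prime p) p%:R^-1 <= ln (ln x%:R) - ln (ln y%:R) + C.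
Proof.
have [C C0 HC] := mertens2 R; exists (2 * C) => [|y x y1 yx]; first lra.
have := HC y x y1 yx; rewrite ler_norml => /andP[_ h].
have l := ln_nat_half R y1; have : C / ln y%:R <= 2 * C; last lra.
by rewrite ler_pdivrMr; [nra|lra].
Qed.

Lemma chi3 p : (p %% 4 == 3)%N -> chir p = -1.
Proof. by rewrite /chi => /eqP ->; rewrite rmorphN. Qed.

(** The sum of chi(p) / p is bounded, so the classes 1 and 3 each carry half of ln ln y. *)
Lemma sum_prime_mod4 : exists2 C : R, 0 <= C & forall y, (1 < y)%N ->
  \sum_(1 <= p < y.+1 | prime p && (p %% 4 != 3)%N) p%:R^-1 <= ln (ln y%:R) / 2 + C /\
  \sum_(1 <= p < y.+1 | prime p && (p %% 4 == 3)%N) p%:R^-1 <= ln (ln y%:R) / 2 + C.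
Proof.
have [C1 C10 H1] := sum_prime_inv; have [C2 C20 H2] := chi_mertens R.
exists (C1 + C2 + 1) => [|y y1]; first lra.
have := H1 y y1; have := H2 y; rewrite !ler_norml => /andP[a1 a2] /andP[a3 a4].
split.
  apply: (@le_trans _ _ (\sum_(1 <= p < y.+1 | prime p) ((p%:R^-1 + chir p / p%:R) / 2 + (p == 2%N)%:R / 4))).
    rewrite big_mkcondr; apply: ler_sum => p pp.
    have p0 : 0 <= p%:R^-1 :> R by rewrite invr_ge0.
    case: ifP => p3.
      case: (even_prime pp) => [->|op]; first by rewrite eqxx /chi /= mul0r; lra.
      have -> : chir p = 1.
        rewrite /chi; have := ltn_pmod p (isT : (0 < 4)%N).
        have : odd (p %% 4) by rewrite (odd_mod p (erefl : odd 4 = false)).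
        by move: (p %% 4)%N p3 => [|[|[|[|//]]]].
      have : 0 <= (p == 2%N)%:R / 4 :> R by rewrite divr_ge0.
      by rewrite mul1r; lra.
    rewrite chi3; last by move/negbT: p3; rewrite negbK.
    by rewrite mulN1r subrr mul0r add0r divr_ge0.
  rewrite big_split /= -mulr_suml big_split /=.
  have : \sum_(1 <= p < y.+1 | prime p) (p == 2%N)%:R / 4 <= 1 / 4 :> R.
    rewrite -mulr_suml ler_wpM2r// big_mkcond.
    rewrite (bigD1_seq 2%N) /= ?mem_index_iota ?iota_uniq//.
    rewrite big1 ?addr0 ?eqxx// => q /negbTE ->; by rewrite if_same.
  by move: (\sum_(_ <= _ < _ | _) (_ == 2%N)%:R / 4) => Z; lra.
apply: (@le_trans _ _ (\sum_(1 <= p < y.+1 | prime p) ((p%:R^-1 - chir p / p%:R) / 2))).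
  rewrite big_mkcondr; apply: ler_sum => p pp.
  have p0 : 0 <= p%:R^-1 :> R by rewrite invr_ge0.
  case: ifP => p3; first by rewrite chi3// mulN1r opprK; lra.
  have := chi_norm R p; rewrite ler_norml => /andP[_ h].
  by have := ler_wpM2r p0 h; lra.
by rewrite -mulr_suml sumrB; lra.
Qed.

Lemma sum_sprimes pr y (F : nat -> R) :
  \sum_(p <- sprimes pr y) F p = \sum_(1 <= p < y.+1 | prime p && ((2 < p)%N && pr p)) F p.
Proof. by rewrite big_filter -[iota 0 y.+1]/(index_iota 0 y.+1) big_ltn_cond. Qed.

Lemma one_sub_ge_exp2 (x : R) : x <= 3 / 4 -> expR (- (x + 4 * x ^+ 2)) <= 1 - x.
Proof.
move=> x1; rewrite expRN; have := expR_ge1Dx (x + 4 * x ^+ 2); set e := expR _ => h.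
have e0 : 0 < e by exact: expR_gt0.
rewrite -(ler_pM2r e0) mulVf ?gt_eqF//.
have h2 : (1 - x) * (1 + (x + 4 * x ^+ 2)) <= (1 - x) * e by apply: ler_wpM2l => //; lra.
apply: le_trans h2; have : 0 <= x ^+ 2 * (3 - 4 * x) by rewrite mulr_ge0 ?sqr_ge0//; lra.
lra.
Qed.

Lemma prod_sprimes_ge pr y (g : nat -> R) : (forall p, p \in sprimes pr y -> `|g p| <= p%:R^-1) ->
  expR (- (\sum_(p <- sprimes pr y) g p + 16)) <= \prod_(p <- sprimes pr y) (1 - g p).
Proof.
move=> Hg; apply: (@le_trans _ _ (\prod_(p <- sprimes pr y) expR (- (g p + 4 * g p ^+ 2)))); last first.
  rewrite big_seq [leRHS]big_seq; apply: ler_prod => p pps; rewrite expR_ge0 one_sub_ge_exp2//.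
  have := Hg p pps; rewrite ler_norml => /andP[_ h]; apply: (le_trans h).
  move: pps; rewrite mem_sprimes => /and4P[_ p2 _ _].
  have : (3 : R) <= p%:R by rewrite ler_nat.
  move=> p3; rewrite -[leLHS]div1r ler_pdivrMr; lra.
rewrite -expR_sum ler_expR sumrN lerN2 big_split /= lerD2l.
apply: le_trans (_ : 4 * 4 <= _); last lra.
rewrite -mulr_sumr ler_wpM2l//; apply: le_trans (sum_prime_inv_sq R y).
apply: (@le_trans _ _ (\sum_(p <- sprimes pr y) (p%:R ^+ 2)^-1)).
  rewrite big_seq [leRHS]big_seq; apply: ler_sum => p /Hg h.
  by rewrite -exprVn -real_normK ?num_real// lerXn2r ?nnegrE// invr_ge0.
rewrite sum_sprimes big_mkcondr; apply: ler_sum => p pp.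
by case: ifP => // _; rewrite invr_ge0 exprn_ge0.
Qed.

Lemma prod_ind (s : seq nat) (b : nat -> bool) :
  \prod_(p <- s) (1 - (b p)%:R) = (all (fun p => ~~ b p) s)%:R :> R.
Proof.
elim: s => [|p s IH]; first by rewrite big_nil.
by rewrite big_cons IH /=; case: (b p); rewrite ?subrr ?mul0r ?subr0 ?mul1r.
Qed.

(** A [nat_pred], so that [(rgh y).-nat n] says that n is y-rough and the library's notion of part
    gives rough and smooth parts. *)
Definition rgh (y : nat) : nat_pred := [pred p | (y < p)%N].

Lemma rgh_all y n : (0 < n)%N -> odd n -> all (fun p => ~~ (p %| n)%N) (sprimes predT y) = (rgh y).-nat n.
Proof.
move=> n0 on; rewrite /pnat n0 /=; apply/allP/allP => [H p|H p].
  rewrite mem_primes => /and3P[pp _ pn]; rewrite inE ltnNge; apply/negP => py.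
  have p2 : (2 < p)%N by rewrite odd_prime_gt2// (dvdn_odd pn).
  by have := H p; rewrite mem_sprimes pp p2 py pn => /(_ isT).
rewrite mem_sprimes => /and4P[pp p2 py _]; apply/negP => pn.
have := H p; rewrite mem_primes pp n0 pn => /(_ isT).
by rewrite inE ltnNge py.
Qed.

Definition achi y t : R := \sum_(1 <= l < t.+1 | (rgh y).-nat l) chir l.

Definition wodd y : R := \prod_(p <- sprimes predT y) (1 - p%:R^-1).

Lemma wodd_le : exists2 C : R, 0 <= C & forall y, (1 < y)%N -> 0 <= wodd y <= C / ln y%:R.
Proof.
have [C C0 HC] := sum_prime_inv; exists (expR (C + 1)) => [|y y1]; first exact: expR_ge0.
have l0 := ln_gt0_nat R y1.
have p1 p : p \in sprimes predT y -> 0 <= 1 - p%:R^-1 :> R.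
  rewrite mem_sprimes => /and4P[_ p2 _ _]; rewrite subr_ge0 invf_le1 ?ler1n ?ltr0n; lia.
apply/andP; split; first by rewrite /wodd big_seq prodr_ge0.
apply: (@le_trans _ _ (expR (- (\sum_(p <- sprimes predT y) p%:R^-1)))).
  rewrite -sumrN expR_sum /wodd big_seq [leRHS]big_seq; apply: ler_prod => p /p1 ->/=.
  exact: expR_ge1Dx.
rewrite ler_pdivlMr// -{1}(lnK (l0 : ln y%:R \is Num.pos)) -expRD ler_expR.
have := HC y y1; rewrite ler_norml => /andP[h _].
have : \sum_(1 <= p < y.+1 | prime p) p%:R^-1 <= \sum_(p <- sprimes predT y) p%:R^-1 + 1 / 2 :> R; last first.
  by move: (ln (ln _)) h => a h; lra.
rewrite sum_sprimes (bigID (fun p => (2 < p)%N)) /=; apply: lerD.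
  by apply: le_of_eq; apply: eq_bigl => p; rewrite andbT.
apply: (@le_trans _ _ (\sum_(1 <= p < y.+1) (p == 2%N)%:R / 2)).
  rewrite big_mkcond; apply: ler_sum => p _; case: ifP => [/andP[/prime_gt1 a b]|_].
    have -> : p = 2%N by lia.
    by rewrite eqxx /=; lra.
  by rewrite divr_ge0.
rewrite -mulr_suml ler_wpM2r//.
rewrite (bigD1_seq 2%N) /= ?mem_index_iota ?iota_uniq//.
by rewrite big1 ?addr0 ?eqxx// => q /negbTE ->.
Qed.

(** The classes 1 and 3 modulo 4 are sieved separately. Their main terms are equal and cancel, which
    leaves only the two sieve errors, a factor 16^(-D) below the trivial size t / ln y. *)
Lemma achi_le : exists2 C : R, 0 <= C & forall D y t, (1 < y)%N ->
  `|achi y t| <= C * t%:R / (ln y%:R * 16 ^+ D) + 2 * y%:R ^+ (16 * D + 25).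
Proof.
have [C1 C10 H1] := fundamental_lemma R; have [C2 C20 H2] := wodd_le.
exists (C1 * C2) => [|D y t y1]; first exact: mulr_ge0.
pose E (p n : nat) := (n == 0 %[mod p])%N.
pose F c (n : nat) := (n == c %[mod 4])%N.
pose S c : R := \sum_(n <- index_iota 1 (1 + t)) (F c n)%:R * \prod_(p <- sprimes predT y) (1 - (E p n)%:R).
have HS c : `|S c - t%:R / 4 * wodd y| <= t%:R / 4 * wodd y * (C1 / 16 ^+ D) + y%:R ^+ (16 * D + 25).
  have pc p : p \in sprimes predT y -> prime p /\ coprime p 4.
    rewrite mem_sprimes => /and4P[pp p2 _ _]; split => //.
    rewrite (_ : 4 = 2 ^ 2)%N// coprimeXr// coprimen2.
    by case: (even_prime pp) p2 => [->|].
  have c4 : cnt (F c) 0 4 = 1%N by apply: cnt_residue.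
  have Ap := @approx_periodic R 4 (F c) (sprimes predT y) E 1 t isT (nper_residue 4 c) pc (fun p _ => nper_residue p 0).
  have cp p : p \in sprimes predT y -> cnt (E p) 0 p = 1%N.
    by rewrite mem_sprimes => /and4P[pp _ _ _]; apply: cnt_residue; exact: prime_gt0.
  rewrite c4 mulr1 in Ap.
  have tA0 : 0 <= t%:R / 4 :> R by rewrite divr_ge0.
  have Hr p : p \in sprimes predT y -> 0 <= ((cnt (E p) 0 p)%:R : R) <= 2 /\
     (cnt (E p) 0 p)%:R / p%:R = (cnt (E p) 0 p)%:R / p%:R :> R.
    by move=> /cp ->; split => //; rewrite ler0n ler_nat.
  have := H1 D y predT _ _ E _ _ _ _ (fun n => ler0n R (F c n)) tA0 ler01 y1 Hr Ap.
  have -> : \prod_(p <- sprimes predT y) (1 - (cnt (E p) 0 p)%:R / p%:R) = wodd y.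
    by apply: eq_big_seq => p /cp ->; rewrite div1r.
  by rewrite mul1r.
have -> : achi y t = S 1%N - S 3%N.
  rewrite /S -sumrB /achi big_mkcond [LHS]big_nat [RHS]big_nat add1n; apply: eq_bigr => n /andP[n1 _].
  rewrite -mulrBl; have -> : chir n = (F 1%N n)%:R - (F 3%N n)%:R.
    rewrite /F /chi (modn_small (isT : (1 < 4)%N)) (modn_small (isT : (3 < 4)%N)).
    by move: (n %% 4)%N => [|[|[|[|k]]]] /=; rewrite ?rmorphN ?subr0 ?sub0r ?subrr.
  case: (boolP (odd n)) => on.
    rewrite prod_ind (eq_all (a2 := fun p => ~~ (p %| n)%N)); last by move=> p; rewrite /E mod0n.
    by rewrite rgh_all//; case: ifP; rewrite ?mulr1 ?mulr0.
  have e c : odd c -> F c n = false.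
    move=> oc; apply/negP => /eqP h; move: on; rewrite -(odd_mod n (erefl : odd 4 = false)) h.
    by rewrite (odd_mod c (erefl : odd 4 = false)) oc.
  by rewrite !e// subrr mul0r if_same.
have /andP[w0 w1] := H2 y y1.
have := HS 1%N; have := HS 3%N; rewrite !ler_norml => /andP[a1 a2] /andP[a3 a4].
have l0 := ln_gt0_nat R y1.
have p16 : 0 < 16 ^+ D :> R by rewrite exprn_gt0.
have k : t%:R / 4 * wodd y * (C1 / 16 ^+ D) <= C1 * C2 * t%:R / (ln y%:R * 16 ^+ D) / 4.
  have -> : C1 * C2 * t%:R / (ln y%:R * 16 ^+ D) / 4 = t%:R / 4 * (C2 / ln y%:R) * (C1 / 16 ^+ D).
    by field; rewrite !gt_eqF.
  by rewrite ler_wpM2r ?divr_ge0 ?(ltW p16)// ler_wpM2l ?divr_ge0.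
have k0 : 0 <= C1 * C2 * t%:R / (ln y%:R * 16 ^+ D) by rewrite divr_ge0 ?mulr_ge0// ?(ltW l0) ?(ltW p16).
move: k0 k a1 a2 a3 a4; move: (t%:R / 4 * wodd y * (C1 / 16 ^+ D)) (_ / (ln y%:R * 16 ^+ D)) => a b k0 k a1 a2 a3 a4.
by apply/andP; split; lra.
Qed.

Lemma leq_double_div p t : (0 < p)%N -> (p <= t)%N -> (t <= 2 * p * (t %/ p))%N.
Proof.
move=> p0 pt; have q0 : (0 < t %/ p)%N by rewrite divn_gt0.
have := ltn_ceil t p0; have := leq_pmull p q0; rewrite mulSn -mulnA [(p * _)%N]mulnC.
by move: (_ * p)%N => w; lia.
Qed.

Definition echi y Y : R := \sum_(1 <= l < Y.+1 | (rgh y).-nat l) chir l / l%:R.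

(** Imposing coprimality to one more prime p subtracts chi(p) / p times the same sum of length t /
    p. [K] depends on [s] without control: only the limit as t grows is wanted. *)
Lemma chisum_sieve (L : R) (s : seq nat) : (forall n, `|chisum R n - L| <= n.+1%:R^-1) ->
  uniq s -> all prime s -> exists2 K : R, 0 <= K & forall t, (0 < t)%N ->
  `|\sum_(1 <= l < t.+1 | all (fun p => ~~ (p %| l)%N) s) chir l / l%:R -
    L * \prod_(p <- s) (1 - chir p / p%:R)| <= K / t%:R.
Proof.
move=> HL; elim: s => [|p s IH] /=.
  move=> _ _; exists 1 => // t t0; rewrite big_nil mulr1.
  apply: le_trans (HL t) _; rewrite div1r lef_pV2 ?posrE ?ltr0n// ler_nat//.
move=> /andP[ps us] /andP[pp as_]; have [K K0 HK] := IH us as_.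
have p0 := prime_gt0 pp.
have p0' : (0 : R) < p%:R by rewrite ltr0n.
exists (3 * K + `|L * \prod_(q <- s) (1 - chir q / q%:R)|) => [|t t0].
  by rewrite addr_ge0// mulr_ge0.
set D := fun t => \sum_(1 <= l < t.+1 | all (fun q => ~~ (q %| l)%N) s) chir l / l%:R.
have co j : all (fun q => ~~ (q %| p * j)%N) s = all (fun q => ~~ (q %| j)%N) s.
  apply: eq_in_all => q qs; rewrite Euclid_dvdM; last exact: (allP as_).
  rewrite dvdn_prime2//; last exact: (allP as_).
  by case: eqP => // qp; move: ps; rewrite -qp qs.
have E : \sum_(1 <= l < t.+1 | ~~ (p %| l)%N && all (fun q => ~~ (q %| l)%N) s) chir l / l%:R =
    D t - chir p / p%:R * D (t %/ p)%N.
  rewrite /D [X in _ = X - _](bigID (fun l => (p %| l)%N)) /=.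
  rewrite (eq_bigl (fun l => all (fun q => ~~ (q %| l)%N) s && ~~ (p %| l)%N)); last by move=> l; rewrite andbC.
  rewrite [X in _ = X + _ - _](_ : _ = chir p / p%:R * \sum_(1 <= l < (t %/ p).+1 | all (fun q => ~~ (q %| l)%N) s) chir l / l%:R); first by rewrite addrAC subrr add0r.
  rewrite (eq_bigl (fun l => (p %| l)%N && all (fun q => ~~ (q %| l)%N) s)); last by move=> l; rewrite andbC.
  rewrite big_mkcondr (sum_dvd (fun l => if all (fun q => ~~ (q %| l)%N) s then chir l / l%:R else 0))//.
  rewrite mulr_sumr [RHS]big_mkcond; apply: eq_big_nat => j /andP[j0 _].
  rewrite co; case: ifP => // _; rewrite chiM rmorphM natrM invfM; ring.
rewrite E big_cons.
set P := \prod_(q <- s) _.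
have -> : D t - chir p / p%:R * D (t %/ p)%N - L * ((1 - chir p / p%:R) * P) =
  (D t - L * P) - chir p / p%:R * (D (t %/ p)%N - L * P) by ring.
have t0' : (0 : R) < t%:R by rewrite ltr0n.
have b1 : `|chir p / p%:R| <= p%:R^-1.
  by rewrite normrM [`|p%:R^-1|]ger0_norm ?invr_ge0// -[leRHS]mul1r ler_wpM2r ?invr_ge0// chi_norm.
apply: le_trans (ler_normB _ _) _; rewrite normrM.
have h1 := HK t t0.
have h2 : `|chir p / p%:R| * `|D (t %/ p)%N - L * P| <= (2 * K + `|L * P|) / t%:R.
  case: (leqP p t) => pt.
    have q0 : (0 < t %/ p)%N by rewrite divn_gt0.
    have q0' : (0 : R) < (t %/ p)%:R by rewrite ltr0n.
    apply: (@le_trans _ _ (p%:R^-1 * (K / (t %/ p)%:R))); first by rewrite ler_pM// HK.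
    have tq : t%:R <= 2 * p%:R * (t %/ p)%:R :> R.
      by rewrite -!natrM ler_nat; exact: leq_double_div.
    apply: (@le_trans _ _ (2 * K / t%:R)).
      rewrite mulrCA -invfM ler_pdivlMr// mulrAC ler_pdivrMr ?mulr_gt0//.
      by have := ler_wpM2l K0 tq; lra.
    by rewrite ler_wpM2r ?invr_ge0 ?lerDl// ltW.
  rewrite divn_small// /D big_geq// sub0r normrN.
  apply: (@le_trans _ _ (p%:R^-1 * `|L * P|)); first by rewrite ler_wpM2r.
  rewrite mulrC; apply: ler_pM; rewrite ?invr_ge0 ?(ltW p0')//.
    by rewrite lerDr mulr_ge0.
  by rewrite lef_pV2 ?posrE// ler_nat ltnW.
apply: le_trans (lerD h1 h2) _; rewrite -mulrDl ler_wpM2r ?invr_ge0 ?(ltW t0')//.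
rewrite -/P; lra.
Qed.

Lemma mul_pow16_le y q : (1 < y)%N -> (0 < q)%N -> y%:R * 16 ^+ q <= y%:R ^+ (23 * q) :> R.
Proof.
move=> y1 q0; apply: (@le_trans _ _ (y%:R ^+ (4 * q).+1)).
  rewrite exprS exprM ler_wpM2l// lerXn2r ?nnegrE ?exprn_ge0//.
  have -> : 16 = 2 ^+ 4 :> R by ring.
  by rewrite lerXn2r ?nnegrE// ler_nat.
rewrite -!natrX ler_nat leq_exp2l//; lia.
Qed.

(** Partial summation from [achi_le] at depth [q]. The range has length at most 64 ln y on the
    logarithmic scale, which is balanced by the density 1 / ln y of rough integers. *)
Lemma echi_block : exists2 C : R, 0 <= C & forall q y Y Z, (1 < y)%N -> (0 < q)%N ->
  (y ^ (64 * q) <= Y)%N -> (Y <= Z)%N -> (Z <= y ^ (64 * q.+1))%N -> `|echi y Z - echi y Y| <= C / 16 ^+ q.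
Proof.
have [C C0 HC] := achi_le; exists (2 * (130 * C + 300)) => [|q y Y Z y1 q0 yY YZ Zy]; first lra.
have y0 : (0 < y)%N by lia.
have Y0 : (0 < Y)%N by apply: leq_trans yY; rewrite expn_gt0 y0.
have Y0' : (0 : R) < Y%:R by rewrite ltr0n.
have l0 := ln_gt0_nat R y1; have lh := ln_nat_half R y1.
have p16 : 0 < 16 ^+ q :> R by rewrite exprn_gt0.
pose b : R := C / (ln y%:R * 16 ^+ q) + 2 / y%:R ^+ (23 * q).
have y0' : (0 : R) < y%:R by rewrite ltr0n.
have b0 : 0 <= b by rewrite addr_ge0// divr_ge0 ?mulr_ge0 ?exprn_ge0// ltW.
(* 64 = 16 + 25 + 23: for t >= y^(64 q) with q >= 1 the remainder y^(16 q + 25) is at most t / y^(23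
   q). *)
have A t : (Y <= t)%N -> `|achi y t| <= b * t%:R.
  move=> Yt; apply: le_trans (HC q y t y1) _.
  have -> : b * t%:R = C * t%:R / (ln y%:R * 16 ^+ q) + 2 * (t%:R / y%:R ^+ (23 * q)) by rewrite /b; ring.
  rewrite lerD2l ler_wpM2l// ler_pdivlMr ?exprn_gt0// -exprD -natrX ler_nat.
  apply: leq_trans (leq_trans yY Yt); rewrite leq_exp2l//; lia.
have E : echi y Z - echi y Y = \sum_(Y.+1 <= l < Z.+1) (if (rgh y).-nat l then chir l else 0) * l%:R^-1.
  rewrite /echi (@big_cat_nat _ _ _ Y.+1) //= addrAC subrr add0r big_mkcond.
  by apply: eq_bigr => l _; case: ifP; rewrite ?mul0r.
rewrite E sum_abel//.
have P j : (Y <= j)%N -> `|\sum_(Y.+1 <= k < j.+1) (if (rgh y).-nat k then chir k else 0)| <= 2 * b * j%:R.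
  move=> Yj; rewrite -big_mkcond.
  have -> : \sum_(Y.+1 <= k < j.+1 | (rgh y).-nat k) chir k = achi y j - achi y Y.
    by rewrite /achi [X in _ = X - _](@big_cat_nat _ _ _ Y.+1) //= addrAC subrr add0r.
  apply: le_trans (ler_normB _ _) _; have h1 := A j Yj; have h2 := A Y (leqnn _).
  have : b * Y%:R <= b * j%:R by rewrite ler_wpM2l// ler_nat.
  lra.
apply: le_trans (ler_normD _ _) _.
have h1 : `|(\sum_(Y.+1 <= k < Z.+1) (if (rgh y).-nat k then chir k else 0)) * Z.+1%:R^-1| <= 2 * b.
  rewrite normrM [`|Z.+1%:R^-1|]ger0_norm ?invr_ge0// ler_pdivrMr ?ltr0n//.
  apply: le_trans (P Z YZ) _; rewrite ler_wpM2l ?ler_nat// mulr_ge0//.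
have h2 : `|\sum_(Y.+1 <= j < Z.+1) (\sum_(Y.+1 <= k < j.+1) (if (rgh y).-nat k then chir k else 0)) * (j%:R^-1 - j.+1%:R^-1)| <=
   2 * b * (64 * ln y%:R).
  apply: le_trans (ler_norm_sum _ _ _) _.
  apply: (@le_trans _ _ (2 * b * (ln Z%:R - ln Y%:R))).
    have T : \sum_(Y.+1 <= j < Z.+1) (ln j%:R - ln j.-1%:R) = ln Z%:R - ln Y%:R :> R.
      by rewrite big_add1 /= telescope_sumr.
    rewrite -T mulr_sumr; apply: ler_sum_nat => j /andP[Yj jZ].
    have j0 : (0 < j)%N by lia.
    have j0' : (0 : R) < j%:R by rewrite ltr0n.
    have j1' : (0 : R) < j.+1%:R by rewrite ltr0n.
    have d0 : 0 <= j%:R^-1 - j.+1%:R^-1 :> R by rewrite subr_ge0 lef_pV2 ?posrE// ler_nat.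
    rewrite normrM (ger0_norm d0).
    apply: le_trans (ler_wpM2r d0 (P j (ltnW Yj))) _.
    rewrite -[leLHS]mulrA; apply: ler_wpM2l; first by rewrite mulr_ge0.
    have jp : (0 < j.-1)%N by case: (j) Yj => [|[|i]] //; case: (Y) Y0.
    have := ln_succ_ge R jp; rewrite prednK// => /(le_trans _); apply.
    have -> : j%:R * (j%:R^-1 - j.+1%:R^-1) = j.+1%:R^-1 :> R.
      by move: j1'; rewrite -(natr1 j) => j1'; field; rewrite !gt_eqF.
    by rewrite lef_pV2 ?posrE// ler_nat.
  rewrite ler_wpM2l ?mulr_ge0//.
  have z1 : ln Z%:R <= ln (y ^ (64 * q.+1))%:R :> R by apply: ler_ln_nat => //; lia.
  have z2 : ln (y ^ (64 * q))%:R <= ln Y%:R :> R by apply: ler_ln_nat => //; rewrite expn_gt0 y0.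
  have lnX n : ln (y ^ n)%:R = n%:R * ln y%:R :> R by rewrite natrX lnXn// mulr_natl.
  move: z1 z2; rewrite !lnX !natrM -(natr1 q); lra.
apply: le_trans (lerD h1 h2) _.
have c1 : b <= C / (ln y%:R * 16 ^+ q) + 2 / (y%:R * 16 ^+ q).
  rewrite /b lerD2l ler_wpM2l// lef_pV2 ?posrE ?mulr_gt0 ?exprn_gt0//.
  exact: mul_pow16_le.
have c2 : ln y%:R <= y%:R :> R by have := @ln_lesub1 R y%:R y0'; lra.
have e1 : C / (ln y%:R * 16 ^+ q) * ln y%:R = C / 16 ^+ q by field; rewrite !gt_eqF.
have e2 : 2 / (y%:R * 16 ^+ q) * ln y%:R <= 2 / 16 ^+ q :> R.
  have -> : 2 / 16 ^+ q = 2 / (y%:R * 16 ^+ q) * y%:R :> R by field; rewrite !gt_eqF.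
  by rewrite ler_wpM2l// divr_ge0// mulr_ge0// ltW.
have e3 : C / (ln y%:R * 16 ^+ q) <= 2 * (C / 16 ^+ q).
  have -> : C / (ln y%:R * 16 ^+ q) = (C / 16 ^+ q) / ln y%:R by field; rewrite !gt_eqF.
  have c0 : 0 <= C / 16 ^+ q by rewrite divr_ge0// ltW.
  by rewrite ler_pdivrMr//; nra.
have e4 : 2 / (y%:R * 16 ^+ q) <= 2 / 16 ^+ q :> R.
  rewrite ler_wpM2l// lef_pV2 ?posrE ?mulr_gt0//.
  by rewrite ler_peMl ?(ltW p16)// ler1n.
have := ler_wpM2r (ltW l0) c1; rewrite [X in _ <= X]mulrDl e1 => c1'.
have -> : 2 * b + 2 * b * (64 * ln y%:R) = 2 * b + 128 * (b * ln y%:R) by ring.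
have -> : 2 * (130 * C + 300) / 16 ^+ q = 260 * (C / 16 ^+ q) + 300 * (2 / 16 ^+ q) by ring.
have : 0 <= C / 16 ^+ q by rewrite divr_ge0// ltW.
have : 0 <= 2 / 16 ^+ q :> R by rewrite divr_ge0// ltW.
move: c1 c1' e2 e3 e4; move: (C / 16 ^+ q) (2 / 16 ^+ q) (2 / (y%:R * 16 ^+ q)) (C / (ln y%:R * 16 ^+ q)) (2 / (y%:R * 16 ^+ q) * ln y%:R) (b * ln y%:R) => d1 d2 d3 d4 d5 d6.
lra.
Qed.

(** Blocks are chained, each contributing at most 1/16 of the bound for its predecessor. The
    induction carries a bound of partial-sum type, with the factor [1 - 16^-1 ^+ k.+1], so that it
    closes. *)
Lemma echi_tail : exists2 C : R, 0 <= C & forall q y Y Z, (1 < y)%N -> (0 < q)%N ->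
  (y ^ (64 * q) <= Y)%N -> (Y <= Z)%N -> `|echi y Z - echi y Y| <= C / 16 ^+ q.
Proof.
have [C C0 HC] := echi_block; exists (4 * C) => [|q y Y Z y1 q0 yY YZ]; first lra.
have y0 : (0 < y)%N by lia.
have H k q' Y' : (0 < q')%N -> (y ^ (64 * q') <= Y')%N -> (Y' <= Z)%N -> (Z <= y ^ (64 * (q' + k.+1)))%N ->
   `|echi y Z - echi y Y'| <= 2 * C / 16 ^+ q' * (1 - 16^-1 ^+ k.+1).
  elim: k q' Y' => [|k IH] q' Y' q'0 h1 h2 h3.
    apply: le_trans (HC q' y Y' Z y1 q'0 h1 h2 _) _; first by rewrite addn1 in h3.
    have : 0 <= C / 16 ^+ q' by rewrite divr_ge0 ?exprn_ge0.
    rewrite expr1; lra.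
  case: (leqP Z (y ^ (64 * q'.+1))) => h4.
    apply: le_trans (HC q' y Y' Z y1 q'0 h1 h2 h4) _.
    have c0 : 0 <= C / 16 ^+ q' by rewrite divr_ge0 ?exprn_ge0.
    have : 16^-1 ^+ k.+2 <= 16^-1 ^+ 1 :> R by apply: ler_wiXn2l => //; lra.
    rewrite expr1; move: (_ ^+ k.+2) => z; nra.
  case: (leqP (y ^ (64 * q'.+1)) Y') => h5.
    apply: le_trans (IH q'.+1 Y' isT h5 h2 _) _; first by rewrite addSnnS.
    have c0 : 0 <= C / 16 ^+ q' by rewrite divr_ge0 ?exprn_ge0.
    have p0 : 0 < 16 ^+ q' :> R by rewrite exprn_gt0.
    rewrite [16 ^+ q'.+1]exprS [X in _ <= _ * (1 - X)]exprS.
    have : 0 <= 16^-1 ^+ k.+1 :> R by rewrite exprn_ge0.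
    have : 16^-1 ^+ k.+1 <= 1 :> R by rewrite exprn_ile1//; lra.
    have -> : 2 * C / (16 * 16 ^+ q') = C / 16 ^+ q' / 8 by field; rewrite gt_eqF.
    have -> : 2 * C / 16 ^+ q' = 2 * (C / 16 ^+ q') by ring.
    move: (_ ^+ k.+1) (C / _) c0 => z c c0; nra.
  set W := (y ^ (64 * q'.+1))%N in h4 h5.
  have -> : echi y Z - echi y Y' = (echi y Z - echi y W) + (echi y W - echi y Y') by ring.
  apply: le_trans (ler_normD _ _) _.
  have a1 := HC q' y Y' W y1 q'0 h1 (ltnW h5) (leqnn _).
  have a2 := IH q'.+1 W isT (leqnn _) (ltnW h4) (leq_trans h3 _).
  have {}a2 := a2 (eq_leq (congr1 (fun e => y ^ (64 * e))%N (esym (addSnnS q' k.+1)))).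
  apply: le_trans (lerD a2 a1) _.
  have c0 : 0 <= C / 16 ^+ q' by rewrite divr_ge0 ?exprn_ge0.
  have p0 : 0 < 16 ^+ q' :> R by rewrite exprn_gt0.
  rewrite [16 ^+ q'.+1]exprS [X in _ <= _ * (1 - X)]exprS.
  have : 0 <= 16^-1 ^+ k.+1 :> R by rewrite exprn_ge0.
  have -> : 2 * C / (16 * 16 ^+ q') = C / 16 ^+ q' / 8 by field; rewrite gt_eqF.
  have -> : 2 * C / 16 ^+ q' = 2 * (C / 16 ^+ q') by ring.
  move: (_ ^+ k.+1) (C / _) c0 => z c c0; nra.
have Zy : (Z <= y ^ (64 * (q + Z.+1)))%N.
  apply: leq_trans (ltnW (ltn_expl Z y1)) _; rewrite leq_exp2l//; lia.
apply: le_trans (H Z q Y q0 yY YZ Zy) _.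
have c0 : 0 <= C / 16 ^+ q by rewrite divr_ge0 ?exprn_ge0.
have -> : 2 * C / 16 ^+ q = 2 * (C / 16 ^+ q) by ring.
have -> : 4 * C / 16 ^+ q = 4 * (C / 16 ^+ q) by ring.
have : 0 <= 16^-1 ^+ Z.+1 :> R by rewrite exprn_ge0.
by move: (_ ^+ Z.+1) (C / _) c0 => z c c0; nra.
Qed.

Lemma prod_chi_ge : exists2 c : R, 0 < c & forall y,
  c <= \prod_(p <- sprimes predT y) (1 - chir p / p%:R).
Proof.
have [C C0 HC] := chi_mertens R; exists (expR (- (C + 16))) => [|y]; first exact: expR_gt0.
apply: le_trans (@prod_sprimes_ge predT y (fun p => chir p / p%:R) _); last first.
  move=> p _; rewrite normrM [`|p%:R^-1|]ger0_norm ?invr_ge0//.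
  by rewrite -[leRHS]mul1r ler_wpM2r ?invr_ge0// chi_norm.
rewrite ler_expR lerN2 lerD2r.
have := HC y; rewrite ler_norml => /andP[_]; apply: le_trans.
rewrite sum_sprimes [leRHS](bigID (fun p => (2 < p)%N)) /=.
rewrite [X in _ <= _ + X]big1 ?addr0.
  by apply: le_of_eq; apply: eq_bigl => p; rewrite andbT.
move=> p /andP[/prime_gt1 a b]; have -> : p = 2%N by lia.
by rewrite /chi /= mul0r.
Qed.

(** The complete sum equals L(1, chi) times the product of 1 - chi(p) / p over odd p <= y, which
    stays above a positive constant since the sum of chi(p) / p is bounded. Cutting at y^(64 q0) or
    later loses only a fraction of it. This constant keeps the mean of B away from 0. *)
Lemma echi_ge : exists (c : R) (q0 : nat), [/\ 0 < c, (0 < q0)%N & forall y Y, (1 < y)%N ->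
  (y ^ (64 * q0) <= Y)%N -> c <= echi y Y].
Proof.
have [L L0 HL] := chisum_lim R.
have [C C0 HC] := echi_tail; have [c c0 Hc] := prod_chi_ge.
have [q0 Hq0] : exists q0, C / 16 ^+ q0.+1 <= c / 16.
  have [n hn] : exists n : nat, 16 * C / c < n%:R.
    by exists (Num.truncn (16 * C / c)).+1; apply: truncnS_gt.
  exists n; rewrite ler_pdivrMr ?exprn_gt0//.
  move: hn; rewrite ltr_pdivrMr// => hn.
  have : n%:R <= 16 ^+ n.+1 :> R.
    by rewrite -natrX ler_nat ltnW// (leq_trans (ltn_expl n (isT : (1 < 16)%N)))// leq_exp2l.
  move: (16 ^+ n.+1) => z hz; have : n%:R * c <= z * c by rewrite ler_wpM2r// ltW.
  lra.
exists (c / 8), q0.+1; split => // [|y Y y1 yY]; first lra.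
have as_ : all prime (sprimes predT y) by apply/allP => p; rewrite mem_sprimes => /and4P[].
have [K K0 HK] := chisum_sieve HL (sprimes_uniq predT y) as_.
(* An auxiliary endpoint, so far out that the uncontrolled constant of [chisum_sieve] becomes
   harmless; [echi_tail] brings the sum back to [Y]. *)
have [Z [YZ Z0 KZ]] : exists Z, [/\ (Y <= Z)%N, (0 < Z)%N & K / Z%:R <= c / 16].
  pose n := (Num.truncn (16 * K / c)).+1; exists (Y + n)%N.
  have hn : 16 * K / c < n%:R by exact: truncnS_gt.
  split; [exact: leq_addr| by rewrite addnS |].
  rewrite ler_pdivrMr ?ltr0n ?addnS//.
  move: hn; rewrite ltr_pdivrMr// => hn; rewrite -addnS natrD.
  have : 0 <= Y%:R * c by rewrite mulr_ge0// ltW.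
  rewrite -/n; lra.
have := HC q0.+1 y Y Z y1 isT yY YZ.
have := HK Z Z0; have -> : \sum_(1 <= l < Z.+1 | all (fun p => ~~ (p %| l)%N) (sprimes predT y)) chir l / l%:R = echi y Z.
  rewrite /echi big_mkcond [RHS]big_mkcond; apply: eq_big_nat => l /andP[l0 _].
  case: (boolP (odd l)) => ol; first by rewrite rgh_all.
  have -> : chi l = 0.
    have : odd (l %% 4) = false by rewrite (odd_mod l (erefl : odd 4 = false)) (negbTE ol).
    by rewrite /chi; move: (l %% 4)%N => [|[|[|[|//]]]].
  by rewrite mul0r !if_same.
have := Hc y; set P := \prod_(_ <- _) _ => hP.
have LP : c / 4 <= L * P.
  have : 1 / 4 * c <= L * P by apply: ler_pM => //; lra.
  lra.
rewrite !ler_norml => /andP[a1 a2] /andP[a3 a4].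
by move: Hq0 KZ a1 a2 a3 a4; move: (C / _) (K / _) (L * P) LP => u w r; lra.
Qed.
End Consequences.

(** * Weighted counts of rough and sifted integers *)

Section Weights.
Variable R : realType.
Notation chir n := ((chi n)%:~R : R).

(* The weight wt built from hw is prod a(p) times z^Omega of the y-rough part: a = 0 keeps only
   the y-rough numbers, a = a3 those without prime factors p = 3 mod 4 up to y. *)
Definition hw (a : nat -> R) (z : R) y p := if (p <= y)%N then a p else z.

(** By Mertens, the sum of 1 / p over y < p <= X up to a bounded error. *)
Definition lr y X : R := ln (ln X%:R) - ln (ln y%:R).

Lemma expR_lr y X : (1 < y)%N -> (1 < X)%N -> expR (lr y X) = ln X%:R / ln y%:R.
Proof.
by move=> y1 X1; rewrite /lr -ln_div ?posrE ?ln_gt0_nat// lnK// posrE divr_gt0 ?ln_gt0_nat.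
Qed.

Lemma lr_pow y w : (1 < y)%N -> (0 < w)%N -> lr y (y ^ w) = ln w%:R.
Proof.
move=> y1 w0; have l0 := ln_gt0_nat R y1.
rewrite /lr natrX lnXn ?ltr0n ?(ltnW y1)// -[ln _ *+ w]mulr_natl lnM ?posrE ?ltr0n//.
by rewrite addrK.
Qed.

Lemma lr_mono y X Z : (1 < y)%N -> (1 < X)%N -> (X <= Z)%N -> lr y X <= lr y Z.
Proof.
move=> y1 X1 XZ; have Z1 := leq_trans X1 XZ.
by rewrite lerD2r ler_ln ?posrE ?ln_gt0_nat//; apply: ler_ln_nat => //; apply: ltnW.
Qed.

Section Fixed.
Variables (a : nat -> R) (z : R) (y : nat).
Hypothesis a0 : forall p, 0 <= a p.
Hypothesis a2 : forall p, prime p -> a p <= 2 /\ a p <= 3 / 4 * p%:R.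
Hypothesis z04 : 0 <= z <= 4.
Hypothesis y5 : (5 <= y)%N.

Lemma hw_ge0 p : 0 <= hw a z y p.
Proof. by rewrite /hw; case: ifP => // _; case/andP: z04. Qed.

Lemma hw_le p : prime p -> hw a z y p <= 4 /\ hw a z y p <= 3 / 4 * p%:R.
Proof.
move=> pp; rewrite /hw; case: leqP => h; first by have [h1 h2] := a2 pp; split => //; lra.
(* Here [5 <= y] enters: it makes 4 at most 3/4 of any prime beyond y. The value 4 is needed for
   squares of 2^Omega. *)
have : (6 : R) <= p%:R by rewrite ler_nat; lia.
by case/andP: z04; split; lra.
Qed.
End Fixed.

Lemma sum_hw : exists2 C : R, 0 <= C & forall a z y X G, (1 < y)%N -> (y <= X)%N -> 0 <= z <= 4 ->
  \sum_(1 <= p < y.+1 | prime p) a p / p%:R <= G ->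
  \sum_(1 <= p < X.+1 | prime p) hw a z y p / p%:R <= G + z * lr y X + C.
Proof.
have [C C0 HC] := sum_prime_between R; exists (4 * C) => [|a z y X G y1 yX /andP[z0 z4] HG].
  exact: mulr_ge0.
rewrite (@big_cat_nat _ _ _ y.+1) //= -addrA; apply: lerD.
  apply: le_trans HG; rewrite big_nat_cond [leRHS]big_nat_cond; apply: ler_sum => p /andP[/andP[_ py] _].
  by rewrite /hw -ltnS py.
apply: (@le_trans _ _ (z * \sum_(y.+1 <= p < X.+1 | prime p) p%:R^-1)).
  rewrite mulr_sumr big_nat_cond [leRHS]big_nat_cond; apply: ler_sum => p /andP[/andP[py _] _].
  by rewrite /hw leqNgt py.
apply: le_trans (ler_wpM2l z0 (HC y X y1 yX)) _; rewrite -/(lr y X) mulrDr lerD2l.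
exact: ler_wpM2r.
Qed.

Definition wt a z y := cmul (hw a z y).

Lemma wt_sum : exists2 C : R, 0 <= C & forall a z y X G, (5 <= y)%N -> (y <= X)%N ->
  (forall p, 0 <= a p) -> (forall p, prime p -> a p <= 2 /\ a p <= 3 / 4 * p%:R) -> 0 <= z <= 4 ->
  \sum_(1 <= p < y.+1 | prime p) a p / p%:R <= G ->
  \sum_(1 <= m < X.+1) wt a z y m <= C * X%:R / ln y%:R * expR (G + (z - 1) * lr y X).
Proof.
have [C C0 HC] := sum_hw; exists (273 * expR 256 * expR C) => [|a z y X G y5 yX a0 a2 z04 HG].
  exact: mulr_ge0 (mulr_ge0 (ler0n _ _) (expR_ge0 _)) (expR_ge0 _).
have y1 : (1 < y)%N by apply: leq_trans y5.
have X1 := leq_trans y1 yX.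
have h0 := hw_ge0 y a0 z04; have h2 := hw_le a2 z04 y5.
apply: le_trans (hall_tenenbaum (cmul1 _) (cmulM (hw a z y)) (cmul_ge0 h0) _ X1) _.
  by move=> p pp; rewrite cmul_prime//; exact: h2.
rewrite (eq_bigr (fun p => hw a z y p / p%:R)); last by move=> p pp; rewrite cmul_prime.
have lX0 := ln_gt0_nat R X1; have ly0 := ln_gt0_nat R y1.
have := HC a z y X G y1 yX z04 HG; rewrite -ler_expR => h.
have c0 : 0 <= 273 * expR 256 * X%:R / ln X%:R :> R.
  exact: divr_ge0 (mulr_ge0 (mulr_ge0 (ler0n _ _) (expR_ge0 _)) (ler0n _ _)) (ltW lX0).
apply: le_trans (ler_wpM2l c0 h) _.
have -> : G + z * lr y X + C = C + (G + (z - 1) * lr y X) + lr y X by ring.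
rewrite expRD [expR (C + _)]expRD expR_lr//; apply: le_of_eq.
by field; rewrite !gt_eqF.
Qed.

Lemma wt_logsum : exists2 C : R, 0 <= C & forall a z y X G, (5 <= y)%N -> (y <= X)%N ->
  (forall p, 0 <= a p) -> (forall p, prime p -> a p <= 2 /\ a p <= 3 / 4 * p%:R) -> 0 <= z <= 4 ->
  \sum_(1 <= p < y.+1 | prime p) a p / p%:R <= G ->
  \sum_(1 <= m < X.+1) wt a z y m / m%:R <= C * expR (G + z * lr y X).
Proof.
have [C C0 HC] := sum_hw; exists (expR 256 * expR C) => [|a z y X G y5 yX a0 a2 z04 HG].
  by rewrite mulr_ge0 ?expR_ge0// mulr_ge0 ?expR_ge0.
have y1 : (1 < y)%N by apply: leq_trans y5.
have h0 := hw_ge0 y a0 z04; have h2 := hw_le a2 z04 y5.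
apply: le_trans (log_sum_le (cmul1 _) (cmulM (hw a z y)) (cmul_ge0 h0) _ X) _.
  by move=> p pp; rewrite cmul_prime//; exact: h2.
rewrite (eq_bigr (fun p => hw a z y p / p%:R)); last by move=> p pp; rewrite cmul_prime.
rewrite -mulrA ler_wpM2l ?expR_ge0// -expRD ler_expR.
by have := HC a z y X G y1 yX z04 HG; lra.
Qed.

Lemma cmul_mul (h g : nat -> R) m : cmul h m * cmul g m = cmul (fun p => h p * g p) m.
Proof. by rewrite /cmul -big_split; apply: eq_bigr => p _; rewrite exprMn. Qed.

Lemma cmul_ge1 (h : nat -> R) m : (0 < m)%N ->
  (forall p, prime p -> (p %| m)%N -> 1 <= h p) -> 1 <= cmul h m.
Proof.
move=> m0 H; rewrite /cmul; elim/big_ind: _ => // [x y x1 y1|p pp].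
  by rewrite -[1]mulr1 ler_pM.
case: (boolP (p %| m)%N) => pm; first by rewrite exprn_ege1// H.
by rewrite lognE pp m0 (negbTE pm) expr0.
Qed.

Lemma cmul_ext (h g : nat -> R) m : (forall p, prime p -> (p %| m)%N -> h p = g p) ->
  cmul h m = cmul g m.
Proof.
move=> H; apply: eq_bigr => p pp; rewrite lognE pp /=.
by case: (boolP (0 < m)%N) => //= m0; case: (boolP (p %| m)%N) => // pm; rewrite H.
Qed.

Definition nrdiv y m : R := \sum_(1 <= l < m.+1 | (l %| m)%N) ((rgh y).-nat l)%:R.

Lemma nrdiv_widen y m B : (0 < m)%N -> (m <= B)%N ->
  \sum_(1 <= l < B.+1 | (l %| m)%N) ((rgh y).-nat l)%:R = nrdiv y m.
Proof.
move=> m0 mB; rewrite (@big_cat_nat _ _ _ m.+1) //= [X in _ + X]big_nat_cond [X in _ + X]big1 ?addr0//.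
by move=> l /andP[/andP[ml _] /(dvdn_leq m0)]; rewrite leqNgt ml.
Qed.

Lemma nrdivM y p m : prime p -> (0 < m)%N -> nrdiv y (p * m) <= (1 + (y < p)%:R) * nrdiv y m.
Proof.
move=> pp m0; have p0 := prime_gt0 pp.
have pm0 : (0 < p * m)%N by rewrite muln_gt0 p0.
have mpm : (m <= p * m)%N by rewrite leq_pmull.
rewrite {1}/nrdiv (bigID (fun l => (p %| l)%N)) /= addrC mulrDl mul1r; apply: lerD.
  rewrite -(nrdiv_widen y m0 mpm) big_mkcond [leRHS]big_mkcond; apply: ler_sum => l _.
  case: (boolP (p %| l)%N) => pl; rewrite ?andbF ?andbT; first by case: ifP.
  by rewrite Gauss_dvdr// coprime_sym prime_coprime.
rewrite (eq_bigl (fun l => (p %| l)%N && (l %| p * m)%N)); last by move=> l; rewrite andbC.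
rewrite big_mkcondr (sum_dvd (fun l => if (l %| p * m)%N then ((rgh y).-nat l)%:R else 0))// mulKn//.
rewrite /nrdiv mulr_sumr [leRHS]big_mkcond; apply: ler_sum_nat => l /andP[l0 _].
rewrite dvdn_pmul2l//; case: ifP => // _.
by rewrite pnatM pnatE// inE -natrM mulnb.
Qed.

Lemma nrdiv1 y : nrdiv y 1 = 1.
Proof. by rewrite /nrdiv big_mkcond big_nat1. Qed.

Lemma nrdiv_le_cmul (h : nat -> R) y m : (0 < m)%N ->
  (forall p, prime p -> (p %| m)%N -> 1 + (y < p)%:R <= h p) -> nrdiv y m <= cmul h m.
Proof.
elim/ltn_ind: m => m IH m0 H; case: (leqP m 1) => [m1|m1].
  by rewrite (_ : m = 1%N) ?nrdiv1 ?cmul1//; lia.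
have [p pp /dvdnP[k mk]] : exists2 p, prime p & (p %| m)%N by exists (pdiv m); rewrite ?pdiv_prime ?pdiv_dvd.
have k0 : (0 < k)%N by case: k mk => // mk; rewrite mk in m0.
have mE : m = (p * k)%N by rewrite mulnC.
rewrite mE (cmulM h (prime_gt0 pp) k0) cmul_prime//; apply: le_trans (nrdivM y pp k0) _.
apply: ler_pM; rewrite ?addr_ge0 ?sumr_ge0//.
  by apply: H => //; rewrite mE dvdn_mulr.
apply: IH => [||q qp qk]//; first by rewrite mE ltn_Pmull// prime_gt1.
by apply: H => //; rewrite mE dvdn_mull.
Qed.

(* The part of the sieve condition on m = n - z^2 that concerns all p = 3 mod 4 up to y. *)
Definition nop3 y m := [&& (0 < m)%N & all (fun p => ~~ (p %| m)%N) (sprimes (fun p => p %% 4 == 3)%N y)].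

Lemma nop3P y m : reflect ((0 < m)%N /\ forall p, prime p -> (p <= y)%N -> (p %% 4 = 3)%N -> ~~ (p %| m)%N) (nop3 y m).
Proof.
apply: (iffP andP) => -[m0].
  move=> /allP H; split => // p pp py p3; apply: H; rewrite mem_sprimes pp py p3 eqxx.
  by case: p pp {py} p3 => [|[|[|p]]].
move=> H; split => //; apply/allP => p; rewrite mem_sprimes => /and4P[pp _ py /eqP p3].
exact: H.
Qed.

Definition a3 (p : nat) : R := (p %% 4 != 3)%N%:R.

Lemma a3_ge0 p : 0 <= a3 p. Proof. by []. Qed.
Lemma a3_le p : prime p -> a3 p <= 2 /\ a3 p <= 3 / 4 * p%:R.
Proof.
move=> /prime_gt1 p1; have : (2 : R) <= p%:R by rewrite ler_nat.
move=> p2; rewrite /a3; case: (_ != _) => /=; split; lra.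
Qed.

Lemma sum_a3 : exists2 C : R, 0 <= C & forall y, (1 < y)%N ->
  \sum_(1 <= p < y.+1 | prime p) a3 p / p%:R <= ln (ln y%:R) / 2 + C.
Proof.
have [C C0 HC] := sum_prime_mod4 R; exists C => // y y1.
have [h _] := HC y y1; apply: le_trans h; rewrite [leRHS]big_mkcondr.
by apply: ler_sum => p _; rewrite /a3; case: ifP; rewrite ?mul1r ?mul0r.
Qed.

Lemma nop3_le z y m : 1 <= z -> (nop3 y m)%:R <= wt a3 z y m.
Proof.
move=> z1; case: (boolP (nop3 y m)) => [/nop3P[m0 H]|_]; last first.
  apply: cmul_ge0 => p; rewrite /hw; case: ifP => // _; lra.
apply: cmul_ge1 => // p pp pm; rewrite /hw; case: ifP => // py.
by rewrite /a3; have := H p pp py; case: eqP => // h /(_ h); rewrite pm.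
Qed.

(** The number of rough divisors is at most 2^Omega of the rough part, and the small primes of a
    sifted m all have [a3 p = 1]. A sharp condition and a divisor count thus become one completely
    multiplicative weight, to which the Hall-Tenenbaum bound applies. *)
Lemma nop3_nrdiv y m : (nop3 y m)%:R * nrdiv y m <= wt a3 2 y m.
Proof.
case: (boolP (nop3 y m)) => [/nop3P[m0 H]|_]; last first.
  by rewrite mul0r; apply: cmul_ge0 => p; rewrite /hw; case: ifP.
rewrite mul1r; apply: nrdiv_le_cmul => // p pp pm; rewrite /hw; case: leqP => py; last by rewrite /=; lra.
by rewrite addr0 /a3; have := H p pp py; case: eqP => // h /(_ h); rewrite pm.
Qed.

(** [a3] takes the values 0 and 1, so squaring the weight only turns 2 into 4. *)
Lemma nop3_nrdiv2 y m : (nop3 y m)%:R * nrdiv y m ^+ 2 <= wt a3 4 y m.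
Proof.
have -> : wt a3 4 y m = wt a3 2 y m ^+ 2.
  rewrite expr2 /wt cmul_mul; apply: cmul_ext => p _ _; rewrite /hw; case: ifP => _; last by ring.
  by rewrite /a3; case: (_ != _); rewrite ?mulr1 ?mulr0.
have h := nop3_nrdiv y m.
apply: (@le_trans _ _ (((nop3 y m)%:R * nrdiv y m) ^+ 2)).
  by case: (nop3 y m); rewrite ?mul1r// mul0r exprn_ge0// mul0r.
by rewrite lerXn2r ?nnegrE ?mulr_ge0 ?sumr_ge0//; apply: le_trans h; rewrite ?mulr_ge0 ?sumr_ge0.
Qed.

Lemma rgh_le y m : ((rgh y).-nat m)%:R <= wt (fun=> 0) 1 y m.
Proof.
case: (boolP ((rgh y).-nat m)) => [/andP[m0 /allP H]|_]; last by apply: cmul_ge0 => p; rewrite /hw; case: ifP.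
apply: cmul_ge1 => // p pp pm; rewrite /hw leqNgt.
by have := H p; rewrite mem_primes pp m0 pm inE => /(_ isT) ->.
Qed.

(* Up to constants, the density of the integers without prime factors p = 3 mod 4 up to y. *)
Definition wy y : R := expR (- (ln (ln y%:R) / 2)).

Lemma wy_gt0 y : 0 < wy y. Proof. exact: expR_gt0. Qed.

Lemma wyE y : (1 < y)%N -> expR (ln (ln y%:R) / 2) / ln y%:R = wy y.
Proof.
move=> y1; have l0 := ln_gt0_nat R y1.
rewrite -{2}(lnK (l0 : ln y%:R \is Num.pos)) -expRN -expRD /wy; congr expR; lra.
Qed.

Lemma wt3_sum : exists2 C : R, 0 <= C & forall z y X, (5 <= y)%N -> (y <= X)%N -> 0 <= z <= 4 ->
  \sum_(1 <= m < X.+1) wt a3 z y m <= C * X%:R * wy y * expR ((z - 1) * lr y X).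
Proof.
have [C C0 HC] := wt_sum; have [C1 C10 HC1] := sum_a3.
exists (C * expR C1) => [|z y X y5 yX z04]; first by rewrite mulr_ge0 ?expR_ge0.
have y1 : (1 < y)%N by apply: leq_trans y5.
apply: le_trans (HC a3 z y X _ y5 yX a3_ge0 a3_le z04 (HC1 y y1)) _.
rewrite -wyE// [expR (_ + _ + _)]expRD expRD; apply: le_of_eq; ring.
Qed.

Lemma wt3_logsum : exists2 C : R, 0 <= C & forall z y X, (5 <= y)%N -> (y <= X)%N -> 0 <= z <= 4 ->
  \sum_(1 <= m < X.+1) wt a3 z y m / m%:R <= C * (ln y%:R * wy y) * expR (z * lr y X).
Proof.
have [C C0 HC] := wt_logsum; have [C1 C10 HC1] := sum_a3.
exists (C * expR C1) => [|z y X y5 yX z04]; first by rewrite mulr_ge0 ?expR_ge0.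
have y1 : (1 < y)%N by apply: leq_trans y5.
apply: le_trans (HC a3 z y X _ y5 yX a3_ge0 a3_le z04 (HC1 y y1)) _.
have l0 := ln_gt0_nat R y1.
rewrite -wyE// [expR (_ + _ + _)]expRD expRD; apply: le_of_eq; field.
by rewrite gt_eqF.
Qed.

Lemma wt0_le (p : nat) : prime p -> (0 : R) <= 2 /\ 0 <= 3 / 4 * p%:R :> R.
Proof. by split => //; rewrite mulr_ge0. Qed.

Lemma wt0_sum : exists2 C : R, 0 <= C & forall z y X, (5 <= y)%N -> (y <= X)%N -> 0 <= z <= 4 ->
  \sum_(1 <= m < X.+1) wt (fun=> 0) z y m <= C * X%:R / ln y%:R * expR ((z - 1) * lr y X).
Proof.
have [C C0 HC] := wt_sum; exists C => // z y X y5 yX z04.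
rewrite -[_ * lr y X]add0r; apply: (HC _ z y X 0 y5 yX (fun=> lexx _) wt0_le z04).
by rewrite big1// => p _; rewrite mul0r.
Qed.

Lemma wt0_logsum : exists2 C : R, 0 <= C & forall z y X, (5 <= y)%N -> (y <= X)%N -> 0 <= z <= 4 ->
  \sum_(1 <= m < X.+1) wt (fun=> 0) z y m / m%:R <= C * expR (z * lr y X).
Proof.
have [C C0 HC] := wt_logsum; exists C => // z y X y5 yX z04.
rewrite -[_ * lr y X]add0r; apply: (HC _ z y X 0 y5 yX (fun=> lexx _) wt0_le z04).
by rewrite big1// => p _; rewrite mul0r.
Qed.
End Weights.

(** * Middle divisors *)

Section Middle.
Variable R : realType.
Notation chir n := ((chi n)%:~R : R).

Lemma ln_ge_eventually (B : R) : exists y0, forall y, (y0 <= y)%N -> B <= ln y%:R.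
Proof.
exists (Num.truncn (expR B)).+1 => y hy.
have hB : expR B < y%:R.
  by apply: lt_le_trans (truncnS_gt _) _; rewrite ler_nat.
by rewrite -[leLHS]expRK ler_ln ?posrE ?expR_gt0 ?(lt_trans _ hB) ?expR_gt0// ltW.
Qed.

Lemma ln_pow_small k (A : R) : exists y0, forall y, (y0 <= y)%N -> A * ln y%:R ^+ k <= y%:R.
Proof.
have [y0 Hy] := ln_ge_eventually (Num.max 1 (A * k.+1`!%:R)); exists y0.+1 => y hy.
have := Hy y (ltnW hy); rewrite ge_max => /andP[l1 lA].
have l0 : 0 <= ln y%:R :> R by lra.
have y0' : (0 : R) < y%:R by rewrite ltr0n; case: y hy {l1 lA l0}.
have := @pow_fact_le R (ln y%:R) k.+1 l0; rewrite lnK ?posrE// ler_pdivrMr ?ltr0n ?fact_gt0// => h.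
have f0 : (0 : R) < k.+1`!%:R by rewrite ltr0n fact_gt0.
rewrite -(ler_pM2r f0); apply: le_trans h; rewrite exprS mulrAC ler_wpM2r// exprn_ge0//.
Qed.

(** The gcd becomes a variable of its own because the character will not see it. The vanishing of
    [F] beyond [B] lets x and t run over the full range. *)
Lemma pair_gcd (F : nat -> nat -> R) B :
  (forall l1 l2, (B < l1)%N || (B < l2)%N -> F l1 l2 = 0) ->
  \sum_(1 <= l1 < B.+1) \sum_(1 <= l2 < B.+1) F l1 l2 =
  \sum_(1 <= g < B.+1) \sum_(1 <= x < B.+1) \sum_(1 <= t < B.+1)
    (coprime x t)%:R * F (g * x)%N (g * t)%N.
Proof.
move=> HF.
transitivity (\sum_(1 <= l1 < B.+1) \sum_(1 <= l2 < B.+1) \sum_(1 <= g < B.+1) (gcdn l1 l2 == g)%:R * F l1 l2).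
  apply: eq_big_nat => l1 /andP[l10 l1B]; apply: eq_big_nat => l2 /andP[l20 l2B].
  have g0 : (0 < gcdn l1 l2)%N by rewrite gcdn_gt0 l10.
  have gB : (gcdn l1 l2 < B.+1)%N by apply: leq_ltn_trans l1B; apply: dvdn_leq => //; exact: dvdn_gcdl.
  rewrite (bigD1_seq (gcdn l1 l2)) /= ?mem_index_iota ?iota_uniq ?g0// eqxx mul1r.
  by rewrite big1 ?addr0// => g /negbTE; rewrite eq_sym => ->; rewrite mul0r.
rewrite (eq_bigr (fun l1 => \sum_(1 <= g < B.+1) \sum_(1 <= l2 < B.+1) (gcdn l1 l2 == g)%:R * F l1 l2)); last first.
  by move=> l1 _; rewrite exchange_big.
rewrite exchange_big /=; apply: eq_big_nat => g /andP[g0 gB].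
have E (H : nat -> R) : (forall l, (B < l)%N -> H l = 0) ->
    \sum_(1 <= l < B.+1 | (g %| l)%N) H l = \sum_(1 <= x < B.+1) H (g * x)%N.
  move=> H0; rewrite sum_dvd// [RHS](@big_cat_nat _ _ _ (B %/ g).+1) //=; last by rewrite ltnS leq_div.
  rewrite [X in _ = _ + X]big_nat [X in _ = _ + X]big1 ?addr0// => x /andP[Bx _].
  by apply: H0; rewrite mulnC -ltn_divLR.
transitivity (\sum_(1 <= l1 < B.+1 | (g %| l1)%N) \sum_(1 <= l2 < B.+1 | (g %| l2)%N) (gcdn l1 l2 == g)%:R * F l1 l2).
  rewrite [RHS]big_mkcond; apply: eq_bigr => l1 _.
  case: ifP => gl1; last first.
    rewrite big1// => l2 _; case: eqP => e; rewrite ?mul0r//.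
    by move: gl1; rewrite -e dvdn_gcdl.
  rewrite [RHS]big_mkcond; apply: eq_bigr => l2 _.
  by case: ifP => gl2//; case: eqP => e; rewrite ?mul0r//; move: gl2; rewrite -e dvdn_gcdr.
rewrite E; last by move=> l hl; rewrite big1// => l2 _; rewrite HF ?hl// mulr0.
apply: eq_bigr => x _; rewrite E; last by move=> l hl; rewrite HF ?hl ?orbT// mulr0.
apply: eq_bigr => t _; rewrite -muln_gcdr; congr (_ * _).
by rewrite /coprime -{2}[g]muln1 eqn_pmul2l.
Qed.

(** An upward closed and a downward closed condition together cut out an interval, so the sum is a
    difference of two initial sums, whatever the conditions look like otherwise. *)
Lemma sum_updown (U D : pred nat) (G : nat -> R) n :
  (forall t, U t -> U t.+1) -> (forall t, D t.+1 -> D t) ->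
  exists a b, [/\ (a <= b)%N, b = 0%N \/ D b &
    \sum_(1 <= t < n.+1) (U t && D t)%:R * G t =
    \sum_(1 <= t < b.+1) G t - \sum_(1 <= t < a.+1) G t].
Proof.
move=> HU HD.
have [b [bD bE]] : exists b, (b = 0%N \/ D b) /\
    \sum_(1 <= t < n.+1) (U t && D t)%:R * G t = \sum_(1 <= t < b.+1) (U t)%:R * G t.
  elim: n => [|n [b [bD bE]]]; first by exists 0%N; split; [left|rewrite !big_geq].
  case: (boolP (D n.+1)) => Dn; last first.
    by exists b; split => //; rewrite big_nat_recr //= (negbTE Dn) andbF mul0r addr0.
  exists n.+1; split; first by right.
  apply: eq_big_nat => t /andP[_ tn]; suff -> : D t by rewrite andbT.
  have : (t <= n.+1)%N by [].
  elim: n.+1 Dn => [|k IH] Dk; first by case: t {tn} => [|//].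
  by rewrite leq_eqVlt => /orP[/eqP ->//|]; rewrite ltnS; apply: IH; exact: HD.
rewrite bE.
suff [a [ab ->]] : exists a, (a <= b)%N /\ \sum_(1 <= t < b.+1) (U t)%:R * G t =
    \sum_(1 <= t < b.+1) G t - \sum_(1 <= t < a.+1) G t by exists a, b.
elim: b {bD bE} => [|b [a [ab aE]]]; first by exists 0%N; split => //; rewrite !big_geq ?subrr.
case: (boolP (U b.+1)) => Ub.
  exists a; split; first exact: leqW.
  by rewrite big_nat_recr //= Ub mul1r aE [X in _ = X - _]big_nat_recr //= addrAC.
exists b.+1; split => //; rewrite subrr big_nat big1// => t /andP[_]; rewrite ltnS => tb.
suff -> : U t = false by rewrite mul0r.
apply/negP => Ut; move: Ub; rewrite -(subnKC tb); move: (b.+1 - t)%N => k.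
by elim: k => [|k IH]; rewrite ?addn0 ?Ut// addnS => /negP; apply; apply: HU; apply: contraT => /IH.
Qed.

(* The coprimality condition costs little because the primes of x exceed y. *)
Lemma achi_coprime y x b X : (2 < y)%N -> (rgh y).-nat x -> (x <= X)%N ->
  `|\sum_(1 <= t < b.+1) ((rgh y).-nat t && coprime x t)%:R * chir t| <=
  `|achi R y b| + b%:R / y%:R * ln X%:R.
Proof.
move=> y2 rx xX; have y0' : (0 : R) < y%:R by rewrite ltr0n; lia.
have x0 : (0 < x)%N by case/andP: rx.
have -> : \sum_(1 <= t < b.+1) ((rgh y).-nat t && coprime x t)%:R * chir t =
   achi R y b - \sum_(1 <= t < b.+1) ((rgh y).-nat t && ~~ coprime x t)%:R * chir t.
  rewrite /achi [X in _ = X - _]big_mkcond -sumrB; apply: eq_bigr => t _.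
  by case: (_.-nat t) => /=; case: (coprime x t); rewrite /= ?mul1r ?mul0r ?subr0 ?subrr.
apply: le_trans (ler_normB _ _) _; rewrite lerD2l.
apply: le_trans (ler_norm_sum _ _ _) _.
apply: (@le_trans _ _ (\sum_(1 <= t < b.+1) \sum_(1 <= p < X.+1 | prime p) (p %| x)%:R * (p %| t)%:R)).
  apply: ler_sum_nat => t /andP[t0 _]; rewrite normrM normr_nat.
  apply: (@le_trans _ _ (~~ coprime x t)%:R).
    rewrite -[leRHS]mulr1 ler_pM ?chi_norm// ler_nat.
    by case: (_.-nat t); case: (coprime x t).
  case: (boolP (coprime x t)) => co /=; first by rewrite sumr_ge0// => p _; rewrite mulr_ge0.
  have g1 : (1 < gcdn x t)%N by rewrite ltn_neqAle eq_sym co gcdn_gt0 x0.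
  set p := pdiv (gcdn x t); have pp : prime p := pdiv_prime g1.
  have px : (p %| x)%N := dvdn_trans (pdiv_dvd _) (dvdn_gcdl x t).
  have pt : (p %| t)%N := dvdn_trans (pdiv_dvd _) (dvdn_gcdr x t).
  rewrite big_mkcond (bigD1_seq p) /= ?iota_uniq ?mem_index_iota ?prime_gt0 ?ltnS ?(leq_trans (dvdn_leq x0 px) xX)//.
  by rewrite pp px pt mul1r lerDl sumr_ge0// => q _; case: ifP => // _; rewrite mulr_ge0.
rewrite exchange_big /=.
apply: (@le_trans _ _ (\sum_(1 <= p < X.+1 | prime p) b%:R / y%:R * ((logn p x)%:R * ln p%:R))); last first.
  rewrite -mulr_sumr ler_wpM2l ?divr_ge0//; apply: le_trans (ln_logn_le R X x0) _.
  exact: ler_ln_nat.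
apply: ler_sum => p pp; rewrite -mulr_sumr.
case: (boolP (p %| x)%N) => px; last by rewrite mul0r mulr_ge0 ?divr_ge0 ?mulr_ge0 ?ln_nat_ge0.
have yp : (y < p)%N.
  by case/andP: rx => _ /allP/(_ p); rewrite mem_primes pp x0 px inE; apply.
have p0' : (0 : R) < p%:R by rewrite ltr0n prime_gt0.
have -> : \sum_(1 <= t < b.+1) (p %| t)%:R = (b %/ p)%:R :> R.
  have := @sum_dvd R (fun=> 1) p b (prime_gt0 pp).
  rewrite [RHS]big_const_nat iter_addr_0 subn1 /= => <-.
  by rewrite [RHS]big_mkcond; apply: eq_bigr => t _; case: ifP.
rewrite mul1r; apply: (@le_trans _ _ (b%:R / y%:R)).
  rewrite ler_pdivlMr// -natrM ler_nat; apply: leq_trans (leq_trunc_div b p).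
  by rewrite leq_mul2l ltnW ?orbT.
have l1 : 1 <= ln p%:R :> R.
  have h2 := ln2_ge R; have := ln_natM R (isT : (0 < 2)%N) (isT : (0 < 2)%N); rewrite -[(2 * 2)%N]/4%N => h4.
  have : ln 4 <= ln p%:R :> R by apply: ler_ln_nat => //; lia.
  lra.
rewrite ler_peMr ?divr_ge0//; apply: (@le_trans _ _ (1 * 1)); first by rewrite mul1r.
by rewrite ler_pM// ler1n -pfactor_dvdn.
Qed.
End Middle.

(** * The second moment of the middle sum *)

Section MiddleMoment.
Variable R : realType.
Notation chir n := ((chi n)%:~R : R).
Notation rg y := (rgh y).-nat.

(* The divisors l counted by the middle sum of dchi_flip for the y-rough part of m. *)
Definition mp Y y m l := [&& rg y l, (l %| m)%N, (Y < l)%N & (l * l < m`_(rgh y))%N].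

Definition mid X Y y m : R := \sum_(1 <= l < X.+1 | mp Y y m l) chir l.

(* (g x, g t) runs over the pairs of middle divisors with gcd g. *)
Definition pr3 Y y m g x t := [&& coprime x t, rg y g, rg y x, rg y t, (g * x * t %| m)%N,
  (Y < g * x)%N, (g * x * (g * x) < m`_(rgh y))%N, (Y < g * t)%N & (g * t * (g * t) < m`_(rgh y))%N].

Lemma rgh_odd y l : (1 < y)%N -> rg y l -> odd l.
Proof.
move=> y1 /andP[l0 /allP H]; apply: contraT => ol.
have := H 2%N; rewrite mem_primes l0 dvdn2 ol => /(_ isT).
by rewrite inE; lia.
Qed.

Lemma rghM y a b : rg y (a * b)%N = rg y a && rg y b. Proof. exact: pnatM. Qed.

Lemma chir_sqr l : odd l -> chir l * chir l = 1.
Proof. by move=> ol; rewrite -rmorphM chi_sqr. Qed.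

(** A rough g is odd, so chi(g)^2 = 1 and the common factor drops out of the character. *)
Lemma mid_sqr X Y y m : (1 < y)%N -> (0 < m)%N -> (m <= X)%N ->
  mid X Y y m ^+ 2 = \sum_(1 <= g < X.+1) \sum_(1 <= x < X.+1) \sum_(1 <= t < X.+1)
    (pr3 Y y m g x t)%:R * (chir x * chir t).
Proof.
move=> y1 m0 mX.
pose H l : R := (mp Y y m l)%:R * chir l.
have -> : mid X Y y m = \sum_(1 <= l < X.+1) H l.
  by rewrite /mid big_mkcond; apply: eq_bigr => l _; rewrite /H; case: ifP; rewrite ?mul1r ?mul0r.
have H0 l : (X < l)%N -> H l = 0.
  move=> Xl; rewrite /H /mp; case: (boolP (l %| m)%N); last by rewrite andbF mul0r.
  by move=> /(dvdn_leq m0) lm; move: Xl; rewrite ltnNge (leq_trans lm mX).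
rewrite expr2 mulr_suml; under eq_bigr do rewrite mulr_sumr.
rewrite (@pair_gcd R (fun l1 l2 => H l1 * H l2)); last first.
  by move=> l1 l2 /orP[/H0 ->|/H0 ->]; rewrite ?mul0r ?mulr0.
apply: eq_bigr => g _; apply: eq_bigr => x _; apply: eq_bigr => t _.
case: (boolP (coprime x t)) => co; last by rewrite /pr3 (negbTE co) !mul0r.
rewrite mul1r /H.
have -> : pr3 Y y m g x t = mp Y y m (g * x) && mp Y y m (g * t).
  rewrite /pr3 /mp co !rghM /=.
  have e : (g * x * t %| m)%N = (g * x %| m)%N && (g * t %| m)%N.
    case: (posnP g) => [->|g0]; first by rewrite !mul0n andbb.
    apply/idP/andP => [h|[]].
      by split; apply: dvdn_trans h; [rewrite dvdn_mulr | rewrite mulnAC dvdn_mulr].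
    case/dvdnP => a ea hb; move: hb; rewrite ea.
    rewrite [X in (_ %| X)%N -> _]mulnCA dvdn_pmul2l// Gauss_dvdl 1?coprime_sym// => /dvdnP[b ->].
    by apply/dvdnP; exists b; ring.
  rewrite e; case: (rg y g); case: (rg y x); case: (rg y t); rewrite ?andbF//=.
  by case: (_ %| m)%N; case: (_ %| m)%N; rewrite ?andbF//= !andbA.
case: (boolP (mp _ _ _ (g * x)%N)) => h1; last by rewrite !mul0r.
case: (boolP (mp _ _ _ (g * t)%N)) => h2; last by rewrite /= !mul0r mulr0.
have og : odd g by case/and4P: h1; rewrite rghM => /andP[/(rgh_odd y1)].
by rewrite /= !mul1r !chiM !rmorphM /= mulrACA chir_sqr// mul1r.
Qed.

Lemma nop3M y a b : (0 < a)%N -> rg y a -> nop3 y (a * b) = nop3 y b.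
Proof.
move=> a0 /andP[_ /allP ra]; apply/nop3P/nop3P => -[h0 H].
  split=> [|p pp py p3]; first by move: h0; rewrite muln_gt0 => /andP[].
  by apply: contra (H p pp py p3) => pb; rewrite dvdn_mull.
split=> [|p pp py p3]; first by rewrite muln_gt0 a0.
rewrite Euclid_dvdM// negb_or (H p)// andbT; apply/negP => pa.
by have := ra p; rewrite mem_primes pp a0 pa inE ltnNge py => /(_ isT).
Qed.

Lemma rough_count : exists2 C : R, 0 <= C & forall y t, (5 <= y)%N -> (y <= t)%N ->
  \sum_(1 <= l < t.+1) (rg y l)%:R <= C * t%:R / ln y%:R.
Proof.
have [C C0 HC] := wt0_sum R; exists C => // y t y5 yt.
have := HC 1 y t y5 yt; rewrite subrr mul0r expR0 mulr1 => /(_ _)/le_trans H.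
apply: le_trans (H _ _ (lexx _)); first by apply: ler_sum => l _; exact: rgh_le.
lra.
Qed.

Lemma nop3_count : exists2 C : R, 0 <= C & forall y t, (5 <= y)%N -> (y <= t)%N ->
  \sum_(1 <= l < t.+1) (nop3 y l)%:R <= C * t%:R * wy R y.
Proof.
have [C C0 HC] := wt3_sum R; exists C => // y t y5 yt.
have := HC 1 y t y5 yt; rewrite subrr mul0r expR0 mulr1 => /(_ _)/le_trans H.
apply: le_trans (H _ _ (lexx _)); first by apply: ler_sum => l _; exact: nop3_le.
lra.
Qed.

Lemma sum_cut_le A B (F : nat -> R) : (forall n, 0 <= F n) ->
  \sum_(1 <= l < A.+1 | (l <= B)%N) F l <= \sum_(1 <= l < B.+1) F l.
Proof.
move=> F0; rewrite -big_filter; apply: sub_le_sum => // [|l].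
  by rewrite filter_uniq// iota_uniq.
by rewrite mem_filter !mem_index_iota !ltnS => /and3P[-> -> _].
Qed.

Lemma rough_logsum : exists2 C : R, 0 <= C & forall y w X, (5 <= y)%N -> (0 < w)%N ->
  \sum_(1 <= l < X.+1) (rg y l && (l <= y ^ w)%N)%:R / l%:R <= C * w%:R.
Proof.
have [C C0 HC] := wt0_logsum R; exists C => // y w X y5 w0.
have y1 : (1 < y)%N by apply: leq_trans y5.
have yw : (y <= y ^ w)%N by rewrite -{1}(expn1 y) leq_exp2l.
have H : \sum_(1 <= l < (y ^ w).+1) (rg y l)%:R / l%:R <= C * w%:R.
  have := HC 1 y (y ^ w)%N y5 yw; rewrite mul1r lr_pow// lnK ?posrE ?ltr0n// => h.
  apply: le_trans (h _); last lra.
  by apply: ler_sum => l _; rewrite ler_wpM2r ?invr_ge0// rgh_le.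
apply: le_trans H.
rewrite (eq_bigr (fun l => if (l <= y ^ w)%N then (rg y l)%:R / l%:R else 0)); last first.
  by move=> l _; case: (l <= _)%N; rewrite ?andbT ?andbF ?mul0r.
rewrite -big_mkcond; apply: sum_cut_le => l; exact: divr_ge0.
Qed.

(** On the logarithmic scale the window for g has length (b - a) ln y wherever x shifts it, and
    rough integers have density of order 1 / ln y, so the bound does not depend on x. The condition
    [x * y <= y ^ a] keeps g above y, where this density bound holds. *)
Lemma rough_window : exists2 C : R, 0 <= C & forall y a b x X, (5 <= y)%N -> (a <= b)%N -> (0 < x)%N ->
  (x * y <= y ^ a)%N ->
  \sum_(1 <= g < X.+1) [&& rg y g, (y ^ a < g * x)%N & (g * x <= y ^ b)%N]%:R / g%:R <= C * (b - a + 2)%:R.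
Proof.
have [C C0 HC] := rough_count; exists C => // y a b x X y5 ab x0 xy.
have y1 : (1 < y)%N by apply: leq_trans y5.
have l0 := ln_gt0_nat R y1; have lh := ln_nat_half R y1.
have x0' : (0 : R) < x%:R by rewrite ltr0n.
pose f l : R := ((x %| l)%N && rg y (l %/ x)%N)%:R.
have yab : (y ^ a <= y ^ b)%N by rewrite leq_exp2l.
have ya0 : (0 < y ^ a)%N by rewrite expn_gt0 (ltnW y1).
have F t : (y ^ a <= t <= y ^ b)%N -> \sum_(1 <= l < t.+1) f l <= C / (x%:R * ln y%:R) * t%:R.
  move=> /andP[at_ _].
  have -> : \sum_(1 <= l < t.+1) f l = \sum_(1 <= j < (t %/ x).+1) (rg y j)%:R.
    have := @sum_dvd R (fun l => (rg y (l %/ x)%N)%:R) x t x0.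
    under [X in _ = X -> _]eq_bigr do rewrite mulKn//.
    by move=> <-; rewrite [RHS]big_mkcond; apply: eq_bigr => l _; rewrite /f; case: ifP.
  have yt : (y <= t %/ x)%N by rewrite leq_divRL// mulnC (leq_trans xy).
  apply: le_trans (HC y _ y5 yt) _.
  have -> : C / (x%:R * ln y%:R) * t%:R = C / ln y%:R * (t%:R / x%:R) by field; rewrite !gt_eqF.
  rewrite mulrAC ler_wpM2l ?divr_ge0 ?(ltW l0)//.
  rewrite ler_pdivlMr// -natrM ler_nat; exact: leq_trunc_div.
have := @abel_inv_sum R f _ _ _ ya0 yab (fun l => ler0n _ _) F.
have -> : 1 + ln (y ^ b)%:R - ln (y ^ a)%:R = 1 + (b - a)%:R * ln y%:R :> R.
  by rewrite !natrX !lnXn ?ltr0n ?(ltnW y1)// -addrA -mulrnBr// mulr_natl.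
move=> h.
have E : \sum_(1 <= g < X.+1) [&& rg y g, (y ^ a < g * x)%N & (g * x <= y ^ b)%N]%:R / g%:R <=
   x%:R * \sum_((y ^ a).+1 <= m < (y ^ b).+1) f m / m%:R.
  apply: (@le_trans _ _ (x%:R * \sum_(1 <= m < (y ^ b).+1) (y ^ a < m)%N%:R * (f m / m%:R))); last first.
    rewrite ler_wpM2l ?(ltW x0')//.
    rewrite (@big_cat_nat _ _ _ (y ^ a).+1) //= big_nat big1 ?add0r.
      by apply: ler_sum => l _; rewrite ler_piMl ?divr_ge0// lern1 leq_b1.
    by move=> l /andP[_ la]; rewrite ltnNge -ltnS la mul0r.
  have := @sum_dvd R (fun m => (y ^ a < m)%N%:R * ((rg y (m %/ x)%N)%:R / m%:R)) x (y ^ b)%N x0.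
  rewrite big_mkcond => e; rewrite [X in _ <= _ * X](eq_bigr (fun m => if (x %| m)%N then (y ^ a < m)%N%:R * ((rg y (m %/ x)%N)%:R / m%:R) else 0)); last first.
    by move=> m _; rewrite /f; case: ifP => _; rewrite ?mul0r ?mulr0.
  rewrite e mulr_sumr.
  apply: (@le_trans _ _ (\sum_(1 <= g < X.+1 | (g <= y ^ b %/ x)%N) (rg y g && (y ^ a < g * x)%N)%:R / g%:R)).
    rewrite [leRHS]big_mkcond; apply: ler_sum => g _; rewrite leq_divRL//.
    by case: (g * x <= y ^ b)%N; rewrite ?andbF ?andbT// mul0r.
  apply: le_trans (@sum_cut_le X _ _ _) _; first by move=> g; exact: divr_ge0.
  apply: ler_sum_nat => g /andP[g0 _]; rewrite mulKn// [(x * g)%N]mulnC.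
  have g0' : (0 : R) < g%:R by rewrite ltr0n.
  rewrite andbC natrM; case: (_ < _)%N; case: (rg y g); rewrite /= ?mul0r ?mulr0// !mul1r le_eqVlt.
  by apply/orP; left; apply/eqP; field; rewrite !gt_eqF.
apply: (le_trans E); apply: le_trans (ler_wpM2l (ltW x0') h) _.
have -> : x%:R * (C / (x%:R * ln y%:R) * (1 + (b - a)%:R * ln y%:R)) = C * ((ln y%:R)^-1 + (b - a)%:R).
  by field; rewrite !gt_eqF.
rewrite ler_wpM2l// natrD addrC lerD2l -[leLHS]div1r ler_pdivrMr//; lra.
Qed.
End MiddleMoment.

Section MomentParts.
Variable R : realType.
Notation chir n := ((chi n)%:~R : R).
Notation rg y := (rgh y).-nat.

Lemma exchange_big4 (F : nat -> nat -> nat -> nat -> R) A B :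
  \sum_(1 <= m < A) \sum_(1 <= g < B) \sum_(1 <= x < B) \sum_(1 <= t < B) F m g x t =
  \sum_(1 <= g < B) \sum_(1 <= x < B) \sum_(1 <= t < B) \sum_(1 <= m < A) F m g x t.
Proof.
rewrite exchange_big; apply: eq_bigr => g _; rewrite exchange_big; apply: eq_bigr => x _.
by rewrite exchange_big.
Qed.

Lemma pr3_bound Y y v m g x t : (0 < m)%N -> (m < y ^ (2 * v).+1)%N -> (0 < y)%N ->
  (pr3 Y y m g x t)%:R <=
  ([&& rg y g, (Y < g * x)%N & (g * x <= y ^ v.+1)%N]%:R * (rg y x)%:R * (rg y t)%:R) * (g * x * t %| m)%:R :> R.
Proof.
move=> m0 mX y0; rewrite /pr3.
case: (boolP (g * x * (g * x) < m`_(rgh y))%N) => [h|_]; last by rewrite !andbF !mulr_ge0.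
have -> : (g * x <= y ^ v.+1)%N.
  rewrite -leq_sqr -!mulnn -expnD ltnW// (leq_trans h)//.
  apply: leq_trans (dvdn_leq m0 (dvdn_part _ _)) _; apply: leq_trans (ltnW mX) _.
  by rewrite leq_pexp2l//; lia.
rewrite -!natrM !mulnb ler_nat.
by case: (coprime x t); case: (rg y g); case: (Y < g * x)%N; case: (rg y x); case: (rg y t); case: (_ %| m)%N; rewrite ?andbF ?leq_b1.
Qed.

(** Pairs whose cofactors x and t are both at most y^w are counted without using the character.
    Writing m = g x t c, the sum over c gives the sifted density, the window for g x the factor s +
    3, and the rough sums over x and t a factor w each; no power of v appears. *)
Lemma part1 : exists2 C : R, 0 <= C & forall y v s w X, (5 <= y)%N -> (0 < w)%N -> (s + w + 2 <= v)%N ->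
  (y ^ (2 * v) <= X)%N -> (X < y ^ (2 * v).+1)%N ->
  \sum_(1 <= m < X.+1) (nop3 y m)%:R * \sum_(1 <= g < X.+1) \sum_(1 <= x < X.+1) \sum_(1 <= t < X.+1)
    ((x <= y ^ w)%N && (t <= y ^ w)%N)%:R * (pr3 (y ^ (v - s)) y m g x t)%:R
  <= C * X%:R * wy R y * ((s + 3)%:R * w%:R ^+ 2).
Proof.
have [C1 C10 H1] := nop3_count R; have [C2 C20 H2] := rough_logsum R; have [C3 C30 H3] := rough_window R.
exists (C1 * C2 ^+ 2 * C3) => [|y v s w X y5 w0 svw Xl Xu].
  exact: mulr_ge0 (mulr_ge0 C10 (exprn_ge0 _ C20)) C30.
have y1 : (1 < y)%N by apply: leq_trans y5.
have y0 : (0 < y)%N by apply: ltnW.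
set Y := (y ^ (v - s))%N; set W := (y ^ w)%N.
pose a g x : R := [&& rg y g, (Y < g * x)%N & (g * x <= y ^ v.+1)%N]%:R.
pose b x : R := (rg y x && (x <= W)%N)%:R.
have w0' := wy_gt0 R y.
apply: (@le_trans _ _ (\sum_(1 <= m < X.+1) \sum_(1 <= g < X.+1) \sum_(1 <= x < X.+1) \sum_(1 <= t < X.+1)
    a g x * b x * b t * ((g * x * t %| m)%:R * (nop3 y m)%:R))).
  apply: ler_sum_nat => m /andP[m0 mX]; rewrite mulr_sumr; apply: ler_sum => g _.
  rewrite mulr_sumr; apply: ler_sum => x _; rewrite mulr_sumr; apply: ler_sum => t _.
  have mX' : (m < y ^ (2 * v).+1)%N by apply: leq_ltn_trans Xu.
  have := @pr3_bound Y y v m g x t m0 mX' y0; rewrite -/(a g x).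
  move=> h; rewrite /b; case: (x <= W)%N; case: (t <= W)%N;
    rewrite /= ?andbF ?andbT ?mul0r ?mulr0 ?mul0r ?mul1r ?lexx//.
  by rewrite mulrC [leRHS]mulrA ler_wpM2r.
rewrite exchange_big4.
apply: (@le_trans _ _ (\sum_(1 <= g < X.+1) \sum_(1 <= x < X.+1) \sum_(1 <= t < X.+1)
    (C1 * X%:R * wy R y) * ((a g x / g%:R) * (b x / x%:R) * (b t / t%:R)))).
  apply: ler_sum_nat => g /andP[g0 _]; apply: ler_sum_nat => x /andP[x0 _]; apply: ler_sum_nat => t /andP[t0 _].
  rewrite -mulr_sumr.
  have -> : C1 * X%:R * wy R y * ((a g x / g%:R) * (b x / x%:R) * (b t / t%:R)) =
     a g x * b x * b t * (C1 * (X%:R / (g * x * t)%:R) * wy R y).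
    rewrite !natrM; field; rewrite !pnatr_eq0; lia.
  rewrite /a /b; case: (boolP [&& _, _ & _]) => [/and3P[_ _ gx]|_]; last by rewrite !mul0r.
  case: (boolP (_ && _)) => [/andP[_ xW]|_]; last by rewrite !mulr0 !mul0r.
  case: (boolP (_ && _)) => [/andP[_ tW]|_]; last by rewrite !mulr0 !mul0r.
  rewrite !mul1r; have q0 : (0 < g * x * t)%N by rewrite !muln_gt0 g0 x0.
  apply: (@le_trans _ _ (\sum_(1 <= c < (X %/ (g * x * t)).+1) (nop3 y c)%:R)).
    have := @sum_dvd R (fun m => (nop3 y m)%:R) _ X q0; rewrite big_mkcond => e.
    rewrite (eq_bigr (fun m => if (g * x * t %| m)%N then (nop3 y m)%:R else 0)); last first.
      by move=> m _; case: ifP => _; rewrite ?mul1r ?mul0r.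
    rewrite e; apply: ler_sum_nat => c /andP[c0 _]; rewrite ler_nat.
    case: (boolP (nop3 y (g * x * t * c))) => // /nop3P[_ h]; rewrite (_ : nop3 y c)//; apply/nop3P; split => // p pp py p3.
    by apply: contra (h p pp py p3) => pc; rewrite dvdn_mull.
  apply: le_trans (H1 y _ y5 _) _.
    rewrite leq_divRL//; apply: leq_trans Xl.
    have : (g * x * t <= y ^ v.+1 * y ^ w)%N by rewrite leq_mul.
    rewrite -expnD => h; apply: (@leq_trans (y * y ^ (v.+1 + w))%N); first by rewrite leq_mul2l h orbT.
    by rewrite -expnS leq_pexp2l//; lia.
  rewrite ler_wpM2r ?(ltW w0')// ler_wpM2l// ler_pdivlMr ?ltr0n// -natrM ler_nat; exact: leq_trunc_div.
have k0 : 0 <= C1 * X%:R * wy R y by rewrite !mulr_ge0// ltW.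
have -> : C1 * C2 ^+ 2 * C3 * X%:R * wy R y * ((s + 3)%:R * w%:R ^+ 2) =
   C1 * X%:R * wy R y * ((C3 * (s + 3)%:R) * (C2 * w%:R) * (C2 * w%:R)) by ring.
under eq_bigr do under eq_bigr do rewrite -mulr_sumr.
under eq_bigr do rewrite -mulr_sumr.
rewrite -mulr_sumr ler_wpM2l//.
set B := \sum_(1 <= t < X.+1) b t / t%:R.
have HB : B <= C2 * w%:R by exact: H2.
have B0 : 0 <= B by apply: sumr_ge0 => t _; exact: divr_ge0.
under eq_bigr do under eq_bigr do rewrite -mulr_sumr -/B.
under eq_bigr do rewrite -mulr_suml.
rewrite -mulr_suml ler_pM//.
  by rewrite sumr_ge0// => g _; rewrite sumr_ge0// => x _; rewrite mulr_ge0 ?divr_ge0.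
rewrite exchange_big /=; under eq_bigr do rewrite -mulr_suml.
apply: (@le_trans _ _ (\sum_(1 <= x < X.+1) C3 * (s + 3)%:R * (b x / x%:R))); last first.
  by rewrite -mulr_sumr ler_wpM2l ?mulr_ge0.
apply: ler_sum_nat => x /andP[x0 _]; rewrite /b; case: (boolP (_ && _)) => [/andP[_ xW]|_]; last by rewrite mul0r !mulr0.
rewrite ler_wpM2r ?divr_ge0//.
have -> : (s + 3 = v.+1 - (v - s) + 2)%N by lia.
apply: (H3 y (v - s)%N v.+1 x X y5) => //; first by lia.
apply: (@leq_trans (y ^ w * y)%N); first by rewrite leq_mul2r xW orbT.
by rewrite -expnSr leq_pexp2l//; lia.
Qed.

(** With m = t c the inequalities on t become monotone: two lower bounds and one upper bound. This
    is what allows [sum_updown] to isolate a character sum over t. *)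
Lemma pr3_mul Y y g x t c : (0 < t)%N -> (0 < c)%N -> rg y t ->
  pr3 Y y (t * c) g x t = [&& rg y g, rg y x, (g * x %| c)%N & (Y < g * x)%N] &&
    ([&& (g * x * (g * x) < t * c`_(rgh y))%N, (Y < g * t)%N & (g * (g * t) < c`_(rgh y))%N] && coprime x t).
Proof.
move=> t0 c0 rt; rewrite /pr3 rt.
have -> : ((t * c)`_(rgh y))%N = (t * c`_(rgh y))%N by rewrite partnM// part_pnat_id.
have -> : (g * x * t %| t * c)%N = (g * x %| c)%N by rewrite [(t * c)%N]mulnC dvdn_pmul2r.
have -> : (g * t * (g * t) = t * (g * (g * t)))%N by ring.
rewrite ltn_pmul2l//.
case: (coprime x t); case: (rg y g); case: (rg y x); case: (_ %| _)%N; case: (Y < g * x)%N; rewrite ?andbF ?andbT//=.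
Qed.

Lemma nrdiv_pairs y c X : (0 < c)%N -> (c <= X)%N ->
  \sum_(1 <= g < X.+1) \sum_(1 <= x < X.+1) [&& rg y g, rg y x & (g * x %| c)%N]%:R <= nrdiv R y c ^+ 2.
Proof.
move=> c0 cX; rewrite expr2 -(nrdiv_widen R y c0 cX) mulr_suml big_mkcond [leRHS]big_mkcond.
apply: ler_sum => g _; case: (boolP (g %| c)%N) => gc; last first.
  rewrite big1// => x _; case: (boolP (g * x %| c)%N); rewrite ?andbF// => h.
  by move: gc; rewrite (dvdn_trans _ h)// dvdn_mulr.
rewrite mulr_sumr [leRHS]big_mkcond; apply: ler_sum => x _.
case: (boolP (x %| c)%N) => xc; last first.
  case: (boolP (g * x %| c)%N); rewrite ?andbF// => h.
  by move: xc; rewrite (dvdn_trans _ h)// dvdn_mull.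
rewrite -natrM mulnb ler_nat andbA.
by case: (rg y g); case: (rg y x); case: (_ %| c)%N.
Qed.

(** The sum over t reduces to two initial sums, estimated by [achi_coprime] and [achi_le]. Since t
    exceeds y^(16 D + 27), the sieve remainder is smaller than the length by a power of y; [y0]
    depends on v so that y also absorbs ln X. *)
Lemma updown_chi : exists2 C : R, 0 <= C & forall D v : nat, exists y0, forall y X, (y0 <= y)%N ->
  (0 < X)%N -> (X < y ^ (2 * v).+1)%N -> forall (U Dn : pred nat) x c n, rg y x -> (x <= X)%N -> (0 < c)%N ->
  (forall t, U t -> U t.+1) -> (forall t, Dn t.+1 -> Dn t) ->
  (forall t, U t -> (y ^ (16 * D + 27) < t)%N) -> (forall t, Dn t -> (t * c <= X)%N) ->
  `|\sum_(1 <= t < n.+1) (U t && Dn t)%:R * ((rg y t && coprime x t)%:R * chir t)| <=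
  C / (ln y%:R * 16 ^+ D) * (X%:R / c%:R).
Proof.
have [C C0 HC] := achi_le R; exists (2 * (C + 1)) => [|D v]; first lra.
have [y0 Hy0] := ln_pow_small 2 ((2 * v + 5)%:R * 16 ^+ D : R).
exists (y0 + 5)%N => y X hy X0 Xu U Dn x c n rx xX c0 HU HD UW DX.
have y1 : (1 < y)%N by lia.
have y2 : (2 < y)%N by lia.
have {}Hy0 := Hy0 y (leq_trans (leq_addr _ _) hy).
have l0 := ln_gt0_nat R y1; have lh := ln_nat_half R y1.
have y0' : (0 : R) < y%:R by rewrite ltr0n; lia.
have c0' : (0 : R) < c%:R by rewrite ltr0n.
have p16 : 0 < 16 ^+ D :> R by rewrite exprn_gt0.
have lX : ln X%:R <= (2 * v).+1%:R * ln y%:R :> R.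
  apply: le_trans (ler_ln_nat R X0 (ltnW Xu)) _.
  by rewrite natrX lnXn// mulr_natl.
have XC0 : 0 <= X%:R / c%:R :> R by rewrite divr_ge0.
have K0 : 0 <= 2 * (C + 1) / (ln y%:R * 16 ^+ D).
  by apply: divr_ge0; [lra | rewrite mulr_ge0 ?ltW].
(* When [y ^ (16 * D + 27) * c] exceeds [X], no t satisfies both [U] and [Dn] and the sum is
   empty. *)
case: (leqP (y ^ (16 * D + 27) * c) X) => hW; last first.
  rewrite big1 ?normr0; [exact: mulr_ge0 | move=> t _].
  case: (boolP (U t)) => Ut; last by rewrite mul0r.
  case: (boolP (Dn t)) => Dt; last by rewrite mul0r.
  have := DX t Dt; have := UW t Ut => h1 h2.
  have : (y ^ (16 * D + 27) * c <= t * c)%N by rewrite leq_mul2r ltnW ?orbT.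
  by move=> h3; move: (leq_ltn_trans (leq_trans h3 h2) hW); rewrite ltnn.
have [a [b [ab bD ->]]] := sum_updown (fun t => (rg y t && coprime x t)%:R * chir t) n HU HD.
have bX : b%:R <= X%:R / c%:R :> R.
  rewrite ler_pdivlMr// -natrM ler_nat; case: bD => [->|/DX//]; by rewrite mul0n.
have aX : a%:R <= X%:R / c%:R :> R by apply: le_trans bX; rewrite ler_nat.
have pw : 2 * y%:R ^+ (16 * D + 25) <= 2 / y%:R * (X%:R / c%:R) :> R.
  have -> : 2 / y%:R * (X%:R / c%:R) = 2 * (X%:R / c%:R / y%:R) :> R by ring.
  rewrite ler_wpM2l// ler_pdivlMr// ler_pdivlMr// -natrX -!natrM ler_nat; apply: leq_trans hW.
  by rewrite leq_mul2r -expnSr leq_pexp2l ?orbT// ?(ltnW y1)// -addnS leq_add2l.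
have S b' : b'%:R <= X%:R / c%:R :> R ->
  `|\sum_(1 <= t < b'.+1) (rg y t && coprime x t)%:R * chir t| <= (C + 1) / (ln y%:R * 16 ^+ D) * (X%:R / c%:R).
  move=> h; apply: le_trans (achi_coprime R b' y2 rx xX) _.
  apply: le_trans (lerD (HC D y b' y1) (lexx _)) _.
  apply: (@le_trans _ _ ((C / (ln y%:R * 16 ^+ D) + 2 / y%:R + ln X%:R / y%:R) * (X%:R / c%:R))).
    rewrite [leRHS]mulrDl [X in _ <= X + _]mulrDl; apply: lerD; first apply: lerD => //.
      by rewrite mulrAC ler_wpM2l// divr_ge0// mulr_ge0// ltW.
    have -> : b'%:R / y%:R * ln X%:R = ln X%:R / y%:R * b'%:R :> R by ring.
    by rewrite ler_wpM2l// divr_ge0 ?ln_nat_ge0.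
  rewrite ler_wpM2r// -addrA [leRHS]mulrDl lerD2l -mulrDl ler_pdivrMr// mul1r mulrC ler_pdivlMr ?mulr_gt0//.
  apply: le_trans Hy0; rewrite natrD.
  move: lX; rewrite -natr1 => lX.
  have : (2 + ln X%:R) * (ln y%:R * 16 ^+ D) <= ((2 * v)%:R + 5) * ln y%:R * (ln y%:R * 16 ^+ D) :> R.
    by rewrite ler_wpM2r ?mulr_ge0 ?(ltW l0) ?(ltW p16)//; lra.
  by rewrite expr2; lra.
apply: le_trans (ler_normB _ _) _; have := lerD (S b bX) (S a aX).
by move=> /le_trans; apply; apply: le_of_eq; ring.
Qed.
End MomentParts.

Section MomentTotal.
Variable R : realType.
Notation chir n := ((chi n)%:~R : R).
Notation rg y := (rgh y).-nat.

Lemma pr3_dvd Y y m g x t : pr3 Y y m g x t -> (t %| m)%N /\ rg y t.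
Proof.
rewrite /pr3 => /andP[_] /andP[_] /andP[_] /andP[rt] /andP[h _]; split => //.
by apply: dvdn_trans h; rewrite dvdn_mull.
Qed.

(** Pairs with a large member t. For fixed c, g and x the sum over t has the cancellation 16^(-D),
    and the pairs (g, x) number at most the square of the rough divisor count of c. The mean of that
    square costs [expR (4 * lr)], a power of v that the depth D is later chosen to beat. *)
Lemma part2 : exists2 C : R, 0 <= C & forall D v, exists y0, forall y X Y, (y0 <= y)%N -> (y <= X)%N ->
  (X < y ^ (2 * v).+1)%N ->
  `|\sum_(1 <= m < X.+1) (nop3 y m)%:R * \sum_(1 <= g < X.+1) \sum_(1 <= x < X.+1) \sum_(1 <= t < X.+1)
    ((y ^ (16 * D + 27) < t)%N && (x < t)%N)%:R * ((pr3 Y y m g x t)%:R * (chir x * chir t))|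
  <= C * X%:R * wy R y * (expR (4 * lr R y X) / 16 ^+ D).
Proof.
have [C1 C10 H1] := updown_chi R; have [C2 C20 H2] := wt3_logsum R.
exists (C1 * C2) => [|D v]; first exact: mulr_ge0.
have [y0 Hy] := H1 D v; exists (y0 + 5)%N => y X Y hy yX Xu.
have y5 : (5 <= y)%N := leq_trans (leq_addl _ _) hy.
have y1 : (1 < y)%N by apply: leq_trans y5.
have X0 : (0 < X)%N by apply: leq_trans yX; apply: ltnW.
have l0 := ln_gt0_nat R y1.
set W := (y ^ (16 * D + 27))%N.
pose U c g x := fun t => [&& (W < t)%N, (x < t)%N, (g * x * (g * x) < t * c`_(rgh y))%N & (Y < g * t)%N].
pose Dn c g := fun t => (t * c <= X)%N && (g * (g * t) < c`_(rgh y))%N.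
pose V c g x := \sum_(1 <= t < X.+1) (U c g x t && Dn c g t)%:R * ((rg y t && coprime x t)%:R * chir t).
pose A c g x := [&& rg y g, rg y x, (g * x %| c)%N & (Y < g * x)%N].
have step : \sum_(1 <= m < X.+1) (nop3 y m)%:R * \sum_(1 <= g < X.+1) \sum_(1 <= x < X.+1) \sum_(1 <= t < X.+1)
    ((W < t)%N && (x < t)%N)%:R * ((pr3 Y y m g x t)%:R * (chir x * chir t)) =
   \sum_(1 <= c < X.+1) (nop3 y c)%:R * \sum_(1 <= g < X.+1) \sum_(1 <= x < X.+1) (A c g x)%:R * chir x * V c g x.
  transitivity (\sum_(1 <= m < X.+1) \sum_(1 <= g < X.+1) \sum_(1 <= x < X.+1) \sum_(1 <= t < X.+1)
      (nop3 y m)%:R * (((W < t)%N && (x < t)%N)%:R * ((pr3 Y y m g x t)%:R * (chir x * chir t)))).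
    by apply: eq_bigr => m _; rewrite mulr_sumr; apply: eq_bigr => g _; rewrite mulr_sumr; apply: eq_bigr => x _; rewrite mulr_sumr.
  transitivity (\sum_(1 <= c < X.+1) \sum_(1 <= g < X.+1) \sum_(1 <= x < X.+1) \sum_(1 <= t < X.+1)
      (nop3 y c)%:R * ((A c g x)%:R * chir x * ((U c g x t && Dn c g t)%:R * ((rg y t && coprime x t)%:R * chir t)))); last first.
    by apply: eq_bigr => m _; rewrite mulr_sumr; apply: eq_bigr => g _; rewrite mulr_sumr; apply: eq_bigr => x _; rewrite !mulr_sumr.
  rewrite [LHS]exchange_big4 [RHS]exchange_big4; apply: eq_bigr => g _; apply: eq_bigr => x _; apply: eq_big_nat => t /andP[t0 _].
  case: (boolP (rg y t)) => rt; last first.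
    rewrite big1 => [|m _]; first by rewrite big1// => c _; rewrite !mul0r !mulr0.
    by case: (boolP (pr3 _ _ _ _ _ _)) => [/pr3_dvd[_]|_]; rewrite ?(negbTE rt)// !mul0r !mulr0.
  set F := fun m => (nop3 y m)%:R * (((W < t)%N && (x < t)%N)%:R * ((pr3 Y y m g x t)%:R * (chir x * chir t))).
  transitivity (\sum_(1 <= m < X.+1 | (t %| m)%N) F m).
    rewrite [RHS]big_mkcond; apply: eq_bigr => m _; rewrite /F; case: ifP => // tm.
    by case: (boolP (pr3 _ _ _ _ _ _)) => [/pr3_dvd[]|_]; rewrite ?tm// !mul0r !mulr0.
  rewrite sum_dvd//.
  transitivity (\sum_(1 <= c < X.+1) (t * c <= X)%N%:R * F (t * c)%N).
    rewrite [RHS](@big_cat_nat _ _ _ (X %/ t).+1) //=; last by rewrite ltnS leq_div.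
    rewrite [X in _ = _ + X]big_nat [X in _ = _ + X]big1 ?addr0; last first.
      by move=> c /andP[h _]; rewrite mulnC -leq_divRL// leqNgt h mul0r.
    by apply: eq_big_nat => c /andP[_ h]; rewrite mulnC -leq_divRL// -ltnS h mul1r.
  apply: eq_big_nat => c /andP[c0 _]; rewrite /F nop3M// pr3_mul// /A /U /Dn /=.

  case: (nop3 y c); rewrite /= ?mul0r ?mulr0 ?mul1r//.
  case: ([&& rg y g, _, _ & _]); rewrite /= ?mul0r ?mulr0 ?mul1r//.
  case: (coprime x t); rewrite /= ?andbF ?mul0r ?mulr0 ?mul1r//.
  case: (W < t)%N; rewrite /= ?mul0r ?mulr0 ?mul1r//.
  case: (x < t)%N; rewrite /= ?mul0r ?mulr0 ?mul1r//.
  case: (_ < t * _)%N; rewrite /= ?mul0r ?mulr0 ?mul1r//.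
  case: (Y < g * t)%N; rewrite /= ?mul0r ?mulr0 ?mul1r//.
  by case: (t * c <= X)%N; case: (_ < _)%N; rewrite /= ?mul0r ?mulr0 ?mul1r ?mulr1.
rewrite step.
have K0 : 0 <= C1 / (ln y%:R * 16 ^+ D) by rewrite divr_ge0// mulr_ge0 ?exprn_ge0 ?(ltW l0).
apply: le_trans (ler_norm_sum _ _ _) _.
apply: (@le_trans _ _ (\sum_(1 <= c < X.+1) C1 / (ln y%:R * 16 ^+ D) * X%:R * (wt (a3 R) 4 y c / c%:R))).
  apply: ler_sum_nat => c /andP[c0 cX]; rewrite normrM normr_nat.
  have B : `|\sum_(1 <= g < X.+1) \sum_(1 <= x < X.+1) (A c g x)%:R * chir x * V c g x| <=
      nrdiv R y c ^+ 2 * (C1 / (ln y%:R * 16 ^+ D) * (X%:R / c%:R)).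
    apply: le_trans (ler_wpM2r _ (nrdiv_pairs R y c0 cX)); last by rewrite mulr_ge0// divr_ge0.
    rewrite mulr_suml; apply: le_trans (ler_norm_sum _ _ _) _; apply: ler_sum_nat => g /andP[g0 _].
    rewrite mulr_suml; apply: le_trans (ler_norm_sum _ _ _) _; apply: ler_sum_nat => x /andP[x0 xX].
    rewrite !normrM normr_nat /A.
    case: (boolP [&& rg y g, rg y x, (g * x %| c)%N & (Y < g * x)%N]) => [/and4P[-> rx -> _]|_]; last first.
      by rewrite !mul0r mulr_ge0// mulr_ge0// divr_ge0.
    rewrite rx !mul1r; apply: le_trans (ler_wpM2r (normr_ge0 _) (chi_norm R x)) _; rewrite mul1r.
    apply: Hy => //; first exact: leq_trans (leq_addr _ _) hy.
    - move=> t /and4P[h1 h2 h3 h4]; rewrite /U !leqW//=; apply/andP; split.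
        by apply: (leq_trans h3); rewrite leq_mul2r leqnSn orbT.
      by apply: (leq_trans h4); rewrite leq_mul2l leqnSn orbT.
    - move=> t /andP[h1 h2]; apply/andP; split.
        by apply: leq_trans h1; rewrite leq_mul2r leqnSn orbT.
      by apply: leq_ltn_trans h2; rewrite !leq_mul2l leqnSn !orbT.
    - by move=> t /and4P[].
    - by move=> t /andP[].
  apply: le_trans (ler_wpM2l (ler0n _ _) B) _.
  have := nop3_nrdiv2 R y c; set w := wt _ _ _ _ => h.
  have c0' : (0 : R) < c%:R by rewrite ltr0n.
  have -> : C1 / (ln y%:R * 16 ^+ D) * X%:R * (w / c%:R) = w * (C1 / (ln y%:R * 16 ^+ D) * (X%:R / c%:R)) by ring.
  rewrite [leLHS]mulrA; apply: ler_wpM2r => //; apply: mulr_ge0 => //; exact: divr_ge0.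
rewrite -mulr_sumr; have z4 : 0 <= (4 : R) <= 4 by rewrite lexx ler0n.
apply: le_trans (ler_wpM2l (mulr_ge0 K0 (ler0n _ X)) (H2 4 y X y5 yX z4)) _.
by apply: le_of_eq; field; rewrite !gt_eqF ?exprn_gt0.
Qed.

(** Either both cofactors are at most [W], or one of them is the larger and exceeds [W]: coprimality
    rules out equal cofactors above 1. Symmetry gives the factor 2 in front of [P2]. *)
Lemma mid_moment : exists2 C : R, 0 <= C & forall D v s, (s + 16 * D + 29 <= v)%N -> exists y0, forall y X, (y0 <= y)%N ->
  (y ^ (2 * v) <= X)%N -> (X < y ^ (2 * v).+1)%N ->
  \sum_(1 <= m < X.+1) (nop3 y m)%:R * mid R X (y ^ (v - s)) y m ^+ 2 <=
  C * X%:R * wy R y * ((s + 3)%:R * (16 * D + 27)%:R ^+ 2 + (2 * v).+1%:R ^+ 4 / 16 ^+ D).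
Proof.
have [C1 C10 H1] := part1 R; have [C2 C20 H2] := part2.
exists (C1 + 2 * C2) => [|D v s vs]; first lra.
have [y0 Hy] := H2 D v; exists (y0 + 5)%N => y X hy Xl Xu.
have y5 : (5 <= y)%N := leq_trans (leq_addl _ _) hy.
have y1 : (1 < y)%N by apply: leq_trans y5.
have yX : (y <= X)%N by apply: leq_trans Xl; rewrite -{1}[y]expn1 leq_pexp2l; lia.
set W := (y ^ (16 * D + 27))%N; set Y := (y ^ (v - s))%N.
have W0 : (0 < W)%N by rewrite expn_gt0 (ltnW y1).
pose Q m g x t : R := (pr3 Y y m g x t)%:R * (chir x * chir t).
pose P1 m := \sum_(1 <= g < X.+1) \sum_(1 <= x < X.+1) \sum_(1 <= t < X.+1)
    ((x <= W)%N && (t <= W)%N)%:R * (pr3 Y y m g x t)%:R : R.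
pose P2 m := \sum_(1 <= g < X.+1) \sum_(1 <= x < X.+1) \sum_(1 <= t < X.+1)
    ((W < t)%N && (x < t)%N)%:R * Q m g x t.
have pt m : (0 < m)%N -> (m < X.+1)%N -> mid R X Y y m ^+ 2 <= P1 m + 2 * P2 m.
  move=> m0 mX; rewrite mid_sqr//.
  have sym : P2 m = \sum_(1 <= g < X.+1) \sum_(1 <= x < X.+1) \sum_(1 <= t < X.+1)
      ((W < x)%N && (t < x)%N)%:R * Q m g x t.
    apply: eq_bigr => g _; rewrite exchange_big; apply: eq_bigr => x _; apply: eq_bigr => t _.
    congr (_ * _); rewrite /Q [chir t * _]mulrC; congr (_%:R * _).
    rewrite /pr3 coprime_sym -!mulnA [(t * x)%N]mulnC.
    case: (coprime _ _); case: (rg y g); case: (rg y x); case: (rg y t); rewrite ?andbF//=.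
    case: (_ %| _)%N => //=.
    by case: (Y < g * x)%N; case: (Y < g * t)%N; rewrite ?andbF//= andbC.
  have -> : 2 * P2 m = P2 m + P2 m by ring.
  rewrite {2}sym addrA /P1 /P2 -!big_split; apply: ler_sum => g _ /=.
  rewrite -!big_split; apply: ler_sum => x _ /=; rewrite -!big_split; apply: ler_sum_nat => t /andP[t0 _] /=.
  rewrite /Q; case: (boolP (pr3 _ _ _ _ _ _)) => [h|_]; last by rewrite !mul0r !mulr0 !addr0.
  rewrite !mul1r mulr1.
  have chiu : chir x * chir t <= 1.
    by rewrite (le_trans (ler_norm _))// normrM -[leRHS]mulr1 ler_pM// chi_norm.
  have cop : coprime x t by case/andP: h.
  case: (leqP x W) => xW; case: (leqP t W) => tW /=.
  - by rewrite !mul0r !addr0.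
  - by rewrite (leq_ltn_trans xW tW) mul0r mul1r add0r addr0.
  - by rewrite (leq_ltn_trans tW xW) !mul0r mul1r !add0r.
  case: (ltngtP x t) => xt; rewrite ?mul0r ?mul1r ?add0r ?addr0//.
  move: cop; rewrite xt /coprime gcdnn => /eqP t1.
  by move: tW; rewrite t1 ltnNge W0.
apply: (@le_trans _ _ (\sum_(1 <= m < X.+1) (nop3 y m)%:R * P1 m + 2 * \sum_(1 <= m < X.+1) (nop3 y m)%:R * P2 m)).
  rewrite mulr_sumr -big_split; apply: ler_sum_nat => m /andP[m0 mX] /=.
  have -> : (nop3 y m)%:R * P1 m + 2 * ((nop3 y m)%:R * P2 m) = (nop3 y m)%:R * (P1 m + 2 * P2 m) by ring.
  by rewrite ler_wpM2l// pt.
have e1 : (0 < 16 * D + 27)%N by rewrite addnS.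
have e2 : (s + (16 * D + 27) + 2 <= v)%N by move: vs; clear; lia.
have {}h1 : \sum_(1 <= m < X.+1) (nop3 y m)%:R * P1 m <= C1 * X%:R * wy R y * ((s + 3)%:R * (16 * D + 27)%:R ^+ 2).
  exact: (H1 y v s (16 * D + 27)%N X y5 e1 e2 Xl Xu).
have := Hy y X Y (leq_trans (leq_addr _ _) hy) yX Xu; rewrite -/(P2 _) -/W => h2.
have {}h2 : \sum_(1 <= m < X.+1) (nop3 y m)%:R * P2 m <= C2 * X%:R * wy R y * (expR (4 * lr R y X) / 16 ^+ D).
  by apply: le_trans (ler_norm _) h2.
have e4 : expR (4 * lr R y X) <= (2 * v).+1%:R ^+ 4.
  have -> : (2 * v).+1%:R ^+ 4 = expR (4 * ln (2 * v).+1%:R) :> R.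
    by rewrite mulr_natl -lnXn ?ltr0n// lnK// posrE exprn_gt0// ltr0n.
  rewrite ler_expR ler_wpM2l// -(lr_pow R y1 (isT : (0 < (2 * v).+1)%N)).
  by apply: lr_mono; rewrite ?(ltnW Xu)// (leq_trans y1).
have w0 := wy_gt0 R y.
have {}h2 : \sum_(1 <= m < X.+1) (nop3 y m)%:R * P2 m <= C2 * X%:R * wy R y * ((2 * v).+1%:R ^+ 4 / 16 ^+ D).
  apply: (le_trans h2); rewrite ler_wpM2l//; first by rewrite !mulr_ge0// ltW.
  by rewrite ler_wpM2r// invr_ge0 exprn_ge0.
apply: le_trans (lerD h1 (ler_wpM2l _ h2)) _ => //.
set a := _ * _ ^+ 2; set b := _ ^+ 4 / _; set k := X%:R * wy R y.
have a0 : 0 <= a by rewrite mulr_ge0 ?exprn_ge0.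
have b0 : 0 <= b by rewrite divr_ge0 ?exprn_ge0.
have k0 : 0 <= k by rewrite mulr_ge0// ltW.
have -> : (C1 + 2 * C2) * X%:R * wy R y * (a + b) = (C1 + 2 * C2) * (k * a + k * b) by rewrite /k; ring.
have -> : C1 * X%:R * wy R y * a + 2 * (C2 * X%:R * wy R y * b) = C1 * (k * a) + 2 * C2 * (k * b) by rewrite /k; ring.
have := mulr_ge0 k0 a0; have := mulr_ge0 k0 b0; move: (k * a) (k * b) => u w u0 w0'.
have := mulr_ge0 C10 u0; have := mulr_ge0 C20 w0'; lra.
Qed.
End MomentTotal.

(** * Integers with middle divisors, and integers with a large smooth part *)

Section MiddleCount.
Variable R : realType.
Notation chir n := ((chi n)%:~R : R).
Notation rg y := (rgh y).-nat.

Lemma wt_rough (a b : nat -> R) z y l : rg y l -> wt a z y l = wt b z y l.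
Proof.
move=> /andP[l0 /allP rl]; apply: cmul_ext => p pp pl; rewrite /hw leqNgt.
by have := rl p; rewrite mem_primes pp l0 pl inE => /(_ isT) ->.
Qed.

Definition nmid X Y y m : R := \sum_(1 <= l < X.+1) (mp Y y m l)%:R.

Lemma mp_le Y y v m l : (0 < m)%N -> (m < y ^ (2 * v).+1)%N -> (0 < y)%N -> mp Y y m l ->
  (l <= y ^ v.+1)%N.
Proof.
move=> m0 mX y0 /and4P[_ _ _ h]; rewrite -leq_sqr -!mulnn -expnD ltnW// (leq_trans h)//.
apply: leq_trans (dvdn_leq m0 (dvdn_part _ _)) _; apply: leq_trans (ltnW mX) _.
by rewrite leq_pexp2l//; lia.
Qed.

(** The mechanism of the multiplication table problem. A middle divisor factors m = l c with both
    factors allowed to reach y^(v - s), and the weight (3/4)^Omega has mean of order (v - s)^(-1/4)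
    on each of them: the saving occurs twice, giving (v - s)^(-1/2). The sum over the window of l
    costs only s + 3. *)
Lemma mid_count : exists2 C : R, 0 <= C & forall y v s X, (5 <= y)%N -> (0 < s)%N -> (s < v)%N ->
  (y ^ (2 * v) <= X)%N -> (X < y ^ (2 * v).+1)%N ->
  \sum_(1 <= m < X.+1) (nop3 y m)%:R * (nmid X (y ^ (v - s)) y m * wt (a3 R) (3 / 4) y m) <=
  C * X%:R * wy R y * ((s + 3)%:R * expR (- (ln (v - s)%:R / 2))).
Proof.
have [C1 C10 H1] := wt3_sum R; have [C2 C20 H2] := wt0_sum R.
exists (C1 * C2) => [|y v s X y5 s0 sv Xl Xu]; first exact: mulr_ge0.
have y1 : (1 < y)%N by apply: leq_trans y5.
have y0 : (0 < y)%N by apply: ltnW.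
have l0 := ln_gt0_nat R y1; have lh := ln_nat_half R y1; have w0 := wy_gt0 R y.
have z34 : 0 <= (3 / 4 : R) <= 4 by lra.
set Y := (y ^ (v - s))%N; set Z := (y ^ v.+1)%N.
set q := expR (- (ln (v - s)%:R / 4)) : R.
have q0 : 0 < q by exact: expR_gt0.
have vs0 : (0 < v - s)%N by rewrite subn_gt0.
have lrq t : (Y <= t)%N -> expR ((3 / 4 - 1) * lr R y t) <= q.
  move=> Yt; rewrite /q ler_expR -(lr_pow R y1 vs0).
  have Y1 : (1 < Y)%N by rewrite /Y -(expn0 y) ltn_exp2l.
  by have := lr_mono R y1 Y1 Yt; rewrite -/Y; lra.
pose f l : R := (rg y l)%:R * wt (fun=> 0) (3 / 4) y l.
have h0 p : 0 <= hw (a3 R) (3 / 4) y p.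
  by rewrite /hw; case: ifP => // _; lra.
have h00 p : 0 <= hw (fun=> 0 : R) (3 / 4) y p.
  by rewrite /hw; case: ifP => // _; lra.
have wt0 m : 0 <= wt (a3 R) (3 / 4) y m by exact: cmul_ge0.
have f0 l : 0 <= f l by rewrite mulr_ge0// cmul_ge0.
have yY : (y <= Y)%N by rewrite -{1}(expn1 y) leq_pexp2l.
have YZ : (Y <= Z)%N by rewrite leq_pexp2l//; lia.
apply: (@le_trans _ _ (\sum_(1 <= l < X.+1) \sum_(1 <= m < X.+1 | (l %| m)%N)
    ((Y < l)%N && (l <= Z)%N)%:R * (rg y l)%:R * wt (a3 R) (3 / 4) y m)).
  under [X in _ <= X]eq_bigr do rewrite big_mkcond.
  rewrite exchange_big; apply: ler_sum_nat => m /andP[m0 mX] /=.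
  rewrite /nmid mulr_suml mulr_sumr; apply: ler_sum_nat => l /andP[l0' _].
  case: (boolP (mp Y y m l)) => h; last first.
    by rewrite mul0r mulr0; case: ifP => // _; rewrite mulr_ge0.
  rewrite (@mp_le Y y v m l)//; last exact: leq_ltn_trans Xu.
  case/and4P: h => -> -> -> _; by rewrite /= !mul1r ler_piMl// lern1 leq_b1.
apply: (@le_trans _ _ (\sum_(1 <= l < X.+1) ((Y < l)%N && (l <= Z)%N)%:R * (f l / l%:R) * (C1 * X%:R * wy R y * q))).
  apply: ler_sum_nat => l /andP[l0' _].
  rewrite sum_dvd// -mulr_sumr -!mulrA.
  case: (boolP (_ && _)) => [/andP[Yl lZ]|_]; last by rewrite !mul0r.
  rewrite /= !mul1r; case: (boolP (rg y l)) => rl; last by rewrite !mul0r.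
  rewrite !mul1r.
  apply: (@le_trans _ _ (wt (fun=> 0) (3 / 4) y l * \sum_(1 <= c < (X %/ l).+1) wt (a3 R) (3 / 4) y c)).
    rewrite mulr_sumr; apply: ler_sum_nat => c /andP[c0 _].
    by rewrite {1}/wt cmulM// -/(wt _ _ _ _) (wt_rough _ (fun=> 0) _ rl).
  rewrite ler_wpM2l ?cmul_ge0//.
  have YX : (Y <= X %/ l)%N.
    rewrite leq_divRL//; apply: leq_trans Xl; apply: (@leq_trans (Y * Z)%N); first by rewrite leq_mul2l lZ orbT.
    by rewrite -expnD leq_pexp2l//; clear -s0 sv; lia.
  apply: le_trans (H1 (3 / 4) y _ y5 (leq_trans yY YX) z34) _.
  have a1 := lrq _ YX.
  have -> : l%:R^-1 * (C1 * (X%:R * (wy R y * q))) = C1 * (X%:R / l%:R) * wy R y * q by ring.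
  apply: ler_pM => //.
    by rewrite !mulr_ge0 ?(ltW w0).
  rewrite ler_wpM2r ?(ltW w0)// ler_wpM2l// ler_pdivlMr ?ltr0n// -natrM ler_nat; exact: leq_trunc_div.
rewrite -mulr_suml.
have F : \sum_(Y.+1 <= l < Z.+1) f l / l%:R <= C2 / ln y%:R * q * (1 + ln Z%:R - ln Y%:R).
  apply: abel_inv_sum => //; first by rewrite expn_gt0 y0.
  move=> t /andP[Yt tZ]; apply: (@le_trans _ _ (\sum_(1 <= l < t.+1) wt (fun=> 0) (3 / 4) y l)).
    by apply: ler_sum => l _; rewrite /f ler_piMl ?cmul_ge0// lern1 leq_b1.
  apply: le_trans (H2 (3 / 4) y t y5 (leq_trans yY Yt) z34) _.
  have -> : C2 / ln y%:R * q * t%:R = C2 * t%:R / ln y%:R * q by ring.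
  by rewrite ler_wpM2l ?lrq// divr_ge0 ?mulr_ge0// ltW.
have G : \sum_(1 <= l < X.+1) ((Y < l)%N && (l <= Z)%N)%:R * (f l / l%:R) <= \sum_(Y.+1 <= l < Z.+1) f l / l%:R.
  rewrite (eq_bigr (fun l => if (l <= Z)%N then (Y < l)%N%:R * (f l / l%:R) else 0)); last first.
    by move=> l _; case: (l <= Z)%N; rewrite ?andbT ?andbF ?mul0r.
  rewrite -big_mkcond; apply: le_trans (sum_cut_le _ _ _) _.
    by move=> l; rewrite mulr_ge0// divr_ge0.
  rewrite (@big_cat_nat _ _ _ Y.+1) //= big_nat big1 ?add0r.
    by apply: ler_sum => l _; rewrite ler_piMl ?divr_ge0// lern1 leq_b1.
  by move=> l /andP[_ la]; rewrite ltnNge -ltnS la mul0r.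
have E : C2 / ln y%:R * q * (1 + ln Z%:R - ln Y%:R) <= C2 * q * (s + 3)%:R.
  have -> : 1 + ln Z%:R - ln Y%:R = 1 + s.+1%:R * ln y%:R :> R.
    rewrite !natrX !lnXn ?ltr0n// -addrA -mulrnBr ?mulr_natl; last by clear -s0 sv; lia.
    by congr (1 + _ *+ _); clear -s0 sv; lia.
  have -> : C2 / ln y%:R * q * (1 + s.+1%:R * ln y%:R) = C2 * q * ((ln y%:R)^-1 + s.+1%:R).
    by field; rewrite gt_eqF.
  rewrite ler_wpM2l ?mulr_ge0 ?(ltW q0)//.
  have : (ln y%:R)^-1 <= 2 :> R by rewrite -[leLHS]div1r ler_pdivrMr//; lra.
  by rewrite -natr1 natrD; lra.
have k0 : 0 <= C1 * X%:R * wy R y * q by rewrite !mulr_ge0// ltW.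
apply: le_trans (ler_wpM2r k0 (le_trans G (le_trans F E))) _.
have -> : expR (- (ln (v - s)%:R / 2)) = q * q :> R by rewrite -expRD; congr expR; lra.
by apply: le_of_eq; ring.
Qed.

(** The Rankin weight A^(1 / (2 ln y)) of the smooth part A of m, written as a completely
    multiplicative weight. *)
Lemma ln_part y m : (0 < m)%N -> (1 < y)%N ->
  wt (fun p => expR (ln p%:R / (2 * ln y%:R))) 1 y m = expR (ln (m`_(rgh y)^')%N%:R / (2 * ln y%:R)) :> R.
Proof.
move=> m0 y1; set A := (m`_(rgh y)^')%N; set k := (m`_(rgh y))%N.
have A0 : (0 < A)%N by exact: part_gt0.
have k0 : (0 < k)%N by exact: part_gt0.
have mE : m = (k * A)%N by rewrite partnC.
have Am : (A <= m)%N by rewrite dvdn_leq// dvdn_part.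
rewrite -(ln_logn R A0 Am) mulr_suml expR_sum; apply: eq_bigr => p pp.
rewrite mE lognM// /hw; case: leqP => py.
  have -> : logn p k = 0%N.
    rewrite lognE pp k0; case: (boolP (p %| k)%N) => // pk.
    by have /andP[_ /allP/(_ p)] := part_pnat (rgh y) m; rewrite mem_primes pp k0 pk inE ltnNge py => /(_ isT).
  by rewrite add0n -expRM_natl mulrA.
rewrite expr1n; have -> : logn p A = 0%N.
  rewrite lognE pp A0; case: (boolP (p %| A)%N) => // pA.
  by have /andP[_ /allP/(_ p)] := part_pnat ((rgh y)^')%N m; rewrite mem_primes pp A0 pA !inE py => /(_ isT).
by rewrite !mul0r expR0.
Qed.

(** Rankin's trick: if the smooth part exceeds y^(2 s - 4), its power 1 / (2 ln y) is at least e^(s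
    - 2). This power multiplies the weight at p <= y by at most 1 + ln p / ln y, which by Mertens
    changes the prime sum by a bounded amount only. *)
Lemma smooth_tail : exists2 C : R, 0 <= C & forall y v s X, (5 <= y)%N -> (2 <= s)%N -> (0 < v)%N ->
  (y ^ (2 * v) <= X)%N -> (X < y ^ (2 * v).+1)%N ->
  \sum_(1 <= m < X.+1) (nop3 y m)%:R * ((y ^ (2 * s - 4) < m`_(rgh y)^')%N%:R * nrdiv R y m) <=
  C * X%:R * wy R y * ((2 * v).+1%:R * expR (- (s - 2)%:R)).
Proof.
have [C1 C10 H1] := wt_sum R; have [C2 C20 H2] := sum_a3 R.
exists (C1 * expR (C2 + 5)) => [|y v s X y5 s2 v0 Xl Xu]; first by rewrite mulr_ge0 ?expR_ge0.
have y1 : (1 < y)%N by apply: leq_trans y5.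
have y0 : (0 < y)%N by apply: ltnW.
have l0 := ln_gt0_nat R y1; have w0 := wy_gt0 R y.
have yX : (y <= X)%N by apply: leq_trans Xl; rewrite -{1}[y]expn1 leq_pexp2l//; lia.
pose rho p : R := expR (ln p%:R / (2 * ln y%:R)).
pose a p : R := if (p <= y)%N then a3 R p * rho p else 0.
have a0 p : 0 <= a p by rewrite /a; case: ifP => // _; rewrite mulr_ge0 ?expR_ge0.
have rho_le p : (0 < p)%N -> (p <= y)%N -> rho p <= 1 + ln p%:R / ln y%:R.
  move=> p0 py; rewrite /rho; set t := _ / (2 * _).
  have e : ln p%:R / ln y%:R = 2 * t by rewrite /t; field; rewrite gt_eqF.
  have t0 : 0 <= t by rewrite divr_ge0 ?ln_nat_ge0// mulr_ge0// ltW.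
  have t1 : t <= 1 / 2.
    by rewrite /t ler_pdivrMr ?mulr_gt0//; have := ler_ln_nat R p0 py; lra.
  rewrite e; have := expR_ge1Dx (- t); rewrite expRN => h.
  have E0 : 0 < expR t by exact: expR_gt0.
  have : (1 - t) * expR t <= 1 by rewrite -ler_pdivlMr// mul1r.
  by move: (expR t) E0 {h} => E E0 h; nra.
have l4 : 4 * ln 2 <= 2 * ln y%:R :> R.
  have := ln_natM R (isT : (0 < 2)%N) (isT : (0 < 2)%N); rewrite -[(2 * 2)%N]/4%N => h4.
  have : ln 4 <= ln y%:R :> R by apply: ler_ln_nat => //; lia.
  lra.
have a2 p : prime p -> a p <= 2 /\ a p <= 3 / 4 * p%:R.
  move=> pp; have p0 := prime_gt0 pp; rewrite /a; case: leqP => py; last by split; rewrite ?mulr_ge0.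
  have r1 := rho_le p p0 py.
  have r2 : ln p%:R / ln y%:R <= 1 :> R by rewrite ler_pdivrMr// mul1r ler_ln_nat.
  have ar : a3 R p * rho p <= rho p.
    by rewrite /a3; case: (_ != _); rewrite ?mul1r// mul0r expR_ge0.
  split; first lra.
  case: (leqP p 2) => p2; last by have : (3 : R) <= p%:R; [rewrite ler_nat | lra].
  have pE : p = 2%N by have := prime_gt1 pp; lia.
  move: r1 ar; rewrite pE => r1 ar.
  have : ln 2 / ln y%:R <= 1 / 2 :> R by rewrite ler_pdivrMr//; lra.
  lra.
have HG : \sum_(1 <= p < y.+1 | prime p) a p / p%:R <= ln (ln y%:R) / 2 + C2 + 5.
  have h2 := H2 y y1; have := mertens1 R y0; rewrite ler_norml => /andP[_ m1].
  have m2 : (\sum_(1 <= p < y.+1) (prime p)%:R * (ln p%:R / p%:R)) / ln y%:R <= 5 / 1 :> R.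
    rewrite ler_pdivrMr//; have := ln2_ge R; have : ln 4 <= ln y%:R :> R by apply: ler_ln_nat => //; lia.
    have := ln_natM R (isT : (0 < 2)%N) (isT : (0 < 2)%N); rewrite -[(2 * 2)%N]/4%N; lra.
  apply: (@le_trans _ _ (\sum_(1 <= p < y.+1 | prime p) a3 R p / p%:R + (\sum_(1 <= p < y.+1) (prime p)%:R * (ln p%:R / p%:R)) / ln y%:R)); last lra.
  have -> : \sum_(1 <= p < y.+1) (prime p)%:R * (ln p%:R / p%:R) = \sum_(1 <= p < y.+1 | prime p) ln p%:R / p%:R :> R.
    by rewrite [RHS]big_mkcond; apply: eq_bigr => p _; case: ifP; rewrite ?mul1r ?mul0r.
  rewrite mulr_suml -big_split /=; rewrite big_nat_cond [leRHS]big_nat_cond; apply: ler_sum => p /andP[/andP[p0 py] pp].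
  rewrite ltnS in py; have r1 := rho_le p p0 py; rewrite /a py.
  have -> : a3 R p / p%:R + ln p%:R / p%:R / ln y%:R = (a3 R p + ln p%:R / ln y%:R) / p%:R by ring.
  rewrite ler_wpM2r ?invr_ge0//.
  have r0 : 0 <= ln p%:R / ln y%:R :> R by rewrite divr_ge0 ?ln_nat_ge0// ltW.
  by rewrite /a3; case: (_ != _); rewrite ?mul1r ?mul0r ?add0r.
have z2 : 0 <= (2 : R) <= 4 by rewrite ler0n ler_nat.
have W := H1 a 2 y X _ y5 yX a0 a2 z2 HG.
set e := expR (- (s - 2)%:R).
have e0 : 0 < e :> R by exact: expR_gt0.
apply: (@le_trans _ _ (e * \sum_(1 <= m < X.+1) wt a 2 y m)).
  rewrite mulr_sumr; apply: ler_sum_nat => m /andP[m0 _].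
  have -> : wt a 2 y m = wt (a3 R) 2 y m * wt rho 1 y m.
    rewrite /wt cmul_mul; apply: cmul_ext => p pp pm; rewrite /hw /a; case: ifP => [->//|_].
    by rewrite mulr1.
  rewrite ln_part// mulrCA [leRHS]mulrCA.
  have h := nop3_nrdiv R y m; have h0 : 0 <= (nop3 y m)%:R * nrdiv R y m by rewrite mulr_ge0// sumr_ge0.
  rewrite mulrC; apply: ler_pM => //.
  case: ltnP => hA; last by rewrite mulr_ge0 ?expR_ge0.
  rewrite /e -expRD -[leLHS]expR0 ler_expR.
  have : ln (y ^ (2 * s - 4))%:R <= ln (m`_(rgh y)^')%N%:R :> R by apply: ler_ln_nat; rewrite ?expn_gt0 ?y0// ltnW.
  have -> : ln (y ^ (2 * s - 4))%:R = 2 * (s - 2)%:R * ln y%:R :> R.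
    by rewrite natrX lnXn ?ltr0n// -natrM mulr_natl mulnBr.
  move=> h2.
  have : (s - 2)%:R <= ln (m`_(rgh y)^')%N%:R / (2 * ln y%:R) :> R.
    by rewrite ler_pdivlMr ?mulr_gt0//; lra.
  lra.
apply: le_trans (ler_wpM2l (ltW e0) W) _.
have -> : ln (ln y%:R) / 2 + C2 + 5 + (2 - 1) * lr R y X = ln (ln y%:R) / 2 + (C2 + 5) + lr R y X :> R by ring.
rewrite [expR (_ + lr R y X)]expRD [expR (_ + (C2 + 5))]expRD -wyE//.
have lrX : expR (lr R y X) <= (2 * v).+1%:R.
  rewrite -[leRHS]lnK ?posrE ?ltr0n// ler_expR -(lr_pow R y1 (isT : (0 < (2 * v).+1)%N)).
  by apply: lr_mono; rewrite ?(ltnW Xu)// (leq_trans y1).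
have -> : e * (C1 * X%:R / ln y%:R * (expR (ln (ln y%:R) / 2) * expR (C2 + 5) * expR (lr R y X))) =
  C1 * expR (C2 + 5) * X%:R * (expR (ln (ln y%:R) / 2) / ln y%:R) * (expR (lr R y X) * e) by ring.
rewrite ler_wpM2l//.
  by rewrite !mulr_ge0 ?expR_ge0// invr_ge0 ltW.
by rewrite ler_wpM2r ?(ltW e0).
Qed.
End MiddleCount.

(** * The divisor sum over sifted integers that are not sums of two squares *)

Section BadSum.
Variable R : realType.
Notation chir n := ((chi n)%:~R : R).
Notation rg y := (rgh y).-nat.
Notation dchi n := (\sum_(1 <= l < n.+1 | (l %| n)%N) chi l).

Definition bsum Y y m : R := \sum_(1 <= l < Y.+1 | rg y l && (l %| m)%N) chir l.

Lemma rgh_dvd_part y m l : (0 < m)%N -> (l %| m`_(rgh y))%N = rg y l && (l %| m)%N.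
Proof.
move=> m0; apply/idP/andP => [lk|[rl lm]].
  by split; [exact: pnat_dvd lk (part_pnat _ _) | exact: dvdn_trans lk (dvdn_part _ _)].
by rewrite -(part_pnat_id rl); apply: partn_dvd.
Qed.

Lemma bsum_le Y y m : (0 < m)%N -> `|bsum Y y m| <= nrdiv R y m.
Proof.
move=> m0; apply: le_trans (ler_norm_sum _ _ _) _.
apply: (@le_trans _ _ (\sum_(1 <= l < Y.+1 | (l %| m)%N && (l <= m)%N) (rg y l)%:R)).
  rewrite big_mkcond [leRHS]big_mkcond; apply: ler_sum => l _.
  case: (boolP (rg y l)) => rl /=; last by case: ifP.
  case: (boolP (l %| m)%N) => lm //=; rewrite dvdn_leq//=; exact: chi_norm.
rewrite big_mkcondl /nrdiv [leRHS]big_mkcond; apply: sum_cut_le => l.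
by case: ifP.
Qed.

(* When no sum of two squares arises, the whole divisor sum vanishes, and flipping l to k/l
   leaves only divisors close to sqrt k. *)
Lemma bsum_mid X Y y m : (0 < m)%N -> (m <= X)%N -> (1 < y)%N -> (Y * Y < m`_(rgh y))%N ->
  chi m`_(rgh y) = 1 -> dchi m`_(rgh y) = 0 -> bsum Y y m = - mid R X Y y m.
Proof.
move=> m0 mX y1 Yk ck dk; set k := (m`_(rgh y))%N in Yk ck dk.
have k0 : (0 < k)%N by exact: part_gt0.
have km : (k <= m)%N by rewrite dvdn_leq// dvdn_part.
have ok : odd k by apply: rgh_odd y1 _; exact: part_pnat.
have := congr1 (fun z : int => z%:~R : R) (dchi_flip ok ck dk Yk).
rewrite rmorphN !rmorph_sum /= => h.
have -> : bsum Y y m = \sum_(1 <= l < Y.+1 | (l %| k)%N) chir l.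
  by apply: eq_bigl => l; rewrite rgh_dvd_part.
rewrite h; congr (- _).
rewrite /mid [RHS](@big_cat_nat _ _ _ k.+1) //=; last by rewrite ltnS (leq_trans km).
rewrite [X in _ = _ + X]big_nat_cond [X in _ = _ + X]big1 ?addr0; last first.
  move=> l /andP[/andP[kl _] /and4P[rl lm _ _]].
  have : (l %| k)%N by rewrite rgh_dvd_part// rl.
  by move=> /(dvdn_leq k0); rewrite leqNgt kl.
by apply: eq_bigl => l; rewrite /mp rgh_dvd_part// -andbA.
Qed.

Definition bad y m := (chi m`_(rgh y) == 1) && (dchi m`_(rgh y) == 0).

(** The lower cut on m guarantees that, once the smooth part is small, the rough part exceeds Y^2 as
    [bsum_mid] requires. *)
Definition tsum X Y y v : R :=
  \sum_(1 <= m < X.+1 | [&& nop3 y m, (y ^ (2 * v - 2) <= m)%N & bad y m]) `|bsum Y y m|.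

(** A linearised Cauchy-Schwarz inequality. On the support of x one has |x| <= (a / 2) x^2 + 1 / (2
    a), and the constant is bounded through 2 <= b f + g / b, valid when f g >= 1; [n], which is at
    least 1 there, is attached to f only. It is applied with f = (3/4)^Omega and g = (4/3)^Omega, so
    that the count of middle divisors profits from the small weight. *)
Lemma amgm3 (x n f g a b : R) : 0 < a -> 0 < b -> 0 <= f -> 0 <= g -> 1 <= f * g ->
  (x == 0) || (1 <= n) -> 0 <= n ->
  `|x| <= a / 2 * x ^+ 2 + b / (4 * a) * (n * f) + (4 * a * b)^-1 * g.
Proof.
move=> a0 b0 f0 g0 fg /orP[/eqP ->|n1] n0.
  rewrite normr0 expr0n mulr0 add0r addr_ge0// mulr_ge0 ?mulr_ge0 ?invr_ge0 ?mulr_ge0 ?(ltW a0) ?(ltW b0)//.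
have a0' : a != 0 by rewrite gt_eqF.
have b0' : b != 0 by rewrite gt_eqF.
have h1 : `|x| <= a / 2 * x ^+ 2 + (2 * a)^-1.
  rewrite -subr_ge0 -real_normK ?num_real//.
  have -> : a / 2 * `|x| ^+ 2 + (2 * a)^-1 - `|x| = (a * `|x| - 1) ^+ 2 / (2 * a) by field.
  by rewrite divr_ge0 ?sqr_ge0// mulr_ge0// ltW.
have h2 : 2 <= b * (n * f) + g / b.
  have h3 : 2 <= b * f + g / b.
    rewrite -subr_ge0; have -> : b * f + g / b - 2 = (b ^+ 2 * f + g - 2 * b) / b by field.
    rewrite divr_ge0 ?(ltW b0)//.
    have : 0 <= (b * f - 1) ^+ 2 + (f * g - 1) by rewrite addr_ge0 ?sqr_ge0// subr_ge0.
    have -> : (b * f - 1) ^+ 2 + (f * g - 1) = f * (b ^+ 2 * f + g - 2 * b) by ring.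
    have f1 : 0 < f by rewrite lt_neqAle f0 andbT; apply: contraTneq fg => <-; rewrite mul0r; lra.
    by rewrite pmulr_rge0.
  have : b * f <= b * (n * f) by rewrite ler_wpM2l ?(ltW b0)// ler_peMl.
  lra.
apply: (le_trans h1); rewrite -addrA lerD2l.
have -> : (2 * a)^-1 = 2 * (4 * a)^-1 by field.
have -> : b / (4 * a) * (n * f) + (4 * a * b)^-1 * g = (b * (n * f) + g / b) * (4 * a)^-1 by field; rewrite a0' b0'.
by rewrite ler_wpM2r// invr_ge0 mulr_ge0// ltW.
Qed.

Lemma mid_nmid X Y y m : (mid R X Y y m == 0) || (1 <= nmid R X Y y m).
Proof.
case: (boolP (has (mp Y y m) (index_iota 1 X.+1))) => [/hasP[l lX hl]|/hasPn H].
  apply/orP; right; rewrite /nmid (bigD1_seq l)//= ?iota_uniq//.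
  by rewrite hl lerDl sumr_ge0.
by apply/orP; left; rewrite /mid big_seq_cond big1// => l /andP[/H/negbTE ->].
Qed.

Lemma scale_step (w W C' C S k u : R) : 0 <= w <= W -> 0 <= C' <= C -> 0 <= k -> 0 <= u ->
  S <= C' * (k * u) -> w * S <= C * (k * (W * u)).
Proof.
move=> /andP[w0 wW] /andP[c0 cC] k0 u0 h.
apply: (le_trans (ler_wpM2l w0 h)).
have -> : w * (C' * (k * u)) = (w * C') * (k * u) by ring.
have -> : C * (k * (W * u)) = (W * C) * (k * u) by ring.
by rewrite ler_wpM2r ?mulr_ge0// ler_pM.
Qed.

(** If the smooth part is large, [smooth_tail] applies to the trivial bound. Otherwise [bsum] flips
    to the middle sum, which [amgm3] distributes over its second moment, the weighted count of
    middle divisors and the mean of (4/3)^Omega. The parameters a and b remain free for a later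
    balance. *)
Lemma tsum_param : exists2 C : R, 0 <= C & forall D v s, (2 <= s)%N -> (s + 16 * D + 29 <= v)%N ->
  exists y0, forall y X (a b : R), (y0 <= y)%N -> (y ^ (2 * v) <= X)%N -> (X < y ^ (2 * v).+1)%N ->
  0 < a -> 0 < b ->
  tsum X (y ^ (v - s)) y v <= C * X%:R * wy R y *
   ((2 * v).+1%:R * expR (- (s - 2)%:R)
    + a * ((s + 3)%:R * (16 * D + 27)%:R ^+ 2 + (2 * v).+1%:R ^+ 4 / 16 ^+ D)
    + b / a * ((s + 3)%:R * expR (- (ln (v - s)%:R / 2)))
    + (a * b)^-1 * expR (ln (2 * v).+1%:R / 3)).
Proof.
have [C1 C10 H1] := smooth_tail R; have [C2 C20 H2] := mid_moment R.
have [C3 C30 H3] := mid_count R; have [C4 C40 H4] := wt3_sum R.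
exists (C1 + C2 + C3 + C4) => [|D v s s2 vs]; first lra.
have [y0 Hy] := H2 D v s vs; exists (y0 + 5)%N => y X a b hy Xl Xu a0 b0.
have y5 : (5 <= y)%N := leq_trans (leq_addl _ _) hy.
have y1 : (1 < y)%N by apply: leq_trans y5.
have y0' : (0 < y)%N by apply: ltnW.
have v0 : (0 < v)%N by clear -vs; lia.
have sv : (s < v)%N by clear -vs; lia.
have yX : (y <= X)%N by apply: leq_trans Xl; rewrite -{1}[y]expn1 leq_pexp2l//; clear -v0; lia.
have {H1}h1 := H1 y v s X y5 s2 v0 Xl Xu.
have {H2}h2 := Hy y X (leq_trans (leq_addr _ _) hy) Xl Xu.
have {H3}h3 := H3 y v s X y5 (ltnW s2) sv Xl Xu.
have z43 : 0 <= (4 / 3 : R) <= 4 by lra.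
have {H4}h4 := H4 (4 / 3) y X y5 yX z43.
have lrX : expR ((4 / 3 - 1) * lr R y X) <= expR (ln (2 * v).+1%:R / 3).
  rewrite ler_expR; have := lr_pow R y1 (isT : (0 < (2 * v).+1)%N).
  have := lr_mono R y1 (leq_trans y1 yX) (ltnW Xu); lra.
set Y := (y ^ (v - s))%N in h2 h3 *.
set S1 := \sum_(1 <= m < X.+1) _ in h1; set S2 := \sum_(1 <= m < X.+1) _ in h2.
set S3 := \sum_(1 <= m < X.+1) _ in h3; set S4 := \sum_(1 <= m < X.+1) _ in h4.
have main : tsum X Y y v <= S1 + a / 2 * S2 + b / (4 * a) * S3 + (4 * a * b)^-1 * S4.
  rewrite /S2 /S3 /S4 !mulr_sumr -!big_split /tsum big_mkcond; apply: ler_sum_nat => m /andP[m0 mX] /=.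
  have f0 z : 0 <= z -> 0 <= wt (a3 R) z y m.
    by move=> z0; apply: cmul_ge0 => p; rewrite /hw; case: ifP.
  have f34 : 0 <= wt (a3 R) (3 / 4) y m by apply: f0; lra.
  have f43 : 0 <= wt (a3 R) (4 / 3) y m by apply: f0; lra.
  have n0 : 0 <= nmid R X Y y m by apply: sumr_ge0.
  have rn0 : 0 <= nrdiv R y m by apply: sumr_ge0.
  have ba0 : 0 <= b / (4 * a) by rewrite divr_ge0 ?(ltW b0)// mulr_ge0// ltW.
  have ab0 : 0 <= (4 * a * b)^-1 by rewrite invr_ge0 !mulr_ge0// ltW.
  have a20 : 0 <= a / 2 by rewrite divr_ge0// ltW.
  case: (boolP (nop3 y m)) => np /=; last first.
    by rewrite !mul0r !mulr0 !add0r mulr_ge0.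
  rewrite !mul1r.
  case: ifP => [/andP[ym /andP[/eqP ck /eqP dk]]|_]; last first.
    exact: addr_ge0 (addr_ge0 (addr_ge0 (mulr_ge0 (ler0n _ _) rn0) (mulr_ge0 a20 (sqr_ge0 _))) (mulr_ge0 ba0 (mulr_ge0 n0 f34))) (mulr_ge0 ab0 f43).
  have np34 : 1 <= wt (a3 R) (3 / 4) y m * wt (a3 R) (4 / 3) y m.
    rewrite /wt cmul_mul; apply: cmul_ge1 => // p pp pm; rewrite /hw.
    case: ifP => py; last lra.
    have /nop3P[_ H] := np; rewrite /a3; have := H p pp py.
    by case: eqP => [h /(_ h)|_ _]; rewrite ?pm// mulr1.
  have am := @amgm3 _ _ _ _ _ _ a0 b0 f34 f43 np34 (mid_nmid X Y y m) n0.
  case: (ltnP (y ^ (2 * s - 4))%N (m`_(rgh y)^')%N) => hA.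
    rewrite mul1r; apply: le_trans (bsum_le Y y m0) _; rewrite -!addrA lerDl addrA.
    by apply: le_trans am.
  rewrite mul0r add0r (@bsum_mid X)// ?normrN//.
  have k0 : (0 < m`_(rgh y))%N by exact: part_gt0.
  have := partnC (rgh y) m0; move: (m`_(rgh y))%N (m`_(rgh y)^')%N k0 hA => k A k0 hA kA.
  (* From m >= y^(2 v - 2) and a smooth part of at most y^(2 s - 4), the rough part is at least Y^2
     y^2. *)
  have h5 : (y ^ (2 * v - 2) <= k * y ^ (2 * s - 4))%N.
    by apply: (leq_trans ym); rewrite -kA leq_mul2l hA orbT.
  have h6 : (Y * Y * (y * y) <= k)%N.
    rewrite -(leq_pmul2r (_ : 0 < y ^ (2 * s - 4))%N) ?expn_gt0 ?y0'//.
    apply: leq_trans h5; rewrite /Y mulnn -[(y * y)%N]/(y ^ 2)%N -expnM -!expnD leq_pexp2l//; clear -s2 sv; lia.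
  apply: leq_trans h6; rewrite ltn_Pmulr ?muln_gt0 ?expn_gt0 ?y0'//.
  by rewrite (leq_trans y1)// leq_pmulr.
have w0 := wy_gt0 R y; set k := X%:R * wy R y.
have k0 : 0 <= k by rewrite mulr_ge0// ltW.
apply: (le_trans main).
have e4 : S4 <= C4 * X%:R * wy R y * expR (ln (2 * v).+1%:R / 3).
  by apply: (le_trans h4); rewrite ler_wpM2l// !mulr_ge0// ltW.
move: h1 h2 h3 e4; set u1 := (2 * v).+1%:R * expR (- (s - 2)%:R); set u2 := _ + _ / 16 ^+ D.
set u3 := (s + 3)%:R * expR (- (ln (v - s)%:R / 2)); set u4 := expR (ln (2 * v).+1%:R / 3) => h1 h2 h3 e4.
have u10 : 0 <= u1 by rewrite mulr_ge0 ?expR_ge0.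
have u20 : 0 <= u2 by rewrite addr_ge0 ?divr_ge0 ?mulr_ge0 ?exprn_ge0.
have u30 : 0 <= u3 by rewrite mulr_ge0 ?expR_ge0.
have u40 : 0 <= u4 by exact: expR_ge0.
have -> : (C1 + C2 + C3 + C4) * X%:R * wy R y * (u1 + a * u2 + b / a * u3 + (a * b)^-1 * u4) =
  (C1 + C2 + C3 + C4) * (k * (1 * u1)) + (C1 + C2 + C3 + C4) * (k * (a * u2)) +
  (C1 + C2 + C3 + C4) * (k * (b / a * u3)) + (C1 + C2 + C3 + C4) * (k * ((a * b)^-1 * u4)) by rewrite /k; ring.
have ba0 : 0 <= b / a by rewrite divr_ge0 // ltW.
have ab0 : 0 <= (a * b)^-1 by rewrite invr_ge0 mulr_ge0 // ltW.
have eb : b / (4 * a) = (b / a) / 4 by field; rewrite gt_eqF.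
have eab : (4 * a * b)^-1 = (a * b)^-1 / 4 by field; rewrite !gt_eqF.
have CC i : i \in [:: C1; C2; C3; C4] -> 0 <= i <= C1 + C2 + C3 + C4.
  by clear -C10 C20 C30 C40; rewrite !inE => /or4P[] /eqP ->; apply/andP; split; lra.
have kE Ci u : Ci * X%:R * wy R y * u = Ci * (k * u) by rewrite /k; ring.
move: h1 h2 h3 e4; rewrite !kE => h1 h2 h3 e4.
rewrite -[S1]mul1r eb eab; move: (C1 + C2 + C3 + C4) CC => C CC.
apply: lerD; first apply: lerD; first apply: lerD.
- apply: (@scale_step _ _ C1); rewrite ?CC ?inE ?eqxx ?orbT//.
  by rewrite lexx ler01.
- apply: (@scale_step _ _ C2); rewrite ?CC ?inE ?eqxx ?orbT//.
  by apply/andP; split; move: ba0 ab0 a0; clear; lra.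
- apply: (@scale_step _ _ C3); rewrite ?CC ?inE ?eqxx ?orbT//.
  by apply/andP; split; move: ba0 ab0 a0; clear; lra.
- apply: (@scale_step _ _ C4); rewrite ?CC ?inE ?eqxx ?orbT//.
  by apply/andP; split; move: ba0 ab0 a0; clear; lra.
Qed.
End BadSum.

(** * Choice of the parameters for the middle sum *)

Section BadSmall.
Variable R : realType.

Lemma pow2_eventually k (A : R) : exists j0, forall j, (j0 <= j)%N -> A * j%:R ^+ k <= 2 ^+ j.
Proof.
have [y0 Hy] := ln_pow_small k (`|A| * 2 ^+ k); exists y0 => j hj.
have : (y0 <= 2 ^ j)%N by apply: leq_trans hj _; apply: ltnW; exact: ltn_expl.
move=> /Hy; rewrite natrX => /(le_trans _); apply.
apply: (@le_trans _ _ (`|A| * j%:R ^+ k)).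
  by rewrite ler_wpM2r ?exprn_ge0// ler_norm.
rewrite -[leRHS]mulrA ler_wpM2l// -exprMn lerXn2r ?nnegrE ?mulr_ge0//.
  by rewrite lnXn// mulrn_wge0// ; have := ln2_ge R; lra.
by rewrite lnXn// -[ln 2 *+ j]mulr_natl; have := ln2_ge R; have := ler0n R j; nra.
Qed.

Lemma expR_half_ln_le (x z : R) : 0 < z -> z ^+ 2 <= x -> expR (- (ln x / 2)) <= z^-1.
Proof.
move=> z0 zx; rewrite expRN lef_pV2 ?posrE ?expR_gt0//.
rewrite -[leLHS]lnK ?posrE// ler_expR.
have : ln (z ^+ 2) <= ln x by rewrite ler_ln ?posrE ?exprn_gt0// (lt_le_trans _ zx) ?exprn_gt0.
by rewrite lnXn// mulr2n; lra.
Qed.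

Lemma expR_third_ln_le (x z : R) : 0 < x -> 0 < z -> x <= z ^+ 3 -> expR (ln x / 3) <= z.
Proof.
move=> x0 z0 xz; rewrite -[leRHS]lnK ?posrE// ler_expR.
have : ln x <= ln (z ^+ 3) by rewrite ler_ln ?posrE ?exprn_gt0.
by rewrite lnXn// -[ln z *+ 3]mulr_natl; lra.
Qed.

Lemma expR_opp_nat_le n : expR (- n%:R) <= (2 ^+ n)^-1 :> R.
Proof.
rewrite expRN lef_pV2 ?posrE ?expR_gt0 ?exprn_gt0// -[n%:R]mulr1 expRM_natl.
by rewrite lerXn2r ?nnegrE ?expR_ge0//; have := expR_ge1Dx (1 : R); lra.
Qed.

Lemma depth_room j : (4 <= j)%N -> (192 * j + 20 + 16 * (24 * j) + 29 <= 2 ^ (24 * j))%N.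
Proof.
move=> j4; have h : (12 * j < 2 ^ (12 * j))%N by exact: ltn_expl.
have -> : (24 * j = 12 * j + 12 * j)%N by lia.
rewrite expnD; move: (2 ^ _)%N h => q h.
have : ((12 * j).+1 * (12 * j).+1 <= q * q)%N by exact: leq_mul.
nia.
Qed.

(** Put u = 2^j, so that v = u^24 and 16^D = v^4, and take a = 1 / u, b = u^10. Up to powers of j
    every term has size 1 / u: the smooth tail is far below it, the second moment gives a v^4 / 16^D
    = 1 / u, the middle count (b / a) v^(-1/2) = u^(11 - 12), and the last term v^(1/3) / (a b) =
    u^(8 - 9). *)
Lemma tsum_small (eta : R) : 0 < eta -> exists j0, forall j, (j0 <= j)%N -> exists y0, forall y X,
  (y0 <= y)%N -> (y ^ (2 * 2 ^ (24 * j)) <= X)%N -> (X < y ^ (2 * 2 ^ (24 * j)).+1)%N ->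
  tsum R X (y ^ (2 ^ (24 * j) - (192 * j + 20))) y (2 ^ (24 * j)) <= eta * X%:R * wy R y.
Proof.
move=> eta0; have [C C0 HC] := tsum_param R.
have [j1 Hj1] := pow2_eventually 3 (C * (89 * 411 ^+ 3) / eta).
exists (j1 + 4)%N => j hj; have j4 : (4 <= j)%N := leq_trans (leq_addl _ _) hj.
(* s = 8 D + 20 with D = 24 j. Then 2 s > 16 D + 26, which keeps Y^2 times the sieve remainder y^(16
   D + 25) below y^(2 v - 1). *)
set v := (2 ^ (24 * j))%N; set s := (192 * j + 20)%N.
have room := depth_room j4; rewrite -/s -/v in room.
have [|y0 Hy] := HC (24 * j)%N v s _ room; first by rewrite /s; clear -j4; lia.
exists y0 => y X hy Xl Xu.
set u : R := 2 ^+ j; have u0 : 0 < u by rewrite exprn_gt0.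
have a0 : 0 < u^-1 by rewrite invr_gt0.
have b0 : 0 < u ^+ 10 by rewrite exprn_gt0.
apply: le_trans (Hy y X u^-1 (u ^+ 10) hy Xl Xu a0 b0) _.
have vE : v%:R = u ^+ 24 :> R by rewrite /v natrX /u -exprM mulnC.
set q : R := 411 * j%:R.
have j1' : (1 : R) <= j%:R by rewrite ler1n; clear -j4; lia.
have q1 : 1 <= q by rewrite /q; lra.
have sq : (s + 3)%:R <= q.
  by rewrite /q -natrM ler_nat /s; clear -j4; lia.
have wq : (16 * (24 * j) + 27)%:R <= q.
  by rewrite /q -natrM ler_nat; clear -j4; lia.
have v1 : (1 : R) <= u ^+ 24 by rewrite exprn_ege1// /u exprn_ege1//; lra.
have v21 : (2 * v).+1%:R <= 3 * u ^+ 24 by rewrite -natr1 natrM vE; lra.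
have t1 : (2 * v).+1%:R * expR (- (s - 2)%:R) <= 3 / u.
  have e : expR (- (s - 2)%:R) <= (u ^+ 25)^-1.
    apply: le_trans (expR_opp_nat_le _) _; rewrite lef_pV2 ?posrE ?exprn_gt0//.
    rewrite /u -exprM ler_eXn2l; last lra.
    by rewrite /s; clear -j4; lia.
  have -> : 3 / u = 3 * u ^+ 24 * (u ^+ 25)^-1 by field; rewrite gt_eqF.
  by apply: ler_pM => //; exact: expR_ge0.
have t2 : u^-1 * ((s + 3)%:R * (16 * (24 * j) + 27)%:R ^+ 2 + (2 * v).+1%:R ^+ 4 / 16 ^+ (24 * j)) <= u^-1 * (q ^+ 3 + 81).
  rewrite ler_wpM2l ?(ltW a0)//; apply: lerD.
    by rewrite [q ^+ 3]exprS; apply: ler_pM; rewrite ?exprn_ge0// lerXn2r ?nnegrE//; apply: le_trans wq.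
  rewrite ler_pdivrMr ?exprn_gt0//.
  have -> : 81 * 16 ^+ (24 * j) = (3 * u ^+ 24) ^+ 4 :> R.
    rewrite exprMn /u -!exprM (_ : 16 = 2 ^+ 4 :> R); last by ring.
    rewrite -exprM (_ : 81 = 3 ^+ 4 :> R); last by ring.
    by congr (_ * _ ^+ _); clear; lia.
  by rewrite lerXn2r ?nnegrE// mulr_ge0// exprn_ge0 ?(ltW u0).
have t3 : u ^+ 10 / u^-1 * ((s + 3)%:R * expR (- (ln (v - s)%:R / 2))) <= 2 * q / u.
  have e : expR (- (ln (v - s)%:R / 2)) <= (u ^+ 12 / 2)^-1.
    apply: expR_half_ln_le; first by rewrite divr_gt0 ?exprn_gt0.
    have -> : (u ^+ 12 / 2) ^+ 2 = v%:R / 4 by rewrite vE; field.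
    have : (v <= 4 * (v - s))%N by clear -room; lia.
    by rewrite -(ler_nat R) natrM; lra.
  have -> : 2 * q / u = u ^+ 10 / u^-1 * (q * (u ^+ 12 / 2)^-1) by field; rewrite gt_eqF.
  rewrite ler_wpM2l ?divr_ge0 ?(ltW a0) ?(ltW b0)//; apply: ler_pM => //; exact: expR_ge0.
have t4 : (u^-1 * u ^+ 10)^-1 * expR (ln (2 * v).+1%:R / 3) <= 2 / u.
  have e : expR (ln (2 * v).+1%:R / 3) <= 2 * u ^+ 8.
    apply: expR_third_ln_le; rewrite ?mulr_gt0 ?exprn_gt0//.
    have -> : (2 * u ^+ 8) ^+ 3 = 8 * u ^+ 24 by ring.
    lra.
  have -> : 2 / u = (u^-1 * u ^+ 10)^-1 * (2 * u ^+ 8) by field; rewrite gt_eqF.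
  by rewrite ler_wpM2l// invr_ge0 mulr_ge0 ?(ltW a0) ?(ltW b0).
have tot : C * (3 / u + u^-1 * (q ^+ 3 + 81) + 2 * q / u + 2 / u) <= eta.
  have := Hj1 j (leq_trans (leq_addr _ _) hj); rewrite -/u.
  have -> : C * (89 * 411 ^+ 3) / eta * j%:R ^+ 3 = C * (89 * q ^+ 3) / eta by rewrite /q exprMn; ring.
  rewrite ler_pdivrMr// => h.
  have -> : 3 / u + u^-1 * (q ^+ 3 + 81) + 2 * q / u + 2 / u = (q ^+ 3 + 2 * q + 86) / u by field; rewrite gt_eqF.
  rewrite mulrA ler_pdivrMr//; apply: le_trans (le_trans _ h) _; last by rewrite mulrC.
  rewrite ler_wpM2l//.
  have q3 : q <= q ^+ 3 by rewrite -{1}[q]expr1 ler_weXn2l.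
  have q31 : 1 <= q ^+ 3 by rewrite exprn_ege1.
  lra.
have -> : eta * X%:R * wy R y = X%:R * wy R y * eta by ring.
have -> : forall Z, C * X%:R * wy R y * Z = X%:R * wy R y * (C * Z) by move=> Z; ring.
rewrite ler_wpM2l ?mulr_ge0 ?(ltW (wy_gt0 _ _))//; apply: le_trans tot.
by rewrite ler_wpM2l//; apply: lerD => //; apply: lerD => //; apply: lerD.
Qed.
End BadSmall.

(** * The second moment *)

Section PairSieve.
Variable R : realType.
Notation chir n := ((chi n)%:~R : R).
Notation rg y := (rgh y).-nat.

Definition p3 P p := (p %% 4 == 3)%N && (P < p)%N.

Definition ev z p n := (n == z ^ 2 %[mod p])%N.

(* sv and bv are the factors s(n, z) and B(n - z^2) of the opening comment, as functions of n. *)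
Definition sv P y z n : R := \prod_(p <- sprimes (p3 P) y) (1 - (ev z p n)%:R).

Definition bv Y y z n : R := \sum_(1 <= l < Y.+1 | rg y l) (ev z l n)%:R * chir l.

(* The number of residues n mod p with n = z1^2 or n = z2^2. *)
Definition rho z1 z2 p : nat := if (z1 ^ 2 == z2 ^ 2 %[mod p])%N then 1%N else 2%N.

Definition vpair P y z1 z2 : R := \prod_(p <- sprimes (p3 P) y) (1 - (rho z1 z2 p)%:R / p%:R).

Definition vone P y : R := \prod_(p <- sprimes (p3 P) y) (1 - p%:R^-1).

Definition urough Y y : R := \sum_(1 <= l < Y.+1) (rg y l)%:R / l%:R.

Lemma rho_le z1 z2 p : (0 < rho z1 z2 p <= 2)%N.
Proof. by rewrite /rho; case: ifP. Qed.

Lemma vpair_ge0 P y z1 z2 : 0 <= vpair P y z1 z2.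
Proof.
rewrite /vpair big_seq; apply: prodr_ge0 => p; rewrite mem_sprimes => /and4P[_ p2 _ _].
have p0 : (0 : R) < p%:R by rewrite ltr0n; lia.
rewrite subr_ge0 ler_pdivrMr// mul1r ler_nat; case/andP: (rho_le z1 z2 p) => _ h.
exact: leq_trans h (ltnW p2).
Qed.

Lemma vpair_diag P y z : vpair P y z z = vone P y.
Proof. by apply: eq_bigr => p _; rewrite /rho eqxx mul1r. Qed.

Lemma coprime_rough P y Q l : (0 < Q)%N -> (P <= y)%N -> (forall p, prime p -> (P < p)%N -> coprime p Q) ->
  rg y l -> coprime Q l.
Proof.
move=> Q0 Py HQ /andP[l0 /allP rl]; apply: contraT => ncop.
have g1 : (1 < gcdn Q l)%N by rewrite ltn_neqAle eq_sym ncop gcdn_gt0 Q0.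
have pp := pdiv_prime g1.
have pl := dvdn_trans (pdiv_dvd (gcdn Q l)) (dvdn_gcdr Q l).
have pQ := dvdn_trans (pdiv_dvd (gcdn Q l)) (dvdn_gcdl Q l).
have := rl (pdiv (gcdn Q l)); rewrite mem_primes pp l0 pl inE => /(_ isT) yp.
by have := HQ _ pp (leq_ltn_trans Py yp); rewrite prime_coprime// pQ.
Qed.

Lemma cnt_or F G q : (forall n, ~~ (F n && G n)) -> cnt (fun n => F n || G n) 0 q = (cnt F 0 q + cnt G 0 q)%N.
Proof.
move=> H; rewrite /cnt -big_split; apply: eq_bigr => n _ /=.
by have := H n; case: (F n); case: (G n).
Qed.

(** The conditions modulo Q, l1 and l2 involve pairwise coprime moduli without sieving primes, so
    they select a single class modulo Q l1 l2. Inside it the two sieves are run as one, each prime p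
    removing [rho] residues. *)
Lemma fl_pair : exists2 C : R, 0 <= C & forall D P y Q c z1 z2 l1 l2 a L, (1 < y)%N -> (0 < Q)%N -> (P <= y)%N ->
  (forall p, prime p -> (P < p)%N -> coprime p Q) -> rg y l1 -> rg y l2 -> coprime l1 l2 ->
  `|\sum_(a <= n < a + L) ((n == c %[mod Q])%N && (ev z1 l1 n && ev z2 l2 n))%:R * (sv P y z1 n * sv P y z2 n)
    - L%:R / (Q * (l1 * l2))%:R * vpair P y z1 z2| <=
  L%:R / (Q * (l1 * l2))%:R * vpair P y z1 z2 * (C / 16 ^+ D) + y%:R ^+ (16 * D + 25).
Proof.
have [C C0 HC] := fundamental_lemma R; exists C => // D P y Q c z1 z2 l1 l2 a L y1 Q0 Py HQ r1 r2 co12.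
pose F0 n := (n == c %[mod Q])%N && (ev z1 l1 n && ev z2 l2 n).
pose E p n := ev z1 p n || ev z2 p n.
have l10 : (0 < l1)%N by case/andP: r1.
have l20 : (0 < l2)%N by case/andP: r2.
have coQ1 := coprime_rough Q0 Py HQ r1; have coQ2 := coprime_rough Q0 Py HQ r2.
have coQ : coprime Q (l1 * l2) by rewrite coprimeMr coQ1.
have q00 : (0 < Q * (l1 * l2))%N by rewrite !muln_gt0 Q0 l10.
have nE z l : nper l (ev z l) by exact: nper_residue.
have n12 : nper (l1 * l2) (fun n => ev z1 l1 n && ev z2 l2 n).
  by apply: nper_and; [apply: nper_dvd (nE z1 l1) _; rewrite dvdn_mulr | apply: nper_dvd (nE z2 l2) _; rewrite dvdn_mull].
have n0 : nper (Q * (l1 * l2)) F0.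
  by apply: nper_and; [apply: nper_dvd (nper_residue Q c) _; rewrite dvdn_mulr | apply: nper_dvd n12 _; rewrite dvdn_mull].
have c0 : cnt F0 0 (Q * (l1 * l2)) = 1%N.
  rewrite (cnt_crt coQ Q0 _ (nper_residue Q c) n12) ?muln_gt0 ?l10//.
  by rewrite (cnt_crt co12 l10 l20 (nE z1 l1) (nE z2 l2)) !cnt_residue.
have pc p : p \in sprimes (p3 P) y -> prime p /\ coprime p (Q * (l1 * l2)).
  rewrite mem_sprimes => /and4P[pp _ py /andP[_ Pp]]; split => //.
  have cr l : rg y l -> coprime p l.
    move=> /andP[l0 /allP rl]; rewrite prime_coprime//; apply/negP => pl.
    by have := rl p; rewrite mem_primes pp l0 pl inE ltnNge py => /(_ isT).
  by rewrite !coprimeMr HQ// !cr.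
have cE p : p \in sprimes (p3 P) y -> cnt (E p) 0 p = rho z1 z2 p.
  rewrite mem_sprimes => /and4P[pp _ _ _]; rewrite /rho /E; case: ifP => h.
    rewrite -[RHS](cnt_residue (z1 ^ 2) (prime_gt0 pp)); apply: eq_bigr => n _.
    by rewrite /ev -(eqP h) orbb.
  rewrite cnt_or ?cnt_residue ?prime_gt0// => n; apply/negP => /andP[/eqP h1 /eqP h2].
  by move: h; rewrite -h1 -h2 eqxx.
have nEp p : p \in sprimes (p3 P) y -> nper p (E p).
  by move=> _ n; rewrite /E !nE.
have Ap := @approx_periodic R _ F0 (sprimes (p3 P) y) E a L q00 n0 pc nEp.
rewrite c0 mulr1 in Ap.
have A0 : 0 <= L%:R / (Q * (l1 * l2))%:R :> R by rewrite divr_ge0.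
have Hr p : p \in sprimes (p3 P) y -> 0 <= ((cnt (E p) 0 p)%:R : R) <= 2 /\
     (cnt (E p) 0 p)%:R / p%:R = (cnt (E p) 0 p)%:R / p%:R :> R.
  by move=> /cE ->; split => //; rewrite ler0n ler_nat; case/andP: (rho_le z1 z2 p).
have := HC D y (p3 P) _ _ E _ _ _ _ (fun n => ler0n R (F0 n)) A0 ler01 y1 Hr Ap.
have -> : \prod_(p <- sprimes (p3 P) y) (1 - (cnt (E p) 0 p)%:R / p%:R) = vpair P y z1 z2.
  by apply: eq_big_seq => p /cE ->.
rewrite mul1r (eq_bigr (fun n => (F0 n)%:R * (sv P y z1 n * sv P y z2 n))) // => n _.
congr (_ * _); rewrite /sv -big_split; apply: eq_bigr => p _ /=; rewrite /E.
by case: (ev z1 p n); case: (ev z2 p n); rewrite /= ?subrr ?subr0 ?mul0r ?mulr0 ?mulr1.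
Qed.

Lemma sv_sqr P y z n : sv P y z n * sv P y z n = sv P y z n.
Proof.
rewrite /sv -big_split; apply: eq_bigr => p _ /=.
by case: (ev z p n); rewrite ?subrr ?subr0 ?mul0r ?mulr1.
Qed.

Lemma sum_chi_le (F : nat -> R) (G : nat -> R) Y : (forall l, 0 <= G l) -> (forall l, `|F l| <= G l) ->
  `|\sum_(1 <= l < Y) F l * chir l| <= \sum_(1 <= l < Y) G l.
Proof.
move=> G0 H; apply: le_trans (ler_norm_sum _ _ _) _; apply: ler_sum => l _.
by rewrite normrM -[leRHS]mulr1 ler_pM// chi_norm.
Qed.

(** The case z1 = z2, l2 = 1 of [fl_pair], since [sv] is an indicator and equals its square. The
    character enters the main term only and builds [echi]; the errors are summed in absolute
    value. *)
Lemma moment1 : exists2 C : R, 0 <= C & forall D P y Q c z a L Y, (1 < y)%N -> (0 < Q)%N -> (P <= y)%N ->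
  (forall p, prime p -> (P < p)%N -> coprime p Q) ->
  `|\sum_(a <= n < a + L) (n == c %[mod Q])%N%:R * (sv P y z n * bv Y y z n)
    - L%:R / Q%:R * vone P y * echi R y Y| <=
  L%:R / Q%:R * vone P y * (C / 16 ^+ D) * urough Y y + Y%:R * y%:R ^+ (16 * D + 25).
Proof.
have [C C0 HC] := fl_pair; exists C => // D P y Q c z a L Y y1 Q0 Py HQ.
pose I l := \sum_(a <= n < a + L) ((n == c %[mod Q])%N && ev z l n)%:R * sv P y z n.
have v0 : 0 <= vone P y by rewrite -(vpair_diag P y 0); exact: vpair_ge0.
have HI l : rg y l -> `|I l - L%:R / Q%:R * vone P y / l%:R| <=
     L%:R / Q%:R * vone P y * (C / 16 ^+ D) / l%:R + y%:R ^+ (16 * D + 25).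
  move=> rl; have l0 : (0 < l)%N by case/andP: rl.
  have r1 : rg y 1 by [].
  have := HC D P y Q c z z l 1%N a L y1 Q0 Py HQ rl r1 (coprimen1 l).
  rewrite vpair_diag muln1.
  have -> : \sum_(a <= n < a + L) ((n == c %[mod Q])%N && (ev z l n && ev z 1 n))%:R * (sv P y z n * sv P y z n) = I l.
    by apply: eq_bigr => n _; rewrite sv_sqr /ev !modn1 eqxx andbT.
  have q0 : (Q%:R : R) != 0 by rewrite pnatr_eq0 -lt0n.
  have l0' : (l%:R : R) != 0 by rewrite pnatr_eq0 -lt0n.
  rewrite natrM.
  have -> : L%:R / (Q%:R * l%:R) * vone P y = L%:R / Q%:R * vone P y / l%:R :> R by field; rewrite q0 l0'.
  by rewrite [_ / l%:R * (C / _)]mulrAC.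
have -> : \sum_(a <= n < a + L) (n == c %[mod Q])%N%:R * (sv P y z n * bv Y y z n) =
   \sum_(1 <= l < Y.+1) ((rg y l)%:R * I l) * chir l.
  rewrite /bv; under eq_bigr do rewrite mulrA mulr_sumr.
  rewrite exchange_big /= big_mkcond; apply: eq_bigr => l _.
  case: ifP => rl; last by rewrite !mul0r.
  rewrite mul1r /I mulr_suml; apply: eq_bigr => n _; rewrite -mulnb natrM; ring.
have -> : L%:R / Q%:R * vone P y * echi R y Y =
   \sum_(1 <= l < Y.+1) ((rg y l)%:R * (L%:R / Q%:R * vone P y / l%:R)) * chir l.
  rewrite /echi big_mkcond mulr_sumr; apply: eq_bigr => l _; case: ifP => _; last by rewrite !mul0r mulr0.
  by rewrite mul1r; ring.
rewrite -sumrB; under eq_bigr do rewrite -mulrBl -mulrBr.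
have k0 : 0 <= L%:R / Q%:R * vone P y * (C / 16 ^+ D).
  by rewrite mulr_ge0 ?mulr_ge0 ?divr_ge0 ?exprn_ge0.
apply: le_trans (@sum_chi_le _ (fun l => (rg y l)%:R * (L%:R / Q%:R * vone P y * (C / 16 ^+ D) / l%:R) + y%:R ^+ (16 * D + 25)) _ _ _) _.
- by move=> l; rewrite addr_ge0 ?exprn_ge0// mulr_ge0// divr_ge0.
- move=> l; rewrite normrM normr_nat; case: (boolP (rg y l)) => rl; last by rewrite !mul0r add0r exprn_ge0.
  by rewrite !mul1r HI.
rewrite big_split /=; apply: lerD.
  rewrite /urough mulr_sumr; apply: le_of_eq; apply: eq_bigr => l _; ring.
by rewrite sumr_const_nat subn1 mulr_natl.
Qed.

(** The gcd g of two non-coprime rough numbers exceeds y. Extracting it from both costs 1 / g^2, and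
    the sum of 1 / g^2 over g > y is at most 1 / y. *)
Lemma noncoprime_sum y Y : (0 < y)%N ->
  \sum_(1 <= l1 < Y.+1) \sum_(1 <= l2 < Y.+1) (~~ coprime l1 l2)%:R * ((rg y l1)%:R / l1%:R * ((rg y l2)%:R / l2%:R)) <=
  urough Y y ^+ 2 / y%:R.
Proof.
move=> y0; pose f l : R := (rg y l)%:R / l%:R.
have f0 l : 0 <= f l by rewrite divr_ge0.
have U0 : 0 <= urough Y y by apply: sumr_ge0 => l _; exact: f0.
apply: (@le_trans _ _ (\sum_(y.+1 <= g < (y + Y).+1) (\sum_(1 <= l < Y.+1 | (g %| l)%N) f l) ^+ 2)).
  apply: (@le_trans _ _ (\sum_(1 <= l1 < Y.+1) \sum_(1 <= l2 < Y.+1) \sum_(y.+1 <= g < (y + Y).+1) ((g %| l1)%N && (g %| l2)%N)%:R * (f l1 * f l2))).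
    apply: ler_sum_nat => l1 /andP[l10 l1Y]; apply: ler_sum_nat => l2 /andP[l20 l2Y]; rewrite -/(f l1) -/(f l2).
    case: (boolP (coprime l1 l2)) => co; first by rewrite mul0r sumr_ge0// => g _; rewrite mulr_ge0 ?mulr_ge0.
    case: (boolP (rg y l1)) => r1; last by rewrite /f (negbTE r1) !mul0r mulr0 big1// => g _; rewrite mulr0.
    have g1 : (1 < gcdn l1 l2)%N by rewrite ltn_neqAle eq_sym co gcdn_gt0 l10.
    have yg : (y < gcdn l1 l2)%N.
      have pp := pdiv_prime g1; have pg := pdiv_dvd (gcdn l1 l2).
      apply: leq_trans (dvdn_leq (ltnW g1) pg).
      by case/andP: r1 => _ /allP/(_ (pdiv (gcdn l1 l2))); rewrite mem_primes pp l10 (dvdn_trans pg (dvdn_gcdl _ _)) inE; apply.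
    have gY : (gcdn l1 l2 < (y + Y).+1)%N.
      by rewrite ltnS (leq_trans (dvdn_leq l10 (dvdn_gcdl _ _)))// (leq_trans _ (leq_addl _ _)).
    rewrite (bigD1_seq (gcdn l1 l2)) /= ?iota_uniq ?mem_index_iota ?yg//.
    rewrite dvdn_gcdl dvdn_gcdr mul1r lerDl sumr_ge0// => g _; by rewrite mulr_ge0 ?mulr_ge0.
  under eq_bigr do rewrite exchange_big.
  rewrite exchange_big /=; apply: ler_sum => g _; rewrite expr2 mulr_suml big_mkcond [leRHS]big_mkcond.
  apply: ler_sum => l1 _; case: (boolP (g %| l1)%N) => g1; last by rewrite big1// => l2 _; rewrite mul0r.
  rewrite mulr_sumr [leRHS]big_mkcond; apply: ler_sum => l2 _.
  by case: (boolP (g %| l2)%N); rewrite /= ?mul1r ?mul0r.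
apply: (@le_trans _ _ (\sum_(y.+1 <= g < (y + Y).+1) (urough Y y) ^+ 2 * (g.-1%:R^-1 - g%:R^-1))); last first.
  rewrite -mulr_sumr ler_wpM2l ?exprn_ge0// big_add1 /=.
  rewrite (eq_bigr (fun i => (- i.+1%:R^-1) - (- i%:R^-1))); last by move=> i _; rewrite opprK addrC.
  rewrite (telescope_sumr (fun i => - i%:R^-1)) ?leq_addr// opprK addrC.
  by rewrite gerBl invr_ge0.
apply: ler_sum_nat => g /andP[yg _]; have g0 : (0 < g)%N by lia.
have g0' : (0 : R) < g%:R by rewrite ltr0n.
have h : \sum_(1 <= l < Y.+1 | (g %| l)%N) f l <= urough Y y / g%:R.
  rewrite sum_dvd// /urough mulr_suml.
  apply: (@le_trans _ _ (\sum_(1 <= j < (Y %/ g).+1) f j / g%:R)).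
    apply: ler_sum_nat => j /andP[j0 _]; rewrite /f rghM natrM invfM mulrA mulrAC.
    rewrite ler_wpM2r ?invr_ge0// ler_wpM2r ?invr_ge0// ler_nat.
    by case: (rg y g); case: (rg y j).
  rewrite [leRHS](@big_cat_nat _ _ _ (Y %/ g).+1) //=; last by rewrite ltnS leq_div.
  by rewrite lerDl sumr_ge0// => j _; rewrite divr_ge0.
apply: (@le_trans _ _ ((urough Y y / g%:R) ^+ 2)).
  by rewrite lerXn2r ?nnegrE ?divr_ge0// sumr_ge0.
rewrite exprMn ler_wpM2l ?exprn_ge0//.
have gp : (0 < g.-1)%N by lia.
have gp' : (0 : R) < g.-1%:R by rewrite ltr0n.
have gE : g%:R = g.-1%:R + 1 :> R by rewrite natr1 prednK.
have -> : g.-1%:R^-1 - g%:R^-1 = (g.-1%:R * g%:R)^-1 :> R.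
  by rewrite gE in g0' *; field; rewrite !gt_eqF.
by rewrite expr2 -invfM lef_pV2 ?posrE ?mulr_gt0// ler_wpM2r ?(ltW g0')// gE lerDl.
Qed.

(** A common prime p > y of l1 and l2 would give z1^2 = z2^2 modulo p, impossible for distinct z1,
    z2 with squares at most y. Hence only coprime pairs contribute, and completing them to the
    square of [echi] costs [noncoprime_sum]. *)
Lemma moment2 : exists2 C : R, 0 <= C & forall D P y Q c z1 z2 a L Y, (1 < y)%N -> (0 < Q)%N -> (P <= y)%N ->
  (forall p, prime p -> (P < p)%N -> coprime p Q) -> z1 <> z2 -> (z1 ^ 2 <= y)%N -> (z2 ^ 2 <= y)%N ->
  \sum_(a <= n < a + L) (n == c %[mod Q])%N%:R * ((sv P y z1 n * bv Y y z1 n) * (sv P y z2 n * bv Y y z2 n)) <=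
  L%:R / Q%:R * vpair P y z1 z2 * (echi R y Y ^+ 2 + urough Y y ^+ 2 * (C / 16 ^+ D + y%:R^-1))
  + Y%:R ^+ 2 * y%:R ^+ (16 * D + 25).
Proof.
have [C C0 HC] := fl_pair; exists C => // D P y Q c z1 z2 a L Y y1 Q0 Py HQ z12 z1y z2y.
have y0 : (0 < y)%N by apply: ltnW.
pose I l1 l2 := \sum_(a <= n < a + L) ((n == c %[mod Q])%N && (ev z1 l1 n && ev z2 l2 n))%:R * (sv P y z1 n * sv P y z2 n).
pose r l : R := (rg y l)%:R.
pose K := L%:R / Q%:R * vpair P y z1 z2.
have K0 : 0 <= K by rewrite mulr_ge0 ?divr_ge0 ?vpair_ge0.
have q0 : (Q%:R : R) != 0 by rewrite pnatr_eq0 -lt0n.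
pose co l1 l2 : R := (coprime l1 l2)%:R.
have nco l1 l2 : rg y l1 -> rg y l2 -> ~~ coprime l1 l2 -> I l1 l2 = 0.
  move=> r1 r2 nc; rewrite /I big1// => n _.
  case: (boolP (ev z1 l1 n)) => [/eqP h1|]; last by rewrite andbF mul0r.
  case: (boolP (ev z2 l2 n)) => [/eqP h2|]; last by rewrite !andbF mul0r.
  have l10 : (0 < l1)%N by case/andP: r1.
  have g1 : (1 < gcdn l1 l2)%N by rewrite ltn_neqAle eq_sym nc gcdn_gt0 l10.
  have pp := pdiv_prime g1; set p := pdiv (gcdn l1 l2) in pp.
  have p1 : (p %| l1)%N := dvdn_trans (pdiv_dvd _) (dvdn_gcdl l1 l2).
  have p2 : (p %| l2)%N := dvdn_trans (pdiv_dvd _) (dvdn_gcdr l1 l2).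
  have yp : (y < p)%N by case/andP: r1 => _ /allP/(_ p); rewrite mem_primes pp l10 p1 inE; apply.
  have e1 : n = z1 ^ 2 %[mod p] by rewrite -(modn_dvdm n p1) h1 modn_dvdm.
  have e2 : n = z2 ^ 2 %[mod p] by rewrite -(modn_dvdm n p2) h2 modn_dvdm.
  have : z1 ^ 2 = z2 ^ 2 %[mod p] by rewrite -e1 -e2.
  rewrite (modn_small (leq_ltn_trans z1y yp)) (modn_small (leq_ltn_trans z2y yp)) => /eqP.
  by rewrite eqn_exp2r// => /eqP.
have HI l1 l2 : rg y l1 -> rg y l2 -> `|I l1 l2 - K * (co l1 l2 / (l1%:R * l2%:R))| <=
     K * (C / 16 ^+ D) / (l1%:R * l2%:R) + y%:R ^+ (16 * D + 25).
  move=> r1 r2.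
  have l10 : (l1%:R : R) != 0 by rewrite pnatr_eq0 -lt0n; case/andP: r1.
  have l20 : (l2%:R : R) != 0 by rewrite pnatr_eq0 -lt0n; case/andP: r2.
  have e0 : 0 <= K * (C / 16 ^+ D) / (l1%:R * l2%:R) + y%:R ^+ (16 * D + 25).
    have kd : 0 <= K * (C / 16 ^+ D) by apply: mulr_ge0 => //; apply: divr_ge0 => //; exact: exprn_ge0.
    by apply: addr_ge0; [apply: divr_ge0 => //; exact: mulr_ge0 | exact: exprn_ge0].
  case: (boolP (coprime l1 l2)) => cp; last by rewrite nco// /co (negbTE cp) mul0r mulr0 subrr normr0.
  have := HC D P y Q c z1 z2 l1 l2 a L y1 Q0 Py HQ r1 r2 cp; rewrite -/(I l1 l2) !natrM.
  have -> : L%:R / (Q%:R * (l1%:R * l2%:R)) * vpair P y z1 z2 = K / (l1%:R * l2%:R) :> R.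
    by rewrite /K; field; rewrite q0 l10 l20.
  by rewrite /co cp mul1r [_ / (_ * _) * (C / _)]mulrAC.
have -> : \sum_(a <= n < a + L) (n == c %[mod Q])%N%:R * ((sv P y z1 n * bv Y y z1 n) * (sv P y z2 n * bv Y y z2 n)) =
   \sum_(1 <= l1 < Y.+1) \sum_(1 <= l2 < Y.+1) (r l1 * r l2 * I l1 l2) * (chir l1 * chir l2).
  have bE z n : bv Y y z n = \sum_(1 <= l < Y.+1) r l * ((ev z l n)%:R * chir l).
    by rewrite /bv big_mkcond; apply: eq_bigr => l _; rewrite /r; case: ifP; rewrite ?mul1r ?mul0r.
  transitivity (\sum_(a <= n < a + L) \sum_(1 <= l1 < Y.+1) \sum_(1 <= l2 < Y.+1)
      (r l1 * r l2 * (((n == c %[mod Q])%N && (ev z1 l1 n && ev z2 l2 n))%:R * (sv P y z1 n * sv P y z2 n))) * (chir l1 * chir l2)).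
    apply: eq_bigr => n _; rewrite mulrACA !bE mulr_suml !mulr_sumr; apply: eq_bigr => l1 _.
    rewrite !mulr_sumr; apply: eq_bigr => l2 _.
    by rewrite -!mulnb !natrM; ring.
  rewrite exchange_big; apply: eq_bigr => l1 _; rewrite exchange_big; apply: eq_bigr => l2 _.
  by rewrite /I mulr_sumr mulr_suml.
pose M := \sum_(1 <= l1 < Y.+1) \sum_(1 <= l2 < Y.+1) (r l1 * r l2 * (K * (co l1 l2 / (l1%:R * l2%:R)))) * (chir l1 * chir l2).
pose E := \sum_(1 <= l1 < Y.+1) \sum_(1 <= l2 < Y.+1) (K * (C / 16 ^+ D) * (r l1 / l1%:R * (r l2 / l2%:R)) + y%:R ^+ (16 * D + 25)) : R.
have cc l1 l2 : `|chir l1 * chir l2| <= 1.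
  by rewrite normrM -[leRHS]mulr1 ler_pM// chi_norm.
have h1 : \sum_(1 <= l1 < Y.+1) \sum_(1 <= l2 < Y.+1) (r l1 * r l2 * I l1 l2) * (chir l1 * chir l2) <= M + E.
  rewrite -lerBlDl /M /E -sumrB; apply: ler_sum => l1 _; rewrite -sumrB; apply: ler_sum => l2 _.
  rewrite -mulrBl -mulrBr /r; apply: le_trans (ler_norm _) _; rewrite normrM.
  apply: le_trans (ler_wpM2l (normr_ge0 _) (cc l1 l2)) _; rewrite mulr1 !normrM !normr_nat.
  case: (boolP (rg y l1)) => r1; last first.
    by rewrite !mul0r mulr0 add0r exprn_ge0.
  case: (boolP (rg y l2)) => r2; last by rewrite !(mul0r, mulr0) add0r exprn_ge0.
  rewrite !mul1r; apply: le_trans (HI l1 l2 r1 r2) _.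
  by rewrite invfM.
have h2 : E <= K * (C / 16 ^+ D) * urough Y y ^+ 2 + Y%:R ^+ 2 * y%:R ^+ (16 * D + 25).
  rewrite /E; under eq_bigr do rewrite big_split /= sumr_const_nat subn1 -mulr_sumr -mulr_sumr.
  rewrite big_split /= sumr_const_nat subn1 -mulr_sumr -mulr_suml; apply: lerD.
    by rewrite expr2.
  by rewrite -!mulrnA -[_ *+ _]mulr_natr natrM /= mulrC expr2.
have h3 : M <= K * (echi R y Y ^+ 2 + urough Y y ^+ 2 / y%:R).
  have eE : echi R y Y = \sum_(1 <= l < Y.+1) r l * (chir l / l%:R).
    by rewrite /echi big_mkcond; apply: eq_bigr => l _; rewrite /r; case: ifP; rewrite ?mul1r ?mul0r.
  have -> : M = K * (echi R y Y ^+ 2 - \sum_(1 <= l1 < Y.+1) \sum_(1 <= l2 < Y.+1)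
      ((~~ coprime l1 l2)%:R * (r l1 / l1%:R * (r l2 / l2%:R))) * (chir l1 * chir l2)).
    rewrite expr2 eE mulr_suml -sumrB mulr_sumr; apply: eq_bigr => l1 _.
    rewrite mulr_sumr -sumrB mulr_sumr; apply: eq_bigr => l2 _.
    rewrite invfM /co; case: (coprime l1 l2) => /=; rewrite ?mul0r ?subr0 ?mul1r; ring.
  rewrite ler_wpM2l// lerD2l; apply: le_trans (noncoprime_sum Y y0).
  rewrite -sumrN; apply: ler_sum => l1 _; rewrite -sumrN; apply: ler_sum => l2 _.
  apply: le_trans (ler_norm _) _; rewrite normrN normrM.
  have n0 : 0 <= (~~ coprime l1 l2)%:R * (r l1 / l1%:R * (r l2 / l2%:R)).
    by rewrite mulr_ge0// mulr_ge0 ?divr_ge0 /r.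
  by rewrite (ger0_norm n0) -[leRHS]mulr1 ler_wpM2l// cc.
apply: (le_trans h1); apply: le_trans (lerD h3 h2) _.
by rewrite -/K; apply: le_of_eq; ring.
Qed.
End PairSieve.

(** * Correlation of the sieve conditions at two values of z *)

Section LocalDensities.
Variable R : realType.
Notation rg y := (rgh y).-nat.

(** Chosen so that (1 + 1 / (p - 1))^2 <= 1 + [bp p] for p >= 3. *)
Definition bp (p : nat) : R := 3 / (p%:R - 1).

Lemma bp_ge0 p : (0 < p)%N -> 0 <= bp p.
Proof. by move=> p0; rewrite divr_ge0// subr_ge0 ler1n. Qed.

Lemma bpq_ge0 p : prime p -> 0 <= bp p / p%:R.
Proof. by move=> pp; apply: divr_ge0 => //; apply: bp_ge0; exact: prime_gt0. Qed.

Definition hprod (ps : seq nat) m : R := \prod_(p <- ps | (p %| m)%N) (1 + bp p).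

Lemma eqn_modMl_coprime q Q i j : coprime q Q -> (Q * i == Q * j %[mod q])%N = (i == j %[mod q])%N.
Proof.
move=> co; wlog ji : i j / (j <= i)%N.
  by move=> W; case: (leqP j i) => [/W//|/ltnW/W]; rewrite eq_sym => ->; rewrite eq_sym.
by rewrite !eqn_mod_dvd ?leq_mul2l ?ji ?orbT// -mulnBr Gauss_dvdr.
Qed.

Lemma ap_count q Q a N : (0 < q)%N -> coprime q Q ->
  \sum_(0 <= j < N) (q %| a + Q * j)%N%:R <= N%:R / q%:R + 1 :> R.
Proof.
move=> q0 co.
have nn : 0 <= N%:R / q%:R + 1 :> R by rewrite addr_ge0 ?divr_ge0.
case: (boolP (has (fun j => q %| a + Q * j)%N (index_iota 0 N))) => [/hasP[j0 _ h0]|/hasPn H]; last first.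
  by rewrite big_seq big1// => j jN; rewrite (negbTE (H j jN)).
have E j : (q %| a + Q * j)%N = (j == j0 %[mod q])%N.
  rewrite -(eqn_modMl_coprime _ _ co) -(eqn_modDl a) [RHS]/eq_op /= -/(eq_op _ _).
  by rewrite /dvdn in h0; rewrite /dvdn (eqP h0).
under eq_bigr do rewrite E.
have := @cnt_approx R (fun j => (j == j0 %[mod q])%N) q 0 N q0 (nper_residue q j0).
rewrite cnt_residue// mulr1 /cnt add0n natr_sum ler_distl => /andP[_]; apply: le_trans.
by [].
Qed.

(** The factor of p is 1 plus [bp p] times the indicator of p | m, and this indicator is absorbed
    into the modulus q. The induction therefore has to be over all q coprime to the remaining
    primes. *)
Lemma ap_hprod ps q Q a N : uniq ps -> (forall p, p \in ps -> prime p /\ coprime p Q) ->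
  (0 < q)%N -> coprime q Q -> (forall p, p \in ps -> coprime p q) ->
  \sum_(0 <= j < N) (q %| a + Q * j)%N%:R * hprod ps (a + Q * j) <=
  N%:R / q%:R * (\prod_(p <- ps) (1 + bp p / p%:R)) + \prod_(p <- ps) (1 + bp p).
Proof.
elim: ps q => [|p ps IH] q.
  move=> _ _ q0 co _; rewrite !big_nil mulr1; under eq_bigr do rewrite /hprod big_nil mulr1.
  exact: ap_count.
move=> /= /andP[pps ups] Hp q0 co cq.
have [pp pQ] := Hp p (mem_head _ _); have p0 := prime_gt0 pp.
have pq : coprime p q by apply: cq; rewrite mem_head.
have Hp' x : x \in ps -> prime x /\ coprime x Q by move=> xp; apply: Hp; rewrite in_cons xp orbT.
have I1 := IH q ups Hp' q0 co (fun x xp => cq x (mem_behead (s := p :: ps) xp)).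
have I2 : \sum_(0 <= j < N) (q * p %| a + Q * j)%N%:R * hprod ps (a + Q * j) <=
  N%:R / (q * p)%:R * (\prod_(p <- ps) (1 + bp p / p%:R)) + \prod_(p <- ps) (1 + bp p).
  apply: IH => //; first by rewrite muln_gt0 q0.
    by rewrite coprimeMl co.
  move=> x xp; rewrite coprimeMr cq ?in_cons ?xp ?orbT//=.
  have [px _] := Hp' x xp; rewrite prime_coprime// dvdn_prime2//.
  by apply: contraNneq pps => <-.
have b0 := bp_ge0 p0.
apply: (@le_trans _ _ (\sum_(0 <= j < N) (q %| a + Q * j)%N%:R * hprod ps (a + Q * j) +
   bp p * \sum_(0 <= j < N) (q * p %| a + Q * j)%N%:R * hprod ps (a + Q * j))).
  rewrite mulr_sumr -big_split; apply: ler_sum => j _ /=.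
  rewrite /hprod big_cons Gauss_dvd 1?coprime_sym//.
  case: (q %| _)%N; case: (p %| _)%N; rewrite /= ?mul0r ?mulr0 ?addr0 ?mul1r//.
  by rewrite mulrDl mul1r.
apply: le_trans (lerD I1 (ler_wpM2l b0 I2)) _.
rewrite !big_cons; set P1 := \prod_(_ <- _) _; set P2 := \prod_(_ <- _) _.
have p0' : (p%:R : R) != 0 by rewrite pnatr_eq0 -lt0n.
have q0' : (q%:R : R) != 0 by rewrite pnatr_eq0 -lt0n.
rewrite natrM; apply: le_of_eq; field; by rewrite p0' q0'.
Qed.

(** Primes above m do not divide it. The cut at A turns the error product of [ap_hprod] into a power
    of ln A, which is far smaller than a power of ln y. *)
Lemma hprod_cut ps m A : (0 < m)%N -> (m <= A)%N -> hprod ps m = hprod [seq p <- ps | (p <= A)%N] m.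
Proof.
move=> m0 mA; rewrite /hprod big_filter_cond; apply: eq_bigl => p.
by case: (boolP (p %| m)%N) => [/(dvdn_leq m0) pm|]; rewrite ?andbF// (leq_trans pm mA).
Qed.

(** The terms 3 / (p (p - 1)) telescope over all integers above P to at most 3 / P. A large P thus
    makes the average correlation close to 1. *)
Lemma prod_bp_div P y : (0 < P)%N -> \prod_(p <- sprimes (p3 P) y) (1 + bp p / p%:R) <= expR (3 / P%:R).
Proof.
move=> P0; apply: (@le_trans _ _ (\prod_(p <- sprimes (p3 P) y) expR (bp p / p%:R))).
  rewrite big_seq [leRHS]big_seq; apply: ler_prod => p; rewrite mem_sprimes => /and4P[pp _ _ _].
  by rewrite addr_ge0 ?bpq_ge0//= expR_ge1Dx.
rewrite -expR_sum ler_expR sum_sprimes.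
apply: (@le_trans _ _ (\sum_(P.+1 <= p < (P + y).+1) 3 * (p.-1%:R^-1 - p%:R^-1))).
  apply: (@le_trans _ _ (\sum_(1 <= p < (P + y).+1 | (P < p)%N) 3 * (p.-1%:R^-1 - p%:R^-1))).
    apply: (@le_trans _ _ (\sum_(1 <= p < y.+1 | (P < p)%N) 3 * (p.-1%:R^-1 - p%:R^-1))).
      rewrite big_mkcond [leRHS]big_mkcond; apply: ler_sum_nat => p /andP[p0 _].
      case: (boolP (P < p)%N) => Pp; last by rewrite /p3 (negbTE Pp) !andbF.
      have p1 : (0 < p.-1)%N by lia.
      have p1' : (0 : R) < p.-1%:R by rewrite ltr0n.
      have pE : p%:R = p.-1%:R + 1 :> R by rewrite natr1 prednK.
      have p0' : (0 : R) < p%:R by rewrite ltr0n.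
      have e : 3 * (p.-1%:R^-1 - p%:R^-1) = bp p / p%:R.
        rewrite /bp pE in p0' *; rewrite addrK; field; by rewrite !gt_eqF.
      rewrite e; case: ifP => // _; by rewrite divr_ge0 ?bp_ge0.
    rewrite [leRHS](@big_cat_nat _ _ _ y.+1) //=; last by rewrite ltnS leq_addl.
    rewrite lerDl big_nat_cond sumr_ge0// => p /andP[/andP[yp _] Pp].
    have p1 : (0 < p.-1)%N by lia.
    by rewrite mulr_ge0// subr_ge0 lef_pV2 ?posrE ?ltr0n ?ler_nat; lia.
  by rewrite [leRHS](@big_nat_widenl _ _ _ _ 1).
rewrite -mulr_sumr ler_wpM2l// big_add1 /=.
rewrite (eq_bigr (fun i => (- i.+1%:R^-1) - (- i%:R^-1))); last by move=> i _; rewrite opprK addrC.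
rewrite (telescope_sumr (fun i => - i%:R^-1)) ?leq_addr// opprK addrC.
by rewrite gerBl invr_ge0.
Qed.

Lemma prod_bp : exists2 C : R, 0 <= C & forall P y A, (1 < A)%N ->
  \prod_(p <- [seq p <- sprimes (p3 P) y | (p <= A)%N]) (1 + bp p) <= C * ln A%:R ^+ 6.
Proof.
have [C C0 HC] := sum_prime_inv R; exists (expR (6 * C)) => [|P y A A1]; first exact: expR_ge0.
apply: (@le_trans _ _ (\prod_(p <- [seq p <- sprimes (p3 P) y | (p <= A)%N]) expR (6 * p%:R^-1))).
  rewrite big_seq [leRHS]big_seq; apply: ler_prod => p.
  rewrite mem_filter mem_sprimes => /andP[_ /and4P[pp p2 _ _]].
  rewrite addr_ge0 ?bp_ge0 ?prime_gt0//=; apply: le_trans (expR_ge1Dx _); rewrite lerD2l /bp.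
  have p3 : (3 : R) <= p%:R by rewrite ler_nat.
  by rewrite ler_pdivrMr; [rewrite mulrAC ler_pdivlMr|]; lra.
rewrite -expR_sum.
have -> : expR (6 * C) * ln A%:R ^+ 6 = expR (6 * C + 6 * ln (ln A%:R)).
  have l0 := ln_gt0_nat R A1.
  by rewrite expRD mulr_natl [6 * ln _]mulr_natl -lnXn// lnK ?posrE ?exprn_gt0.
rewrite ler_expR -mulr_sumr -mulrDr ler_wpM2l//.
have := HC A A1; rewrite ler_norml => /andP[_ h].
apply: (@le_trans _ _ (\sum_(1 <= p < A.+1 | prime p) p%:R^-1)); last lra.
rewrite -[leRHS]big_filter; apply: sub_le_sum => [|p|n]; last by rewrite invr_ge0.
  by rewrite !filter_uniq// iota_uniq.
rewrite mem_filter mem_sprimes => /andP[pA /and4P[pp _ _ _]].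
by rewrite mem_filter pp mem_index_iota prime_gt0// ltnS.
Qed.

Lemma hprod_sum : exists2 C : R, 0 <= C & forall P y Q a N A, (0 < P)%N -> (1 < A)%N -> (0 < a)%N ->
  (a + Q * N <= A)%N -> (forall p, prime p -> (P < p)%N -> coprime p Q) ->
  \sum_(0 <= j < N) hprod (sprimes (p3 P) y) (a + Q * j) <= N%:R * expR (3 / P%:R) + C * ln A%:R ^+ 6.
Proof.
have [C C0 HC] := prod_bp; exists C => // P y Q a N A P0 A1 a0 aA HQ.
set ps := [seq p <- sprimes (p3 P) y | (p <= A)%N].
have Hps p : p \in ps -> prime p /\ coprime p Q.
  by rewrite mem_filter mem_sprimes => /andP[_ /and4P[pp _ _ /andP[_ Pp]]]; split => //; exact: HQ.
have ups : uniq ps by rewrite !filter_uniq// iota_uniq.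
have := @ap_hprod ps 1%N Q a N ups Hps isT (coprime1n Q) (fun p _ => coprimen1 p).
rewrite divr1.
have -> : \sum_(0 <= j < N) (1 %| a + Q * j)%N%:R * hprod ps (a + Q * j) =
  \sum_(0 <= j < N) hprod (sprimes (p3 P) y) (a + Q * j).
  apply: eq_big_nat => j /andP[_ jN]; rewrite dvd1n mul1r -hprod_cut//; first by rewrite addn_gt0 a0.
  by apply: leq_trans aA; rewrite leq_add2l leq_mul2l ltnW ?orbT.
move=> /le_trans; apply; apply: lerD; last exact: HC.
rewrite ler_wpM2l//; apply: le_trans (prod_bp_div y P0).
rewrite /ps big_filter [leRHS](bigID (fun p => (p <= A)%N)) /= ler_peMr//.
  rewrite big_seq_cond prodr_ge0// => p /andP[]; rewrite mem_sprimes => /and4P[pp _ _ _] _.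
  by rewrite addr_ge0 ?bpq_ge0.
rewrite big_seq_cond; elim/big_rec: _ => // p x /andP[]; rewrite mem_sprimes => /and4P[pp _ _ _] _ x1.
by rewrite mulr_ege1// lerDl bpq_ge0.
Qed.

(** Compared with (1 - 1/p)^2, the local factor is larger by exactly 1 + 1 / (p - 1) when p divides
    z1^2 - z2^2, and not larger otherwise. Bounding the product over z1 - z2 and z1 + z2 by the mean
    of squares leaves one linear form in each sum. *)
Lemma vpair_le P y z1 z2 : (z2 < z1)%N ->
  vpair R P y z1 z2 <= vone R P y ^+ 2 *
   ((hprod (sprimes (p3 P) y) (z1 - z2) + hprod (sprimes (p3 P) y) (z1 + z2)) / 2).
Proof.
move=> z21; set ps := sprimes (p3 P) y.
pose g m : R := \prod_(p <- ps | (p %| m)%N) (1 + (p%:R - 1)^-1).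
have pp_ge p : p \in ps -> (3 : R) <= p%:R.
  by rewrite mem_sprimes => /and4P[_ p2 _ _]; rewrite ler_nat.
have gh m : g m ^+ 2 <= hprod ps m.
  rewrite expr2 /g -big_split /hprod big_seq_cond [leRHS]big_seq_cond; apply: ler_prod => p /andP[/pp_ge p3 _] /=.
  have t0 : 0 <= (p%:R - 1)^-1 :> R by rewrite invr_ge0; lra.
  have t1 : (p%:R - 1)^-1 <= 1 :> R by rewrite invf_le1; lra.
  rewrite /bp; move: (p%:R - 1)^-1 t0 t1 => t t0 t1; apply/andP; split; nra.
have v0 : 0 <= vone R P y by rewrite -(vpair_diag R P y 0); exact: vpair_ge0.
have g0 m : 0 <= g m.
  rewrite /g big_seq_cond prodr_ge0// => p /andP[/pp_ge p3 _].
  by rewrite addr_ge0 // invr_ge0; lra.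
apply: (@le_trans _ _ (vone R P y ^+ 2 * (g (z1 - z2)%N * g (z1 + z2)%N))); last first.
  rewrite ler_wpM2l ?exprn_ge0//; have := gh (z1 - z2)%N; have := gh (z1 + z2)%N.
  have := sqr_ge0 (g (z1 - z2)%N - g (z1 + z2)%N); rewrite sqrrB => h1 h2 h3; lra.
rewrite /vpair /vone /g ![\prod_(p <- ps | _) _]big_mkcond expr2 -!big_split.
rewrite big_seq [leRHS]big_seq; apply: ler_prod => p pps /=; have p3 := pp_ge p pps.
have p0 : (0 : R) < p%:R by lra.
have p1 : (0 : R) < p%:R - 1 by lra.
apply/andP; split.
  rewrite subr_ge0 ler_pdivrMr// mul1r; case/andP: (rho_le z1 z2 p) => _ h.
  apply: (@le_trans _ _ 2); [by rewrite ler_nat | lra].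
have t0 : 0 <= (p%:R - 1)^-1 :> R by rewrite invr_ge0; lra.
have f1 m : 1 <= (if (p %| m)%N then 1 + (p%:R - 1)^-1 else 1) :> R by case: ifP => // _; lra.
have i0 : 0 <= p%:R^-1 :> R by rewrite invr_ge0; lra.
have i1 : p%:R^-1 <= 1 :> R by rewrite invf_le1; lra.
have sq0 : 0 <= (1 - p%:R^-1) * (1 - p%:R^-1) :> R by rewrite mulr_ge0 ?subr_ge0.
rewrite /rho; case: ifP => h.
  have e : (1 - p%:R^-1) * (1 - p%:R^-1) * (1 + (p%:R - 1)^-1) = 1 - 1 / p%:R :> R.
    by field; rewrite !gt_eqF.
  rewrite -e ler_wpM2l//.
  have : (p %| (z1 - z2) * (z1 + z2))%N.
    by rewrite -subn_sqr -eqn_mod_dvd// leq_exp2r// ltnW.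
  have pp : prime p by move: pps; rewrite mem_sprimes => /and4P[].
  rewrite Euclid_dvdM// => /orP[] ->; [have := f1 (z1 + z2)%N | have := f1 (z1 - z2)%N];
    set w := (if _ then _ else _) => w1; [rewrite ler_peMr//| rewrite ler_peMl//]; lra.
apply: (@le_trans _ _ ((1 - p%:R^-1) * (1 - p%:R^-1))).
  by have := sqr_ge0 (p%:R^-1 : R); rewrite expr2; lra.
by rewrite ler_peMr// mulr_ege1.
Qed.

Lemma vpair_sum : exists2 C : R, 0 <= C & forall P y Q z0 N A, (0 < P)%N -> (1 < A)%N -> (0 < z0)%N -> (0 < Q)%N ->
  (2 * z0 + 2 * Q * N <= A)%N -> (forall p, prime p -> (P < p)%N -> coprime p Q) ->
  forall i, (i <= N)%N ->
  \sum_(0 <= j < i) vpair R P y (z0 + Q * i) (z0 + Q * j) <=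
  vone R P y ^+ 2 * (i%:R * expR (3 / P%:R) + C * ln A%:R ^+ 6).
Proof.
have [C C0 HC] := hprod_sum; exists C => // P y Q z0 N A P0 A1 z00 Q0 zA HQ i iN.
set ps := sprimes (p3 P) y.
have h1 : \sum_(0 <= j < i) hprod ps (z0 + Q * i - (z0 + Q * j)) <= i%:R * expR (3 / P%:R) + C * ln A%:R ^+ 6.
  rewrite big_nat_rev /= add0n.
  (* The differences are Q (i - j), and no sieving prime divides Q, so Q drops out of [hprod] and
     consecutive integers remain. *)
  rewrite (eq_big_nat _ _ (F2 := fun j => hprod ps (1 + 1 * j))); last first.
    move=> j /andP[_ ji]; rewrite subnDl -mulnBr subKn// mul1n add1n /hprod.
    rewrite big_seq_cond [RHS]big_seq_cond; apply: eq_bigl => p; case: (boolP (p \in ps)) => //= pps.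
    move: pps; rewrite mem_sprimes => /and4P[pp _ _ /andP[_ Pp]].
    by rewrite Gauss_dvdr// HQ.
  apply: (HC P y 1%N 1%N i A) => //; last by move=> p _ _; exact: coprimen1.
  apply: leq_trans zA; rewrite mul1n addnC addn1.
  have : (i <= 2 * Q * N)%N by rewrite (leq_trans iN)// leq_pmull// muln_gt0 Q0.
  by lia.
have h2 : \sum_(0 <= j < i) hprod ps (z0 + Q * i + (z0 + Q * j)) <= i%:R * expR (3 / P%:R) + C * ln A%:R ^+ 6.
  rewrite (eq_bigr (fun j => hprod ps (2 * z0 + Q * i + Q * j))); last by move=> j _; congr hprod; lia.
  apply: HC => //; first by lia.
  apply: leq_trans zA; have : (Q * i <= Q * N)%N by rewrite leq_mul2l iN orbT.
  by lia.
apply: (@le_trans _ _ (vone R P y ^+ 2 * ((\sum_(0 <= j < i) hprod ps (z0 + Q * i - (z0 + Q * j)) + \sum_(0 <= j < i) hprod ps (z0 + Q * i + (z0 + Q * j))) / 2))).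
  rewrite -big_split mulr_suml mulr_sumr; apply: ler_sum_nat => j /andP[_ ji] /=.
  by apply: vpair_le; rewrite ltn_add2l ltn_pmul2l.
by rewrite ler_wpM2l ?sqr_ge0//; lra.
Qed.
End LocalDensities.

(** * The variance of the sifted sum over z *)

Section Variance.
Variable R : realType.
Notation rg y := (rgh y).-nat.

Lemma vone_ge : exists2 c : R, 0 < c & forall P y, (1 < y)%N -> c * wy R y <= vone R P y.
Proof.
have [C C0 HC] := sum_prime_mod4 R; exists (expR (- (C + 16))) => [|P y y1]; first exact: expR_gt0.
have p3E : {subset sprimes (p3 P) y <= sprimes (fun p => p %% 4 == 3)%N y}.
  by move=> p; rewrite !mem_sprimes => /and4P[-> -> -> /andP[->]].
apply: le_trans (@prod_sprimes_ge R (p3 P) y (fun p => p%:R^-1) _); last first.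
  by move=> p _; rewrite ger0_norm ?invr_ge0.
rewrite /wy -expRD ler_expR -opprD lerN2.
have [_ h] := HC y y1.
suff : \sum_(p <- sprimes (p3 P) y) p%:R^-1 <= \sum_(1 <= p < y.+1 | prime p && (p %% 4 == 3)%N) p%:R^-1 :> R by lra.
rewrite -[leRHS]big_filter; apply: sub_le_sum => [|p|n]; last by rewrite invr_ge0.
  exact: sprimes_uniq.
rewrite mem_sprimes => /and4P[pp _ py /andP[p4 _]].
by rewrite mem_filter pp p4 mem_index_iota prime_gt0// ltnS.
Qed.

Lemma vone_le1 P y : 0 <= vone R P y <= 1.
Proof.
have H p : p \in sprimes (p3 P) y -> 0 <= (1 - p%:R^-1 : R) <= 1.
  rewrite mem_sprimes => /and4P[_ p2 _ _]; have p0 : (0 : R) < p%:R by rewrite ltr0n; lia.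
  by rewrite subr_ge0 invf_le1 ?ler1n ?gerBl ?invr_ge0 ?(ltW p0) ?andbT//; lia.
rewrite /vone; elim: (sprimes _ _) H => [|p s IH] H; first by rewrite big_nil ler01 lexx.
rewrite big_cons; have /andP[a1 a2] := H p (mem_head _ _).
have /andP[b1 b2] : 0 <= (\prod_(p <- s) (1 - p%:R^-1) : R) <= 1.
  by apply: IH => q qs; apply: H; rewrite in_cons qs orbT.
by rewrite mulr_ge0//= mulr_ile1.
Qed.

Lemma urough_le : exists2 C : R, 0 <= C & forall y w, (5 <= y)%N -> (0 < w)%N -> 0 <= urough R (y ^ w) y <= C * w%:R.
Proof.
have [C C0 HC] := rough_logsum R; exists C => // y w y5 w0; apply/andP; split.
  by apply: sumr_ge0 => l _; rewrite divr_ge0.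
apply: le_trans (HC y w (y ^ w)%N y5 w0); apply: le_of_eq.
by apply: eq_big_nat => l /andP[_]; rewrite ltnS => ->; rewrite andbT.
Qed.

Lemma ev_dvd z l n : (z ^ 2 <= n)%N -> ev z l n = (l %| n - z ^ 2)%N.
Proof. by move=> zn; rewrite /ev eqn_mod_dvd. Qed.

Lemma bv_bsum Y y z n : (z ^ 2 <= n)%N -> bv R Y y z n = bsum R Y y (n - z ^ 2).
Proof.
move=> zn; rewrite /bv /bsum [RHS]big_mkcondr; apply: eq_bigr => l _.
by rewrite ev_dvd//; case: ifP; rewrite ?mul1r ?mul0r.
Qed.

Lemma sv_nop3 P y z n : (z ^ 2 < n)%N ->
  (forall p, prime p -> (p <= P)%N -> (p %% 4 = 3)%N -> ~~ (p %| n - z ^ 2)%N) ->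
  sv R P y z n = (nop3 y (n - z ^ 2))%:R.
Proof.
move=> zn HP; rewrite /sv prod_ind; congr (nat_of_bool _)%:R.
apply/allP/nop3P => [H|[_ H] p].
  split=> [|p pp py p4]; first by rewrite subn_gt0.
  case: (leqP p P) => Pp; first exact: HP.
  rewrite -ev_dvd ?(ltnW zn)//; apply: H; rewrite mem_sprimes /p3 pp py p4 Pp eqxx.
  by case: p pp {py Pp} p4 => [|[|[|p]]].
rewrite mem_sprimes => /and4P[pp _ py /andP[/eqP p4 _]].
by rewrite ev_dvd ?(ltnW zn)// H.
Qed.

Lemma sum_shift (F : nat -> R) a b k X : (k < a)%N -> (b <= X.+1)%N -> (forall m, 0 <= F m) ->
  \sum_(a <= n < b) F (n - k)%N <= \sum_(1 <= m < X.+1) F m.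
Proof.
move=> ka bX F0; case: (leqP a b) => ab; last by rewrite big_geq ?sumr_ge0// ltnW.
rewrite -(subnK (ltnW ka)) big_addn; under eq_bigr do rewrite addnK.
have h1 : (1 <= a - k)%N by rewrite subn_gt0.
have h2 : (b - k <= X.+1)%N by apply: leq_trans bX; rewrite leq_subr.
have h3 : (a - k <= b - k)%N by rewrite leq_sub2r.
rewrite [leRHS](@big_cat_nat _ _ _ (a - k)) //=; last exact: leq_trans h3 h2.
rewrite [X in _ <= _ + X](@big_cat_nat _ _ _ (b - k)) //=.
by rewrite addrCA lerDl addr_ge0// sumr_ge0.
Qed.

(** The hypothesis on [A] settles the primes up to P, so [sv] becomes [nop3] of n - z^2. B is at
    most the number of rough divisors, and the mean of the square of that number over sifted
    integers costs [expR (3 * lr)], at most (2 v + 1)^3. *)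
Lemma diag_le : exists2 C : R, 0 <= C & forall P y v X Y z a b, (5 <= y)%N -> (y <= X)%N -> (X < y ^ (2 * v).+1)%N ->
  (z ^ 2 < a)%N -> (b <= X.+1)%N ->
  forall A : pred nat, (forall n p, A n -> (z ^ 2 < n)%N -> prime p -> (p <= P)%N -> (p %% 4 = 3)%N -> ~~ (p %| n - z ^ 2)%N) ->
  \sum_(a <= n < b) (A n)%:R * (sv R P y z n * bv R Y y z n) ^+ 2 <= C * X%:R * wy R y * (2 * v).+1%:R ^+ 3.
Proof.
have [C C0 HC] := wt3_sum R; exists C => // P y v X Y z a b y5 yX Xu za bX A HA.
have y1 : (1 < y)%N by apply: leq_trans y5.
have w4 m : 0 <= wt (a3 R) 4 y m by apply: cmul_ge0 => p; rewrite /hw; case: ifP.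
apply: (@le_trans _ _ (\sum_(a <= n < b) wt (a3 R) 4 y (n - z ^ 2))).
  apply: ler_sum_nat => n /andP[an _]; have zn := leq_trans za an.
  case: (boolP (A n)) => An; last by rewrite mul0r.
  rewrite mul1r (sv_nop3 _ zn) ?bv_bsum ?(ltnW zn)//; last by move=> p; exact: HA.
  apply: le_trans (nop3_nrdiv2 R y _).
  case: (nop3 _ _); last by rewrite !mul0r expr0n.
  rewrite !mul1r -real_normK ?num_real// lerXn2r ?nnegrE ?sumr_ge0//.
  by apply: bsum_le; rewrite subn_gt0.
apply: le_trans (sum_shift za bX w4) _.
have z4 : 0 <= (4 : R) <= 4 by rewrite lexx ler0n.
apply: le_trans (HC 4 y X y5 yX z4) _; rewrite ler_wpM2l ?mulr_ge0 ?(ltW (wy_gt0 _ _))//.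
have -> : (2 * v).+1%:R ^+ 3 = expR (3 * ln (2 * v).+1%:R) :> R.
  by rewrite mulr_natl -lnXn ?ltr0n// lnK// posrE exprn_gt0// ltr0n.
rewrite ler_expR (_ : 4 - 1 = 3 :> R); last by ring.
rewrite ler_wpM2l// -(lr_pow R y1 (isT : (0 < (2 * v).+1)%N)).
by apply: lr_mono; rewrite ?(ltnW Xu)// (leq_trans y1).
Qed.

Lemma sqr_sum_nat (f : nat -> R) N : (\sum_(0 <= i < N) f i) ^+ 2 =
  \sum_(0 <= i < N) f i ^+ 2 + 2 * \sum_(0 <= i < N) \sum_(0 <= j < i) f i * f j.
Proof.
elim: N => [|N IH]; first by rewrite !big_geq// expr0n mulr0 addr0.
rewrite !big_nat_recr //= sqrrD IH -mulr_sumr -[_ *+ 2]mulr_natl; ring.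
Qed.

Lemma sum_nat_le N : \sum_(0 <= i < N) i%:R <= N%:R ^+ 2 / 2 :> R.
Proof.
elim: N => [|N IH]; first by rewrite big_geq// expr0n mul0r.
by rewrite big_nat_recr //= -natr1; have := ler0n R N; lra.
Qed.

Definition rsum P Y y Q z0 N n : R := \sum_(0 <= i < N) sv R P y (z0 + Q * i) n * bv R Y y (z0 + Q * i) n.

(** The square is expanded. Diagonal terms are left as they stand for [diag_le]; pairs i > j go to
    [moment2] and are averaged by [vpair_sum]; the linear term uses the lower bound from [moment1].
    The main terms are not cancelled here, since that needs the relations between the parameters. *)
Lemma variance : exists2 C : R, 0 <= C & forall D P y Q c z0 N a L Y A (X1 V E U d th : R),
  (1 < y)%N -> (0 < P)%N -> (P <= y)%N ->
  (0 < Q)%N -> (forall p, prime p -> (P < p)%N -> coprime p Q) -> (0 < z0)%N -> (1 < A)%N ->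
  (2 * z0 + 2 * Q * N <= A)%N -> ((z0 + Q * N) ^ 2 <= y)%N -> 0 <= E ->
  X1 = L%:R / Q%:R -> V = vone R P y -> E = echi R y Y -> U = urough R Y y ->
  d = C / 16 ^+ D -> th = y%:R ^+ (16 * D + 25) ->
  \sum_(a <= n < a + L) (n == c %[mod Q])%N%:R * (rsum P Y y Q z0 N n - N%:R * V * E) ^+ 2 <=
  \sum_(0 <= i < N) \sum_(a <= n < a + L) (n == c %[mod Q])%N%:R * (sv R P y (z0 + Q * i) n * bv R Y y (z0 + Q * i) n) ^+ 2
  + (X1 * V ^+ 2 * (N%:R ^+ 2 * expR (3 / P%:R) + 2 * N%:R * (C * ln A%:R ^+ 6)) * (E ^+ 2 + U ^+ 2 * (d + y%:R^-1))
     + N%:R ^+ 2 * (Y%:R ^+ 2 * th))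
  - 2 * (N%:R * V * E) * (N%:R * (X1 * V * E - X1 * V * d * U - Y%:R * th))
  + (N%:R * V * E) ^+ 2 * (X1 + 1).
Proof.
have [C1 C10 H1] := moment1 R; have [C2 C20 H2] := moment2 R; have [C3 C30 H3] := vpair_sum R.
exists (C1 + C2 + C3) => [|D P y Q c z0 N a L Y A X1 V E U d th y1 P0 Py Q0 HQ z00 A1 zA zy E0 eX1 eV eE eU ed eth]; first lra.
have y0 : (0 : R) < y%:R by rewrite ltr0n ltnW.
have U0 : 0 <= U by rewrite eU; apply: sumr_ge0 => l _; rewrite divr_ge0.
have /andP[V0 V1] := vone_le1 P y; rewrite -eV in V0 V1.
have X10 : 0 <= X1 by rewrite eX1 divr_ge0.
have th0 : 0 <= th by rewrite eth exprn_ge0// ltW.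
have p16 : 0 < 16 ^+ D :> R by rewrite exprn_gt0.
have lA : 0 <= ln A%:R :> R by exact: ln_nat_ge0.
have d0 : 0 <= d by rewrite ed divr_ge0 ?(ltW p16)// !addr_ge0.
pose f i n := sv R P y (z0 + Q * i) n * bv R Y y (z0 + Q * i) n.
pose I n : R := (n == c %[mod Q])%N%:R.
set M := N%:R * V * E.
have M0 : 0 <= M by rewrite !mulr_ge0.
have ex : \sum_(a <= n < a + L) I n * (rsum P Y y Q z0 N n - M) ^+ 2 =
   \sum_(0 <= i < N) \sum_(a <= n < a + L) I n * f i n ^+ 2 +
   2 * (\sum_(0 <= i < N) \sum_(0 <= j < i) \sum_(a <= n < a + L) I n * (f i n * f j n))
   - 2 * M * (\sum_(0 <= i < N) \sum_(a <= n < a + L) I n * f i n) + M ^+ 2 * \sum_(a <= n < a + L) I n.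
  transitivity (\sum_(a <= n < a + L) (\sum_(0 <= i < N) I n * f i n ^+ 2 +
    2 * (\sum_(0 <= i < N) \sum_(0 <= j < i) I n * (f i n * f j n)) - 2 * M * (\sum_(0 <= i < N) I n * f i n) + M ^+ 2 * I n)).
    apply: eq_bigr => n _.
    have -> : rsum P Y y Q z0 N n = \sum_(0 <= i < N) f i n by [].
    rewrite sqrrB sqr_sum_nat.
    have -> : \sum_(0 <= i < N) I n * f i n ^+ 2 = I n * \sum_(0 <= i < N) f i n ^+ 2 by rewrite mulr_sumr.
    have -> : \sum_(0 <= i < N) I n * f i n = I n * \sum_(0 <= i < N) f i n by rewrite mulr_sumr.
    have -> : \sum_(0 <= i < N) \sum_(0 <= j < i) I n * (f i n * f j n) = I n * \sum_(0 <= i < N) \sum_(0 <= j < i) f i n * f j n.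
      by rewrite mulr_sumr; apply: eq_bigr => i _; rewrite mulr_sumr.
    rewrite -[_ *+ 2]mulr_natl; ring.
  rewrite big_split sumrB big_split /= -!mulr_sumr; congr (_ + _ - _ + _).
  - by rewrite exchange_big.
  - by congr (2 * _); rewrite exchange_big; apply: eq_bigr => i _; rewrite exchange_big.
  - by congr (_ * _); rewrite exchange_big.
rewrite -/M in ex *; rewrite ex.
set W := E ^+ 2 + U ^+ 2 * (d + y%:R^-1).
have W0 : 0 <= W by rewrite addr_ge0 ?sqr_ge0// mulr_ge0 ?sqr_ge0// addr_ge0// invr_ge0 ltW.
have zi i : (i <= N)%N -> ((z0 + Q * i) ^ 2 <= y)%N.
  by move=> iN; apply: leq_trans zy; rewrite leq_exp2r// leq_add2l leq_mul2l iN orbT.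
have cross : 2 * (\sum_(0 <= i < N) \sum_(0 <= j < i) \sum_(a <= n < a + L) I n * (f i n * f j n)) <=
   X1 * V ^+ 2 * (N%:R ^+ 2 * expR (3 / P%:R) + 2 * N%:R * ((C1 + C2 + C3) * ln A%:R ^+ 6)) * W + N%:R ^+ 2 * (Y%:R ^+ 2 * th).
  have step i : (i < N)%N -> \sum_(0 <= j < i) \sum_(a <= n < a + L) I n * (f i n * f j n) <=
      X1 * V ^+ 2 * (i%:R * expR (3 / P%:R) + (C1 + C2 + C3) * ln A%:R ^+ 6) * W + i%:R * (Y%:R ^+ 2 * th).
    move=> iN; apply: (@le_trans _ _ (\sum_(0 <= j < i) (X1 * W * vpair R P y (z0 + Q * i) (z0 + Q * j) + Y%:R ^+ 2 * th))).
      apply: ler_sum_nat => j /andP[_ ji].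
      have ne : (z0 + Q * i)%N <> (z0 + Q * j)%N.
        by move=> /eqP; rewrite eqn_add2l eqn_pmul2l// gtn_eqF.
      apply: le_trans (H2 D P y Q c _ _ a L Y y1 Q0 Py HQ ne (zi i (ltnW iN)) (zi j (ltnW (ltn_trans ji iN)))) _.
      rewrite -eX1 -eE -eU -eth lerD2r.
      have -> : X1 * W * vpair R P y (z0 + Q * i) (z0 + Q * j) = X1 * vpair R P y (z0 + Q * i) (z0 + Q * j) * W by ring.
      rewrite ler_wpM2l ?mulr_ge0 ?vpair_ge0// /W lerD2l ler_wpM2l ?sqr_ge0// lerD2r ed ler_wpM2r ?invr_ge0 ?(ltW p16)//; lra.
    rewrite big_split /= -mulr_sumr sumr_const_nat subn0 -[_ *+ i]mulr_natl lerD2r.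
    apply: (@le_trans _ _ (X1 * W * (V ^+ 2 * (i%:R * expR (3 / P%:R) + C3 * ln A%:R ^+ 6)))).
      by rewrite ler_wpM2l ?mulr_ge0// eV; apply: (H3 P y Q z0 N A) => //; exact: ltnW.
    have -> : X1 * V ^+ 2 * (i%:R * expR (3 / P%:R) + (C1 + C2 + C3) * ln A%:R ^+ 6) * W =
      X1 * W * (V ^+ 2 * (i%:R * expR (3 / P%:R) + (C1 + C2 + C3) * ln A%:R ^+ 6)) by ring.
    rewrite ler_wpM2l ?mulr_ge0// ler_wpM2l ?sqr_ge0// lerD2l ler_wpM2r ?exprn_ge0//; lra.
  apply: (@le_trans _ _ (2 * \sum_(0 <= i < N) (X1 * V ^+ 2 * (i%:R * expR (3 / P%:R) + (C1 + C2 + C3) * ln A%:R ^+ 6) * W + i%:R * (Y%:R ^+ 2 * th)))).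
    by rewrite ler_wpM2l//; apply: ler_sum_nat => i /andP[_]; exact: step.
  rewrite big_split /= -!mulr_suml -mulr_sumr big_split /= -mulr_suml sumr_const_nat subn0 -[_ *+ N]mulr_natl.
  have S := sum_nat_le N; set S1 := \sum_(0 <= i < N) i%:R in S *.
  have e0 : 0 <= expR (3 / P%:R) :> R by exact: expR_ge0.
  have Yt : 0 <= Y%:R ^+ 2 * th by rewrite mulr_ge0 ?sqr_ge0.
  have k1 : X1 * V ^+ 2 * (S1 * expR (3 / P%:R) + N%:R * ((C1 + C2 + C3) * ln A%:R ^+ 6)) * W <=
    X1 * V ^+ 2 * (N%:R ^+ 2 / 2 * expR (3 / P%:R) + N%:R * ((C1 + C2 + C3) * ln A%:R ^+ 6)) * W.
    by rewrite ler_wpM2r// ler_wpM2l ?mulr_ge0 ?sqr_ge0// lerD2r ler_wpM2r.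
  have k2 := ler_wpM2r Yt S.
  apply: le_trans (ler_wpM2l _ (lerD k1 k2)) _ => //.
  by apply: le_of_eq; field.
have first : N%:R * (X1 * V * E - X1 * V * d * U - Y%:R * th) <= \sum_(0 <= i < N) \sum_(a <= n < a + L) I n * f i n.
  have -> : N%:R * (X1 * V * E - X1 * V * d * U - Y%:R * th) = \sum_(0 <= i < N) (X1 * V * E - X1 * V * d * U - Y%:R * th).
    by rewrite sumr_const_nat subn0 mulr_natl.
  apply: ler_sum => i _.
  have := H1 D P y Q c (z0 + Q * i)%N a L Y y1 Q0 Py HQ; rewrite ler_norml => /andP[h _].
  rewrite -eX1 -eV -eE -eU -eth in h.
  have dd : X1 * V * (C1 / 16 ^+ D) * U <= X1 * V * d * U.
    rewrite ler_wpM2r// ler_wpM2l ?mulr_ge0// ed ler_wpM2r ?invr_ge0 ?(ltW p16)//; lra.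
  move: h; rewrite -/(f i _) -/(I _); move: dd; clear; move: (\sum_(_ <= _ < _) _) => S dd h.
  lra.
have cntI : \sum_(a <= n < a + L) I n <= X1 + 1.
  have := @cnt_approx R (fun n => (n == c %[mod Q])%N) Q a L Q0 (nper_residue Q c).
  rewrite cnt_residue// mulr1 /cnt natr_sum ler_distl => /andP[_ h].
  by rewrite eX1; apply: le_trans h _.
have f2 := ler_wpM2l (mulr_ge0 (ler0n R 2) M0) first.
have f3 := ler_wpM2l (sqr_ge0 M) cntI.
have four (A1' A2' B1 B2 C1' C2' D1 : R) : A1' <= A2' -> B2 <= B1 -> C1' <= C2' -> D1 + A1' - B1 + C1' <= D1 + A2' - B2 + C2'.
  by move=> *; lra.
exact: four cross f2 f3.
Qed.
End Variance.

(** * Counting exceptions *)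

Section Modulus.

Definition oddprod P := (\prod_(p <- sprimes predT P) p)%N.
Definition modulus P := (8 * oddprod P)%N.
(* Chosen so that n - z^2 is coprime to every odd p <= P and has odd part 1 mod 4,
   whenever n = c and z = zbase P c modulo modulus P and n is admissible. *)
Definition zbase P c :=
  ((if (c %% 4 == 1)%N then 2 else 1) * \prod_(p <- sprimes predT P | ~~ (p %| c)%N) p)%N.

Lemma prod_pos (s : seq nat) (A : pred nat) : (forall p, p \in s -> (0 < p)%N) -> (0 < \prod_(p <- s | A p) p)%N.
Proof.
move=> H; rewrite big_seq_cond; elim/big_ind: _ => // [x y x0 y0|p /andP[/H]//].
by rewrite muln_gt0 x0.
Qed.

Lemma sprimes_pos pr P p : p \in sprimes pr P -> (0 < p)%N.
Proof. by rewrite mem_sprimes => /and4P[_ h _ _]; lia. Qed.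

Lemma modulus_gt0 P : (0 < modulus P)%N.
Proof. by rewrite muln_gt0 /=; apply: prod_pos => p; exact: sprimes_pos. Qed.

Lemma zbase_gt0 P c : (0 < zbase P c)%N.
Proof.
rewrite muln_gt0 prod_pos ?andbT; first by case: ifP.
by move=> p; exact: sprimes_pos.
Qed.

Lemma zbase_le P c : (zbase P c <= modulus P)%N.
Proof.
apply: leq_mul; first by case: ifP.
rewrite /oddprod [leqRHS](bigID (fun p => ~~ (p %| c)%N)) /= leq_pmulr//.
by apply: prod_pos => p; exact: sprimes_pos.
Qed.

Lemma modulus_coprime P p : (2 <= P)%N -> prime p -> (P < p)%N -> coprime p (modulus P).
Proof.
move=> P2 pp Pp; rewrite coprimeMr; apply/andP; split.
  rewrite (_ : 8 = 2 ^ 3)%N// coprimeXr// prime_coprime// dvdn_prime2//.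
  by apply/eqP => p2; move: Pp; rewrite p2 ltnNge P2.
rewrite /oddprod big_seq; apply: (big_ind (fun x => coprime p x)).
- exact: coprimen1.
- by move=> x y; rewrite coprimeMr => -> ->.
move=> q; rewrite mem_sprimes => /and4P[pq _ qP _]; rewrite prime_coprime// dvdn_prime2//.
by apply/eqP => pq'; move: Pp; rewrite pq' ltnNge qP.
Qed.

Lemma dvd_prod (s : seq nat) (A : pred nat) p : p \in s -> A p -> (p %| \prod_(q <- s | A q) q)%N.
Proof.
move=> ps Ap; elim: s ps => // q s IH; rewrite inE => /orP[/eqP <-|ps]; rewrite big_cons.
  by rewrite Ap dvdn_mulr.
by case: ifP => _; [rewrite dvdn_mull// IH | exact: IH].
Qed.

Lemma odd_prod (s : seq nat) (A : pred nat) : (forall p, p \in s -> odd p) -> odd (\prod_(p <- s | A p) p).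
Proof.
move=> H; rewrite big_seq_cond; elim/big_ind: _ => // [x y ox oy|p /andP[/H]//].
by rewrite oddM ox.
Qed.

Lemma sprimes_odd pr P p : p \in sprimes pr P -> odd p.
Proof. by rewrite mem_sprimes => /and4P[pp h _ _]; case: (even_prime pp) h => [->|]. Qed.

Lemma modn8 z : odd z -> (z ^ 2 %% 8 = 1)%N.
Proof.
move=> oz; rewrite -modnXm; have : odd (z %% 8) by rewrite (odd_mod z (erefl : odd 8 = false)).
by have := ltn_pmod z (isT : (0 < 8)%N); move: (z %% 8)%N => [|[|[|[|[|[|[|[|]]]]]]]].
Qed.

(** Here w = z^2. The residues of n modulo 8 are 1, 2, 3, 5, 6. An even z serves 1 and 5; an odd z
    gives n - 1 = 1, 2, 5 modulo 8 for n = 2, 3, 6, and the case 2 modulo 8 is twice an odd number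
    that is 1 modulo 4. *)
Lemma sub_mod_cases n w : (w <= n)%N -> ~~ (4 %| n)%N -> (n != 7 %[mod 8])%N ->
  (if (n %% 4 == 1)%N then (w %% 4 == 0)%N else (w %% 8 == 1)%N) ->
  ((n - w) %% 4 = 1)%N \/ ((n - w) %% 8 = 2)%N.
Proof.
move=> wn; rewrite /dvdn; move: (subnK wn) => e; move: (n - w)%N e => m e.
case: ifP => h; lia.
Qed.

(** For each odd p <= P exactly one of n and z is divisible by p, so p never divides n - z^2. *)
Lemma class_local P c n i z : (n = c %[mod modulus P])%N -> admissible n ->
  z = (zbase P c + modulus P * i)%N -> (z ^ 2 < n)%N ->
  (forall p, prime p -> (2 < p)%N -> (p <= P)%N -> ~~ (p %| n - z ^ 2)%N) /\
  (((n - z ^ 2) %% 4 = 1)%N \/ ((n - z ^ 2) %% 8 = 2)%N).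
Proof.
move=> nc /andP[n4 n8] zE zn.
have d8 : (8 %| modulus P)%N by rewrite dvdn_mulr.
have n8c : (n = c %[mod 8])%N by rewrite -(modn_dvdm n d8) nc modn_dvdm.
split.
  move=> p pp p2 pP; have ps : p \in sprimes predT P by rewrite mem_sprimes pp p2 pP.
  have pM : (p %| modulus P)%N by rewrite dvdn_mull//; exact: dvd_prod.
  have npc : (n = c %[mod p])%N by rewrite -(modn_dvdm n pM) nc modn_dvdm.
  have pcn : (p %| n)%N = (p %| c)%N by rewrite /dvdn npc.
  have pz : (p %| z)%N = ~~ (p %| n)%N.
    rewrite zE dvdn_addl; last by rewrite dvdn_mulr.
    rewrite pcn; case: (boolP (p %| c)%N) => pc /=; last by rewrite dvdn_mull//; exact: dvd_prod.
    apply/negP; rewrite Euclid_dvdM// => /orP[].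
      case: ifP => _; last by rewrite dvdn1 => /eqP p1; rewrite p1 in p2.
      by move=> h; have := dvdn_leq (isT : (0 < 2)%N) h; rewrite leqNgt p2.
    rewrite big_seq_cond; apply/negP; elim/big_ind: _ => [|x y hx hy|q /andP[qs qc]].
    - by rewrite dvdn1; apply/eqP => p1; rewrite p1 in p2.
    - by rewrite Euclid_dvdM// negb_or hx.
    move: qs; rewrite mem_sprimes => /and4P[qq _ _ _]; rewrite dvdn_prime2//.
    by apply: contraNneq qc => <-.
  apply/negP => pm; have zn' := ltnW zn.
  case: (boolP (p %| n)%N) => pn.
    have : (p %| z ^ 2)%N by rewrite -(dvdn_subr zn').
    by rewrite Euclid_dvdX// pz pn.
  have pz2 : (p %| z ^ 2)%N by rewrite Euclid_dvdX// pz pn.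
  by move: pn; rewrite -(subnK zn') dvdn_add.
apply: sub_mod_cases => //; first exact: ltnW.
have c4 : (n %% 4 = c %% 4)%N by rewrite -(modn_dvdm n (isT : (4 %| 8)%N)) n8c modn_dvdm.
have zb : odd (\prod_(p <- sprimes predT P | ~~ (p %| c)%N) p).
  by apply: odd_prod => p; exact: sprimes_odd.
have oM : odd (modulus P * i) = false by rewrite oddM /modulus oddM.
rewrite c4; case: ifP => h.
  rewrite zE /zbase h /modulus; apply/eqP/eqP; rewrite -/(dvdn 4 _).
  rewrite (_ : 8 = 2 * 4)%N// -!mulnA -mulnDr expnMn dvdn_mulr//.
by rewrite modn8// zE oddD oM addbF /zbase h mul1n.
Qed.

Lemma chi_1mod4 a : odd a -> (forall p, prime p -> (p %| a)%N -> (p %% 4 != 3)%N) -> chi a = 1.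
Proof.
elim/ltn_ind: a => a IH oa H; case: (leqP a 1) => a1.
  by have -> : a = 1%N by case: a a1 oa {IH H} => [|[|]].
have pp := pdiv_prime a1; have /dvdnP[k kE] := pdiv_dvd a; set p := pdiv a in pp kE.
have k0 : (0 < k)%N by case: k kE => // kE; rewrite kE in a1.
have pa : (p %| a)%N by rewrite kE dvdn_mull.
have op : odd p by rewrite (dvdn_odd pa).
have ok : odd k by rewrite (@dvdn_odd k a)// kE dvdn_mulr.
have ck : chi k = 1.
  apply: IH => // [|q pq qk]; first by rewrite kE ltn_Pmulr// prime_gt1.
  by apply: H => //; rewrite kE dvdn_mulr.
have cp : chi p = 1.
  have := chi_sign op => -[//|]; rewrite /chi; case: ifP => // _; case: ifP => // h _.
  by have := H p pp pa; rewrite h.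
by rewrite kE chiM ck cp.
Qed.

(** The smooth part of a sifted m has no prime factor 3 mod 4, hence is a sum of two squares, and
    its odd part is 1 mod 4. So the failure of m lies in the rough part, whose divisor sum must
    vanish, and the odd part of m being 1 mod 4 gives the rough part chi = 1. *)
Lemma bad_of_not_sum2sq y m : (1 < y)%N -> nop3 y m -> (m %% 4 = 1)%N \/ (m %% 8 = 2)%N ->
  ~ sum2sq m -> bad y m.
Proof.
move=> y1 /nop3P[m0 H] hm ns; set k := (m`_(rgh y))%N; set A := (m`_(rgh y)^')%N.
have mE : m = (k * A)%N by rewrite partnC.
have k0 : (0 < k)%N by exact: part_gt0.
have A0 : (0 < A)%N by exact: part_gt0.
have ok : odd k by apply: rgh_odd y1 _; exact: part_pnat.
have HA p : prime p -> (p %| A)%N -> (p %% 4 != 3)%N.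
  move=> pp pA; apply/eqP => p3.
  have py : (p <= y)%N.
    have /andP[_ /allP/(_ p)] := part_pnat ((rgh y)^')%N m.
    by rewrite mem_primes pp A0 pA !inE => /(_ isT); rewrite -leqNgt.
  by have := H p pp py p3; rewrite mE dvdn_mull.
have sA : sum2sq A by apply: sum2sq_1mod4.
rewrite /bad -/k; apply/andP; split; last first.
  by apply/negPn/negP => dk; apply: ns; rewrite mE; apply: sum2sqM => //; exact: sum2sq_dchi.
case: hm => hm.
  have om : odd m by rewrite -(odd_mod m (erefl : odd 4 = false)) hm.
  have cA : chi A = 1 by apply: chi_1mod4 => //; rewrite (@dvdn_odd A m)// mE dvdn_mull.
  have : chi m = 1 by rewrite /chi hm.
  by rewrite mE chiM cA mulr1 => /eqP.
have em : odd m = false by rewrite -(odd_mod m (erefl : odd 8 = false)) hm.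
have eA : odd A = false by move: em; rewrite mE oddM ok.
have [B AE] : exists B, A = (B * 2)%N by apply/dvdnP; rewrite dvdn2 eA.
have hB : ((k * B) %% 4 = 1)%N by move: hm; rewrite mE AE mulnA; move: (k * B)%N => w; lia.
have oB : odd B.
  have : odd (k * B) by rewrite -(odd_mod (k * B) (erefl : odd 4 = false)) hB.
  by rewrite oddM => /andP[].
have cB : chi B = 1.
  by apply: chi_1mod4 => // p pp pB; apply: HA => //; rewrite AE dvdn_mulr.
have : chi (k * B)%N = 1 by rewrite /chi hB.
by rewrite chiM cB mulr1 => /eqP.
Qed.
End Modulus.

(** * Exceptions in one class, bounded by the variance and the bad sum *)

Section Exceptions.
Variable R : realType.

(** A constant [K] stands in for [Psi], whose growth enters only in the last deduction. *)
Definition zrep (K : R) n := exists z : nat,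
  [/\ (0 < z)%N, (z ^ 2 <= n)%N, z%:R < K * Num.sqrt (ln n%:R) & sum2sq (n - z ^ 2)].

Definition exc K n := admissible n && ~~ `[< zrep K n >].

(** For an exceptional n every surviving z yields a bad n - z^2, so the sifted sum is bounded by the
    terms of [tsum]. Either it is below M / 2, and Chebyshev's inequality applies with factor 4 /
    M^2, or it is at least M / 2, and Markov's inequality applies with factor 2 / M. *)
Lemma exc_class P K y v Y c N a L X (M : R) : (1 < y)%N -> (2 <= P)%N ->
  (forall i n, (i < N)%N -> (a <= n)%N -> (zbase P c + modulus P * i)%:R < K * Num.sqrt (ln n%:R)) ->
  (forall i, (i < N)%N -> ((zbase P c + modulus P * i) ^ 2 + y ^ (2 * v - 2) <= a)%N) ->
  (a + L <= X.+1)%N -> 0 < M ->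
  \sum_(a <= n < a + L) ((n == c %[mod modulus P])%N && exc K n)%:R <=
  4 / M ^+ 2 * (\sum_(a <= n < a + L) (n == c %[mod modulus P])%N%:R * (rsum R P Y y (modulus P) (zbase P c) N n - M) ^+ 2)
  + 2 / M * (N%:R * tsum R X Y y v).
Proof.
move=> y1 P2 HK Ha aX M0; set Q := modulus P; set z0 := zbase P c.
pose t m : R := if [&& nop3 y m, (y ^ (2 * v - 2) <= m)%N & bad y m] then `|bsum R Y y m| else 0.
have t0 m : 0 <= t m by rewrite /t; case: ifP.
have y0 : (0 < y)%N by apply: ltnW.
have zlt i : (i < N)%N -> ((z0 + Q * i) ^ 2 < a)%N.
  by move=> iN; apply: leq_trans (Ha i iN); rewrite -addn1 leq_add2l expn_gt0 y0.
apply: (@le_trans _ _ (\sum_(a <= n < a + L) (4 / M ^+ 2 * ((n == c %[mod Q])%N%:R * (rsum R P Y y Q z0 N n - M) ^+ 2)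
   + 2 / M * \sum_(0 <= i < N) t (n - (z0 + Q * i) ^ 2)%N))).
  apply: ler_sum_nat => n /andP[an _].
  have T0 : 0 <= 2 / M * \sum_(0 <= i < N) t (n - (z0 + Q * i) ^ 2)%N.
    by rewrite mulr_ge0 ?sumr_ge0// divr_ge0// ltW.
  case: (boolP (_ && _)) => [/andP[nc /andP[adm nrep]]|_]; last first.
    by rewrite addr_ge0// mulr_ge0 ?divr_ge0 ?exprn_ge0 ?(ltW M0)// mulr_ge0 ?sqr_ge0.
  rewrite nc mul1r; set r := rsum _ _ _ _ _ _ _ _.
  have rT : `|r| <= \sum_(0 <= i < N) t (n - (z0 + Q * i) ^ 2)%N.
    apply: le_trans (ler_norm_sum _ _ _) _; apply: ler_sum_nat => i /andP[_ iN].
    set z := (z0 + Q * i)%N; have zn : (z ^ 2 < n)%N := leq_trans (zlt i iN) an.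
    have [loc1 loc2] := class_local (eqP nc) adm (erefl z) zn.
    rewrite (@sv_nop3 R P y z n zn); last first.
      move=> p pp pP p3; apply: loc1 => //; by case: p pp {pP} p3 => [|[|[|p]]].
    rewrite bv_bsum ?(ltnW zn)// /t.
    case: (boolP (nop3 y (n - z ^ 2))) => np; last by rewrite mul0r normr0.
    have bd : bad y (n - z ^ 2).
      apply: bad_of_not_sum2sq => // ss; move/asboolP: nrep; apply; exists z; split => //.
      - by rewrite /z addn_gt0 zbase_gt0.
      - exact: ltnW.
      - exact: HK.
    rewrite bd andbT mul1r.
    have -> : (y ^ (2 * v - 2) <= n - z ^ 2)%N.
      by rewrite leq_subRL ?(ltnW zn)//; apply: leq_trans an; exact: Ha.
    by [].
  have k1 : 0 <= 4 / M ^+ 2 by rewrite divr_ge0 ?exprn_ge0// ltW.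
  case: (lerP (M / 2) `|r|) => hr.
    have : 1 <= 2 / M * `|r| by rewrite mulrAC ler_pdivlMr//; lra.
    move=> /le_trans; apply; apply: le_trans (ler_wpM2l _ rT) _; first by rewrite divr_ge0// ltW.
    by rewrite lerDr mulr_ge0 ?sqr_ge0.
  rewrite -[leLHS]addr0; apply: lerD => //.
  have h : M ^+ 2 / 4 <= (r - M) ^+ 2.
    have := ler_norm r => h1.
    have -> : (r - M) ^+ 2 = (M - r) ^+ 2 by rewrite -sqrrN opprB.
    have -> : M ^+ 2 / 4 = (M / 2) ^+ 2 by field.
    by rewrite lerXn2r ?nnegrE; lra.
  apply: le_trans (ler_wpM2l k1 h); rewrite -[true%:R]/(1 : R); apply: le_of_eq.
  by field; rewrite gt_eqF.
rewrite big_split /= -mulr_sumr lerD2l -mulr_sumr ler_wpM2l ?divr_ge0 ?(ltW M0)//.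
rewrite exchange_big /=.
have -> : N%:R * tsum R X Y y v = \sum_(0 <= i < N) tsum R X Y y v.
  by rewrite sumr_const_nat subn0 mulr_natl.
apply: ler_sum_nat => i /andP[_ iN]; rewrite /tsum [leRHS]big_mkcond.
exact: (sum_shift (zlt i iN) aX t0).
Qed.

Lemma sum_classes (F : nat -> bool) Q a b : (0 < Q)%N ->
  \sum_(a <= n < b) (F n)%:R = \sum_(0 <= c < Q) \sum_(a <= n < b) ((n == c %[mod Q])%N && F n)%:R :> R.
Proof.
move=> Q0; rewrite exchange_big; apply: eq_bigr => n _ /=.
rewrite (bigD1_seq (n %% Q)%N) /= ?mem_index_iota ?iota_uniq ?ltn_pmod// modn_mod eqxx /=.
rewrite big_nat_cond big1 ?addr0// => c /andP[/andP[_ cQ] cn].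
by rewrite (modn_small cQ) eq_sym (negbTE cn).
Qed.

Lemma wy_sqrt y : (1 < y)%N -> (wy R y)^-1 = Num.sqrt (ln y%:R).
Proof.
move=> y1; have l0 := ln_gt0_nat R y1.
rewrite /wy expRN invrK -[LHS]ger0_norm ?expR_ge0// -sqrtr_sqr; congr Num.sqrt.
rewrite expr2 -expRD -[RHS]lnK ?posrE//; congr expR; lra.
Qed.

(* The y with y^(2v) <= X < y^(2v+1), that is u = ln X / ln y of size 2v. *)
Lemma scale_exists v B : (0 < v)%N -> exists X0, forall X, (X0 <= X)%N ->
  exists y, [/\ (B <= y)%N, (y ^ (2 * v) <= X)%N & (X < y ^ (2 * v).+1)%N].
Proof.
(* The summand 4^v ensures (2 y)^(2 v) = 4^v y^(2 v) <= y^(2 v + 1), so that y + 1 <= 2 y gives the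
   upper bound from the maximality of y. *)
move=> v0; set B' := (B + 4 ^ v + 1)%N; exists (B' ^ (2 * v))%N => X hX.
have ex : exists y, (y ^ (2 * v) <= X)%N by exists B'.
have ub y : (y ^ (2 * v) <= X)%N -> (y <= X)%N.
  by apply: leq_trans; case: y => // y; rewrite -{1}[y.+1]expn1 leq_pexp2l// muln_gt0.
case: (ex_maxnP ex ub) => y hy my; have By : (B' <= y)%N by exact: my.
exists y; split => //; first by apply: leq_trans By; rewrite /B' -addnA leq_addr.
have : ~~ (y.+1 ^ (2 * v) <= X)%N by apply/negP => /my; rewrite ltnn.
rewrite -ltnNge => /leq_trans; apply; apply: (@leq_trans ((2 * y) ^ (2 * v))).
  by rewrite leq_exp2r ?muln_gt0//; move: By; rewrite /B'; clear; lia.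
rewrite expnMn expnS expnM leq_mul2r; apply/orP; right.
by apply: leq_trans By; rewrite /B' -addnA addnC leq_addl || (rewrite /B'; move: (4 ^ v)%N; clear; lia).
Qed.
End Exceptions.

(** * Exceptions in one residue class *)

Section ClassCount.
Variable R : realType.

(** With G the squared mean times X1, the main terms G - 2 G + G cancel. The errors in units of q G
    are 5 from the second moment, 2 from the sieve error in the linear term, and 1 each from the two
    remainders, the count of the class and the diagonal: 11 in all. *)
Lemma var_algebra (q X1 V E U d th N Y e lg yi Dg : R) :
  0 < q -> q <= 1 / 4 -> 0 <= X1 -> 0 <= V -> 0 <= E -> 0 <= U -> 0 <= N -> 0 <= e -> e <= 1 + q -> 0 <= lg ->
  U ^+ 2 * (d + yi) <= 2 * q * E ^+ 2 -> 0 <= U ^+ 2 * (d + yi) -> 2 * lg <= q * N -> d * U <= q * E ->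
  Y ^+ 2 * th <= q * (X1 * V ^+ 2 * E ^+ 2) -> 2 * (V * E * (Y * th)) <= q * (X1 * V ^+ 2 * E ^+ 2) ->
  1 <= q * X1 -> Dg <= q * (X1 * V ^+ 2 * N ^+ 2 * E ^+ 2) ->
  Dg + (X1 * V ^+ 2 * (N ^+ 2 * e + 2 * N * lg) * (E ^+ 2 + U ^+ 2 * (d + yi)) + N ^+ 2 * (Y ^+ 2 * th))
  - 2 * (N * V * E) * (N * (X1 * V * E - X1 * V * d * U - Y * th)) + (N * V * E) ^+ 2 * (X1 + 1)
  <= 11 * q * (X1 * V ^+ 2 * N ^+ 2 * E ^+ 2).
Proof.
move=> q0 q4 X10 V0 E0 U0 N0 e0 e1 lg0 h1 h1' h2 h3 h4 h5 h6 h7.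
set G := X1 * V ^+ 2 * N ^+ 2 * E ^+ 2 in h7 *.
have G0 : 0 <= G by rewrite /G !mulr_ge0 ?sqr_ge0.
have N2 := sqr_ge0 N.
have t2 : X1 * V ^+ 2 * (N ^+ 2 * e + 2 * N * lg) * (E ^+ 2 + U ^+ 2 * (d + yi)) <= G * (1 + 5 * q).
  have a1 : N ^+ 2 * e + 2 * N * lg <= N ^+ 2 * (1 + 2 * q).
    have := ler_wpM2l N2 e1; have := ler_wpM2l N0 h2; rewrite expr2; lra.
  have a2 : E ^+ 2 + U ^+ 2 * (d + yi) <= E ^+ 2 * (1 + 2 * q) by lra.
  have k0 : 0 <= X1 * V ^+ 2 by rewrite mulr_ge0 ?sqr_ge0.
  have b1 : 0 <= X1 * V ^+ 2 * (N ^+ 2 * e + 2 * N * lg).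
    by rewrite mulr_ge0// addr_ge0 ?mulr_ge0.
  have b2 : 0 <= E ^+ 2 + U ^+ 2 * (d + yi) by rewrite addr_ge0 ?sqr_ge0.
  apply: le_trans (ler_pM b1 b2 (ler_wpM2l k0 a1) a2) _.
  have -> : X1 * V ^+ 2 * (N ^+ 2 * (1 + 2 * q)) * (E ^+ 2 * (1 + 2 * q)) = G * (1 + 2 * q) ^+ 2 by rewrite /G; ring.
  rewrite ler_wpM2l//; have : q * q <= q * (1 / 4) by rewrite ler_wpM2l// ltW.
  by rewrite expr2; lra.
have t3 : N ^+ 2 * (Y ^+ 2 * th) <= q * G.
  apply: le_trans (ler_wpM2l N2 h4) _; rewrite /G; apply: le_of_eq; ring.
have t4 : 2 * (N * V * E) * (N * (X1 * V * d * U)) <= 2 * q * G.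
  have k0 : 0 <= 2 * N ^+ 2 * X1 * V ^+ 2 * E by rewrite !mulr_ge0 ?sqr_ge0.
  have := ler_wpM2l k0 h3.
  have -> : 2 * N ^+ 2 * X1 * V ^+ 2 * E * (q * E) = 2 * q * G by rewrite /G; ring.
  by apply: le_trans; apply: le_of_eq; ring.
have t5 : 2 * (N * V * E) * (N * (Y * th)) <= q * G.
  have := ler_wpM2l N2 h5.
  have -> : N ^+ 2 * (q * (X1 * V ^+ 2 * E ^+ 2)) = q * G by rewrite /G; ring.
  by apply: le_trans; apply: le_of_eq; ring.
have t6 : (N * V * E) ^+ 2 <= q * G.
  have := ler_wpM2l (sqr_ge0 (N * V * E)) h6; rewrite mulr1 => /le_trans; apply.
  by rewrite /G; apply: le_of_eq; ring.
have e5 : 2 * (N * V * E) * (N * (X1 * V * E - X1 * V * d * U - Y * th)) =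
  2 * G - 2 * (N * V * E) * (N * (X1 * V * d * U)) - 2 * (N * V * E) * (N * (Y * th)) by rewrite /G; ring.
have e6 : (N * V * E) ^+ 2 * (X1 + 1) = G + (N * V * E) ^+ 2 by rewrite /G; ring.
rewrite e5 e6.
move: t2 t3 t4 t5 t6 h7; clearbody G; clear.
move: (X1 * V ^+ 2 * _ * _) (N ^+ 2 * (Y ^+ 2 * th)) (_ * (N * (X1 * V * d * U))) (_ * (N * (Y * th))) ((N * V * E) ^+ 2) => a1 a2 a3 a4 a5.
have -> : G * (1 + 5 * q) = G + 5 * (q * G) by ring.
have -> : 11 * q * G = 11 * (q * G) by ring.
have -> : 2 * q * G = 2 * (q * G) by ring.
move: (q * G) => g; lra.
Qed.

Lemma admissible_class P n c : (n = c %[mod modulus P])%N -> admissible n = admissible c.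
Proof.
move=> nc; have d8 : (8 %| modulus P)%N by rewrite dvdn_mulr.
have n8c : (n = c %[mod 8])%N by rewrite -(modn_dvdm n d8) nc modn_dvdm.
rewrite /admissible n8c; congr (~~ _ && _).
by rewrite /dvdn -(modn_dvdm n (isT : (4 %| 8)%N)) n8c modn_dvdm.
Qed.

(** The hypotheses make each error in the variance at most q times the main term; then 44 = 4 * 11,
    the 4 being that of Chebyshev's inequality. The diagonal bound is required per value of z, which
    is why it contains [N%:R] and not its square. *)
Lemma class_count : exists Cd Cv : R, [/\ 0 <= Cd, 0 <= Cv & forall (q K : R) D P y v c N X Y T0 A,
  0 < q -> q <= 1 / 4 -> (5 <= y)%N -> (2 <= P)%N -> (P <= y)%N -> (1 < A)%N -> (0 < N)%N ->
  (2 * zbase P c + 2 * modulus P * N <= A)%N -> ((zbase P c + modulus P * N) ^ 2 <= y)%N ->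
  (y <= X)%N -> (X < y ^ (2 * v).+1)%N -> (T0 <= X)%N ->
  (forall i n, (i < N)%N -> (T0 <= n)%N -> (zbase P c + modulus P * i)%:R < K * Num.sqrt (ln n%:R)) ->
  (forall i, (i < N)%N -> ((zbase P c + modulus P * i) ^ 2 + y ^ (2 * v - 2) <= T0)%N) ->
  expR (3 / P%:R) <= 1 + q ->
  forall X1 V E U : R, X1 = (X.+1 - T0)%:R / (modulus P)%:R -> V = vone R P y -> E = echi R y Y -> U = urough R Y y ->
  0 < V -> 0 < E ->
  U ^+ 2 * (Cv / 16 ^+ D + y%:R^-1) <= 2 * q * E ^+ 2 ->
  2 * (Cv * ln A%:R ^+ 6) <= q * N%:R -> Cv / 16 ^+ D * U <= q * E ->
  Y%:R ^+ 2 * y%:R ^+ (16 * D + 25) <= q * (X1 * V ^+ 2 * E ^+ 2) ->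
  2 * (V * E * (Y%:R * y%:R ^+ (16 * D + 25))) <= q * (X1 * V ^+ 2 * E ^+ 2) ->
  1 <= q * X1 -> Cd * X%:R * wy R y * (2 * v).+1%:R ^+ 3 <= q * (X1 * V ^+ 2 * N%:R * E ^+ 2) ->
  \sum_(T0 <= n < X.+1) ((n == c %[mod modulus P])%N && exc K n)%:R <=
  44 * q * X1 + 2 / (V * E) * tsum R X Y y v].
Proof.
have [Cd Cd0 Hd] := diag_le R; have [Cv Cv0 Hv] := variance R.
exists Cd, Cv; split => // q K D P y v c N X Y T0 A q0 q4 y5 P2 Py A1 N0 zA zy yX Xu TX HK Ha eP X1 V E U eX1 eV eE eU V0 E0 h1 h2 h3 h4 h5 h6 h7.
have y1 : (1 < y)%N by apply: leq_trans y5.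
have y0 : (0 : R) < y%:R by rewrite ltr0n ltnW.
have N0' : (0 : R) < N%:R by rewrite ltr0n.
have Q0 := modulus_gt0 P.
have HQ p : prime p -> (P < p)%N -> coprime p (modulus P) by exact: modulus_coprime.
have P0 : (0 < P)%N by apply: ltnW.
have E0' : 0 <= E by exact: ltW.
have TL : (T0 + (X.+1 - T0) = X.+1)%N by rewrite subnKC// leqW.
have tE : 2 / (V * E) * tsum R X Y y v = 2 / (N%:R * V * E) * (N%:R * tsum R X Y y v).
  by field; rewrite !gt_eqF.
have X10 : 0 <= X1 by rewrite eX1 divr_ge0.
have ts0 : 0 <= tsum R X Y y v by apply: sumr_ge0.
(* Admissibility depends on n modulo 8 and is constant on the class; a class that is not admissible
   contains no exceptions. *)
case: (boolP (admissible c)) => ac; last first.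
  rewrite big_nat_cond big1 => [|n _].
    by rewrite addr_ge0 ?mulr_ge0 ?invr_ge0 ?mulr_ge0 ?(ltW V0) ?(ltW q0).
  case: (boolP (n == c %[mod modulus P])%N) => //= /eqP nc.
  by rewrite /exc (admissible_class nc) (negbTE ac).
have M0 : 0 < N%:R * V * E by rewrite !mulr_gt0.
have TX1 : (T0 + (X.+1 - T0) <= X.+1)%N by rewrite TL.
have := @exc_class R P K y v Y c N T0 (X.+1 - T0) X (N%:R * V * E) y1 P2 HK Ha TX1 M0.
rewrite TL => /le_trans; apply; rewrite tE lerD2r.
have := Hv D P y (modulus P) c (zbase P c) N T0 (X.+1 - T0)%N Y A X1 V E U _ _ y1 P0 Py Q0 HQ (zbase_gt0 P c) A1 zA zy E0' eX1 eV eE eU erefl erefl.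
rewrite TL => var.
set Dg := \sum_(0 <= i < N) _ in var.
have hDg : Dg <= q * (X1 * V ^+ 2 * N%:R ^+ 2 * E ^+ 2).
  have -> : q * (X1 * V ^+ 2 * N%:R ^+ 2 * E ^+ 2) = \sum_(0 <= i < N) q * (X1 * V ^+ 2 * N%:R * E ^+ 2).
    by rewrite sumr_const_nat subn0 -[RHS]mulr_natl; ring.
  apply: ler_sum_nat => i /andP[_ iN]; apply: le_trans h7.
  apply: (Hd P y v X Y (zbase P c + modulus P * i)%N T0 X.+1 y5 yX Xu _ (leqnn _) (fun n => (n == c %[mod modulus P])%N)).
    by apply: leq_trans (Ha i iN); rewrite -addn1 leq_add2l expn_gt0 (ltnW y1).
  move=> n p /eqP nc zn pp pP p3.
  have an : admissible n by rewrite (admissible_class nc).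
  have [loc _] := class_local nc an erefl zn; apply: loc => //.
  by case: p pp {pP} p3 => [|[|[|p]]].
have p16 : 0 <= 16 ^+ D :> R by exact: exprn_ge0.
have U0 : 0 <= U by rewrite eU; apply: sumr_ge0 => l _; rewrite divr_ge0.
have w0 : 0 <= U ^+ 2 * (Cv / 16 ^+ D + y%:R^-1).
  by rewrite mulr_ge0 ?sqr_ge0// addr_ge0 ?invr_ge0 ?(ltW y0)// divr_ge0.
have lg0 : 0 <= Cv * ln A%:R ^+ 6 by rewrite mulr_ge0// exprn_ge0// ln_nat_ge0.
have tot := var_algebra q0 q4 X10 (ltW V0) E0' U0 (ltW N0') (expR_ge0 _) eP lg0 h1 w0 h2 h3 h4 h5 h6 hDg.
apply: le_trans (ler_wpM2l _ (le_trans var tot)) _; first by rewrite divr_ge0 ?exprn_ge0// ltW.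
by apply: le_of_eq; field; rewrite !gt_eqF.
Qed.
End ClassCount.

(** * Final choice of constants and passage to density zero *)

Section Density.
Variable R : realType.

(** [T] will be the threshold y^(2 v - 1), which bounds the remainder [Z]. The main term is of order
    y T w^2 / Q = y T / (Q ln y), so it exceeds T as soon as y dominates ln y. *)
Lemma main_term_ge (q Q X1 V E c1 c0 w l y T Z : R) : 0 < q -> 0 < Q -> 0 < c1 -> 0 < c0 -> 0 < w -> 0 <= T ->
  y * T / (2 * Q) <= X1 -> c1 * w <= V -> c0 <= E -> w ^+ 2 * l = 1 ->
  2 * Q / (q * c1 ^+ 2 * c0 ^+ 2) * l <= y -> 0 <= l -> Z <= T -> Z <= q * (X1 * V ^+ 2 * E ^+ 2).
Proof.
move=> q0 Q0 c10 c00 w0 T0 hX hV hE wl hy l0 ZT; apply: le_trans ZT _.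
have e0 : 0 <= c1 * w by rewrite mulr_ge0// ltW.
have y0 : 0 <= y by apply: le_trans hy; rewrite !mulr_ge0// ?invr_ge0 ?mulr_ge0 ?sqr_ge0// ltW.
have b0 : 0 <= y * T / (2 * Q) by rewrite divr_ge0 ?mulr_ge0// ltW.
have h1 : y * T / (2 * Q) * (c1 * w) ^+ 2 * c0 ^+ 2 <= X1 * V ^+ 2 * E ^+ 2.
  have E0 := lt_le_trans c00 hE; have V0 := le_trans e0 hV.
  move: (y * T / (2 * Q)) b0 hX => B b0 hX.
  apply: ler_pM => //; first by apply: mulr_ge0 => //; exact: sqr_ge0.
  - exact: sqr_ge0.
  - by apply: ler_pM => //; first exact: sqr_ge0; rewrite lerXn2r ?nnegrE.
  - by rewrite lerXn2r ?nnegrE// ltW.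
apply: le_trans (ler_wpM2l (ltW q0) h1).
have k0 : 0 <= q * T / (2 * Q) * (c1 * w) ^+ 2 * c0 ^+ 2.
  by rewrite !mulr_ge0 ?sqr_ge0// ?invr_ge0 ?mulr_ge0// ltW.
have := ler_wpM2r k0 hy.
have -> : 2 * Q / (q * c1 ^+ 2 * c0 ^+ 2) * l * (q * T / (2 * Q) * (c1 * w) ^+ 2 * c0 ^+ 2) = T * (w ^+ 2 * l).
  by field; rewrite !gt_eqF.
rewrite wl mulr1 => /le_trans; apply; apply: le_of_eq; field; by rewrite gt_eqF.
Qed.

Lemma cross_term_ge (q Q X1 V E c1 c0 w l y T Z : R) : 0 < q -> 0 < Q -> 0 < c1 -> 0 < c0 -> 0 < w -> 0 <= T ->
  y * T / (2 * Q) <= X1 -> c1 * w <= V -> c0 <= E -> 1 <= w * l ->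
  4 * Q / (q * c1 * c0) * l <= y -> 0 <= l -> Z <= T -> 2 * (V * E * Z) <= q * (X1 * V ^+ 2 * E ^+ 2).
Proof.
move=> q0 Q0 c10 c00 w0 T0 hX hV hE wl hy l0 ZT.
have e0 : 0 < c1 * w by rewrite mulr_gt0.
have V0 := lt_le_trans e0 hV; have E0 := lt_le_trans c00 hE.
have VE0 : 0 < V * E by rewrite mulr_gt0.
have y0 : 0 <= y by apply: le_trans hy; rewrite !mulr_ge0// ?invr_ge0 ?mulr_ge0// ltW.
have b0 : 0 <= y * T / (2 * Q) by rewrite divr_ge0 ?mulr_ge0// ltW.
suff h : 2 * T <= q * (X1 * (V * E)).
  have := ler_wpM2l (ltW VE0) (le_trans (ler_wpM2l (ltW (ltr0Sn R 1)) ZT) h).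
  have -> : V * E * (2 * Z) = 2 * (V * E * Z) by ring.
  by have -> : V * E * (q * (X1 * (V * E))) = q * (X1 * V ^+ 2 * E ^+ 2) by ring.
have h1 : y * T / (2 * Q) * (c1 * w * c0) <= X1 * (V * E).
  move: (y * T / (2 * Q)) b0 hX => B b0 hX.
  apply: ler_pM => //; first by rewrite mulr_ge0// ltW.
  by apply: ler_pM => //; rewrite ltW.
apply: le_trans (ler_wpM2l (ltW q0) h1).
have k0 : 0 <= q * T / (2 * Q) * (c1 * w * c0).
  by rewrite !mulr_ge0// ?invr_ge0 ?mulr_ge0// ltW.
have := ler_wpM2r k0 hy.
have -> : 4 * Q / (q * c1 * c0) * l * (q * T / (2 * Q) * (c1 * w * c0)) = 2 * T * (w * l).
  by field; rewrite !gt_eqF.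
move=> h2; have h3 : 2 * T <= 2 * T * (w * l) by rewrite ler_peMr// mulr_ge0.
apply: le_trans h3 (le_trans h2 _); apply: le_of_eq; field; by rewrite gt_eqF.
Qed.

(** The diagonal carries one factor w where the main term has w^2 N. The hypothesis on N w is
    therefore what fixes the number of values of z. *)
Lemma diag_term_ge (q Q X X1 V E c1 c0 w N Cd u : R) : 0 < q -> 0 < Q -> 0 < c1 -> 0 < c0 -> 0 < w -> 0 <= X -> 0 <= N ->
  X / (2 * Q) <= X1 -> c1 * w <= V -> c0 <= E ->
  2 * Q * Cd * u / (q * c1 ^+ 2 * c0 ^+ 2) <= N * w -> Cd * X * w * u <= q * (X1 * V ^+ 2 * N * E ^+ 2).
Proof.
move=> q0 Q0 c10 c00 w0 X0 N0 hX hV hE hN.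
have e0 : 0 < c1 * w by rewrite mulr_gt0.
have V0 := lt_le_trans e0 hV; have E0 := lt_le_trans c00 hE.
have b0 : 0 <= X / (2 * Q) by rewrite divr_ge0 ?mulr_ge0// ltW.
have h1 : X / (2 * Q) * (c1 * w) ^+ 2 * N * c0 ^+ 2 <= X1 * V ^+ 2 * N * E ^+ 2.
  move: (X / (2 * Q)) b0 hX => B b0 hX.
  have s0 := sqr_ge0 (c1 * w).
  apply: ler_pM; rewrite ?sqr_ge0//; [exact: mulr_ge0 (mulr_ge0 b0 s0) N0| |by rewrite lerXn2r ?nnegrE// ltW].
  rewrite ler_wpM2r//; apply: ler_pM => //; rewrite ?sqr_ge0//.
  by rewrite lerXn2r ?nnegrE// ltW.
apply: le_trans (ler_wpM2l (ltW q0) h1).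
have k0 : 0 <= q * X / (2 * Q) * c1 ^+ 2 * w * c0 ^+ 2.
  by rewrite !mulr_ge0 ?sqr_ge0// ?invr_ge0 ?mulr_ge0// ltW.
have := ler_wpM2r k0 hN.
have -> : 2 * Q * Cd * u / (q * c1 ^+ 2 * c0 ^+ 2) * (q * X / (2 * Q) * c1 ^+ 2 * w * c0 ^+ 2) = Cd * X * w * u.
  by field; rewrite !gt_eqF.
move=> /le_trans; apply; apply: le_of_eq; field; by rewrite gt_eqF.
Qed.

Lemma rough_term_le (q c0 E U CU Cv v d y a : R) : 0 < q -> 0 < c0 -> c0 <= E -> 0 <= U -> U <= CU * v -> 0 <= Cv ->
  0 < d -> 0 < y -> 1 <= v -> 0 < a -> v ^+ 2 * a <= d ->
  CU ^+ 2 * Cv / (q * c0 ^+ 2) <= a -> Cv * CU / (q * c0) <= a -> CU ^+ 2 * v ^+ 2 / (q * c0 ^+ 2) <= y ->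
  U ^+ 2 * (Cv / d + y^-1) <= 2 * q * E ^+ 2 /\ Cv / d * U <= q * E.
Proof.
move=> q0 c00 hE U0 hU Cv0 d0 y0 v1 a0 hd h1 h2 h3.
have v0 : 0 < v by apply: lt_le_trans v1.
have CU0 : 0 <= CU by have := le_trans U0 hU; rewrite pmulr_lge0.
have E0 := lt_le_trans c00 hE.
have E2 : c0 ^+ 2 <= E ^+ 2 by rewrite lerXn2r ?nnegrE// ltW.
have U2 : U ^+ 2 <= CU ^+ 2 * v ^+ 2 by rewrite -exprMn lerXn2r ?nnegrE// (le_trans U0).
have g1 : CU ^+ 2 * Cv <= q * c0 ^+ 2 * a by move: h1; rewrite ler_pdivrMr ?mulr_gt0 ?exprn_gt0// => /le_trans; apply; rewrite mulrC.
have g2 : Cv * CU <= q * c0 * a by move: h2; rewrite ler_pdivrMr ?mulr_gt0// => /le_trans; apply; rewrite mulrC.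
have g3 : CU ^+ 2 * v ^+ 2 <= q * c0 ^+ 2 * y by move: h3; rewrite ler_pdivrMr ?mulr_gt0 ?exprn_gt0// => /le_trans; apply; rewrite mulrC.
split.
  have t1 : U ^+ 2 * (Cv / d) <= q * c0 ^+ 2.
    rewrite mulrA ler_pdivrMr//; apply: le_trans (ler_wpM2r Cv0 U2) _.
    have k := ler_wpM2r (sqr_ge0 v) g1.
    rewrite mulrAC; apply: le_trans k _; rewrite -!mulrA ler_wpM2l ?(ltW q0)// ler_wpM2l ?exprn_ge0 ?(ltW c00)//.
    by rewrite ler_wpM2l ?(ltW c00)// mulrC.
  have t2 : U ^+ 2 * y^-1 <= q * c0 ^+ 2 by rewrite ler_pdivrMr// (le_trans U2).
  rewrite mulrDr; apply: le_trans (lerD t1 t2) _.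
  have := ler_wpM2l (ltW q0) E2; lra.
apply: (@le_trans _ _ (q * c0)); last by rewrite ler_wpM2l// ltW.
rewrite mulrAC ler_pdivrMr//; apply: le_trans (ler_wpM2l Cv0 hU) _.
rewrite mulrA; apply: le_trans (ler_wpM2r (ltW v0) g2) _.
rewrite -!mulrA ler_wpM2l ?(ltW q0)// ler_wpM2l ?(ltW c00)//; apply: le_trans hd.
by rewrite mulrC ler_wpM2r ?(ltW a0)// expr2 ler_peMl// ltW.
Qed.

Lemma log_large (B : R) : exists y1 : nat, forall y : nat, (y1 <= y)%N ->
  [/\ (16 <= y)%N, B <= y%:R, 1 <= ln (y%:R : R), B <= ln (y%:R : R) & B * ln (y%:R : R) <= y%:R].
Proof.
have [a1 h1] := ln_ge_eventually (1 : R); have [a2 h2] := ln_ge_eventually B.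
have [a3 h3] := ln_pow_small 1 B; have [a4 h4] := ln_pow_small 0 B.
exists (16 + a1 + a2 + a3 + a4)%N => y hy; split.
- by move: hy; clear; lia.
- by have := h4 y; rewrite expr0 mulr1; apply; move: hy; clear; lia.
- by apply: h1; move: hy; clear; lia.
- by apply: h2; move: hy; clear; lia.
- by have := h3 y; rewrite expr1; apply; move: hy; clear; lia.
Qed.

Lemma wy_facts y (w := wy R y) (l := ln (y%:R : R)) : (1 < y)%N -> 1 <= l ->
  [/\ 0 < w, w ^+ 2 * l = 1, 1 <= w * l, 1 <= w^-1 & w^-1 ^+ 2 = l].
Proof.
move=> y1 l1; have w0 : 0 < w := wy_gt0 R y; have e := wy_sqrt R y1.
have l0 : 0 <= l by apply: le_trans l1.
have r2 : w^-1 ^+ 2 = l by rewrite /w e sqr_sqrtr.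
have r1 : 1 <= w^-1 by rewrite /w e -[leLHS]sqrtr1 ler_wsqrtr.
have wl : w * l = w^-1 by rewrite -r2 expr2 mulrA divff ?mul1r ?gt_eqF.
split => //; last by rewrite wl.
by rewrite expr2 -mulrA wl divff ?gt_eqF.
Qed.

Lemma trunc_facts (K1 r : R) (N := (Num.truncn (K1 * r)).+1) : 1 <= K1 -> 1 <= r ->
  K1 * r <= (N%:R : R) <= (K1 + 1) * r.
Proof.
move=> k1 r1; have k0 : 0 <= K1 * r by rewrite mulr_ge0// (le_trans ler01).
have /andP[h1 h2] := truncn_itv k0.
by rewrite /N (ltW h2) -natr1 mulrDl mul1r lerD.
Qed.

Lemma pow_room j : (2 ^ (24 * j))%:R ^+ 2 * 2 ^+ j <= 16 ^+ (24 * j) :> R.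
Proof.
rewrite -!natrX -natrM ler_nat -expnM -expnD -[16%N]/(2 ^ 4)%N -expnM leq_exp2l//; lia.
Qed.

(** [P] and the lower bounds c1, c0 come before j, which fixes v, s and D; K1 then depends on v, and
    y only has to be large in terms of all of these. [K] must not depend on X, while y and N do. *)
Lemma density_params (q : R) P : 0 < q -> q <= 1 / 4 -> (2 <= P)%N -> expR (3 / P%:R) <= 1 + q ->
  exists (K : R) X0, forall X, (X0 <= X)%N -> exists T0, [/\ (1 <= T0)%N, (T0 <= X)%N, T0%:R <= q * X%:R &
    forall c, \sum_(T0 <= n < X.+1) ((n == c %[mod modulus P])%N && exc K n)%:R <=
      44 * q * ((X.+1 - T0)%:R / (modulus P)%:R) + q * X%:R / (modulus P)%:R].
Proof.
move=> q0 q4 P2 eP.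
have [c1 c10 Hc1] := vone_ge R; have [c0 [j1 [c00 j10 Hc0]]] := echi_ge R.
have [CU CU0 HU] := urough_le R; have [Cd [Cv [Cd0 Cv0 HC]]] := class_count R.
set Q := modulus P; have Q0 : (0 < Q)%N := modulus_gt0 P.
have Qr : 1 <= Q%:R :> R by rewrite ler1n.
have Qp : 0 < Q%:R :> R by rewrite ltr0n.
(* Tuned so that 2 / (V E) times [tsum], with V E >= c1 w c0, is at most q X / Q. *)
have etaT0 : 0 < q * c1 * c0 / (2 * Q%:R) by rewrite divr_gt0 ?mulr_gt0.
have [j2 Hj2] := tsum_small etaT0.
have [j3 Hj3] := pow2_eventually 0 (CU ^+ 2 * Cv / (q * c0 ^+ 2)).
have [j4 Hj4] := pow2_eventually 0 (Cv * CU / (q * c0)).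
pose j := (4 + j1 + j2 + j3 + j4)%N.
have [y1 Hy1] := Hj2 j ltac:(rewrite /j; clear; lia).
have {Hj3} := Hj3 j ltac:(rewrite /j; clear; lia); rewrite expr0 mulr1 => hj3.
have {Hj4} := Hj4 j ltac:(rewrite /j; clear; lia); rewrite expr0 mulr1 => hj4.
have room := @depth_room j ltac:(rewrite /j; clear; lia).
have jj1 : (j1 <= j)%N by rewrite /j; clear; lia.
have pr := pow_room j.
move: j hj3 hj4 room jj1 Hy1 pr => j; set D := (24 * j)%N.
move: (2 ^ D)%N => v hj3 hj4 room jj1 Hy1 pr.
pose u : R := (2 * v).+1%:R ^+ 3.
(* The fraction is the lower bound that [diag_term_ge] demands of N w; the summand 1 makes K1 at
   least 1. *)
pose K1 : R := 2 * Q%:R * Cd * u / (q * c1 ^+ 2 * c0 ^+ 2) + 1.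
have K11 : 1 <= K1 by rewrite lerDr divr_ge0 ?mulr_ge0 ?exprn_ge0// ltW.
have [y2 Hy2] := ln_pow_small 6 (8 * Q%:R * Cv / q).
pose b3 := 4 * Q%:R ^+ 2 * (K1 + 1) ^+ 2; pose b4 := CU ^+ 2 * v%:R ^+ 2 / (q * c0 ^+ 2).
pose b5 := 2 * Q%:R / (q * c1 ^+ 2 * c0 ^+ 2); pose b6 := 4 * Q%:R / (q * c1 * c0).
pose b7 := 2 * Q%:R / q.
have K10 : 0 <= K1 + 1 by rewrite addr_ge0// (le_trans ler01).
have b30 : 0 <= b3 by rewrite /b3 !mulr_ge0 ?sqr_ge0// ltW.
have b40 : 0 <= b4 by rewrite /b4 divr_ge0 ?mulr_ge0 ?sqr_ge0// ltW.
have b50 : 0 <= b5 by rewrite /b5 divr_ge0 ?mulr_ge0 ?exprn_ge0// ltW.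
have b60 : 0 <= b6 by rewrite /b6 divr_ge0 ?mulr_ge0// ltW.
have b70 : 0 <= b7 by rewrite /b7 divr_ge0 ?mulr_ge0// ltW.
pose B : R := P%:R + y1%:R + y2%:R ^+ 2 + b3 + b4 + b5 + b6 + b7.
have y20 : 0 <= y2%:R ^+ 2 :> R by rewrite exprn_ge0.
have BB : [/\ P%:R <= B, y1%:R <= B, y2%:R ^+ 2 <= B & [/\ b3 <= B, b4 <= B, b5 <= B, b6 <= B & b7 <= B]].
  have := ler0n R P; have := ler0n R y1; rewrite /B; clear Hy1; clearbody b3 b4 b5 b6 b7; clear B; move: b30 b40 b50 b60 b70 y20.
  by move: (y2%:R ^+ 2) (P%:R) (y1%:R) b3 b4 b5 b6 b7; clear => *; split; [lra|lra|lra|split; lra].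
have [y3 Hy3] := log_large B.
have v0 : (0 < v)%N by move: room; clear; lia.
have [X0 HX0] := scale_exists y3 v0.
(* Every z used is at most Q N <= Q (K1 + 1) sqrt(ln y), and ln y <= ln n for n >= T0. The final + 1
   makes the inequality strict. *)
exists (Q%:R * (K1 + 1) + 1), X0 => X /HX0[y [yy3 yX Xy]].
have [y16 By l1 Bl Bly] := Hy3 y yy3.
have [w0 w2l wl r1 r2] := wy_facts (leq_trans (isT : (2 <= 16)%N) y16) l1.
set w := wy R y in w0 w2l wl r1 r2; set l := ln _ in l1 Bl Bly w2l wl r2.
have /andP[N1 N2] := trunc_facts K11 r1; set N := (Num.truncn _).+1 in N1 N2.
case: BB => BP By1 By2 [B3 B4 B5 B6 B7].
have l0 : 0 <= l by apply: le_trans l1.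
have scl b : b <= B -> b * l <= y%:R by move=> h; apply: le_trans Bly; rewrite ler_wpM2r.
have yr0 : 0 < y%:R :> R by rewrite ltr0n (leq_trans _ y16).
have rN : w^-1 <= N%:R by apply: le_trans N1; rewrite ler_peMl// (le_trans ler01).
have eT : (y * y ^ (2 * v - 1) = y ^ (2 * v))%N by rewrite -expnS; congr (_ ^ _)%N; move: v0; clear; lia.
(* Smaller n are given up: T0 <= X / y is negligible, while n >= T0 ensures n - z^2 >= y^(2 v - 2)
   as well as ln n >= ln y. *)
set T0 := (y ^ (2 * v - 1))%N in eT.
have T0p : (0 < T0)%N by rewrite expn_gt0 (leq_trans _ y16).
have yT : y%:R * T0%:R <= X%:R :> R by rewrite -natrM eT ler_nat.
have T0X : (2 * T0 <= X)%N.
  by apply: leq_trans yX; rewrite -eT leq_mul2r (leq_trans _ y16) ?orbT.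
have yX' : (y <= X)%N by apply: leq_trans yX; rewrite -{1}[y]expn1 leq_pexp2l ?(leq_trans _ y16)//; move: v0; clear; lia.
have qy : 1 <= q * y%:R.
  have := le_trans B7 By; rewrite /b7 ler_pdivrMr//; rewrite [q * _]mulrC; move: Qr; move: (y%:R * q) => z; clear; lra.
have TqX : T0%:R <= q * X%:R :> R.
  have h := ler_wpM2l (ltW q0) yT; apply: le_trans h; rewrite mulrA; exact: ler_peMl.
exists T0; split => //; first by apply: leq_trans T0X; rewrite mul2n -addnn leq_addl.
move=> c; have zQ : (zbase P c <= Q)%N := zbase_le P c.
set X1 : R := _ / _; set Y := (y ^ (v - (192 * j + 20)))%N in Hy1.
have y1' : (1 < y)%N by apply: leq_trans y16.
have hX : X%:R / (2 * Q%:R) <= X1.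
  rewrite invfM mulrA /X1 ler_wpM2r ?invr_ge0 ?(ltW Qp)// ler_pdivrMr// -natrM ler_nat.
  by move: T0X; clear; lia.
have hXy : y%:R * T0%:R / (2 * Q%:R) <= X1.
  by apply: le_trans hX; rewrite ler_wpM2r// invr_ge0 mulr_ge0// ltW.
have hV := Hc1 P y y1'; have hE : c0 <= echi R y Y.
  by apply: Hc0 => //; rewrite leq_exp2l//; move: jj1 room; rewrite /D; clear; lia.
have y5 : (5 <= y)%N by apply: leq_trans y16.
have vs0 : (0 < v - (192 * j + 20))%N by move: room; clear; lia.
have /andP[U0 hU] := HU y _ y5 vs0; rewrite -/Y in U0 hU.
have hU' : urough R Y y <= CU * v%:R.
  by apply: le_trans hU _; rewrite ler_wpM2l// ler_nat leq_subr.
have V0 : 0 < vone R P y by apply: lt_le_trans hV; rewrite mulr_gt0.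
have E0 : 0 < echi R y Y by apply: lt_le_trans hE.
have v1 : 1 <= v%:R :> R by rewrite ler1n.
have d0 : 0 < 16 ^+ D :> R by rewrite exprn_gt0.
have a0 : 0 < 2 ^+ j :> R by rewrite exprn_gt0.
have [ru1 ru2] := rough_term_le q0 c00 hE U0 hU' Cv0 d0 yr0 v1 a0 pr hj3 hj4 (le_trans B4 By).
have T0r : 0 <= T0%:R :> R by [].
have m1 : Y%:R ^+ 2 * y%:R ^+ (16 * D + 25) <= T0%:R :> R.
  rewrite -!natrX -natrM ler_nat /Y -expnM -expnD leq_exp2l//; move: room; rewrite /D; clear; lia.
have m2 : Y%:R * y%:R ^+ (16 * D + 25) <= T0%:R :> R.
  rewrite -!natrX -natrM ler_nat /Y -expnD leq_exp2l//; move: room; rewrite /D; clear; lia.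
have mt := main_term_ge q0 Qp c10 c00 w0 T0r hXy hV hE w2l (scl _ B5) l0 m1.
have ct := cross_term_ge q0 Qp c10 c00 w0 T0r hXy hV hE wl (scl _ B6) l0 m2.
have Nw : K1 <= N%:R * w by rewrite -ler_pdivrMr// .
have Xr : 0 <= X%:R :> R by []. have Nr : 0 <= N%:R :> R by [].
have dt : Cd * X%:R * w * u <= q * (X1 * vone R P y ^+ 2 * N%:R * echi R y Y ^+ 2).
  apply: diag_term_ge hX hV hE _ => //.
  by apply: le_trans Nw; rewrite /K1 lerDl.
have qX1 : 1 <= q * X1.
  have h : y%:R / (2 * Q%:R) <= X1.
    by apply: le_trans hX; rewrite ler_wpM2r ?invr_ge0 ?mulr_ge0 ?(ltW Qp)// ler_nat.
  apply: le_trans (ler_wpM2l (ltW q0) h); rewrite mulrA ler_pdivlMr ?mulr_gt0// mul1r.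
  by have := le_trans B7 By; rewrite /b7 ler_pdivrMr// [q * _]mulrC.
have N0 : (0 < N)%N by [].
have Py : (P <= y)%N by rewrite -(ler_nat R) (le_trans BP).
have A1 : (1 < 4 * Q * N)%N.
  have : (0 < Q * N)%N by rewrite muln_gt0; apply/andP.
  by rewrite -mulnA; move: (Q * N)%N; clear; lia.
have QN1 : (Q <= Q * N)%N by rewrite leq_pmulr.
have zA : (2 * zbase P c + 2 * modulus P * N <= 4 * Q * N)%N.
  rewrite -(mulnA 2) -(mulnA 4) -/Q; move: zQ QN1.
  by move: (zbase P c) (Q * N)%N (Q) => a b d; clear; lia.
have zy : ((zbase P c + modulus P * N) ^ 2 <= y)%N.
  rewrite -(ler_nat R) natrX.
  have h : (zbase P c + Q * N)%:R <= 2 * Q%:R * ((K1 + 1) * w^-1) :> R.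
    apply: (@le_trans _ _ (2 * Q%:R * N%:R)); last by rewrite ler_wpM2l// mulr_ge0// ltW.
    by rewrite -!natrM ler_nat -mulnA mul2n -addnn leq_add2r (leq_trans zQ).
  have h2 : (zbase P c + Q * N)%:R ^+ 2 <= (2 * Q%:R * ((K1 + 1) * w^-1)) ^+ 2 :> R.
    by rewrite lerXn2r ?nnegrE ?(le_trans _ h).
  apply: le_trans h2 _; apply: le_trans (scl _ B3).
  by rewrite /b3 -r2; apply: le_of_eq; ring.
have Xlt : (T0 <= X)%N by apply: leq_trans T0X; rewrite mul2n -addnn leq_addl.
have HK : forall i n, (i < N)%N -> (T0 <= n)%N ->
    (zbase P c + modulus P * i)%:R < (Q%:R * (K1 + 1) + 1) * Num.sqrt (ln (n%:R : R)).
  move=> i n iN Tn.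
  have yn : (y <= n)%N.
    apply: leq_trans Tn; rewrite /T0 -{1}[y]expn1 leq_pexp2l ?(ltnW y1')//; move: v0; clear; lia.
  have ln_n : w^-1 <= Num.sqrt (ln (n%:R : R)).
    rewrite wy_sqrt// ler_wsqrtr// ler_ln ?posrE ?ler_nat// ltr0n (leq_trans _ yn)//; exact: ltnW.
  have k0 : 0 <= Q%:R * (K1 + 1) + 1 by rewrite addr_ge0// mulr_ge0// ltW.
  apply: lt_le_trans (ler_wpM2l k0 ln_n).
  apply: (@le_lt_trans _ _ (Q%:R * ((K1 + 1) * w^-1))).
    apply: (@le_trans _ _ (Q%:R * N%:R)); last by rewrite ler_wpM2l// ltW.
    rewrite -natrM ler_nat; apply: leq_trans (leq_add zQ (leqnn _)) _.
    by rewrite -/Q -mulnS leq_mul2l iN orbT.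
  by rewrite mulrA [ltRHS]mulrDl mul1r ltrDl (lt_le_trans ltr01).
have HT : forall i, (i < N)%N -> ((zbase P c + modulus P * i) ^ 2 + y ^ (2 * v - 2) <= T0)%N.
  move=> i iN; apply: (@leq_trans (y + y ^ (2 * v - 2))).
    rewrite leq_add2r; apply: leq_trans zy; rewrite leq_exp2r// leq_add2l leq_mul2l (ltnW iN) orbT.
    by [].
  have -> : T0 = (y * y ^ (2 * v - 2))%N by rewrite /T0 -expnS; congr (_ ^ _)%N; move: room; clear; lia.
  have : (y <= y ^ (2 * v - 2))%N.
    rewrite -{1}[y]expn1 leq_pexp2l ?(ltnW y1')//; move: room; clear; lia.
  by move: (y ^ (2 * v - 2))%N y1' => z; clear; nia.
have lA : 2 * (Cv * ln ((4 * Q * N)%:R : R) ^+ 6) <= q * N%:R.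
  have Ay : (y2 <= 4 * Q * N)%N.
    rewrite -(ler_nat R); apply: (@le_trans _ _ N%:R); last by rewrite ler_nat leq_pmull// muln_gt0.
    apply: le_trans rN; rewrite -[leLHS]ger0_norm// -[leRHS]ger0_norm ?(le_trans ler01)//.
    by rewrite -ler_sqr ?nnegrE// !real_normK ?num_real// r2 (le_trans By2).
  have := Hy2 _ Ay; move: (ln _ ^+ 6) => L6; rewrite (natrM _ (4 * Q)%N) (natrM _ 4) => h.
  have k0 : 0 <= q / (4 * Q%:R) by rewrite divr_ge0 ?mulr_ge0// ltW.
  have := ler_wpM2r k0 h; have -> : 8 * Q%:R * Cv / q * L6 * (q / (4 * Q%:R)) = 2 * (Cv * L6) by field; rewrite !gt_eqF.
  by move=> /le_trans; apply; apply: le_of_eq; field; rewrite gt_eqF.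
rewrite /u in dt; clearbody T0 N.
have G := HC q (Q%:R * (K1 + 1) + 1) D P y v c N X Y T0 (4 * Q * N)%N q0 q4 y5 P2 Py A1 N0 zA zy yX' Xy Xlt HK HT eP X1 _ _ _ erefl erefl erefl erefl.
have {}G := G V0 E0 ru1 lA ru2 mt ct qX1 dt.
apply: le_trans G _; rewrite lerD2l.

have y1y : (y1 <= y)%N by rewrite -(ler_nat R) (le_trans By1).
have ht := Hy1 y X y1y yX Xy.
have VEg : c1 * w * c0 <= vone R P y * echi R y Y by apply: ler_pM => //; rewrite ?mulr_ge0// ltW.
have cw0 : 0 < c1 * w * c0 by rewrite !mulr_gt0.
have k0 : 0 <= 2 / (vone R P y * echi R y Y) by rewrite divr_ge0 ?mulr_ge0// ltW.
apply: le_trans (ler_wpM2l k0 ht) _.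
have r0 : 0 <= q * c1 * c0 / (2 * Q%:R) * X%:R * wy R y.
  by rewrite !mulr_ge0// ?invr_ge0 ?mulr_ge0// ltW.
apply: (@le_trans _ _ (2 / (c1 * w * c0) * (q * c1 * c0 / (2 * Q%:R) * X%:R * wy R y))).
  rewrite ler_wpM2r// ler_wpM2l// lef_pV2 ?posrE// mulr_gt0//.
rewrite -/w; apply: le_of_eq; field; by rewrite !gt_eqF.
Qed.

Lemma density (eps : R) : 0 < eps -> exists (K : R) X0, forall X, (X0 <= X)%N ->
  \sum_(1 <= n < X.+1) (exc K n)%:R <= eps * X%:R.
Proof.
wlog e1 : eps / eps <= 1 => [wl e0|e0].
  case: (leP eps 1) => he; first exact: wl.
  have [K [X0 h]] := wl 1 (lexx _) ltr01; exists K, X0 => X hX.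
  by apply: le_trans (h X hX) _; rewrite ler_wpM2r// ltW.
(* The n below T0 contribute q X, and all classes together 44 q (X + 1 - T0) + q X <= 89 q X, so 90
   q <= eps would do; [q <= 1 / 4] is required as well. *)
pose q := eps / 400; have q0 : 0 < q by rewrite /q; lra.
have q4 : q <= 1 / 4 by rewrite /q; lra.
have lq : 0 < ln (1 + q) by rewrite ln_gt0// ltrDl.
pose P := (Num.truncn (3 / ln (1 + q))).+2.
have eP : expR (3 / P%:R) <= 1 + q.
  rewrite -[leRHS]lnK ?posrE ?addr_gt0// ler_expR ler_pdivrMr// mulrC -ler_pdivrMr//.
  have /andP[_ /ltW h] := truncn_itv (divr_ge0 (ler0n R 3) (ltW lq)).
  by apply: le_trans h _; rewrite ler_nat.
have [K [X0 H]] := density_params q0 q4 (isT : (2 <= P)%N) eP.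
exists K, (maxn X0 1) => X; rewrite geq_max => /andP[hX X1].
have [T0 [T1 TX Tq Hc]] := H X hX.
have Q0 : (0 < modulus P)%N := modulus_gt0 P.
have Qp : 0 < (modulus P)%:R :> R by rewrite ltr0n.
rewrite (big_cat_nat T1 (leqW TX)) /=.
have X1r : 1 <= X%:R :> R by rewrite ler1n.
have p1 : \sum_(1 <= n < T0) (exc K n)%:R <= q * X%:R.
  apply: le_trans Tq; apply: (@le_trans _ _ (\sum_(1 <= n < T0) 1)).
    by apply: ler_sum => n _; case: (exc _ _).
  by rewrite sumr_const_nat ler_nat leq_subr.
have p2 : \sum_(T0 <= n < X.+1) (exc K n)%:R <= 89 * q * X%:R.
  rewrite (sum_classes R _ _ _ Q0).
  apply: le_trans (ler_sum _ (fun c _ => Hc c)) _.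
  rewrite sumr_const_nat subn0 -[leLHS]mulr_natr mulrDl (mulrA _ _ (_^-1)) !divfK ?gt_eqF//.
  have h : (X.+1 - T0)%:R <= 2 * X%:R :> R by rewrite -natrM ler_nat; move: X1; clear; lia.
  have := ler_wpM2l (ltW q0) h; lra.
apply: le_trans (lerD p1 p2) _.
have k : 0 <= eps * X%:R by rewrite mulr_ge0// ltW.
rewrite /q; lra.
Qed.
End Density.

Lemma small_representable_zrep (R : realType) (Psi : R -> R) (K : R) n :
  K <= Psi n%:R -> zrep K n -> small_representable Psi n.
Proof.
move=> hK [z [z0 zn zK [x [y xy]]]]; exists x, y, z%:Z; split.
- by rewrite -xy -subzn// -!natz natrX subrK.
- by rewrite ltz_nat.
- apply: lt_le_trans zK _; rewrite pmulrn mulrC ler_wpM2l//.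
Qed.

Lemma sum_lt_nat n1 M : (\sum_(1 <= n < M.+1) (n < n1) <= n1)%N.
Proof.
suff : (\sum_(1 <= n < M.+1) (n < n1) <= minn M n1)%N by move/leq_trans; apply; exact: geq_minr.
elim: M => [|M IH]; first by rewrite big_geq.
by rewrite big_nat_recr//=; case: ltnP IH; lia.
Qed.

(** The finitely many n below [n1] are all counted as exceptions; beyond [n1] the function [Psi]
    dominates [K], so an exception for [Psi] is one for [K]. *)
Lemma exception_count_le (R : realType) (Psi : R -> R) (K : R) n1 X :
  (forall n, (n1 <= n)%N -> K <= Psi n%:R) ->
  (exception_count Psi X)%:R <= n1%:R + \sum_(1 <= n < (Num.truncn X).+1) (exc K n)%:R :> R.
Proof.
move=> hK; rewrite /exception_count natr_sum big_mkcond /=.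
apply: (@le_trans _ _ (\sum_(1 <= n < (Num.truncn X).+1) ((n < n1)%N%:R + (exc K n)%:R))).
  apply: ler_sum => n _; case: (ltnP n n1) => [_|n1n]; first by case: ifP; case: exc => //=; lra.
  rewrite add0r /exc; case: (admissible n) => //=.
  case: asboolP => [|ns]; first by case: asboolP.
  by case: asboolP => // /small_representable_zrep -/(_ _ (hK n n1n)).
by rewrite big_split /= lerD2r -natr_sum ler_nat sum_lt_nat.
Qed.

Unset Implicit Arguments.

Theorem theorem1p2 (R : realType) (Psi : R -> R)
    (hPsi1 : forall t : R, 1 <= t -> 1 <= Psi t)
    (hPsi : Psi t @[t --> +oo] --> +oo) :
  ((exception_count Psi X)%:R / X : R) @[X --> +oo] --> (0 : R).
Proof.
apply/cvgrPdist_le => e e0.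
have e2 : 0 < e / 2 by lra.
have [K [X0 HX0]] := density e2.
have /cvgryPge/(_ K)[M [_ HM]] := hPsi.
have [n1 Hn1] : exists n1 : nat, forall n, (n1 <= n)%N -> K <= Psi n%:R.
  exists (Num.truncn `|M|).+1 => n hn; apply: HM.
  have /andP[_ h] := truncn_itv (normr_ge0 M).
  by apply: le_lt_trans (ler_norm M) (lt_le_trans h _); rewrite ler_nat.
near=> X.
have X1 : 1 <= X by near: X; apply: nbhs_pinfty_ge; exact: num_real.
(* The n below [n1] take the second half of [e]. *)
have Xn : n1%:R / (e / 2) <= X by near: X; apply: nbhs_pinfty_ge; exact: num_real.
have XX : X0%:R <= X by near: X; apply: nbhs_pinfty_ge; exact: num_real.
have X00 : 0 <= X by lra.
have Xp : 0 < X by lra.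
have /andP[t1 t2] := truncn_itv X00.
have XT : (X0 <= Num.truncn X)%N by rewrite -ltnS -(ltr_nat R) (le_lt_trans XX).
have h := le_trans (exception_count_le X Hn1) (lerD (lexx _) (HX0 _ XT)).
rewrite sub0r normrN ger0_norm ?divr_ge0// ler_pdivrMr//.
apply: le_trans h _.
have h1 := ler_wpM2l (ltW e2) t1.
move: Xn; rewrite ler_pdivrMr// mulrC => Xn.
by lra.
Unshelve. all: by end_near.
Qed.
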